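(* Let $n\ge 2$, let $\theta\in\mathbb{R}$, and let $\omega_1,\ldots,\omega_n\in H(\theta)$ satisfy $\Im(\omega_j/\omega_k)\neq 0$ for all $j\neq k$. Let $0\le y<1$ and $a(y)=(\omega_1+\cdots+\omega_n)(1-y)$. Then $$\zeta_n(s,a(y);\omega_1,\ldots,\omega_n)=-\frac{2\pi i}{\Gamma(s)(e^{2\pi i s}-1)}\sum_{k=1}^n\sum_{m\in\mathbb{Z}\setminus\{0\}}\omega_k^{-1}\Bigl(\prod_{\substack{j=1\\ j\neq k}}^n\frac{e^{(2m\pi i\omega_j/\omega_k)y}}{e^{2m\pi i\omega_j/\omega_k}-1}\Bigr)(2m\pi i\omega_k^{-1})^{s-1}e^{2m\pi i y},$$ where the series on the right-hand side converges absolutely, and uniformly on compact subsets, on the whole space $s\in\mathbb{C}$ if $0<y<1$, and on the region $\Re s<0$ if $y=0$ (the identity being one of meromorphic functions of $s$ on the respective region). In particular, if $y=1/2$, $$\zeta_n\bigl(s,(\omega_1+\cdots+\omega_n)/2;\omega_1,\ldots,\omega_n\bigr)=-\frac{1}{2^{n-1}}\frac{2\pi i}{\Gamma(s)(e^{2\pi i s}-1)}\sum_{k=1}^n\sum_{m\in\mathbb{Z}\setminus\{0\}}\omega_k^{-1}(-1)^m\Bigl(\prod_{\substack{j=1\\ j\neq k}}^n\frac{1}{\sinh(m\pi i\omega_j/\omega_k)}\Bigr)(2m\pi i\omega_k^{-1})^{s-1}.$$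
   Context: For $\theta\in\mathbb{R}$, $H(\theta)=\{re^{i(\theta+\phi)}\in\mathbb{C} : r>0,\ -\pi/2<\phi<\pi/2\}$ is the open half plane with normal vector $e^{i\theta}$. For $a,\omega_1,\ldots,\omega_n\in H(\theta)$, the Barnes zeta-function is $$\zeta_n(s,a;\omega_1,\ldots,\omega_n)=\sum_{m_1=0}^\infty\cdots\sum_{m_n=0}^\infty\frac{1}{(a+\omega_1m_1+\cdots+\omega_nm_n)^s}\qquad(\Re s>n),$$ where for $x\in H(\theta)$ the power $x^{-s}$ is taken with $\arg x\in(\theta-\pi/2,\theta+\pi/2)$. It is continued meromorphically to all $s\in\mathbb{C}$, and $\zeta_n$ denotes this continuation. Powers $t^{s-1}$ with $t=2m\pi i\omega_k^{-1}$ are taken with the argument of $t$ in $-\theta\le\arg t\le-\theta+2\pi$ (such $t$ never lie on the ray of argument $-\theta$). *)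

(* Defs.v *)
From Stdlib Require Import Reals ZArith List ClassicalEpsilon.
From Coquelicot Require Export Coquelicot.
Open Scope R_scope.

Definition Cexp (z : C) : C := (exp (Re z) * (cos (Im z), sin (Im z)))%C.

Definition Csinh (z : C) : C := ((Cexp z - Cexp (- z)) / 2)%C.

(* The argument of [z] lying in the set of angles [I]; meaningful when there is
   exactly one such angle. *)
Definition arg_in (I : R -> Prop) (z : C) : R :=
  epsilon (inhabits 0) (fun phi => I phi /\ z = (Cmod z * Cexp (Ci * phi))%C).

(* [z ^ w] for nonzero [z], with [arg z] taken in [I]. *)
Definition Cpow_in (I : R -> Prop) (z w : C) : C :=
  Cexp (w * (ln (Cmod z) + Ci * arg_in I z)).

Definition half_plane (theta : R) (z : C) : Prop :=
  exists r phi : R, 0 < r /\ - PI / 2 < phi < PI / 2 /\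
    z = (r * Cexp (Ci * (theta + phi)))%C.

Definition Csum (f : nat -> C) (l : list nat) : C :=
  fold_right Cplus (RtoC 0) (map f l).

Definition Cprod (f : nat -> C) (l : list nat) : C :=
  fold_right Cmult (RtoC 1) (map f l).

Definition CSeries (u : nat -> C) : C :=
  (Series (fun m => Re (u m)), Series (fun m => Im (u m))).

Definition holomorphic_at (f : C -> C) (z : C) : Prop :=
  locally z (fun w : C => ex_derive (K := C_AbsRing) (V := C_NormedModule) f w).

Definition pole_at (f : C -> C) (z : C) : Prop :=
  locally' z
    (fun w : C => ex_derive (K := C_AbsRing) (V := C_NormedModule) f w) /\
  filterlim (fun w : C => Cmod (f w)) (locally' z) (Rbar_locally p_infty).

(* The value of [f] at a pole is irrelevant. *)
Definition meromorphic_on (D : C -> Prop) (f : C -> C) : Prop :=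
  forall z, D z -> holomorphic_at f z \/ pole_at f z.

(* Identity on [D] between the meromorphic function [f] and the meromorphic
   function given by the expression [g].  Values at isolated points are
   disregarded: the quotient 1 / (Gamma(s) (e^(2 pi i s) - 1)) has removable
   singularities at the nonpositive integers, where it is not defined as
   written, and poles at the positive integers. *)
Definition meromorphic_eq (D : C -> Prop) (f g : C -> C) : Prop :=
  meromorphic_on D f /\
  forall z, D z -> locally' z (fun w : C => f w = g w).

Definition compact_set (K : C -> Prop) : Prop :=
  forall (J : Type) (U : J -> C -> Prop),
    (forall j, open (U j)) ->
    (forall z, K z -> exists j, U j z) ->
    exists l : list J, forall z, K z -> exists j, In j l /\ U j z.

Definition Gamma_integral (s : C) : C :=
  RInt_gen (V := C_R_CompleteNormedModule)
    (fun t : R => (Cexp ((s - 1) * ln t) * exp (- t))%C)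
    (at_right 0) (Rbar_locally p_infty).

(* Euler's integral for [0 < Re s], continued by
   Gamma(s) = Gamma(s + N) / (s (s + 1) ... (s + N - 1)), where [N] is the least
   natural number with [0 < Re s + N]. *)
Definition CGamma (s : C) : C :=
  let N := Z.to_nat (up (- Re s)) in
  (Gamma_integral (s + INR N) / Cprod (fun k => s + INR k) (seq 0 N))%C.

(* The iterated series over m_1, ..., m_n, the outermost sum being over m_1;
   the powers use the argument in (theta - pi/2, theta + pi/2). *)
Fixpoint barnes_series (theta : R) (ws : list C) (a s : C) : C :=
  match ws with
  | nil =>
      Cpow_in (fun phi => theta - PI / 2 < phi < theta + PI / 2) a (- s)
  | w :: ws' => CSeries (fun m => barnes_series theta ws' (a + w * INR m) s)
  end.

Definition barnes_continuation
    (theta : R) (ws : list C) (a : C) (f : C -> C) : Prop :=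
  meromorphic_on (fun _ => True) f /\
  forall s, INR (length ws) < Re s -> f s = barnes_series theta ws a s.

(* The meromorphic continuation of [barnes_series]. It is determined outside its
   poles by the identity theorem. *)
Definition barnes_zeta (theta : R) (ws : list C) (a : C) : C -> C :=
  epsilon (inhabits (fun _ : C => RtoC 0)) (barnes_continuation theta ws a).

(* [Zstar] is the set of nonzero integers; the lower and upper cut-offs of a
   series over it are independent. *)

Definition Zstar_partial (f : Z -> C) (M N : nat) : C :=
  (Csum (fun m => f (- Z.of_nat m)%Z) (seq 1 M) +
   Csum (fun m => f (Z.of_nat m)) (seq 1 N))%C.

Definition Zstar_sum (f : Z -> C) : C :=
  (CSeries (fun m => f (- Z.of_nat (S m))%Z) +
   CSeries (fun m => f (Z.of_nat (S m))))%C.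

Definition Zstar_abs_cv (f : Z -> C) : Prop :=
  ex_series (fun m => Cmod (f (- Z.of_nat (S m))%Z)) /\
  ex_series (fun m => Cmod (f (Z.of_nat (S m)))).

Definition Zstar_cvu (K : C -> Prop) (f : Z -> C -> C) : Prop :=
  forall eps : R, 0 < eps -> exists N0 : nat, forall M N : nat,
    (N0 <= M)%nat -> (N0 <= N)%nat -> forall s, K s ->
      Cmod (Zstar_partial (fun m => f m s) M N
            - Zstar_sum (fun m => f m s))%C < eps.

(* The periods are [omega 1], ..., [omega n]. *)

Definition indices (n : nat) : list nat := seq 1 n.

Definition indices_but (n k : nat) : list nat :=
  filter (fun j => negb (Nat.eqb j k)) (indices n).

Definition residue_point (omega : nat -> C) (k : nat) (m : Z) : C :=
  (2 * IZR m * PI * Ci * / omega k)%C.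

Definition residue_power
    (theta : R) (omega : nat -> C) (k : nat) (m : Z) (s : C) : C :=
  Cpow_in (fun phi => - theta <= phi <= - theta + 2 * PI)
    (residue_point omega k m) (s - 1).

Definition expansion_term
    (theta : R) (n : nat) (omega : nat -> C) (y : R) (k : nat) (m : Z) (s : C)
    : C :=
  (/ omega k *
   Cprod (fun j =>
       Cexp (2 * IZR m * PI * Ci * omega j / omega k * y) /
       (Cexp (2 * IZR m * PI * Ci * omega j / omega k) - 1))
     (indices_but n k) *
   residue_power theta omega k m s *
   Cexp (2 * IZR m * PI * Ci * y))%C.

Definition sinh_term
    (theta : R) (n : nat) (omega : nat -> C) (k : nat) (m : Z) (s : C) : C :=
  (/ omega k * (-1) ^ Z.abs_nat m *
   Cprod (fun j => / Csinh (IZR m * PI * Ci * omega j / omega k))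
     (indices_but n k) *
   residue_power theta omega k m s)%C.

Definition gamma_factor (s : C) : C :=
  (2 * PI * Ci / (CGamma s * (Cexp (2 * PI * Ci * s) - 1)))%C.

Definition expansion
    (theta : R) (n : nat) (omega : nat -> C) (y : R) (s : C) : C :=
  (- gamma_factor s *
   Csum (fun k => Zstar_sum (fun m => expansion_term theta n omega y k m s))
     (indices n))%C.

Definition sinh_expansion
    (theta : R) (n : nat) (omega : nat -> C) (s : C) : C :=
  (- (1 / 2 ^ (n - 1)) * gamma_factor s *
   Csum (fun k => Zstar_sum (fun m => sinh_term theta n omega k m s))
     (indices n))%C.

(* For [0 <= y]: the whole plane if [0 < y], and [Re s < 0] if [y = 0]. *)
Definition region (y : R) (s : C) : Prop := 0 < y \/ Re s < 0.

Definition expansion_converges (D : C -> Prop)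
    (theta : R) (n : nat) (omega : nat -> C) (y : R) : Prop :=
  forall k, In k (indices n) ->
    (forall s, D s ->
       Zstar_abs_cv (fun m => expansion_term theta n omega y k m s)) /\
    (forall K : C -> Prop, compact_set K -> (forall s, K s -> D s) ->
       Zstar_cvu K (expansion_term theta n omega y k)).

(* Main.v *)
(* Rotating by [e^(-i theta)] we may take [Re omega_k > 0].  For [Re s > n], Gamma(s) times the Barnes series is the
   Mellin transform of [G(t) = prod_k e^(omega_k y t) / (e^(omega_k t) - 1)].  All poles of [G] other than 0 are simple,
   they are the points [2 m pi i / omega_k], and they stay uniformly apart because no ratio [omega_j / omega_k] is real.
   As [G] is bounded away from its poles, subtracting the polar part at 0 and the series of
   [r t^2 / (p^2 (t - p))] over the poles [p] with residue [r] leaves an entire function of at most quadratic growth,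
   so Liouville's theorem and the boundedness of [G] on [[1, oo)] give, for [u > 0],
   [G(u) = polar part + c_0 + sum_p r u / (p (u - p))].  In the strip [-1 < Re s < 0] the continued Mellin transform of [G]
   is that of the last sum alone, and integrating it termwise with [int_0^oo u^(s-1) / (u + e^w) du = e^((s-1) w) pi / sin (pi s)]
   yields the expansion; the identity theorem carries it to the whole region. *)

Require Import Defs.
From Stdlib Require Import Reals List ZArith Lra Lia Psatz ClassicalEpsilon FunctionalExtensionality PropExtensionality.
From Stdlib Require Import ssreflect.
From Coquelicot Require Import Coquelicot.
Open Scope R_scope.

(** * Complex numbers and the exponential *)

(** The coefficients of the polar part at 0 are never computed. Integrated against [u^(s-1)], a
    power [u^(-i)] gives [1 / (s - i)] over [(0, 1)] for large [Re s] and [-1 / (s - i)] over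
    [(1, oo)] for [Re s < 0]; continuation therefore cancels the polar part, constant included, once
    [Re s < 0]. The bound [-1 < Re s] comes from the remaining sum: its terms are
    [O(u^k |p|^(-1-k))] for [0 <= k <= 1], so the sum is [O(u^k)] for [0 < k <= 1]. At [y = 0] the
    residues need not decay, and [t^2 / (p^2 (t - p))] is then summable from a lower bound on
    [|t - p|] alone. Termwise integration yields [pi / sin (pi s)] whereas the series carries
    [Gamma (s)], so the reflection formula is proved on the way. Mellin integrals are taken in
    [x = ln u] with majorants [K / (1 + x^2)]: the one constant [K] controls convergence,
    differentiation and summation. Since values at poles are arbitrary, the identity theorem is
    needed for functions vanishing on punctured discs, along segments that may run through
    singularities. *)

Lemma C_eta (z : C) : z = (Re z, Im z).
Proof. by case: z. Qed.

Lemma C_ext (z w : C) : Re z = Re w -> Im z = Im w -> z = w.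
Proof. by case: z => a b; case: w => c d /= -> ->. Qed.

Lemma Re_plus (z w : C) : Re (z + w)%C = Re z + Re w.
Proof. by []. Qed.

Lemma Re_mult (z w : C) : Re (z * w)%C = Re z * Re w - Im z * Im w.
Proof. by []. Qed.

Lemma Im_le_Cmod (z : C) : Rabs (Im z) <= Cmod z.
Proof. apply: Rle_trans (Rmax_Cmod z). exact: Rmax_r. Qed.

Lemma Re_le_Cmod (z : C) : Rabs (Re z) <= Cmod z.
Proof. apply: Rle_trans (Rmax_Cmod z). exact: Rmax_l. Qed.

Lemma Cmod_le_sum (z : C) : Cmod z <= Rabs (Re z) + Rabs (Im z).
Proof.
  have -> : z = (RtoC (Re z) + Ci * RtoC (Im z))%C.
  { apply: C_ext; rewrite /=; ring. }
  apply: Rle_trans (Cmod_triangle _ _) _.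
  rewrite Cmod_mult Cmod_Ci !Cmod_R /=. rewrite !Rmult_0_l !Rmult_0_r !Rmult_1_l.
  apply: Req_le. congr (Rabs _ + Rabs _); ring.
Qed.

Lemma Cmod_minus_sym (z w : C) : Cmod (z - w)%C = Cmod (w - z)%C.
Proof. rewrite -Cmod_opp. congr Cmod. ring. Qed.

Lemma Cmod_triangle_minus (z w : C) : Cmod (z - w)%C <= Cmod z + Cmod w.
Proof. rewrite /Cminus. apply: Rle_trans (Cmod_triangle _ _) _. rewrite Cmod_opp. lra. Qed.

Lemma Cmod_triangle3 (z w c : C) : Cmod (z - w)%C <= Cmod (z - c)%C + Cmod (c - w)%C.
Proof.
  have -> : (z - w = (z - c) + (c - w))%C by ring.
  exact: Cmod_triangle.
Qed.

Lemma Cmod_triangle_rev (z w : C) : Cmod z - Cmod w <= Cmod (z + w)%C.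
Proof.
  have := Cmod_triangle_minus (z + w)%C w.
  have -> : (z + w - w = z)%C by ring. lra.
Qed.

Lemma Cmod_triangle_rev_minus (z w : C) : Cmod z - Cmod w <= Cmod (z - w)%C.
Proof. have := Cmod_triangle_rev z (- w)%C. by rewrite Cmod_opp. Qed.

Lemma Cmod_self (z : C) : Cmod (z - z)%C = 0.
Proof. have -> : (z - z = 0)%C by ring. exact: Cmod_0. Qed.

Lemma Cminus_eq_0 (z w : C) : (z - w = 0)%C -> z = w.
Proof. move=> H. have -> : z = (z - w + w)%C by ring. rewrite H. ring. Qed.

Lemma Cminus_neq_0 (z w : C) : z <> w -> (z - w <> 0)%C.
Proof. by move=> H /Cminus_eq_0. Qed.

Lemma Cmod_minus_gt0 (z w : C) : z <> w -> 0 < Cmod (z - w)%C.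
Proof. move=> H. apply Cmod_gt_0. exact: Cminus_neq_0. Qed.

Lemma Cmod_pos_neq0 (z : C) : 0 < Cmod z -> z <> 0%C.
Proof. by move=> /Cmod_gt_0. Qed.

Lemma Cmod_le_0 (z : C) : Cmod z <= 0 -> z = 0%C.
Proof. move=> H. apply: Cmod_eq_0. have := Cmod_ge_0 z. lra. Qed.

Lemma C_eq_small (z w : C) : (forall e, 0 < e -> Cmod (z - w)%C <= e) -> z = w.
Proof.
  move=> H. apply: Cminus_eq_0. apply: Cmod_le_0.
  apply: Rnot_lt_le => h. have := H (Cmod (z - w)%C / 2). lra.
Qed.

Lemma Cmult_eq_0 (z w : C) : (z * w = 0)%C -> z = 0%C \/ w = 0%C.
Proof.
  move=> H. case: (classic (z = 0%C)) => [h|h]; [by left|right].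
  have -> : w = (/ z * (z * w))%C by field. rewrite H. ring.
Qed.

Lemma Cinv_neq_0 (z : C) : z <> 0%C -> (/ z <> 0)%C.
Proof.
  move=> H h. have : (z * / z = 1)%C by field. rewrite h Cmult_0_r => E.
  apply: R1_neq_R0. by apply: RtoC_inj.
Qed.

Lemma Cinv_0 : (/ 0 = 0)%C.
Proof. rewrite /Cinv /=. by rewrite !Rmult_0_l Rplus_0_l /Rdiv Ropp_0 !Rmult_0_l. Qed.

Lemma RtoC_neq0 (x : R) : x <> 0 -> RtoC x <> 0%C.
Proof. move=> H h. apply: H. by apply: RtoC_inj. Qed.

Lemma Ci_neq0 : Ci <> 0%C.
Proof. apply: Cmod_pos_neq0. rewrite Cmod_Ci. lra. Qed.

Lemma Ci2 : (Ci * Ci = - (1))%C.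
Proof. apply: C_ext; rewrite /=; ring. Qed.

Lemma Cexp_eq (z : C) : Cexp z = (exp (Re z) * cos (Im z), exp (Re z) * sin (Im z)).
Proof. rewrite /Cexp. apply: C_ext; rewrite /=; ring. Qed.

Lemma Cexp_plus (z w : C) : Cexp (z + w)%C = (Cexp z * Cexp w)%C.
Proof.
  rewrite !Cexp_eq. apply: C_ext; rewrite /= exp_plus ?cos_plus ?sin_plus /Re /Im; ring.
Qed.

Lemma Cexp_R (x : R) : Cexp (RtoC x) = RtoC (exp x).
Proof. rewrite Cexp_eq /= cos_0 sin_0. apply: C_ext; rewrite /=; ring. Qed.

Lemma Cexp_0 : Cexp 0%C = 1%C.
Proof. by rewrite Cexp_R exp_0. Qed.

Lemma Cexp_Ci (x : R) : Cexp (Ci * x)%C = (cos x, sin x).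
Proof.
  rewrite Cexp_eq /=. rewrite !Rmult_0_l !Rmult_0_r !Rmult_1_l Rminus_0_r Rplus_0_l exp_0.
  by rewrite !Rmult_1_l.
Qed.

Lemma Cmod_Cexp (z : C) : Cmod (Cexp z) = exp (Re z).
Proof.
  rewrite /Cexp Cmod_mult Cmod_R.
  have -> : Cmod (cos (Im z), sin (Im z)) = 1.
  { rewrite /Cmod /=. rewrite !Rmult_1_r. have := sin2_cos2 (Im z). rewrite /Rsqr Rplus_comm => ->.
    exact: sqrt_1. }
  rewrite Rmult_1_r. apply: Rabs_pos_eq. exact: Rlt_le (exp_pos _).
Qed.

Lemma Cexp_neq0 (z : C) : Cexp z <> 0%C.
Proof. apply: Cmod_pos_neq0. rewrite Cmod_Cexp. exact: exp_pos. Qed.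

Lemma Cexp_opp (z : C) : Cexp (- z)%C = (/ Cexp z)%C.
Proof.
  have H : (Cexp (- z) * Cexp z = 1)%C by rewrite -Cexp_plus Cplus_comm Cplus_opp_r Cexp_0.
  have h := Cexp_neq0 z.
  have -> : Cexp (- z)%C = (Cexp (- z) * Cexp z * / Cexp z)%C by field.
  rewrite H. field. exact: h.
Qed.

Lemma Cexp_minus (z w : C) : Cexp (z - w)%C = (Cexp z / Cexp w)%C.
Proof. by rewrite /Cminus Cexp_plus Cexp_opp. Qed.

Lemma Cexp_2PI : Cexp (2 * PI * Ci)%C = 1%C.
Proof.
  have -> : (2 * PI * Ci)%C = (Ci * RtoC (2 * PI))%C by rewrite RtoC_mult; ring.
  rewrite Cexp_Ci cos_2PI sin_2PI. by [].
Qed.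

Lemma Cexp_2PI_nat (m : nat) : Cexp (INR m * (2 * PI * Ci))%C = 1%C.
Proof.
  elim: m => [|m IH].
  - by rewrite /= Cmult_0_l Cexp_0.
  - rewrite S_INR RtoC_plus Cmult_plus_distr_r Cexp_plus IH Cmult_1_l.
    by rewrite Cmult_1_l Cexp_2PI.
Qed.

Lemma Cexp_2PI_Z (m : Z) : Cexp (IZR m * (2 * PI * Ci))%C = 1%C.
Proof.
  case: (Z_le_gt_dec 0 m) => h.
  - have -> : m = Z.of_nat (Z.to_nat m) by lia. rewrite -INR_IZR_INZ. exact: Cexp_2PI_nat.
  - have -> : m = (- Z.of_nat (Z.to_nat (- m)))%Z by lia.
    rewrite opp_IZR -INR_IZR_INZ RtoC_opp.
    have -> : (- INR (Z.to_nat (- m)) * (2 * PI * Ci) = - (INR (Z.to_nat (- m)) * (2 * PI * Ci)))%C by ring.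
    rewrite Cexp_opp Cexp_2PI_nat. field.
Qed.

Lemma cos_eq1_small (x : R) : - (2 * PI) < x < 2 * PI -> cos x = 1 -> x = 0.
Proof.
  move=> Hx Hc.
  have E : cos x = 1 - 2 * sin (x / 2) * sin (x / 2).
  { have -> : x = 2 * (x / 2) by field. rewrite cos_2a_sin. have -> : 2 * (x / 2) / 2 = x / 2 by field. by []. }
  have Hs : sin (x / 2) = 0 by nra.
  case: (Rtotal_order x 0) => [h|[h|h]] //.
  - have : 0 < sin (- (x / 2)). { apply: sin_gt_0; lra. } rewrite sin_neg. lra.
  - have : 0 < sin (x / 2). { apply: sin_gt_0; lra. } lra.
Qed.

Lemma Cexp_eq1 (z : C) : - (2 * PI) < Im z < 2 * PI -> Cexp z = 1%C -> z = 0%C.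
Proof.
  move=> Hz H.
  have Hm : exp (Re z) = 1. { by rewrite -Cmod_Cexp H Cmod_1. }
  have Hr : Re z = 0. { apply: exp_inv. by rewrite exp_0. }
  move: H. rewrite Cexp_eq Hm => H.
  have Hc : cos (Im z) = 1. { have := f_equal Re H. rewrite /=. lra. }
  apply: C_ext => //. exact: cos_eq1_small.
Qed.

Lemma Cexp_inj_strip (z w : C) : - (2 * PI) < Im z - Im w < 2 * PI -> Cexp z = Cexp w -> z = w.
Proof.
  move=> H E. apply: Cminus_eq_0. apply: Cexp_eq1.
  - by [].
  - rewrite Cexp_minus E. field. exact: Cexp_neq0.
Qed.

Lemma cos_sin_polar (x y : R) : x * x + y * y = 1 -> exists b, -PI < b <= PI /\ x = cos b /\ y = sin b.
Proof.
  move=> H.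
  have Hx : -1 <= x <= 1 by nra.
  have Hb := acos_bound x.
  have Hs : sin (acos x) = sqrt (1 - x * x). { rewrite sin_acos //. }
  have Hyy : 1 - x * x = y * y by lra.
  rewrite Hyy in Hs.
  have Hy : sqrt (y * y) = Rabs y by rewrite -(sqrt_Rsqr_abs y).
  rewrite Hy in Hs.
  case: (Rle_lt_dec 0 y) => hy.
  - exists (acos x). rewrite cos_acos // Hs Rabs_pos_eq //. have := PI_RGT_0. lra.
  - exists (- acos x). rewrite cos_neg sin_neg cos_acos // Hs Rabs_left //.
    split; last lra. split; last (have := PI_RGT_0; lra).
    case: (Rle_lt_or_eq_dec _ _ (proj2 Hb)) => [|E]; first lra.
    move: Hs. rewrite E sin_PI Rabs_left //. lra.
Qed.

Lemma Cexp_surj (z : C) : z <> 0%C -> exists w, Cexp w = z /\ -PI < Im w <= PI /\ Re w = ln (Cmod z).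
Proof.
  move=> Hz. have Hp : 0 < Cmod z by apply Cmod_gt_0.
  have Hsq : Cmod z * Cmod z = Re z * Re z + Im z * Im z.
  { have := Cmod2_alt z. rewrite /=. lra. }
  case: (cos_sin_polar (Re z / Cmod z) (Im z / Cmod z)).
  { have -> : Re z / Cmod z * (Re z / Cmod z) + Im z / Cmod z * (Im z / Cmod z)
       = (Re z * Re z + Im z * Im z) / (Cmod z * Cmod z). { field. lra. }
    rewrite -Hsq. field. lra. }
  move=> b [Hb [Hc Hs]].
  exists (ln (Cmod z), b). split; last by split.
  rewrite Cexp_eq /= exp_ln // -Hc -Hs. apply: C_ext; rewrite /=; field; lra.
Qed.

(** Both this bound and the next follow from [1 + x <= exp x] at [x] and at [- x], the latter giving
    [exp x * (1 - x) <= 1]. *)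
Lemma exp_m1_bound (x : R) : Rabs x <= 1 / 2 -> Rabs (exp x - 1) <= 2 * Rabs x.
Proof.
  move=> H. have h1 := exp_ineq1_le x. have h2 := exp_ineq1_le (- x).
  have hp := exp_pos x. rewrite exp_Ropp in h2.
  have h3 : exp x * (1 - x) <= 1.
  { have : exp x * / exp x = 1 by field; lra. nra. }
  move: H. case: (Rle_lt_dec 0 x) => hx.
  - rewrite !(Rabs_pos_eq x) // => H. rewrite Rabs_pos_eq; nra.
  - rewrite !(Rabs_left x) // => H.
    have : exp x < 1. { rewrite -exp_0. exact: exp_increasing. }
    move=> h4. rewrite Rabs_left; nra.
Qed.

Lemma exp_taylor2 (x : R) : Rabs x <= 1 / 2 -> Rabs (exp x - 1 - x) <= 2 * (x * x).
Proof.
  move=> H. have h1 := exp_ineq1_le x. have h2 := exp_ineq1_le (- x).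
  have hp := exp_pos x. rewrite exp_Ropp in h2.
  have h3 : exp x * (1 - x) <= 1.
  { have : exp x * / exp x = 1 by field; lra. nra. }
  have := Rabs_le_between x (1 / 2) => [[B _]]. have {}B := B H.
  rewrite Rabs_pos_eq; nra.
Qed.

Lemma sin_abs_le (x : R) : Rabs (sin x) <= Rabs x.
Proof.
  case: (MVT_abs sin cos 0 x).
  { move=> c _. apply is_derive_Reals. apply: is_derive_sin. }
  move=> c [E _]. rewrite sin_0 !Rminus_0_r in E. rewrite E.
  have := COS_bound c. have := Rabs_pos x. move=> h1 h2.
  have : Rabs (cos c) <= 1 by apply: Rabs_le; lra. nra.
Qed.

Lemma cos_taylor1 (x : R) : 0 <= 1 - cos x <= x * x.
Proof.
  split; first by have := COS_bound x; lra.
  have E : cos x = 1 - 2 * sin (x / 2) * sin (x / 2).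
  { have -> : x = 2 * (x / 2) by field. rewrite cos_2a_sin. have -> : 2 * (x / 2) / 2 = x / 2 by field. by []. }
  rewrite E. have := sin_abs_le (x / 2).
  move=> h. have h2 := Rsqr_le_abs_1 _ _ h. rewrite /Rsqr in h2. nra.
Qed.

Lemma sin_taylor1 (x : R) : Rabs x <= 1 -> Rabs (sin x - x) <= x * x.
Proof.
  move=> Hx.
  case: (MVT_abs (fun u => sin u - u) (fun u => cos u - 1) 0 x).
  { move=> c _. apply is_derive_Reals. auto_derive => //. ring. }
  move=> c [E Hc]. rewrite sin_0 !Rminus_0_r in E. rewrite E.
  have h := cos_taylor1 c. rewrite Rabs_minus_sym Rabs_pos_eq; last lra.
  have hc : Rabs c <= Rabs x.
  { move: Hc. rewrite /Rmin /Rmax. case: Rle_dec => h1 [h2 h3].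
    - rewrite !Rabs_pos_eq; lra.
    - rewrite !Rabs_left1; lra. }
  have := Rsqr_le_abs_1 _ _ hc. rewrite /Rsqr.
  have : Rabs x * Rabs x = x * x by rewrite -Rabs_mult Rabs_pos_eq; nra.
  have := Rabs_pos x. nra.
Qed.

(** The constant is generous: the real and the imaginary part are each at most [4 * |h|^2]. *)
Lemma Cexp_taylor2 (h : C) : Cmod h <= 1 / 2 -> Cmod (Cexp h - 1 - h)%C <= 20 * (Cmod h * Cmod h).
Proof.
  move=> H.
  have hx := Re_le_Cmod h. have hy := Im_le_Cmod h.
  have e1 := exp_m1_bound (Re h) ltac:(lra). have e2 := exp_taylor2 (Re h) ltac:(lra).
  have c1 := cos_taylor1 (Im h). have s1 := sin_taylor1 (Im h) ltac:(lra).
  apply: Rle_trans (Cmod_le_sum _) _. rewrite Cexp_eq /=.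
  set x := Re h in hx e1 e2 *. set y := Im h in hy c1 s1 *. set M := Cmod h in H hx hy *.
  have M0 : 0 <= M by apply: Cmod_ge_0.
  change (fst h) with x. change (snd h) with y.
  have xx : x * x <= M * M. { have := Rsqr_le_abs_1 x M. rewrite /Rsqr (Rabs_pos_eq M) //. apply. exact hx. }
  have yy : y * y <= M * M. { have := Rsqr_le_abs_1 y M. rewrite /Rsqr (Rabs_pos_eq M) //. apply. exact hy. }
  have ex : 0 < exp x <= 2.
  { split; first exact: exp_pos. have : Rabs (exp x - 1) <= 1 by lra. move/Rabs_le_between. lra. }
  have A : Rabs (exp x * cos y + -(1) + - x) <= 4 * (M * M).
  { have -> : exp x * cos y + -(1) + - x = (exp x - 1 - x) + - (exp x * (1 - cos y)) by ring.
    apply: Rle_trans (Rabs_triang _ _) _. rewrite Rabs_Ropp (Rabs_pos_eq (exp x * (1 - cos y))); nra. }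
  have B : Rabs (exp x * sin y + -0 + - y) <= 4 * (M * M).
  { have -> : exp x * sin y + -0 + - y = exp x * (sin y - y) + y * (exp x - 1) by ring.
    apply: Rle_trans (Rabs_triang _ _) _. rewrite !Rabs_mult (Rabs_pos_eq (exp x)); last lra.
    have := Rabs_pos y. have := Rabs_pos x. have := Rabs_pos (sin y - y). have := Rabs_pos (exp x - 1).
    move=> *. have : Rabs y * Rabs (exp x - 1) <= M * (2 * M) by apply: Rmult_le_compat; lra.
    nra. }
  nra.
Qed.

(** * Complex derivatives *)

Definition cdiff (f : C -> C) (z : C) : Prop :=
  ex_derive (K := C_AbsRing) (V := C_NormedModule) f z.

(** Equivalent to [is_derive] over [C_AbsRing] by [cderiv_is_derive], but written with [Cmod], so
    that derivatives can be established by direct estimates. *)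
Definition cderiv (f : C -> C) (z l : C) : Prop :=
  forall e, 0 < e -> exists d, 0 < d /\ forall w, Cmod (w - z)%C < d ->
    Cmod (f w - f z - l * (w - z))%C <= e * Cmod (w - z)%C.

Lemma locally_Cmod (z : C) (P : C -> Prop) :
  locally (T := C_UniformSpace) z P <-> exists d, 0 < d /\ forall w, Cmod (w - z)%C < d -> P w.
Proof.
  split.
  - move=> H. have [d Hd] := proj1 (locally_C z P) H.
    exists d. split; first exact: cond_pos. move=> w Hw. apply: Hd. exact: Hw.
  - move=> [d [Hd H]]. apply (locally_C z P). exists (mkposreal d Hd) => w Hw. apply: H. exact: Hw.
Qed.

Lemma cderiv_is_derive (f : C -> C) (z l : C) :
  cderiv f z l <-> is_derive (K := C_AbsRing) (V := C_NormedModule) f z l.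
Proof.
  split.
  - move=> H. split; first exact: is_linear_scal_l.
    move=> x Hx. have -> : x = z.
    { symmetry. exact: (is_filter_lim_locally_unique (K := C_AbsRing) (V := AbsRing_NormedModule C_AbsRing) z x Hx). }
    move=> e. have [d [Hd H']] := H e (cond_pos e).
    exists (mkposreal d Hd) => w Hw.
    have := H' w Hw. have -> : (f w - f z - l * (w - z))%C = minus (minus (f w) (f z)) (scal (minus w z) l).
    { rewrite /minus /scal /= /mult /= /plus /opp /=. ring. }
    move=> K; exact K.
  - move=> [_ H] e He.
    have [d Hd] := H z (fun P HP => HP) (mkposreal e He).
    exists d. split; first exact: cond_pos. move=> w Hw.
    have := Hd w Hw. have -> : (f w - f z - l * (w - z))%C = minus (minus (f w) (f z)) (scal (minus w z) l).
    { rewrite /minus /scal /= /mult /= /plus /opp /=. ring. }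
    move=> K; exact K.
Qed.

Lemma cdiff_cderiv (f : C -> C) (z : C) : cdiff f z <-> exists l, cderiv f z l.
Proof. by split=> [[l /cderiv_is_derive]|[l /cderiv_is_derive]]; exists l. Qed.

Lemma cderiv_cdiff f z l : cderiv f z l -> cdiff f z.
Proof. move=> H. apply cdiff_cderiv. by exists l. Qed.

Definition ccont (f : C -> C) (z : C) : Prop :=
  forall e, 0 < e -> exists d, 0 < d /\ forall w, Cmod (w - z)%C < d -> Cmod (f w - f z)%C < e.

Lemma cdiff_ccont (f : C -> C) (z : C) : cdiff f z -> ccont f z.
Proof.
  move=> /cdiff_cderiv [l H] e He.
  have [d [Hd H1]] := H 1 Rlt_0_1.
  have L0 := Cmod_ge_0 l.
  exists (Rmin d (e / (2 + Cmod l))). split.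
  { apply: Rmin_glb_lt => //. apply: Rdiv_lt_0_compat; lra. }
  move=> w Hw.
  have h1 := Rlt_le_trans _ _ _ Hw (Rmin_l _ _).
  have h2 := Rlt_le_trans _ _ _ Hw (Rmin_r _ _).
  have K1 := H1 w h1.
  have := Cmod_triangle (f w - f z - l * (w - z))%C (l * (w - z))%C.
  have -> : (f w - f z - l * (w - z) + l * (w - z) = f w - f z)%C by ring.
  rewrite Cmod_mult.
  have : Cmod (w - z)%C * (2 + Cmod l) < e.
  { apply: (Rmult_lt_reg_r (/ (2 + Cmod l))). apply: Rinv_0_lt_compat; lra.
    rewrite Rmult_assoc Rinv_r; last lra. by rewrite Rmult_1_r. }
  have := Cmod_ge_0 (w - z)%C. nra.
Qed.

Lemma cderiv_ext_loc (f g : C -> C) (z : C) (l : C) (d : R) : 0 < d -> (forall w, Cmod (w - z)%C < d -> f w = g w) ->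
  cderiv f z l -> cderiv g z l.
Proof.
  move=> Hd E H e He. have [d' [Hd' H']] := H e He.
  exists (Rmin d d'). split; first exact: Rmin_glb_lt.
  move=> w Hw. rewrite -!E.
  - apply: H'. exact: Rlt_le_trans Hw (Rmin_r _ _).
  - have -> : (z - z = 0)%C by ring. by rewrite Cmod_0.
  - exact: Rlt_le_trans Hw (Rmin_l _ _).
Qed.

Lemma cdiff_ext_loc (f g : C -> C) (z : C) (d : R) : 0 < d -> (forall w, Cmod (w - z)%C < d -> f w = g w) ->
  cdiff f z -> cdiff g z.
Proof. move=> Hd E /cdiff_cderiv [l H]. apply cdiff_cderiv. exists l. exact: cderiv_ext_loc Hd E H. Qed.

Lemma cdiff_ext (f g : C -> C) (z : C) : (forall w, f w = g w) -> cdiff f z -> cdiff g z.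
Proof. move=> E. apply: (cdiff_ext_loc f g z 1); [lra|by move=> w _]. Qed.

Lemma cdiff_const (c : C) (z : C) : cdiff (fun _ => c) z.
Proof. exact: ex_derive_const. Qed.

Lemma cdiff_id (z : C) : cdiff (fun w => w) z.
Proof.
  apply cdiff_cderiv. exists 1%C => e He. exists 1. split; first lra. move=> w _.
  have -> : (w - z - 1 * (w - z) = 0)%C by ring. rewrite Cmod_0.
  have := Cmod_ge_0 (w - z)%C. nra.
Qed.

Lemma cdiff_plus (f g : C -> C) (z : C) : cdiff f z -> cdiff g z -> cdiff (fun w => f w + g w)%C z.
Proof. move=> Hf Hg. exact: (ex_derive_plus (K := C_AbsRing) (V := C_NormedModule)). Qed.

Lemma cdiff_opp (f : C -> C) (z : C) : cdiff f z -> cdiff (fun w => - f w)%C z.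
Proof. move=> Hf. exact: (ex_derive_opp (K := C_AbsRing) (V := C_NormedModule)). Qed.

Lemma cdiff_minus (f g : C -> C) (z : C) : cdiff f z -> cdiff g z -> cdiff (fun w => f w - g w)%C z.
Proof. move=> Hf Hg. apply: cdiff_plus => //. exact: cdiff_opp. Qed.

Lemma cderiv_mult (f g : C -> C) (z : C) (l : C) (m : C) : cderiv f z l -> cderiv g z m ->
  cderiv (fun w => f w * g w)%C z (l * g z + f z * m)%C.
Proof.
  move=> Hf Hg e He.
  have [d0 [Hd0 C0]] := cdiff_ccont g z (cderiv_cdiff _ _ _ Hg) 1 Rlt_0_1.
  set A := Cmod (g z) + 1. set B := Cmod (f z) + 1. set L := Cmod l + 1.
  have A0 := Cmod_ge_0 (g z). have B0 := Cmod_ge_0 (f z). have L0 := Cmod_ge_0 l.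
  have [d1 [Hd1 H1]] := Hf (e / (3 * A)) ltac:(apply: Rdiv_lt_0_compat; rewrite /A; lra).
  have [d2 [Hd2 H2]] := Hg (e / (3 * B)) ltac:(apply: Rdiv_lt_0_compat; rewrite /B; lra).
  have [d3 [Hd3 H3]] := cdiff_ccont g z (cderiv_cdiff _ _ _ Hg) (e / (3 * L)) ltac:(apply: Rdiv_lt_0_compat; rewrite /L; lra).
  exists (Rmin (Rmin d0 d1) (Rmin d2 d3)). split.
  { repeat apply: Rmin_glb_lt => //. }
  move=> w Hw.
  have k0 : Cmod (w - z)%C < d0 by apply: Rlt_le_trans Hw _; apply: Rle_trans (Rmin_l _ _) (Rmin_l _ _).
  have k1 : Cmod (w - z)%C < d1 by apply: Rlt_le_trans Hw _; apply: Rle_trans (Rmin_l _ _) (Rmin_r _ _).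
  have k2 : Cmod (w - z)%C < d2 by apply: Rlt_le_trans Hw _; apply: Rle_trans (Rmin_r _ _) (Rmin_l _ _).
  have k3 : Cmod (w - z)%C < d3 by apply: Rlt_le_trans Hw _; apply: Rle_trans (Rmin_r _ _) (Rmin_r _ _).
  have {}C0 := C0 w k0. have {}H1 := H1 w k1. have {}H2 := H2 w k2. have {}H3 := H3 w k3.
  have hW := Cmod_ge_0 (w - z)%C. set W := Cmod (w - z)%C in H1 H2 hW *.
  have -> : (f w * g w - f z * g z - (l * g z + f z * m) * (w - z) =
    (f w - f z - l * (w - z)) * g w + f z * (g w - g z - m * (w - z)) + l * (w - z) * (g w - g z))%C by ring.
  apply: Rle_trans (Cmod_triangle _ _) _. apply: Rle_trans (Rplus_le_compat_r _ _ _ (Cmod_triangle _ _)) _.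
  rewrite !Cmod_mult -/W.
  have gw : Cmod (g w) <= A.
  { have -> : (g w = (g w - g z) + g z)%C by ring. have := Cmod_triangle (g w - g z)%C (g z). rewrite /A. lra. }
  have p1 : Cmod (f w - f z - l * (w - z))%C * Cmod (g w) <= e / (3 * A) * W * A.
  { apply: Rmult_le_compat => //; exact: Cmod_ge_0. }
  have p2 : Cmod (f z) * Cmod (g w - g z - m * (w - z))%C <= B * (e / (3 * B) * W).
  { apply: Rmult_le_compat => //; try exact: Cmod_ge_0. rewrite /B; lra. }
  have p3 : Cmod l * W * Cmod (g w - g z)%C <= L * W * (e / (3 * L)).
  { apply: Rmult_le_compat => //; try exact: Cmod_ge_0; try lra. exact: Rmult_le_pos.
    apply: Rmult_le_compat_r => //. rewrite /L; lra. }
  have E1 : e / (3 * A) * W * A = e * W / 3 by field; rewrite /A; lra.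
  have E2 : B * (e / (3 * B) * W) = e * W / 3 by field; rewrite /B; lra.
  have E3 : L * W * (e / (3 * L)) = e * W / 3 by field; rewrite /L; lra.
  lra.
Qed.

Lemma cdiff_mult (f g : C -> C) (z : C) : cdiff f z -> cdiff g z -> cdiff (fun w => f w * g w)%C z.
Proof.
  move=> /cdiff_cderiv [l Hf] /cdiff_cderiv [m Hg]. apply cdiff_cderiv. eexists. exact: cderiv_mult Hf Hg.
Qed.

Lemma cderiv_comp (f g : C -> C) (z : C) (l : C) (m : C) : cderiv f (g z) l -> cderiv g z m ->
  cderiv (fun w => f (g w)) z (l * m)%C.
Proof.
  move=> /cderiv_is_derive Hf /cderiv_is_derive Hg. apply cderiv_is_derive.
  rewrite Cmult_comm.
  (* [is_derive_comp] takes the inner function with values in [C] as a module over itself, a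
     structure formally different from [C_NormedModule]; the little-o condition is the same for
     both. *)
  have H0 : is_derive (K := C_AbsRing) (V := AbsRing_NormedModule C_AbsRing) g z m.
  { apply: (filterdiff_ext_lin (K := C_AbsRing) (U := AbsRing_NormedModule C_AbsRing) (V := AbsRing_NormedModule C_AbsRing) g (fun y => scal y m)) => //.
    split; first exact: is_linear_scal_l. exact: (proj2 Hg). }
  exact: (is_derive_comp (K := C_AbsRing) (V := C_NormedModule) f g z l m Hf H0).
Qed.

Lemma cdiff_comp (f g : C -> C) (z : C) : cdiff f (g z) -> cdiff g z -> cdiff (fun w => f (g w)) z.
Proof.
  move=> /cdiff_cderiv [l Hf] /cdiff_cderiv [m Hg]. apply cdiff_cderiv. eexists. exact: cderiv_comp Hf Hg.
Qed.

Lemma cderiv_Cinv (z : C) : z <> 0%C -> cderiv (fun w => / w)%C z (- / (z * z))%C.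
Proof.
  move=> Hz e He. have p : 0 < Cmod z. { apply Cmod_gt_0. exact Hz. }
  set M := Cmod z in p *.
  exists (Rmin (M / 2) (e * (M * M * M) / 2)). split.
  { apply: Rmin_glb_lt; first lra. apply: Rdiv_lt_0_compat; last lra. repeat apply: Rmult_lt_0_compat => //. }
  move=> w Hw.
  have h1 := Rlt_le_trans _ _ _ Hw (Rmin_l _ _).
  have h2 := Rlt_le_trans _ _ _ Hw (Rmin_r _ _).
  have hw : M / 2 < Cmod w.
  { have := Cmod_triangle_rev_minus z w. rewrite Cmod_minus_sym -/M. lra. }
  have w0 : w <> 0%C by apply: Cmod_pos_neq0; lra.
  have -> : (/ w - / z - - / (z * z) * (w - z) = (w - z) * (w - z) / (z * z * w))%C by field.
  have zz : (z * z * w <> 0)%C. { by apply: Cmult_neq_0 => //; apply: Cmult_neq_0. }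
  rewrite Cmod_div // !Cmod_mult -/M.
  have hW := Cmod_ge_0 (w - z)%C. set W := Cmod (w - z)%C in h1 h2 hW *.
  apply: (Rmult_le_reg_r (M * M * Cmod w)). { repeat apply: Rmult_lt_0_compat => //. lra. }
  have -> : W * W / (M * M * Cmod w) * (M * M * Cmod w) = W * W by field; split; lra.
  have : e * (M * M * M) / 2 <= e * (M * M * Cmod w).
  { have : 0 < e * (M * M) by repeat apply: Rmult_lt_0_compat. nra. }
  nra.
Qed.

Lemma cdiff_inv (f : C -> C) (z : C) : f z <> 0%C -> cdiff f z -> cdiff (fun w => / f w)%C z.
Proof.
  move=> H Hf. apply: (cdiff_comp (fun w => / w)%C f) => //. exact: (cderiv_cdiff _ _ _ (cderiv_Cinv (f z) H)).
Qed.

Lemma cdiff_div (f g : C -> C) (z : C) : g z <> 0%C -> cdiff f z -> cdiff g z -> cdiff (fun w => f w / g w)%C z.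
Proof. move=> H Hf Hg. apply: cdiff_mult => //. exact: cdiff_inv. Qed.

Lemma cderiv_Cexp (z : C) : cderiv Cexp z (Cexp z).
Proof.
  move=> e He. have p : 0 < Cmod (Cexp z) by apply Cmod_gt_0; exact: Cexp_neq0.
  set M := Cmod (Cexp z) in p *.
  exists (Rmin (1 / 2) (e / (20 * M))). split.
  { apply: Rmin_glb_lt; first lra. apply: Rdiv_lt_0_compat; lra. }
  move=> w Hw.
  have h1 := Rlt_le_trans _ _ _ Hw (Rmin_l _ _).
  have h2 := Rlt_le_trans _ _ _ Hw (Rmin_r _ _).
  have -> : (Cexp w - Cexp z - Cexp z * (w - z) = Cexp z * (Cexp (w - z) - 1 - (w - z)))%C.
  { have {1}-> : w = (z + (w - z))%C by ring. rewrite Cexp_plus. ring. }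
  rewrite Cmod_mult -/M. have := Cexp_taylor2 (w - z)%C ltac:(lra).
  have hW := Cmod_ge_0 (w - z)%C. set W := Cmod (w - z)%C in h1 h2 hW *.
  have h3 : W * (20 * M) < e.
  { have -> : e = e / (20 * M) * (20 * M) by field; lra. apply: Rmult_lt_compat_r; lra. }
  move=> H. apply: Rle_trans (Rmult_le_compat_l _ _ _ (Rlt_le _ _ p) H) _. nra.
Qed.

Lemma cdiff_Cexp (f : C -> C) (z : C) : cdiff f z -> cdiff (fun w => Cexp (f w)) z.
Proof. move=> Hf. apply: (cdiff_comp Cexp f) => //. exact: (cderiv_cdiff _ _ _ (cderiv_Cexp _)). Qed.

Lemma cdiff_pow (f : C -> C) (n : nat) (z : C) : cdiff f z -> cdiff (fun w => f w ^ n)%C z.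
Proof. move=> Hf. elim: n => [|n IH] /=; [exact: cdiff_const|exact: cdiff_mult]. Qed.

Lemma cdiff_Csum (f : nat -> C -> C) l z : (forall k, In k l -> cdiff (f k) z) ->
  cdiff (fun w => Csum (fun k => f k w) l) z.
Proof.
  elim: l => [|k l IH] H /=; first exact: cdiff_const.
  apply: cdiff_plus; first by apply: H; left. apply: IH => j Hj. apply: H. by right.
Qed.

Lemma cdiff_Cprod (f : nat -> C -> C) l z : (forall k, In k l -> cdiff (f k) z) ->
  cdiff (fun w => Cprod (fun k => f k w) l) z.
Proof.
  elim: l => [|k l IH] H /=; first exact: cdiff_const.
  apply: cdiff_mult; first by apply: H; left. apply: IH => j Hj. apply: H. by right.
Qed.

Ltac cdiff_tac := repeat (try assumption; lazymatch goal with
  | |- cdiff (fun _ => ?c) _ => apply cdiff_const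
  | |- cdiff (fun w => w) _ => apply cdiff_id
  | |- cdiff (fun w => Cplus _ _) _ => apply cdiff_plus
  | |- cdiff (fun w => Cminus _ _) _ => apply cdiff_minus
  | |- cdiff (fun w => Copp _) _ => apply cdiff_opp
  | |- cdiff (fun w => Cmult _ _) _ => apply cdiff_mult
  | |- cdiff (fun w => Cdiv _ _) _ => apply cdiff_div
  | |- cdiff (fun w => Cinv _) _ => apply cdiff_inv
  | |- cdiff (fun w => Cpow _ _) _ => apply cdiff_pow
  | |- cdiff (fun w => Cexp _) _ => apply cdiff_Cexp
  | |- cdiff (Cmult ?c) ?z => change (cdiff (fun w => Cmult c w) z)
  | |- cdiff (Cplus ?c) ?z => change (cdiff (fun w => Cplus c w) z)
  | |- cdiff (Cminus ?c) ?z => change (cdiff (fun w => Cminus c w) z)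
  | |- cdiff (Cdiv ?c) ?z => change (cdiff (fun w => Cdiv c w) z)
  | |- cdiff Cinv ?z => change (cdiff (fun w => Cinv w) z)
  | |- cdiff Copp ?z => change (cdiff (fun w => Copp w) z)
  | |- cdiff Cexp _ => apply (cdiff_Cexp (fun w => w))
  end).

(** * Integrals of complex functions of a real variable *)

Definition rcont (f : R -> C) (x : R) : Prop :=
  continuous (U := C_UniformSpace) f x.

Lemma ball_C_Cmod (z w : C) (e : posreal) : Cmod (w - z)%C < e -> ball (M := C_UniformSpace) z e w.
Proof. move=> H. apply: C_NormedModule_mixin_compat1. exact: H. Qed.

Lemma rcont_eps (f : R -> C) (x : R) :
  rcont f x <-> forall e, 0 < e -> exists d, 0 < d /\ forall y, Rabs (y - x) < d -> Cmod (f y - f x)%C < e.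
Proof.
  split.
  - move=> H e He.
    have L : locally (T := C_UniformSpace) (f x) (fun w => Cmod (w - f x)%C < e).
    { apply locally_Cmod. by exists e. }
    have [d Hd] := H _ L. exists d. split; first exact: cond_pos. move=> y Hy. exact: (Hd y Hy).
  - move=> H P [e He]. have [d [Hd K]] := H e (cond_pos e).
    exists (mkposreal d Hd) => y Hy. apply: He. apply: ball_C_Cmod. apply: K. exact: Hy.
Qed.

Lemma rcont_comp (f : C -> C) (g : R -> C) (x : R) : ccont f (g x) -> rcont g x -> rcont (fun y => f (g y)) x.
Proof.
  move=> Hf /rcont_eps Hg. apply rcont_eps => e He.
  have [d [Hd H1]] := Hf e He. have [d' [Hd' H2]] := Hg d Hd.
  exists d'. split => // y Hy. apply: H1. exact: H2.
Qed.

Lemma rcont_cdiff (f : C -> C) (g : R -> C) (x : R) : cdiff f (g x) -> rcont g x -> rcont (fun y => f (g y)) x.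
Proof. move=> /cdiff_ccont. exact: rcont_comp. Qed.

Lemma rcont_const (c : C) (x : R) : rcont (fun _ => c) x.
Proof. exact: continuous_const. Qed.

Lemma rcont_R (f : R -> R) x : continuous f x -> rcont (fun y => RtoC (f y)) x.
Proof.
  move=> H. apply rcont_eps => e He.
  have [d Hd] := proj1 (filterlim_locally _ _) H (mkposreal e He).
  exists d. split; first exact: cond_pos. move=> y Hy.
  rewrite -RtoC_minus Cmod_R. exact: (Hd y Hy).
Qed.

Lemma rcont_RtoC (x : R) : rcont (fun y => RtoC y) x.
Proof. apply: (rcont_R (fun y => y)). exact: continuous_id. Qed.

Lemma rcont_plus (f g : R -> C) (x : R) : rcont f x -> rcont g x -> rcont (fun y => f y + g y)%C x.
Proof. move=> Hf Hg. exact: (continuous_plus (V := C_R_NormedModule) f g). Qed.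

Lemma rcont_opp (f : R -> C) (x : R) : rcont f x -> rcont (fun y => - f y)%C x.
Proof. move=> Hf. exact: (continuous_opp (V := C_R_NormedModule) f). Qed.

Lemma rcont_minus (f g : R -> C) (x : R) : rcont f x -> rcont g x -> rcont (fun y => f y - g y)%C x.
Proof. move=> Hf Hg. apply: rcont_plus => //. exact: rcont_opp. Qed.

Lemma rcont_mult (f g : R -> C) (x : R) : rcont f x -> rcont g x -> rcont (fun y => f y * g y)%C x.
Proof.
  move=> /rcont_eps Hf /rcont_eps Hg. apply rcont_eps => e He.
  set A := Cmod (g x) + 1. set B := Cmod (f x) + 1.
  have A0 := Cmod_ge_0 (g x). have B0 := Cmod_ge_0 (f x).
  have [d0 [Hd0 H0]] := Hg 1 Rlt_0_1.
  have [d1 [Hd1 H1]] := Hf (e / (2 * A)) ltac:(apply: Rdiv_lt_0_compat; rewrite /A; lra).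
  have [d2 [Hd2 H2]] := Hg (e / (2 * B)) ltac:(apply: Rdiv_lt_0_compat; rewrite /B; lra).
  exists (Rmin d0 (Rmin d1 d2)). split; first by repeat apply: Rmin_glb_lt.
  move=> y Hy.
  have k0 : Rabs (y - x) < d0 by apply: Rlt_le_trans Hy (Rmin_l _ _).
  have k1 : Rabs (y - x) < d1 by apply: Rlt_le_trans Hy _; apply: Rle_trans (Rmin_r _ _) (Rmin_l _ _).
  have k2 : Rabs (y - x) < d2 by apply: Rlt_le_trans Hy _; apply: Rle_trans (Rmin_r _ _) (Rmin_r _ _).
  have {}H0 := H0 y k0. have {}H1 := H1 y k1. have {}H2 := H2 y k2.
  have -> : (f y * g y - f x * g x = (f y - f x) * g y + f x * (g y - g x))%C by ring.
  apply: Rle_lt_trans (Cmod_triangle _ _) _. rewrite !Cmod_mult.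
  have gw : Cmod (g y) <= A.
  { have -> : (g y = (g y - g x) + g x)%C by ring. have := Cmod_triangle (g y - g x)%C (g x). rewrite /A. lra. }
  have p1 : Cmod (f y - f x)%C * Cmod (g y) <= Cmod (f y - f x)%C * A by apply: Rmult_le_compat_l => //; exact: Cmod_ge_0.
  have p1' : Cmod (f y - f x)%C * A < e / (2 * A) * A by apply: Rmult_lt_compat_r => //; rewrite /A; lra.
  have p2 : Cmod (f x) * Cmod (g y - g x)%C <= B * Cmod (g y - g x)%C by apply: Rmult_le_compat_r; [exact: Cmod_ge_0|rewrite /B; lra].
  have p2' : B * Cmod (g y - g x)%C < B * (e / (2 * B)) by apply: Rmult_lt_compat_l => //; rewrite /B; lra.
  have E1 : e / (2 * A) * A = e / 2 by field; rewrite /A; lra.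
  have E2 : B * (e / (2 * B)) = e / 2 by field; rewrite /B; lra.
  lra.
Qed.

Lemma rcont_Cexp (f : R -> C) (x : R) : rcont f x -> rcont (fun y => Cexp (f y)) x.
Proof. apply: rcont_cdiff. exact: (cderiv_cdiff _ _ _ (cderiv_Cexp _)). Qed.

Lemma rcont_inv (f : R -> C) (x : R) : f x <> 0%C -> rcont f x -> rcont (fun y => / f y)%C x.
Proof. move=> H. apply: (rcont_cdiff (fun w => / w)%C). exact: (cderiv_cdiff _ _ _ (cderiv_Cinv (f x) H)). Qed.

Lemma rcont_div (f g : R -> C) (x : R) : g x <> 0%C -> rcont f x -> rcont g x -> rcont (fun y => f y / g y)%C x.
Proof. move=> H Hf Hg. apply: rcont_mult => //. exact: rcont_inv. Qed.

Lemma rcont_pair (f g : R -> R) x : continuous f x -> continuous g x -> rcont (fun y => (f y, g y)) x.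
Proof.
  move=> Hf Hg. have H : rcont (fun y => RtoC (f y) + Ci * RtoC (g y))%C x.
  { apply: rcont_plus; first exact: rcont_R. apply: rcont_mult; [exact: rcont_const|exact: rcont_R]. }
  apply: (continuous_ext (U := C_UniformSpace) _ _ _ _ H) => y. apply: C_ext; rewrite /=; ring.
Qed.

Ltac rcont_tac := repeat (try assumption; lazymatch goal with
  | |- rcont (fun _ => ?c) _ => apply rcont_const
  | |- rcont (fun y => RtoC y) _ => apply rcont_RtoC
  | |- rcont RtoC _ => apply rcont_RtoC
  | |- rcont (fun y => Cplus _ _) _ => apply rcont_plus
  | |- rcont (fun y => Cminus _ _) _ => apply rcont_minus
  | |- rcont (fun y => Copp _) _ => apply rcont_opp
  | |- rcont (fun y => Cmult _ _) _ => apply rcont_mult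
  | |- rcont (fun y => Cdiv _ _) _ => apply rcont_div
  | |- rcont (fun y => Cinv _) _ => apply rcont_inv
  | |- rcont (fun y => Cexp _) _ => apply rcont_Cexp
  end).

Definition isCI (f : R -> C) (a b : R) (l : C) : Prop := is_RInt (V := C_R_NormedModule) f a b l.
Definition exCI (f : R -> C) (a b : R) : Prop := ex_RInt (V := C_R_NormedModule) f a b.
Definition CI (f : R -> C) (a b : R) : C := RInt (V := C_R_CompleteNormedModule) f a b.

Lemma isCI_CI f a b : exCI f a b -> isCI f a b (CI f a b).
Proof. exact: (RInt_correct (V := C_R_CompleteNormedModule)). Qed.

Lemma CI_eq f a b l : isCI f a b l -> CI f a b = l.
Proof. exact: (is_RInt_unique (V := C_R_CompleteNormedModule)). Qed.

Lemma exCI_cont (f : R -> C) a b : a <= b -> (forall x, a <= x <= b -> rcont f x) -> exCI f a b.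
Proof.
  move=> Hab H. apply: (ex_RInt_continuous (V := C_R_CompleteNormedModule)) => z.
  rewrite Rmin_left // Rmax_right //. exact: H.
Qed.

Lemma exCI_cont_all (f : R -> C) a b : (forall x, rcont f x) -> exCI f a b.
Proof.
  move=> H. apply: (ex_RInt_continuous (V := C_R_CompleteNormedModule)) => z _. exact: H.
Qed.

Lemma isCI_ext (f g : R -> C) a b l : (forall x, Rmin a b < x < Rmax a b -> f x = g x) -> isCI f a b l -> isCI g a b l.
Proof. exact: is_RInt_ext. Qed.

Lemma exCI_ext (f g : R -> C) a b : (forall x, Rmin a b < x < Rmax a b -> f x = g x) -> exCI f a b -> exCI g a b.
Proof. exact: ex_RInt_ext. Qed.

Lemma CI_ext (f g : R -> C) a b : (forall x, Rmin a b < x < Rmax a b -> f x = g x) -> CI f a b = CI g a b.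
Proof. exact: (RInt_ext (V := C_R_CompleteNormedModule)). Qed.

Lemma CI_ext_all (f g : R -> C) a b : (forall x, f x = g x) -> CI f a b = CI g a b.
Proof. move=> H. apply: CI_ext => x _. exact: H. Qed.

Lemma isCI_plus f g a b l m : isCI f a b l -> isCI g a b m -> isCI (fun x => f x + g x)%C a b (l + m)%C.
Proof. exact: is_RInt_plus. Qed.

Lemma isCI_opp f a b l : isCI f a b l -> isCI (fun x => - f x)%C a b (- l)%C.
Proof. exact: is_RInt_opp. Qed.

Lemma isCI_Re f a b l : isCI f a b l -> is_RInt (fun x => Re (f x)) a b (Re l).
Proof. exact: (is_RInt_fct_extend_fst (U := R_NormedModule) (V := R_NormedModule)). Qed.

Lemma isCI_Im f a b l : isCI f a b l -> is_RInt (fun x => Im (f x)) a b (Im l).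
Proof. exact: (is_RInt_fct_extend_snd (U := R_NormedModule) (V := R_NormedModule)). Qed.

Lemma isCI_pair (f : R -> C) a b (l : C) : is_RInt (fun x => Re (f x)) a b (Re l) ->
  is_RInt (fun x => Im (f x)) a b (Im l) -> isCI f a b l.
Proof.
  move=> H1 H2. rewrite (C_eta l). exact: (is_RInt_fct_extend_pair (U := R_NormedModule) (V := R_NormedModule) f).
Qed.

Lemma isCI_scal f a b l (k : C) : isCI f a b l -> isCI (fun x => k * f x)%C a b (k * l)%C.
Proof.
  move=> H. apply: isCI_pair.
  - exact: (is_RInt_minus (V := R_NormedModule) _ _ _ _ _ _ (is_RInt_scal _ _ _ (Re k) _ (isCI_Re _ _ _ _ H)) (is_RInt_scal _ _ _ (Im k) _ (isCI_Im _ _ _ _ H))).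
  - exact: (is_RInt_plus (V := R_NormedModule) _ _ _ _ _ _ (is_RInt_scal _ _ _ (Re k) _ (isCI_Im _ _ _ _ H)) (is_RInt_scal _ _ _ (Im k) _ (isCI_Re _ _ _ _ H))).
Qed.

Lemma isCI_minus f g a b l m : isCI f a b l -> isCI g a b m -> isCI (fun x => f x - g x)%C a b (l - m)%C.
Proof. move=> H K. apply: isCI_plus => //. exact: isCI_opp. Qed.

Lemma exCI_plus f g a b : exCI f a b -> exCI g a b -> exCI (fun x => f x + g x)%C a b.
Proof. move=> [l H] [m K]. eexists. exact: isCI_plus H K. Qed.

Lemma exCI_scal f a b (k : C) : exCI f a b -> exCI (fun x => k * f x)%C a b.
Proof. move=> [l H]. eexists. exact: isCI_scal H. Qed.

Lemma CI_plus f g a b : exCI f a b -> exCI g a b -> CI (fun x => f x + g x)%C a b = (CI f a b + CI g a b)%C.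
Proof. move=> Hf Hg. apply: CI_eq. apply: isCI_plus; exact: isCI_CI. Qed.

Lemma CI_minus f g a b : exCI f a b -> exCI g a b -> CI (fun x => f x - g x)%C a b = (CI f a b - CI g a b)%C.
Proof. move=> Hf Hg. apply: CI_eq. apply: isCI_minus; exact: isCI_CI. Qed.

Lemma CI_scal f a b (k : C) : exCI f a b -> CI (fun x => k * f x)%C a b = (k * CI f a b)%C.
Proof. move=> Hf. apply: CI_eq. apply: isCI_scal; exact: isCI_CI. Qed.

Lemma CI_const (c : C) a b : CI (fun _ => c) a b = (RtoC (b - a) * c)%C.
Proof. rewrite -scal_R_Cmult. apply: CI_eq. exact: is_RInt_const. Qed.

Lemma isCI_Chasles f a b c l m : isCI f a b l -> isCI f b c m -> isCI f a c (l + m)%C.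
Proof. exact: is_RInt_Chasles. Qed.

Lemma exCI_Chasles f a b c : exCI f a b -> exCI f b c -> exCI f a c.
Proof. exact: ex_RInt_Chasles. Qed.

Lemma CI_Chasles f a b c : exCI f a b -> exCI f b c -> CI f a c = (CI f a b + CI f b c)%C.
Proof. move=> H K. apply: CI_eq. apply: isCI_Chasles; exact: isCI_CI. Qed.

Lemma exCI_swap f a b : exCI f a b -> exCI f b a.
Proof. exact: ex_RInt_swap. Qed.

Lemma CI_swap f a b : exCI f a b -> CI f b a = (- CI f a b)%C.
Proof. move=> H. apply: CI_eq. exact: (is_RInt_swap (V := C_R_NormedModule) _ _ _ _ (isCI_CI _ _ _ H)). Qed.

Lemma CI_point f a : CI f a a = 0%C.
Proof. exact: (RInt_point (V := C_R_CompleteNormedModule)). Qed.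

Lemma Cmod_norm_R (z : C) : Cmod z = norm (K := R_AbsRing) (V := C_R_NormedModule) z.
Proof.
  rewrite /Cmod /norm /= /prod_norm /= /norm /= /abs /=. congr sqrt.
  have S : forall x, Rabs x * (Rabs x * 1) = x * (x * 1).
  { move=> x. rewrite !Rmult_1_r -Rabs_mult. apply: Rabs_pos_eq. nra. }
  by rewrite !S.
Qed.

Lemma CI_norm_le (f : R -> C) (g : R -> R) a b I : a <= b -> exCI f a b -> is_RInt g a b I ->
  (forall x, a <= x <= b -> Cmod (f x) <= g x) -> Cmod (CI f a b) <= I.
Proof.
  move=> Hab Hf Hg H. rewrite Cmod_norm_R.
  apply: (norm_RInt_le (V := C_R_NormedModule) f g a b _ _ Hab _ (isCI_CI _ _ _ Hf) Hg).
  move=> x Hx. rewrite -Cmod_norm_R. exact: H.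
Qed.

Lemma CI_norm (f : R -> C) a b M : a <= b -> exCI f a b ->
  (forall x, a <= x <= b -> Cmod (f x) <= M) -> Cmod (CI f a b) <= M * (b - a).
Proof.
  move=> Hab Hf H. apply: (CI_norm_le f (fun _ => M) a b) => //.
  have -> : M * (b - a) = scal (b - a) M by rewrite /scal /= /mult /= Rmult_comm.
  exact: is_RInt_const.
Qed.

Lemma isCI_comp_lin (f : R -> C) u v a b l : isCI f (u * a + v) (u * b + v) l ->
  isCI (fun y => RtoC u * f (u * y + v)%R)%C a b l.
Proof.
  move=> H. apply: (is_RInt_ext (fun y => scal u (f (u * y + v)))).
  - move=> x _. exact: scal_R_Cmult.
  - exact: is_RInt_comp_lin.
Qed.

Definition rderiv (F : R -> C) (x : R) (l : C) : Prop :=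
  is_derive (K := R_AbsRing) (V := C_R_NormedModule) F x l.

Lemma rderiv_eps (F : R -> C) (x : R) (l : C) : rderiv F x l <->
  forall e, 0 < e -> exists d, 0 < d /\ forall y, Rabs (y - x) < d ->
    Cmod (F y - F x - l * RtoC (y - x))%C <= e * Rabs (y - x).
Proof.
  have E : forall y, (F y - F x - l * RtoC (y - x))%C = minus (G := C_R_NormedModule) (minus (F y) (F x)) (scal (minus y x) l).
  { move=> y. rewrite scal_R_Cmult /minus /plus /opp /=. rewrite /prod_plus /prod_opp /=. apply: C_ext; rewrite /plus /opp /=; ring. }
  split.
  - move=> [_ H] e He.
    have [d Hd] := H x (fun P HP => HP) (mkposreal e He).
    exists d. split; first exact: cond_pos. move=> y Hy. rewrite E Cmod_norm_R. exact: (Hd y Hy).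
  - move=> H. split; first exact: is_linear_scal_l.
    move=> x' Hx'. have -> : x' = x by symmetry; exact: (is_filter_lim_locally_unique (K := R_AbsRing) (V := AbsRing_NormedModule R_AbsRing) x x' Hx').
    move=> e. have [d [Hd K]] := H e (cond_pos e).
    exists (mkposreal d Hd) => y Hy. have := K y Hy. rewrite E Cmod_norm_R. by [].
Qed.

Lemma rderiv_cont F x l : rderiv F x l -> rcont F x.
Proof. move=> H. apply: (ex_derive_continuous (K := R_AbsRing) (V := C_R_NormedModule)). by exists l. Qed.

Lemma rderiv_comp (f : C -> C) (g : R -> C) x l m : cderiv f (g x) l -> rderiv g x m -> rderiv (fun y => f (g y)) x (l * m)%C.
Proof.
  move=> Hf Hg. apply rderiv_eps => e He. have Hg' := proj1 (rderiv_eps _ _ _) Hg.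
  set A := Cmod m + 1. set B := Cmod l + 1.
  have A0 := Cmod_ge_0 m. have B0 := Cmod_ge_0 l.
  have [d1 [Hd1 H1]] := Hf (e / (2 * A)) ltac:(apply: Rdiv_lt_0_compat; rewrite /A; lra).
  have [d2 [Hd2 H2]] := Hg' (Rmin 1 (e / (2 * B))) ltac:(apply: Rmin_glb_lt; [lra|apply: Rdiv_lt_0_compat; rewrite /B; lra]).
  have [d3 [Hd3 H3]] := proj1 (rcont_eps _ _) (rderiv_cont _ _ _ Hg) d1 Hd1.
  exists (Rmin d2 d3). split; first exact: Rmin_glb_lt.
  move=> y Hy. have k2 := Rlt_le_trans _ _ _ Hy (Rmin_l _ _). have k3 := Rlt_le_trans _ _ _ Hy (Rmin_r _ _).
  have {}H3 := H3 y k3. have {}H2 := H2 y k2. have {}H1 := H1 _ H3.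
  have Y0 := Rabs_pos (y - x). set Y := Rabs (y - x) in H2 Y0 *.
  have H2a : Cmod (g y - g x - m * RtoC (y - x))%C <= Y.
  { apply: Rle_trans H2 _. have := Rmin_l 1 (e / (2 * B)). nra. }
  have H2b : Cmod (g y - g x - m * RtoC (y - x))%C <= e / (2 * B) * Y.
  { apply: Rle_trans H2 _. apply: Rmult_le_compat_r => //. exact: Rmin_r. }
  have Hgy : Cmod (g y - g x)%C <= A * Y.
  { have -> : (g y - g x = (g y - g x - m * RtoC (y - x)) + m * RtoC (y - x))%C by ring.
    apply: Rle_trans (Cmod_triangle _ _) _. rewrite Cmod_mult Cmod_R -/Y /A. lra. }
  have -> : (f (g y) - f (g x) - l * m * RtoC (y - x) = (f (g y) - f (g x) - l * (g y - g x)) + l * (g y - g x - m * RtoC (y - x)))%C by ring.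
  apply: Rle_trans (Cmod_triangle _ _) _. rewrite Cmod_mult.
  have P1 : e / (2 * A) * Cmod (g y - g x)%C <= e / (2 * A) * (A * Y).
  { apply: Rmult_le_compat_l => //. apply: Rlt_le; apply: Rdiv_lt_0_compat; rewrite /A; lra. }
  have P2 : Cmod l * Cmod (g y - g x - m * RtoC (y - x))%C <= B * (e / (2 * B) * Y).
  { apply: Rmult_le_compat => //; try exact: Cmod_ge_0. rewrite /B; lra. }
  have E1 : e / (2 * A) * (A * Y) = e / 2 * Y by field; rewrite /A; lra.
  have E2 : B * (e / (2 * B) * Y) = e / 2 * Y by field; rewrite /B; lra.
  lra.
Qed.

Lemma rderiv_RtoC (f : R -> R) x l : is_derive f x l -> rderiv (fun y => RtoC (f y)) x (RtoC l).
Proof.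
  move=> [_ H]. apply rderiv_eps => e He.
  have [d Hd] := H x (fun P HP => HP) (mkposreal e He).
  exists d. split; first exact: cond_pos. move=> y Hy.
  rewrite -RtoC_minus -RtoC_mult -RtoC_minus Cmod_R. have := Hd y Hy.
  rewrite /norm /= /abs /= /minus /plus /opp /scal /= /mult /=.
  have -> : f y + - f x + - ((y + - x) * l) = f y - f x - l * (y - x) by ring. by [].
Qed.

Lemma rderiv_id x : rderiv (fun y => RtoC y) x 1%C.
Proof. apply: (rderiv_RtoC (fun y => y)). exact: is_derive_id. Qed.

Lemma rderiv_plus F G x l m : rderiv F x l -> rderiv G x m -> rderiv (fun y => F y + G y)%C x (l + m)%C.
Proof. exact: is_derive_plus. Qed.

Lemma rderiv_scal (c : C) F x l : rderiv F x l -> rderiv (fun y => c * F y)%C x (c * l)%C.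
Proof.
  move=> H. apply: (rderiv_comp (fun w => c * w)%C) H.
  move=> e He. exists 1. split; first lra. move=> w _.
  have -> : (c * w - c * F x - c * (w - F x) = 0)%C by ring. rewrite Cmod_0.
  have := Cmod_ge_0 (w - F x)%C. nra.
Qed.

Lemma rderiv_ext (F G : R -> C) x l : (forall y, F y = G y) -> rderiv F x l -> rderiv G x l.
Proof. move=> E. exact: is_derive_ext. Qed.

Lemma rderiv_mult F G x l m : rderiv F x l -> rderiv G x m -> rderiv (fun y => F y * G y)%C x (l * G x + F x * m)%C.
Proof.
  move=> HF HG.
  have sq : forall H k, rderiv H x k -> rderiv (fun y => H y * H y)%C x ((H x + H x) * k)%C.
  { move=> H k HH. apply: (rderiv_comp (fun w => w * w)%C H) => //.
    have -> : (H x + H x = 1 * H x + H x * 1)%C by ring.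
    have di : cderiv (fun w => w) (H x) 1%C.
    { move=> e He. exists 1. split; first lra. move=> w _.
      have -> : (w - H x - 1 * (w - H x) = 0)%C by ring. rewrite Cmod_0. have := Cmod_ge_0 (w - H x)%C. nra. }
    exact: cderiv_mult. }
  (* polarization: 4FG = (F+G)^2 - (F-G)^2 *)
  have hm := rderiv_plus _ _ _ _ _ HF (rderiv_scal (- (1)) _ _ _ HG).
  have h := rderiv_scal (/ 4)%C _ _ _ (rderiv_plus _ _ _ _ _ (sq _ _ (rderiv_plus _ _ _ _ _ HF HG)) (rderiv_scal (- (1)) _ _ _ (sq _ _ hm))).
  have -> : (l * G x + F x * m = / 4 * ((F x + G x + (F x + G x)) * (l + m) + - (1) * ((F x + - (1) * G x + (F x + - (1) * G x)) * (l + - (1) * m))))%C by field.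
  apply: rderiv_ext h => y. field.
Qed.

Lemma isCI_FTC (F f : R -> C) a b : a <= b -> (forall x, a <= x <= b -> rderiv F x (f x)) ->
  (forall x, a <= x <= b -> rcont f x) -> isCI f a b (F b - F a)%C.
Proof.
  move=> Hab H K. apply: (is_RInt_derive (V := C_R_CompleteNormedModule) F f a b) => x; rewrite Rmin_left // Rmax_right //.
  exact: H. exact: K.
Qed.

Lemma CI_FTC (F f : R -> C) a b : a <= b -> (forall x, a <= x <= b -> rderiv F x (f x)) ->
  (forall x, a <= x <= b -> rcont f x) -> CI f a b = (F b - F a)%C.
Proof. move=> *. apply: CI_eq. exact: isCI_FTC. Qed.

(** * Cauchy's theorem, removable singularities and the identity theorem *)

Lemma dependent_choice_nat (T : Type) (Q : nat -> T -> Prop) (S' : nat -> T -> T -> Prop) (p0 : T) :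
  Q O p0 -> (forall n p, Q n p -> exists p', Q (S n) p' /\ S' n p p') ->
  exists f : nat -> T, f O = p0 /\ forall n, Q n (f n) /\ S' n (f n) (f (S n)).
Proof.
  move=> H0 H.
  pose nxt (n : nat) (p : {p | Q n p}) : {p | Q (S n) p} :=
    let e := constructive_indefinite_description _ (H n (proj1_sig p) (proj2_sig p)) in
    exist _ (proj1_sig e) (proj1 (proj2_sig e)).
  pose g := fix g n : {p | Q n p} := match n with O => exist _ p0 H0 | S m => nxt m (g m) end.
  exists (fun n => proj1_sig (g n)). split => // n. split; first exact: proj2_sig.
  rewrite /= /nxt /=. by case: (constructive_indefinite_description _ _) => p' [h1 h2].
Qed.

Lemma pow_half_small (L e : R) : 0 < e -> exists n, L / 2 ^ n < e.
Proof.
  move=> He. have [n Hn] := INR_unbounded (L / e).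
  exists n. have hp : 0 < 2 ^ n by apply: pow_lt; lra.
  have h2 : INR n < 2 ^ n.
  { elim: n {Hn hp} => [|n IH]; first by rewrite /=; lra.
    rewrite S_INR /=. have : 1 <= 2 ^ n by apply: pow_R1_Rle; lra. lra. }
  apply: (Rmult_lt_reg_r (2 ^ n)) => //.
  have -> : L / 2 ^ n * 2 ^ n = L by field; lra.
  have -> : L = L / e * e by field; lra. nra.
Qed.

Lemma nested_limit (u l : nat -> R) : (forall n, u n <= u (S n) <= u n + l (S n)) ->
  (forall n, l n = 2 * l (S n)) -> 0 <= l O -> exists x, forall n, u n <= x <= u n + l n.
Proof.
  move=> H Hl l0.
  have lp : forall n, 0 <= l n. { elim=> [//|n IH]. have := Hl n. lra. }
  have I : forall n m, u n <= u (m + n)%nat /\ u (m + n)%nat + l (m + n)%nat <= u n + l n.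
  { move=> n. elim=> [|m [IH1 IH2]] /=; first lra. have := H (m + n)%nat. have := Hl (m + n)%nat. lra. }
  have U : forall n m, u m <= u n + l n.
  { move=> n m. case: (Nat.le_ge_cases n m) => h.
    - have := I n (m - n)%nat. have -> : (m - n + n = m)%nat by lia. have := lp m. lra.
    - have := I m (n - m)%nat. have -> : (n - m + m = n)%nat by lia. have := lp n. lra. }
  have [x [Hx1 Hx2]] : {x | is_lub (fun y => exists n, y = u n) x}.
  { apply: completeness. exists (u O + l O) => y [n ->]. exact: U. by exists (u O), O. }
  exists x => n. split. apply: Hx1; by exists n. apply: Hx2 => y [m ->]. exact: U.
Qed.

(** Bisection: if [P] failed, some quarter would fail again and again, and the failing rectangles
    would shrink to a point [(x, y)], contradicting the local hypothesis there. The midpoints are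
    fixed by equations because the intended [P], a bound proportional to the squared size, is
    inherited only under exact halving. *)
Lemma cousin_rect (P : R -> R -> R -> R -> Prop) (a b c d : R) :
  a <= b -> c <= d ->
  (forall a m b c n d, m = (a + b) / 2 -> n = (c + d) / 2 ->
    P a m c n -> P m b c n -> P a m n d -> P m b n d -> P a b c d) ->
  (forall x y, a <= x <= b -> c <= y <= d -> exists e, 0 < e /\ forall a' b' c' d',
     a <= a' <= x -> x <= b' <= b -> c <= c' <= y -> y <= d' <= d -> b' - a' < e -> d' - c' < e -> P a' b' c' d') ->
  P a b c d.
Proof.
  move=> Hab Hcd Hs Hl. apply: NNPP => HP.
  set L := b - a. set M := d - c.
  have h2 : forall n X, X / 2 ^ n = 2 * (X / 2 ^ S n).
  { move=> n X /=. field. apply: pow_nonzero; lra. }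
  (* Only the lower left corner is carried along; after [n] steps the sides are [L / 2 ^ n] and
     [M / 2 ^ n]. *)
  case: (dependent_choice_nat (R * R)
    (fun n p => ~ P (fst p) (fst p + L / 2 ^ n) (snd p) (snd p + M / 2 ^ n))
    (fun n p q => fst p <= fst q <= fst p + L / 2 ^ S n /\ snd p <= snd q <= snd p + M / 2 ^ S n)
    (a, c)).
  { rewrite /= /L /M !Rdiv_1_r. have -> : a + (b - a) = b by ring. have -> : c + (d - c) = d by ring. done. }
  { move=> n [x y] /= Hn. apply: NNPP => Hno. apply: Hn.
    have E1 := h2 n L. have E2 := h2 n M.
    have L0 : 0 <= L / 2 ^ S n. { apply: Rmult_le_pos; first by rewrite /L; lra. apply: Rlt_le; apply: Rinv_0_lt_compat; apply: pow_lt; lra. }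
    have M0 : 0 <= M / 2 ^ S n. { apply: Rmult_le_pos; first by rewrite /M; lra. apply: Rlt_le; apply: Rinv_0_lt_compat; apply: pow_lt; lra. }
    simpl in E1, E2, L0, M0. set l := L / (2 * 2 ^ n) in E1 L0 Hno *. set m := M / (2 * 2 ^ n) in E2 M0 Hno *.
    apply: (Hs _ (x + l) _ _ (y + m)); try lra; apply: NNPP => K; apply: Hno.
    - exists (x, y) => /=. split => //. lra.
    - exists (x + l, y) => /=. split; last lra. have -> : x + l + l = x + L / 2 ^ n by lra. done.
    - exists (x, y + m) => /=. split; last lra. have -> : y + m + m = y + M / 2 ^ n by lra. done.
    - exists (x + l, y + m) => /=. split; last lra.
      have -> : x + l + l = x + L / 2 ^ n by lra. have -> : y + m + m = y + M / 2 ^ n by lra. done. }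
  move=> f [f0 Hf].
  have [x Hx] := nested_limit (fun n => fst (f n)) (fun n => L / 2 ^ n) ltac:(move=> n; have [_ [K _]] := Hf n; exact K) ltac:(move=> n; exact: h2) ltac:(rewrite /L /= Rdiv_1_r; lra).
  have [y Hy] := nested_limit (fun n => snd (f n)) (fun n => M / 2 ^ n) ltac:(move=> n; have [_ [_ K]] := Hf n; exact K) ltac:(move=> n; exact: h2) ltac:(rewrite /M /= Rdiv_1_r; lra).
  have B : forall n, a <= fst (f n) /\ fst (f n) + L / 2 ^ n <= b /\ c <= snd (f n) /\ snd (f n) + M / 2 ^ n <= d.
  { elim=> [|n IH].
    - rewrite f0 /= /L /M !Rdiv_1_r. lra.
    - have [_ [K1 K2]] := Hf n. have E1 := h2 n L. have E2 := h2 n M. lra. }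
  have x0 := Hx O. have y0 := Hy O. have B0 := B O.
  have [e [He K]] := Hl x y ltac:(lra) ltac:(lra).
  have [n1 N1] := pow_half_small L e He. have [n2 N2] := pow_half_small M e He.
  have dec : forall X k m, 0 <= X -> X / 2 ^ (k + m) <= X / 2 ^ m.
  { move=> X k m HX. elim: k => [|k IH]; first by apply: Rle_refl.
    have := h2 (k + m)%nat X. have : 0 <= X / 2 ^ S (k + m). { apply: Rmult_le_pos => //. apply: Rlt_le; apply: Rinv_0_lt_compat; apply: pow_lt; lra. }
    rewrite -plus_Sn_m in IH *. lra. }
  have [Hn _] := Hf (n1 + n2)%nat. apply: Hn.
  have := B (n1 + n2)%nat. have := Hx (n1 + n2)%nat. have := Hy (n1 + n2)%nat.
  have := dec M n1 n2 ltac:(rewrite /M; lra).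
  have := dec L n2 n1 ltac:(rewrite /L; lra). rewrite (Nat.add_comm n2 n1) => *.
  apply: K; lra.
Qed.

(** The integral of [f z dz] along the boundary of [[a, b] x [c, d]], counterclockwise; [Ci] comes
    from [dz = i dy] on the vertical sides. *)
Definition bd (f : C -> C) (a b c d : R) : C :=
  (CI (fun x => f (x, c)) a b + Ci * CI (fun y => f (b, y)) c d
   - CI (fun x => f (x, d)) a b - Ci * CI (fun y => f (a, y)) c d)%C.

Definition contrect (f : C -> C) a b c d :=
  forall x y, a <= x <= b -> c <= y <= d -> ccont f (x, y).

Lemma rcont_horiz (f : C -> C) x y : ccont f (x, y) -> rcont (fun t => f (t, y)) x.
Proof. move=> H. apply: (rcont_comp f (fun t => (t, y))) => //. apply: rcont_pair; [exact: continuous_id|exact: continuous_const]. Qed.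

Lemma rcont_vert (f : C -> C) x y : ccont f (x, y) -> rcont (fun t => f (x, t)) y.
Proof. move=> H. apply: (rcont_comp f (fun t => (x, t))) => //. apply: rcont_pair; [exact: continuous_const|exact: continuous_id]. Qed.

Lemma ex_horiz f a b c d x x' y : contrect f a b c d -> a <= x -> x <= x' -> x' <= b -> c <= y <= d -> exCI (fun t => f (t, y)) x x'.
Proof. move=> H h1 h2 h3 h4. apply: exCI_cont => // t Ht. apply: rcont_horiz. apply: H; lra. Qed.

Lemma ex_vert f a b c d x y y' : contrect f a b c d -> c <= y -> y <= y' -> y' <= d -> a <= x <= b -> exCI (fun t => f (x, t)) y y'.
Proof. move=> H h1 h2 h3 h4. apply: exCI_cont => // t Ht. apply: rcont_vert. apply: H; lra. Qed.

Lemma bd_split_x f a m b c d : contrect f a b c d -> a <= m <= b -> c <= d -> bd f a b c d = (bd f a m c d + bd f m b c d)%C.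
Proof.
  move=> H Hm Hcd. rewrite /bd.
  rewrite (CI_Chasles (fun x => f (x, c)) a m b); try (apply: ex_horiz H _ _ _ _; lra).
  rewrite (CI_Chasles (fun x => f (x, d)) a m b); try (apply: ex_horiz H _ _ _ _; lra).
  ring.
Qed.

Lemma bd_split_y f a b c m d : contrect f a b c d -> c <= m <= d -> a <= b -> bd f a b c d = (bd f a b c m + bd f a b m d)%C.
Proof.
  move=> H Hm Hcd. rewrite /bd.
  rewrite (CI_Chasles (fun y => f (a, y)) c m d); try (apply: ex_vert H _ _ _ _; lra).
  rewrite (CI_Chasles (fun y => f (b, y)) c m d); try (apply: ex_vert H _ _ _ _; lra).
  ring.
Qed.

Lemma bd_norm f a b c d K : a <= b -> c <= d -> contrect f a b c d ->
  (forall x y, a <= x <= b -> c <= y <= d -> Cmod (f (x, y)) <= K) -> Cmod (bd f a b c d) <= 2 * K * ((b - a) + (d - c)).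
Proof.
  move=> Hab Hcd H HK.
  have h1 : Cmod (CI (fun x => f (x, c)) a b) <= K * (b - a).
  { apply: CI_norm => //; [apply: (ex_horiz _ _ _ _ _ _ _ _ H)|move=> x Hx; apply: HK]; lra. }
  have h2 : Cmod (CI (fun x => f (x, d)) a b) <= K * (b - a).
  { apply: CI_norm => //; [apply: (ex_horiz _ _ _ _ _ _ _ _ H)|move=> x Hx; apply: HK]; lra. }
  have h3 : Cmod (CI (fun y => f (a, y)) c d) <= K * (d - c).
  { apply: CI_norm => //; [apply: (ex_vert _ _ _ _ _ _ _ _ H)|move=> x Hx; apply: HK]; lra. }
  have h4 : Cmod (CI (fun y => f (b, y)) c d) <= K * (d - c).
  { apply: CI_norm => //; [apply: (ex_vert _ _ _ _ _ _ _ _ H)|move=> x Hx; apply: HK]; lra. }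
  rewrite /bd.
  apply: Rle_trans (Cmod_triangle_minus _ _) _.
  apply: Rle_trans (Rplus_le_compat_r _ _ _ (Cmod_triangle_minus _ _)) _.
  apply: Rle_trans (Rplus_le_compat_r _ _ _ (Rplus_le_compat_r _ _ _ (Cmod_triangle _ _))) _.
  rewrite !Cmod_mult Cmod_Ci. lra.
Qed.

Lemma CI_affine (p q : C) a b : a <= b -> CI (fun x => p + q * RtoC x)%C a b = (p * RtoC (b - a) + q * RtoC ((b * b - a * a) / 2))%C.
Proof.
  move=> Hab.
  have -> : (p * RtoC (b - a) + q * RtoC ((b * b - a * a) / 2))%C
    = ((p * RtoC b + q * RtoC (b * b / 2)) - (p * RtoC a + q * RtoC (a * a / 2)))%C.
  { apply: C_ext; rewrite /=; field. }
  apply: (CI_FTC (fun x => p * RtoC x + q * RtoC (x * x / 2))%C) => //.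
  - move=> x _.
    have -> : (p + q * RtoC x = p * 1 + q * RtoC x)%C by ring.
    apply: rderiv_plus; apply: rderiv_scal. exact: rderiv_id.
    apply: (rderiv_RtoC (fun y => y * y / 2)). auto_derive => //. field.
  - move=> x _. rcont_tac.
Qed.

Lemma bd_affine (f : C -> C) (p q : C) a b c d : a <= b -> c <= d -> (forall z, f z = p + q * z)%C -> bd f a b c d = 0%C.
Proof.
  move=> Hab Hcd E. rewrite /bd.
  have Hh : forall y, CI (fun x => f (x, y)) a b = ((p + q * (Ci * RtoC y)) * RtoC (b - a) + q * RtoC ((b * b - a * a) / 2))%C.
  { move=> y. rewrite -CI_affine //. apply: CI_ext_all => x. rewrite E. apply: C_ext; rewrite /=; ring. }
  have Hv : forall x, CI (fun y => f (x, y)) c d = ((p + q * RtoC x) * RtoC (d - c) + (q * Ci) * RtoC ((d * d - c * c) / 2))%C.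
  { move=> x. rewrite -CI_affine //. apply: CI_ext_all => y. rewrite E. apply: C_ext; rewrite /=; ring. }
  rewrite !Hh !Hv. apply: C_ext; rewrite /=; field.
Qed.

Lemma bd_minus f g a b c d : a <= b -> c <= d -> contrect f a b c d -> contrect g a b c d ->
  bd (fun w => f w - g w)%C a b c d = (bd f a b c d - bd g a b c d)%C.
Proof.
  move=> Hab Hcd Hf Hg. rewrite /bd.
  rewrite (CI_minus (fun x => f (x, c)) (fun x => g (x, c)) a b);
    [|apply: (ex_horiz _ _ _ _ _ _ _ _ Hf); lra|apply: (ex_horiz _ _ _ _ _ _ _ _ Hg); lra].
  rewrite (CI_minus (fun x => f (x, d)) (fun x => g (x, d)) a b);
    [|apply: (ex_horiz _ _ _ _ _ _ _ _ Hf); lra|apply: (ex_horiz _ _ _ _ _ _ _ _ Hg); lra].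
  rewrite (CI_minus (fun y => f (a, y)) (fun y => g (a, y)) c d);
    [|apply: (ex_vert _ _ _ _ _ _ _ _ Hf); lra|apply: (ex_vert _ _ _ _ _ _ _ _ Hg); lra].
  rewrite (CI_minus (fun y => f (b, y)) (fun y => g (b, y)) c d);
    [|apply: (ex_vert _ _ _ _ _ _ _ _ Hf); lra|apply: (ex_vert _ _ _ _ _ _ _ _ Hg); lra].
  ring.
Qed.

(** Near a point of differentiability [f] differs from its tangent map by at most [e / 2] times the
    distance, and affine maps integrate to 0, so the boundary integral is at most [e] times the
    square of the half perimeter. Halving both sides divides this bound by exactly four, so it
    survives reassembly in [cousin_rect]. *)
Lemma goursat (f : C -> C) a b c d : a <= b -> c <= d ->
  (forall x y, a <= x <= b -> c <= y <= d -> cdiff f (x, y)) -> bd f a b c d = 0%C.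
Proof.
  move=> Hab Hcd H.
  have Hc : forall a' b' c' d', a <= a' -> b' <= b -> c <= c' -> d' <= d -> contrect f a' b' c' d'.
  { move=> a' b' c' d' *. move=> x y Hx Hy. apply: cdiff_ccont. apply: H; lra. }
  set T := (b - a) + (d - c).
  suff K : forall e, 0 < e -> Cmod (bd f a b c d) <= e * (T * T).
  { apply: Cmod_le_0. apply: Rnot_lt_le => h.
    have TT : 0 <= T * T by nra.
    have := K (Cmod (bd f a b c d) / (2 * (T * T + 1))) ltac:(apply: Rdiv_lt_0_compat; lra).
    set X := Cmod (bd f a b c d) in h *.
    have : X / (2 * (T * T + 1)) * (T * T) < X.
    { have -> : X / (2 * (T * T + 1)) * (T * T) = X * (T * T / (2 * (T * T + 1))) by field; lra.
      have : T * T / (2 * (T * T + 1)) < 1.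
      { apply: (Rmult_lt_reg_r (2 * (T * T + 1))); first lra.
        have -> : T * T / (2 * (T * T + 1)) * (2 * (T * T + 1)) = T * T by field; lra. lra. }
      nra. }
    lra. }
  move=> e He.
  have := cousin_rect (fun a' b' c' d' => a <= a' <= b' -> b' <= b -> c <= c' <= d' -> d' <= d ->
     Cmod (bd f a' b' c' d') <= e * ((b' - a' + (d' - c')) * (b' - a' + (d' - c')))) a b c d Hab Hcd.
  apply; try lra.
  - move=> a1 m b1 c1 n d1 Em En P1 P2 P3 P4 h1 h2 h3 h4.
    rewrite (bd_split_x f a1 m b1 c1 d1); [|apply: Hc; lra|lra|lra].
    rewrite (bd_split_y f a1 m c1 n d1); [|apply: Hc; lra|lra|lra].
    rewrite (bd_split_y f m b1 c1 n d1); [|apply: Hc; lra|lra|lra].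
    apply: Rle_trans (Cmod_triangle _ _) _.
    have t1 := Cmod_triangle (bd f a1 m c1 n) (bd f a1 m n d1).
    have t2 := Cmod_triangle (bd f m b1 c1 n) (bd f m b1 n d1).
    have {}P1 := P1 ltac:(lra) ltac:(lra) ltac:(lra) ltac:(lra).
    have {}P2 := P2 ltac:(lra) ltac:(lra) ltac:(lra) ltac:(lra).
    have {}P3 := P3 ltac:(lra) ltac:(lra) ltac:(lra) ltac:(lra).
    have {}P4 := P4 ltac:(lra) ltac:(lra) ltac:(lra) ltac:(lra).
    have Q : forall u v, u = (b1 - a1) / 2 -> v = (d1 - c1) / 2 -> e * ((u + v) * (u + v)) = e * ((b1 - a1 + (d1 - c1)) * (b1 - a1 + (d1 - c1))) / 4.
    { move=> u v -> ->. field. }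
    rewrite Q in P1; [|lra|lra]. rewrite Q in P2; [|lra|lra]. rewrite Q in P3; [|lra|lra]. rewrite Q in P4; [|lra|lra].
    lra.
  - move=> x y Hx Hy.
    have [l Hl] := proj1 (cdiff_cderiv _ _) (H x y Hx Hy).
    have [dl [Hdl Hd]] := Hl (e / 2) ltac:(lra).
    exists (dl / 2). split; first lra.
    move=> a' b' c' d' h1 h2 h3 h4 s1 s2 _ _ _ _.
    set p := (f (x, y) - l * (x, y))%C.
    have E : bd f a' b' c' d' = bd (fun w => f w - (p + l * w))%C a' b' c' d'.
    { have A := bd_affine (fun w => p + l * w)%C p l a' b' c' d' ltac:(lra) ltac:(lra) ltac:(done).
      have Z : bd (fun w => f w - (p + l * w))%C a' b' c' d' = (bd f a' b' c' d' - bd (fun w => p + l * w)%C a' b' c' d')%C.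
      { have Hf := Hc a' b' c' d' ltac:(lra) ltac:(lra) ltac:(lra) ltac:(lra).
        have Ha : contrect (fun w => p + l * w)%C a' b' c' d'.
        { move=> ? ? ? ?. apply: cdiff_ccont. cdiff_tac. }
        apply: bd_minus; [lra|lra|exact: Hf|exact: Ha]. }
      rewrite Z A. ring. }
    rewrite E. set U := (b' - a') + (d' - c').
    have U0 : 0 <= U by rewrite /U; lra.
    have -> : e * (U * U) = 2 * (e / 2 * U) * U by field.
    apply: bd_norm; try lra.
    + move=> x' y' Hx' Hy'. apply: cdiff_ccont. apply: cdiff_minus; last by cdiff_tac. apply: H; lra.
    + move=> x' y' Hx' Hy'.
      have W : Cmod ((x', y') - (x, y))%C <= U.
      { apply: Rle_trans (Cmod_le_sum _) _. rewrite /= /U.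
        have : Rabs (x' + - x) <= b' - a' by apply: Rabs_le; lra.
        have : Rabs (y' + - y) <= d' - c' by apply: Rabs_le; lra. lra. }
      have := Hd (x', y') ltac:(rewrite /U in W; lra).
      have -> : (f (x', y') - (p + l * (x', y')) = f (x', y') - f (x, y) - l * ((x', y') - (x, y)))%C by rewrite /p; ring.
      move=> K. apply: Rle_trans K _. apply: Rmult_le_compat_l; lra.
Qed.

Lemma bd_degenerate_x f a c d : bd f a a c d = 0%C.
Proof. rewrite /bd !CI_point. ring. Qed.

Lemma bd_degenerate_y f a b c : bd f a b c c = 0%C.
Proof. rewrite /bd !CI_point. ring. Qed.

(** The point [z0] is boxed in a rectangle of side at most [2 n] on which [f] is bounded by
    continuity; the four rectangles around the box contribute 0 and the box contributes [O(n)]. *)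
Lemma goursat_punctured (f : C -> C) (z0 : C) a b c d : a <= b -> c <= d -> contrect f a b c d ->
  (forall x y, a <= x <= b -> c <= y <= d -> (x, y) <> z0 -> cdiff f (x, y)) -> bd f a b c d = 0%C.
Proof.
  move=> Hab Hcd Hc H.
  case: (classic (a <= Re z0 <= b /\ c <= Im z0 <= d)) => [[Hx Hy]|Hn]; last first.
  { apply: goursat => // x y hx hy. apply: H => // E. apply: Hn. by rewrite -E. }
  case: z0 H Hx Hy => x0 y0 H /= Hx Hy.
  have [dl [Hdl B]] := Hc x0 y0 Hx Hy 1 Rlt_0_1.
  set K := Cmod (f (x0, y0)) + 1.
  have K0 : 0 < K by rewrite /K; have := Cmod_ge_0 (f (x0, y0)); lra.
  apply: Cmod_le_0. apply: Rnot_lt_le => h.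
  set X := Cmod (bd f a b c d) in h.
  (* [n] keeps the box inside the disc where [|f| <= K] and makes its contribution, at most [8 K n],
     no more than [X / 2]. *)
  set n := Rmin (dl / 4) (X / (16 * K)).
  have Xp : 0 < X / (16 * K) by apply: Rdiv_lt_0_compat; lra.
  have n0 : 0 < n by rewrite /n; apply: Rmin_glb_lt; lra.
  have n1 : n <= dl / 4 by exact: Rmin_l. have n2 : n <= X / (16 * K) by exact: Rmin_r.
  set x1 := Rmax a (x0 - n). set x2 := Rmin b (x0 + n). set y1 := Rmax c (y0 - n). set y2 := Rmin d (y0 + n).
  have hx1 : a <= x1 <= x0 by rewrite /x1 /Rmax; case: Rle_dec; lra.
  have hx2 : x0 <= x2 <= b by rewrite /x2 /Rmin; case: Rle_dec; lra.
  have hy1 : c <= y1 <= y0 by rewrite /y1 /Rmax; case: Rle_dec; lra.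
  have hy2 : y0 <= y2 <= d by rewrite /y2 /Rmin; case: Rle_dec; lra.
  have hx1' : x0 - n <= x1 /\ (a = x1 \/ x1 < x0) by rewrite /x1 /Rmax; case: Rle_dec; lra.
  have hx2' : x2 <= x0 + n /\ (x2 = b \/ x0 < x2) by rewrite /x2 /Rmin; case: Rle_dec; lra.
  have hy1' : y0 - n <= y1 /\ (c = y1 \/ y1 < y0) by rewrite /y1 /Rmax; case: Rle_dec; lra.
  have hy2' : y2 <= y0 + n /\ (y2 = d \/ y0 < y2) by rewrite /y2 /Rmin; case: Rle_dec; lra.
  have Hs : forall a' b' c' d', a <= a' -> b' <= b -> c <= c' -> d' <= d -> contrect f a' b' c' d'.
  { move=> a' b' c' d' q1 q2 q3 q4 x y Hx' Hy'. apply: Hc; lra. }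
  (* Each of the four outer pieces is either degenerate, when [z0] is within [n] of that side of the
     rectangle, or strictly separated from [z0]. *)
  have Z1 : bd f a x1 c d = 0%C.
  { case: (proj2 hx1') => [<-|q]; first exact: bd_degenerate_x.
    apply: goursat; try lra. move=> x y q1 q2. apply: H; try lra. move=> []. lra. }
  have Z2 : bd f x2 b c d = 0%C.
  { case: (proj2 hx2') => [->|q]; first exact: bd_degenerate_x.
    apply: goursat; try lra. move=> x y q1 q2. apply: H; try lra. move=> []. lra. }
  have Z3 : bd f x1 x2 c y1 = 0%C.
  { case: (proj2 hy1') => [<-|q]; first exact: bd_degenerate_y.
    apply: goursat; try lra. move=> x y q1 q2. apply: H; try lra. move=> []. lra. }
  have Z4 : bd f x1 x2 y2 d = 0%C.
  { case: (proj2 hy2') => [->|q]; first exact: bd_degenerate_y.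
    apply: goursat; try lra. move=> x y q1 q2. apply: H; try lra. move=> []. lra. }
  have E : bd f a b c d = bd f x1 x2 y1 y2.
  { rewrite (bd_split_x f a x1 b c d) ?Z1; try lra; last by apply: Hs; lra.
    rewrite (bd_split_x f x1 x2 b c d) ?Z2; try lra; last by apply: Hs; lra.
    rewrite (bd_split_y f x1 x2 c y1 d) ?Z3; try lra; last by apply: Hs; lra.
    rewrite (bd_split_y f x1 x2 y1 y2 d) ?Z4; try lra; last by apply: Hs; lra.
    ring. }
  have := bd_norm f x1 x2 y1 y2 K ltac:(lra) ltac:(lra) ltac:(apply: Hs; lra).
  rewrite -E -/X => L.
  have {}L : X <= 2 * K * (x2 - x1 + (y2 - y1)).
  { apply: L => x y q1 q2.
    have W : Cmod ((x, y) - (x0, y0))%C < dl.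
    { apply: Rle_lt_trans (Cmod_le_sum _) _. rewrite /=.
      have : Rabs (x + - x0) <= n by apply: Rabs_le; lra.
      have : Rabs (y + - y0) <= n by apply: Rabs_le; lra. lra. }
    have := B _ W. have := Cmod_triangle_rev_minus (f (x, y)) (f (x0, y0)). rewrite /K. lra. }
  have : 2 * K * (x2 - x1 + (y2 - y1)) <= 2 * K * (4 * n) by apply: Rmult_le_compat_l; lra.
  have : K * n <= X / 16.
  { have -> : X / 16 = K * (X / (16 * K)) by field; lra. apply: Rmult_le_compat_l; lra. }
  lra.
Qed.

(** * Circle averages and Cauchy's integral formula *)

Definition circ (c : C) (r t : R) : C := (c + RtoC r * Cexp (Ci * t))%C.

(** The measure is [dt], not [dz]: this is the contour integral of [g z / (z - c)] divided by [i].
    Hence the extra factor [w - c] in Cauchy's formula below. *)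
Definition circ_int (g : C -> C) (c : C) (r : R) : C := CI (fun t => g (circ c r t)) 0 (2 * PI).

Lemma Cmod_circ_minus c r t : 0 <= r -> Cmod (circ c r t - c)%C = r.
Proof.
  move=> Hr. have -> : (circ c r t - c = RtoC r * Cexp (Ci * t))%C by rewrite /circ; ring.
  rewrite Cmod_mult Cmod_R Cmod_Cexp /= Rabs_pos_eq //.
  have -> : 0 * t - 1 * 0 = 0 by ring. rewrite exp_0. ring.
Qed.

Lemma rcont_circ c r t : rcont (fun t => circ c r t) t.
Proof. rewrite /circ. rcont_tac. Qed.

Lemma circ_exp c x y : (c + Cexp (x, y))%C = circ c (exp x) y.
Proof. rewrite /circ Cexp_eq Cexp_Ci. apply: C_ext; rewrite /=; ring. Qed.

Lemma rcont_on_circ (g : C -> C) c r t : ccont g (circ c r t) -> rcont (fun t => g (circ c r t)) t.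
Proof. move=> H. apply: (rcont_comp g (fun t => circ c r t)) => //. exact: rcont_circ. Qed.

Lemma ccont_comp (f g : C -> C) (z : C) : ccont f (g z) -> ccont g z -> ccont (fun w => f (g w)) z.
Proof.
  move=> Hf Hg e He. have [d [Hd H1]] := Hf e He. have [d' [Hd' H2]] := Hg d Hd.
  exists d'. split => // w Hw. apply: H1. exact: H2.
Qed.

(** Under [w -> c + Cexp w] the annulus becomes the rectangle [[ln r1, ln r2] x [0, 2 pi]]; its
    horizontal sides cancel by periodicity and its vertical sides are the two circle averages. One
    exceptional point [z0] is allowed because difference quotients are to be inserted for [g]. *)
Lemma circ_int_const (g : C -> C) (c z0 : C) r1 r2 : 0 < r1 -> r1 <= r2 ->
  (forall z, r1 <= Cmod (z - c)%C <= r2 -> ccont g z) ->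
  (forall z, r1 <= Cmod (z - c)%C <= r2 -> z <> z0 -> cdiff g z) ->
  circ_int g c r1 = circ_int g c r2.
Proof.
  move=> H1 H12 Hc Hd.
  set G := fun w => g (c + Cexp w)%C.
  have Hl : ln r1 <= ln r2 by apply: ln_le.
  have Hm : forall x y, ln r1 <= x <= ln r2 -> r1 <= Cmod (c + Cexp (x, y) - c)%C <= r2.
  { move=> x y Hx. have -> : (c + Cexp (x, y) - c = Cexp (x, y))%C by ring. rewrite Cmod_Cexp /=.
    have e1 : exp (ln r1) = r1 by apply: exp_ln. have e2 : exp (ln r2) = r2 by apply: exp_ln; lra.
    rewrite -{1}e1 -e2. split.
    - case: (Rle_lt_or_eq_dec _ _ (proj1 Hx)) => [q|<-]; [apply: Rlt_le; exact: exp_increasing|lra].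
    - case: (Rle_lt_or_eq_dec _ _ (proj2 Hx)) => [q|->]; [apply: Rlt_le; exact: exp_increasing|lra]. }
  have P0 := PI_RGT_0.
  have Hcr : forall c1 d1, contrect G (ln r1) (ln r2) c1 d1.
  { move=> c1 d1 x y Hx Hy. apply: (ccont_comp g (fun w => c + Cexp w)%C). apply: Hc. exact: Hm.
    apply: cdiff_ccont. cdiff_tac. }
  (* A height of at most [PI] ensures that the rectangle contains at most one logarithm [w0] of
     [z0 - c]. *)
  have Hb : forall c1 d1, c1 <= d1 -> d1 - c1 <= PI -> bd G (ln r1) (ln r2) c1 d1 = 0%C.
  { move=> c1 d1 Hcd HP.
    case: (classic (exists w0 : C, (c + Cexp w0 = z0)%C /\ c1 <= Im w0 <= d1)) => [[w0 [ml_rest I0]]|Hn].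
    - apply: (goursat_punctured G w0) => // x y Hx Hy Hne.
      apply: (cdiff_comp g (fun w => c + Cexp w)%C); last by cdiff_tac.
      apply: Hd; first exact: Hm.
      move=> E. apply: Hne. apply: Cexp_inj_strip; first by rewrite /=; lra.
      have -> : Cexp (x, y) = (c + Cexp (x, y) - c)%C by ring. rewrite E -ml_rest. ring.
    - apply: goursat => // x y Hx Hy.
      apply: (cdiff_comp g (fun w => c + Cexp w)%C); last by cdiff_tac.
      apply: Hd; first exact: Hm.
      move=> E. apply: Hn. by exists (x, y). }
  have E : bd G (ln r1) (ln r2) 0 (2 * PI) = 0%C.
  { rewrite (bd_split_y G (ln r1) (ln r2) 0 PI (2 * PI)); try lra; last exact: Hcr.
    rewrite !Hb; try lra. ring. }
  have V : forall r, 0 < r -> CI (fun y => G (ln r, y)) 0 (2 * PI) = circ_int g c r.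
  { move=> r Hr. apply: CI_ext_all => y. by rewrite /G circ_exp exp_ln. }
  have U : CI (fun x => G (x, 2 * PI)) (ln r1) (ln r2) = CI (fun x => G (x, 0)) (ln r1) (ln r2).
  { apply: CI_ext_all => x. rewrite /G !Cexp_eq /= cos_2PI sin_2PI cos_0 sin_0. done. }
  move: E. rewrite /bd U !V; try lra. move=> E.
  have E2 : (Ci * (circ_int g c r2 - circ_int g c r1) = 0)%C by rewrite -E; ring.
  case: (Cmult_eq_0 _ _ E2) => [/Ci_neq0 //|]. by move/Cminus_eq_0.
Qed.

Lemma circ_int_norm (g : C -> C) c r K : (forall t, rcont (fun t => g (circ c r t)) t) ->
  (forall t, 0 <= t <= 2 * PI -> Cmod (g (circ c r t)) <= K) -> Cmod (circ_int g c r) <= 2 * PI * K.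
Proof.
  move=> Hc H. have -> : 2 * PI * K = K * (2 * PI - 0) by ring. apply: CI_norm.
  have := PI_RGT_0; lra. exact: exCI_cont_all. by [].
Qed.

Lemma circ_avoid c r t z : 0 <= r -> Cmod (z - c)%C < r -> r - Cmod (z - c)%C <= Cmod (circ c r t - z)%C.
Proof.
  move=> Hr H. have := Cmod_triangle3 (circ c r t) c z. rewrite Cmod_circ_minus //.
  lra.
Qed.

Lemma circ_neq c r t z : 0 <= r -> Cmod (z - c)%C < r -> (circ c r t - z <> 0)%C.
Proof. move=> Hr H. apply: Cmod_pos_neq0. have := circ_avoid c r t z Hr H. lra. Qed.

(** The average does not depend on the radius, and the kernel tends to 1 as the radius grows. *)
Lemma circ_int_kernel (c z : C) r : Cmod (z - c)%C < r ->
  circ_int (fun w => (w - c) / (w - z))%C c r = RtoC (2 * PI).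
Proof.
  move=> Hz. have z0 := Cmod_ge_0 (z - c)%C. have P0 := PI_RGT_0.
  apply: C_eq_small => e He.
  set m := Cmod (z - c)%C in Hz z0.
  (* On the circle of radius [r'] the kernel differs from 1 by at most [m / (r' - m)], and [r' - m]
     is at least [2 PI m / e]. *)
  set r' := r + 2 * PI * m / e.
  have Hr' : r <= r'.
  { rewrite /r'. have : 0 <= 2 * PI * m / e; last lra. apply: Rmult_le_pos; first nra. apply: Rlt_le; exact: Rinv_0_lt_compat. }
  have neq : forall rho t, r <= rho -> (circ c rho t - z <> 0)%C.
  { move=> rho t Hrho. apply: circ_neq; rewrite -/m; lra. }
  rewrite (circ_int_const _ c z r r'); try lra.
  - have rc : forall t, rcont (fun t => (circ c r' t - c) / (circ c r' t - z))%C t.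
    { move=> t. rcont_tac; try exact: rcont_circ. exact: neq. }
    have -> : (circ_int (fun w => (w - c) / (w - z)) c r' - RtoC (2 * PI))%C
      = circ_int (fun w => (w - c) / (w - z) - 1)%C c r'.
    { rewrite /circ_int (CI_minus _ (fun _ => 1%C)). rewrite CI_const Rminus_0_r. ring.
      exact: exCI_cont_all. apply: exCI_cont_all => t. rcont_tac. }
    have -> : e = 2 * PI * (e / (2 * PI)) by field; lra.
    apply: circ_int_norm.
    + move=> t. apply: rcont_minus; [exact: rc|exact: rcont_const].
    + move=> t _. have N := neq r' t Hr'.
      have -> : ((circ c r' t - c) / (circ c r' t - z) - 1 = (z - c) / (circ c r' t - z))%C by field.
      rewrite Cmod_div // -/m.
      have A := circ_avoid c r' t z ltac:(lra) ltac:(rewrite -/m; lra). rewrite -/m in A.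
      have B : 2 * PI * m / e <= r' - m by rewrite /r'; lra.
      set D := Cmod _ in A *. have D0 : 0 < D by lra.
      apply: (Rmult_le_reg_r D) => //. have -> : m / D * D = m by field; lra.
      have -> : m = e / (2 * PI) * (2 * PI * m / e) by field; split; lra.
      apply: Rmult_le_compat_l; last lra. apply: Rlt_le; apply: Rdiv_lt_0_compat; lra.
  - move=> w Hw. apply: cdiff_ccont. cdiff_tac. move=> E.
    have Ew : w = z by exact: Cminus_eq_0. move: Hw. rewrite Ew -/m. lra.
  - move=> w Hw _. cdiff_tac. move=> E.
    have Ew : w = z by exact: Cminus_eq_0. move: Hw. rewrite Ew -/m. lra.
Qed.

Definition slope (f : C -> C) (z0 l : C) (z : C) : C :=
  match excluded_middle_informative (z = z0) with left _ => l | right _ => ((f z - f z0) / (z - z0))%C end.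

Lemma slope_neq f z0 l z : z <> z0 -> slope f z0 l z = ((f z - f z0) / (z - z0))%C.
Proof. move=> H. by rewrite /slope; case: excluded_middle_informative. Qed.

Lemma slope_eq f z0 l : slope f z0 l z0 = l.
Proof. by rewrite /slope; case: excluded_middle_informative. Qed.

Lemma slope_mult f z0 l z : (f z = f z0 + (z - z0) * slope f z0 l z)%C.
Proof.
  case: (classic (z = z0)) => [->|H]; first by ring.
  rewrite slope_neq //. have := Cminus_neq_0 _ _ H. move=> h. field. exact: h.
Qed.

Lemma slope_ccont f z0 l : cderiv f z0 l -> ccont (slope f z0 l) z0.
Proof.
  move=> H e He. have [d [Hd K]] := H (e / 2) ltac:(lra).
  exists d. split => // w Hw. rewrite slope_eq.
  case: (classic (w = z0)) => [->|N].
  { rewrite slope_eq. have -> : (l - l = 0)%C by ring. by rewrite Cmod_0. }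
  rewrite slope_neq //. have N' := Cminus_neq_0 _ _ N.
  have -> : ((f w - f z0) / (w - z0) - l = (f w - f z0 - l * (w - z0)) / (w - z0))%C by field.
  rewrite Cmod_div //. have := K w Hw. have := Cmod_minus_gt0 _ _ N.
  set D := Cmod (w - z0)%C. set X := Cmod _ => D0 HX.
  apply: (Rmult_lt_reg_r D) => //. have -> : X / D * D = X by field; lra. nra.
Qed.

Lemma slope_cdiff_off f z0 l z : z <> z0 -> cdiff f z -> cdiff (slope f z0 l) z.
Proof.
  move=> N H. apply: (cdiff_ext_loc (fun w => (f w - f z0) / (w - z0))%C _ z (Cmod (z - z0)%C)).
  - exact: Cmod_minus_gt0.
  - move=> w Hw. rewrite slope_neq // => E. move: Hw. rewrite E Cmod_minus_sym. lra.
  - cdiff_tac. exact: Cminus_neq_0.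
Qed.

(** The difference quotient [q] at [z] is continuous, and differentiable off [z], so the average of
    [q w * (w - c)] is independent of the radius; it tends to 0 with the radius, hence vanishes.
    Expanding [q] leaves [f z] times the kernel average. *)
Lemma cauchy_formula (f : C -> C) (c z : C) r : Cmod (z - c)%C < r ->
  (forall w, Cmod (w - c)%C <= r -> cdiff f w) ->
  (RtoC (2 * PI) * f z)%C = circ_int (fun w => f w * (w - c) / (w - z))%C c r.
Proof.
  move=> Hz H. have z0 := Cmod_ge_0 (z - c)%C. have r0 : 0 < r by lra. have P0 := PI_RGT_0.
  have [l Hl] := proj1 (cdiff_cderiv _ _) (H z ltac:(lra)).
  set q := slope f z l.
  have qc : forall w, Cmod (w - c)%C <= r -> ccont q w.
  { move=> w Hw. case: (classic (w = z)) => [->|N]; first exact: slope_ccont.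
    apply: cdiff_ccont. apply: slope_cdiff_off => //. exact: H. }
  have gc : forall w, Cmod (w - c)%C <= r -> forall rho t, w = circ c rho t -> rcont (fun t => (fun w => q w * (w - c))%C (circ c rho t)) t.
  { move=> w Hw rho t E. apply: rcont_mult.
    - apply: rcont_on_circ. rewrite -E. exact: qc.
    - apply: rcont_minus; [exact: rcont_circ|exact: rcont_const]. }
  have Z : circ_int (fun w => q w * (w - c))%C c r = 0%C.
  { apply: C_eq_small => e He.
    have -> : (circ_int (fun w => q w * (w - c)) c r - 0 = circ_int (fun w => q w * (w - c)) c r)%C by ring.
    have [d [Hd B]] := qc c ltac:(rewrite Cmod_self; lra) 1 Rlt_0_1.
    set K := Cmod (q c) + 1. have K0 := Cmod_ge_0 (q c).
    set rho := Rmin r (Rmin (d / 2) (e / (2 * PI * K))).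
    have rp : 0 < rho. { rewrite /rho. repeat apply: Rmin_glb_lt; try lra. apply: Rdiv_lt_0_compat => //. rewrite /K; nra. }
    have r1 : rho <= r by exact: Rmin_l.
    have r2 : rho <= d / 2 by apply: Rle_trans (Rmin_r _ _) (Rmin_l _ _).
    have r3 : rho <= e / (2 * PI * K) by apply: Rle_trans (Rmin_r _ _) (Rmin_r _ _).
    rewrite -(circ_int_const _ c z rho r) //.
    - apply: Rle_trans (circ_int_norm _ c rho (K * rho) _ _) _.
      + move=> t. apply: (gc (circ c rho t)) => //. rewrite Cmod_circ_minus; lra.
      + move=> t _. rewrite Cmod_mult Cmod_circ_minus; last lra.
        apply: Rmult_le_compat_r; first lra.
        have := B (circ c rho t) ltac:(rewrite Cmod_circ_minus; lra).
        have := Cmod_triangle_rev_minus (q (circ c rho t)) (q c). rewrite /K. lra.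
      + have : 2 * PI * K * rho <= 2 * PI * K * (e / (2 * PI * K)) by apply: Rmult_le_compat_l => //; rewrite /K; nra.
        have -> : 2 * PI * K * (e / (2 * PI * K)) = e by field; rewrite /K; split; lra. lra.
    - move=> w Hw. move=> e' He'.
      have C1 := qc w ltac:(lra).
      have [d1 [Hd1 D1]] := C1 (Rmin 1 (e' / (2 * (r + 1)))) ltac:(apply: Rmin_glb_lt; [lra|apply: Rdiv_lt_0_compat; lra]).
      have Q0 := Cmod_ge_0 (q w).
      exists (Rmin d1 (e' / (2 * (Cmod (q w) + 1)))). split.
      { apply: Rmin_glb_lt => //. apply: Rdiv_lt_0_compat; lra. }
      move=> v Hv. have v1 := Rlt_le_trans _ _ _ Hv (Rmin_l _ _). have v2 := Rlt_le_trans _ _ _ Hv (Rmin_r _ _).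
      have {}D1 := D1 v v1.
      have d2 := Rlt_le_trans _ _ _ D1 (Rmin_l _ _). have d3 := Rlt_le_trans _ _ _ D1 (Rmin_r _ _).
      have -> : (q v * (v - c) - q w * (w - c) = q v * (v - w) + (q v - q w) * (w - c))%C by ring.
      apply: Rle_lt_trans (Cmod_triangle _ _) _. rewrite !Cmod_mult.
      have qv : Cmod (q v) <= Cmod (q w) + 1 by have := Cmod_triangle_rev_minus (q v) (q w); lra.
      have p1 : Cmod (q v) * Cmod (v - w)%C <= (Cmod (q w) + 1) * Cmod (v - w)%C by apply: Rmult_le_compat_r => //; exact: Cmod_ge_0.
      have p2 : (Cmod (q w) + 1) * Cmod (v - w)%C < (Cmod (q w) + 1) * (e' / (2 * (Cmod (q w) + 1))) by apply: Rmult_lt_compat_l => //; lra.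
      have E1 : (Cmod (q w) + 1) * (e' / (2 * (Cmod (q w) + 1))) = e' / 2 by field; lra.
      have p3 : Cmod (q v - q w)%C * Cmod (w - c)%C <= e' / (2 * (r + 1)) * r by apply: Rmult_le_compat; try exact: Cmod_ge_0; lra.
      have E2 : e' / (2 * (r + 1)) * r <= e' / 2.
      { apply: (Rmult_le_reg_r (2 * (r + 1))); first lra. have -> : e' / (2 * (r + 1)) * r * (2 * (r + 1)) = e' * r by field; lra. nra. }
      lra.
    - move=> w Hw N. cdiff_tac. apply: slope_cdiff_off => //. apply: H. lra. }
  have rc1 : forall t, rcont (fun t => (fun w => f w * (w - c) / (w - z))%C (circ c r t)) t.
  { move=> t. have cc := rcont_circ c r t. rcont_tac.
    - apply: circ_neq; lra.
    - apply: rcont_on_circ. apply: cdiff_ccont. apply: H. rewrite Cmod_circ_minus; lra. }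
  have rc2 : forall t, rcont (fun t => (fun w => (w - c) / (w - z))%C (circ c r t)) t.
  { move=> t. have cc := rcont_circ c r t. rcont_tac. apply: circ_neq; lra. }
  rewrite -(circ_int_kernel c z r Hz) Cmult_comm.
  rewrite /circ_int -CI_scal; last exact: exCI_cont_all.
  apply: Cminus_eq_0. rewrite -CI_minus; try apply: exCI_cont_all => t; last first.
  - exact: rc1.
  - apply: rcont_mult; [exact: rcont_const|exact: rc2].
  transitivity (-(1) * circ_int (fun w => q w * (w - c)) c r)%C; last by rewrite Z; ring.
  rewrite /circ_int -CI_scal.
  - apply: CI_ext_all => t. have N := circ_neq c r t z ltac:(lra) Hz.
    rewrite /q slope_neq; last by move=> E; apply: N; rewrite E; ring. field. exact: N.
  - apply: exCI_cont_all => t. apply: (gc (circ c r t)) => //. rewrite Cmod_circ_minus; lra.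
Qed.

Definition Ccvg (u : nat -> C) (l : C) : Prop :=
  forall e, 0 < e -> exists N, forall n, (N <= n)%nat -> Cmod (u n - l)%C < e.

Lemma Ccauchy_cvg (u : nat -> C) :
  (forall e, 0 < e -> exists N, forall n m, (N <= n)%nat -> (N <= m)%nat -> Cmod (u n - u m)%C < e) ->
  exists l, Ccvg u l.
Proof.
  move=> H.
  have K : forall g : C -> R, (forall z w, Rabs (g z - g w) <= Cmod (z - w)%C) -> {l | Un_cv (fun n => g (u n)) l}.
  { move=> g Hg. apply: (Rcomplete.R_complete (fun n => g (u n))) => e He. have [N HN] := H e He. exists N => n m Hn Hm.
    apply: Rle_lt_trans (Hg _ _) _. exact: HN. }
  have [a Ha] := K Re ltac:(move=> z w; exact: (Re_le_Cmod (z - w)%C)).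
  have [b Hb] := K Im ltac:(move=> z w; exact: (Im_le_Cmod (z - w)%C)).
  exists (a, b) => e He.
  have [N1 H1] := Ha (e / 2) ltac:(lra). have [N2 H2] := Hb (e / 2) ltac:(lra).
  exists (N1 + N2)%nat => n Hn. apply: Rle_lt_trans (Cmod_le_sum _) _.
  have := H1 n ltac:(lia). have := H2 n ltac:(lia). rewrite /Rdist /Rminus /Re /Im /=. lra.
Qed.

Lemma small_inv (r : R) : 0 < r -> forall e, 0 < e -> exists N, forall n, (N <= n)%nat -> r / (INR n + 2) < e.
Proof.
  move=> Hr e He. have [N HN] := INR_unbounded (r / e). exists N => n Hn.
  have hn : INR N <= INR n by apply: le_INR.
  have h0 : 0 < r / e by apply: Rdiv_lt_0_compat.
  apply: (Rmult_lt_reg_r (INR n + 2)); first lra.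
  have -> : r / (INR n + 2) * (INR n + 2) = r by field; lra.
  have -> : r = e * (r / e) by field; lra. apply: Rmult_lt_compat_l; lra.
Qed.

(** The quotients along [r / (n + 2)] form a Cauchy sequence, so a derivative exists without a
    candidate being named. Functions defined by integrals and series are handled this way, since the
    hypothesis passes through sums and integrals. *)
Lemma cdiff_of_slope_lipschitz (f : C -> C) (z : C) r K : 0 < r -> 0 <= K ->
  (forall h h', 0 < Cmod h < r -> 0 < Cmod h' < r ->
    Cmod ((f (z + h) - f z) / h - (f (z + h') - f z) / h')%C <= K * (Cmod h + Cmod h')) ->
  cdiff f z.
Proof.
  move=> Hr HK H.
  set hn := fun n => RtoC (r / (INR n + 2)).
  have hm : forall n, Cmod (hn n) = r / (INR n + 2).
  { move=> n. rewrite /hn Cmod_R Rabs_pos_eq //. have := pos_INR n => p. apply: Rlt_le; apply: Rdiv_lt_0_compat; lra. }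
  have hr : forall n, 0 < Cmod (hn n) < r.
  { move=> n. rewrite hm. have p := pos_INR n. split; first by apply: Rdiv_lt_0_compat; lra.
    apply: (Rmult_lt_reg_r (INR n + 2)); first lra. have -> : r / (INR n + 2) * (INR n + 2) = r by field; lra. nra. }
  set u := fun n => ((f (z + hn n) - f z) / hn n)%C.
  have [l Hl] : exists l, Ccvg u l.
  { apply: Ccauchy_cvg => e He.
    have [N HN] := small_inv r Hr (e / (2 * (K + 1))) ltac:(apply: Rdiv_lt_0_compat; lra).
    exists N => n m Hn Hm. apply: Rle_lt_trans (H _ _ (hr n) (hr m)) _.
    have := HN n Hn. have := HN m Hm. rewrite -!hm. move: (hr n) (hr m) => a b c d.
    have E : e = (K + 1) * (e / (2 * (K + 1)) + e / (2 * (K + 1))) by field; lra.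
    rewrite E. apply: Rle_lt_trans (Rmult_le_compat_r _ _ (K + 1) _ _) _; try lra.
    apply: Rmult_lt_compat_l; lra. }
  apply: (cderiv_cdiff _ _ l) => e He.
  exists (Rmin r (e / (4 * (K + 1)))). split.
  { apply: Rmin_glb_lt => //. apply: Rdiv_lt_0_compat; lra. }
  move=> w Hw. have w1 := Rlt_le_trans _ _ _ Hw (Rmin_l _ _). have w2 := Rlt_le_trans _ _ _ Hw (Rmin_r _ _).
  case: (classic (w = z)) => [->|N].
  { have -> : (f z - f z - l * (z - z) = 0)%C by ring. rewrite Cmod_0 Cmod_self. lra. }
  have D0 := Cmod_minus_gt0 _ _ N. have N' := Cminus_neq_0 _ _ N.
  set h := (w - z)%C in Hw w1 w2 D0 N' *.
  have Ew : w = (z + h)%C by rewrite /h; ring.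
  have [N1 HN1] := Hl (e / 4) ltac:(lra).
  have [N2 HN2] := small_inv r Hr (e / (4 * (K + 1))) ltac:(apply: Rdiv_lt_0_compat; lra).
  set n := (N1 + N2)%nat.
  have A1 := HN1 n ltac:(rewrite /n; lia). have A2 := HN2 n ltac:(rewrite /n; lia). rewrite -hm in A2.
  have A3 := H h (hn n) (conj D0 w1) (hr n). rewrite -/(u n) in A3.
  have A4 : K * (Cmod h + Cmod (hn n)) <= e / 2.
  { have -> : e / 2 = (K + 1) * (e / (4 * (K + 1)) + e / (4 * (K + 1))) by field; lra.
    have := hr n => p. apply: Rmult_le_compat; lra. }
  rewrite Ew.
  have -> : (f (z + h) - f z - l * h = h * (((f (z + h) - f z) / h - u n) + (u n - l)))%C by field.
  rewrite Cmod_mult Rmult_comm. apply: Rmult_le_compat_r; first lra.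
  apply: Rle_trans (Cmod_triangle _ _) _. lra.
Qed.

Lemma Cmod_lip (z w : C) : Rabs (Cmod z - Cmod w) <= Cmod (z - w)%C.
Proof.
  have := Cmod_triangle_rev_minus z w. have := Cmod_triangle_rev_minus w z. rewrite (Cmod_minus_sym w z).
  move=> *. apply: Rabs_le. lra.
Qed.

Lemma rcont_bounded (g : R -> C) a b : a <= b -> (forall t, rcont g t) -> exists M, 0 <= M /\ forall t, a <= t <= b -> Cmod (g t) <= M.
Proof.
  move=> Hab H.
  have Hc : forall t, a <= t <= b -> continuity_pt (fun t => Cmod (g t)) t.
  { move=> t _. apply continuity_pt_filterlim.
    move=> P [e He]. have [d [Hd K]] := proj1 (rcont_eps _ _) (H t) e (cond_pos e).
    exists (mkposreal d Hd) => y Hy. apply: He. apply: Rle_lt_trans (Cmod_lip _ _) _. exact: K. }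
  have [Mx [HM _]] := continuity_ab_maj (fun t => Cmod (g t)) a b Hab Hc.
  exists (Cmod (g Mx)). split; first exact: Cmod_ge_0. exact: HM.
Qed.

Lemma rcont_f_circ (f : C -> C) c r : 0 <= r -> (forall w, Cmod (w - c)%C <= r -> cdiff f w) -> forall t, rcont (fun t => f (circ c r t)) t.
Proof. move=> Hr H t. apply: rcont_on_circ. apply: cdiff_ccont. apply: H. rewrite Cmod_circ_minus; lra. Qed.

Lemma circ_bounded (f : C -> C) c r : 0 <= r -> (forall w, Cmod (w - c)%C <= r -> cdiff f w) ->
  exists M, 0 <= M /\ forall t, 0 <= t <= 2 * PI -> Cmod (f (circ c r t)) <= M.
Proof.
  move=> Hr H. apply: (rcont_bounded (fun t => f (circ c r t))); first by have := PI_RGT_0; lra.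
  exact: rcont_f_circ.
Qed.

Lemma cauchy_estimate (f : C -> C) (c : C) r M : 0 < r -> (forall w, Cmod (w - c)%C <= r -> cdiff f w) ->
  (forall t, 0 <= t <= 2 * PI -> Cmod (f (circ c r t)) <= M) -> forall z, Cmod (z - c)%C <= r / 2 -> Cmod (f z) <= 2 * M.
Proof.
  move=> Hr H HM z Hz. have P0 := PI_RGT_0.
  have Hz' : Cmod (z - c)%C < r by lra.
  have E := cauchy_formula f c z r Hz' H.
  apply: (Rmult_le_reg_l (2 * PI)); first lra.
  have -> : 2 * PI * Cmod (f z) = Cmod (RtoC (2 * PI) * f z)%C by rewrite Cmod_mult Cmod_R Rabs_pos_eq; lra.
  rewrite E. apply: circ_int_norm.
  - move=> t. apply: rcont_div; first exact: circ_neq (Rlt_le _ _ Hr) Hz'.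
    + apply: rcont_mult; first exact: rcont_f_circ (Rlt_le _ _ Hr) H t. apply: rcont_minus; [exact: rcont_circ|exact: rcont_const].
    + apply: rcont_minus; [exact: rcont_circ|exact: rcont_const].
  - move=> t Ht. have N := circ_neq c r t z (Rlt_le _ _ Hr) Hz'.
    rewrite Cmod_div // Cmod_mult Cmod_circ_minus; last lra.
    have A := circ_avoid c r t z (Rlt_le _ _ Hr) Hz'.
    set D := Cmod (circ c r t - z)%C in A *. have D0 : r / 2 <= D by lra.
    apply: (Rmult_le_reg_r D); first lra.
    have -> : Cmod (f (circ c r t)) * r / D * D = Cmod (f (circ c r t)) * r by field; lra.
    have := HM t Ht. have := Cmod_ge_0 (f (circ c r t)). nra.
Qed.

(** As a contour integral this is [f w / ((w - c) (w - z))] integrated over the circle and divided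
    by [2 pi i], the divided difference of [f] between [c] and [z]; it still makes sense for
    [z = c]. *)
Definition circ_transform (f : C -> C) (c : C) (r : R) (z : C) : C :=
  (/ RtoC (2 * PI) * circ_int (fun w => f w / (w - z)) c r)%C.

Lemma RtoC_2PI_neq0 : RtoC (2 * PI) <> RtoC 0.
Proof. apply: RtoC_neq0. have := PI_RGT_0; lra. Qed.

Lemma rcont_kernel (f : C -> C) c r (z : C) t : Cmod (z - c)%C < r -> (forall w, Cmod (w - c)%C <= r -> cdiff f w) ->
  rcont (fun t => f (circ c r t) / (circ c r t - z))%C t.
Proof.
  move=> Hz H. have r0 : 0 <= r by have := Cmod_ge_0 (z - c)%C; lra.
  apply: rcont_div; first exact: circ_neq. exact: rcont_f_circ. apply: rcont_minus; [exact: rcont_circ|exact: rcont_const].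
Qed.

Lemma slope_transform (f : C -> C) (c z : C) r l : Cmod (z - c)%C < r -> z <> c -> (forall w, Cmod (w - c)%C <= r -> cdiff f w) ->
  slope f c l z = circ_transform f c r z.
Proof.
  move=> Hz N H. rewrite slope_neq //. have r0 : 0 < r by have := Cmod_ge_0 (z - c)%C; lra.
  have N' := Cminus_neq_0 _ _ N.
  have E1 := cauchy_formula f c z r Hz H.
  have E2 := cauchy_formula f c c r ltac:(rewrite Cmod_self; lra) H.
  have T := RtoC_2PI_neq0.
  have E3 : (RtoC (2 * PI) * (f z - f c) = (z - c) * circ_int (fun w => f w / (w - z)) c r)%C.
  { have -> : (RtoC (2 * PI) * (f z - f c) = RtoC (2 * PI) * f z - RtoC (2 * PI) * f c)%C by ring.
    rewrite E1 E2 /circ_int -CI_minus.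
    - rewrite -CI_scal.
      + apply: CI_ext_all => t. have h1 := circ_neq c r t z (Rlt_le _ _ r0) Hz.
        have h2 := circ_neq c r t c (Rlt_le _ _ r0) ltac:(rewrite Cmod_self; lra). field. by split.
      + apply: exCI_cont_all => t. exact: rcont_kernel.
    - apply: exCI_cont_all => t. apply: rcont_div; first exact: circ_neq (Rlt_le _ _ r0) Hz.
      + apply: rcont_mult; first exact: rcont_f_circ (Rlt_le _ _ r0) H t. apply: rcont_minus; [exact: rcont_circ|exact: rcont_const].
      + apply: rcont_minus; [exact: rcont_circ|exact: rcont_const].
    - apply: exCI_cont_all => t. apply: rcont_div; first by apply: circ_neq; rewrite ?Cmod_self; lra.
      + apply: rcont_mult; first exact: rcont_f_circ (Rlt_le _ _ r0) H t. apply: rcont_minus; [exact: rcont_circ|exact: rcont_const].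
      + apply: rcont_minus; [exact: rcont_circ|exact: rcont_const]. }
  rewrite /circ_transform.
  have -> : (f z - f c = / RtoC (2 * PI) * (RtoC (2 * PI) * (f z - f c)))%C by field.
  rewrite E3. field. by split.
Qed.

Lemma transform_lip (f : C -> C) (c : C) r M (z z' : C) : 0 < r -> (forall w, Cmod (w - c)%C <= r -> cdiff f w) ->
  (forall t, 0 <= t <= 2 * PI -> Cmod (f (circ c r t)) <= M) ->
  Cmod (z - c)%C <= r / 2 -> Cmod (z' - c)%C <= r / 2 ->
  Cmod (circ_transform f c r z - circ_transform f c r z')%C <= 4 * M / (r * r) * Cmod (z - z')%C.
Proof.
  move=> Hr H HM Hz Hz'. have P0 := PI_RGT_0.
  have -> : (circ_transform f c r z - circ_transform f c r z' = / RtoC (2 * PI) * circ_int (fun w => f w * (z - z') / ((w - z) * (w - z'))) c r)%C.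
  { rewrite /circ_transform.
    have -> : forall a b k : C, (k * a - k * b = k * (a - b))%C by move=> *; ring.
    congr (_ * _)%C. rewrite /circ_int -CI_minus.
    - apply: CI_ext_all => t. field. split; apply: circ_neq; lra.
    - apply: exCI_cont_all => t. apply: rcont_kernel => //; lra.
    - apply: exCI_cont_all => t. apply: rcont_kernel => //; lra. }
  rewrite Cmod_mult Cmod_inv; last exact: RtoC_2PI_neq0. rewrite Cmod_R Rabs_pos_eq; last lra.
  apply: (Rmult_le_reg_l (2 * PI)); first lra. rewrite -Rmult_assoc Rinv_r ?Rmult_1_l; last lra.
  apply: circ_int_norm.
  - move=> t. apply: rcont_div.
    + apply: Cmult_neq_0; apply: circ_neq; lra.
    + apply: rcont_mult; last exact: rcont_const. exact: rcont_f_circ (Rlt_le _ _ Hr) H t.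
    + apply: rcont_mult; apply: rcont_minus; try exact: rcont_circ; exact: rcont_const.
  - move=> t Ht. rewrite Cmod_div; last by apply: Cmult_neq_0; apply: circ_neq; lra.
    rewrite !Cmod_mult.
    have A := circ_avoid c r t z (Rlt_le _ _ Hr) ltac:(lra). have A' := circ_avoid c r t z' (Rlt_le _ _ Hr) ltac:(lra).
    set D := Cmod (circ c r t - z)%C in A *. set D' := Cmod (circ c r t - z')%C in A' *.
    have B := HM t Ht. have B0 := Cmod_ge_0 (f (circ c r t)). have Z0 := Cmod_ge_0 (z - z')%C.
    set X := Cmod (f (circ c r t)) in B B0 *. set Z := Cmod (z - z')%C in Z0 *.
    have DD : r / 2 * (r / 2) <= D * D' by apply: Rmult_le_compat; lra.
    have DD0 : 0 < r / 2 * (r / 2) by apply: Rmult_lt_0_compat; lra.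
    apply: (Rmult_le_reg_r (D * D')); first lra.
    have -> : X * Z / (D * D') * (D * D') = X * Z by field; split; nra.
    have -> : X * Z = 4 * X / (r * r) * Z * (r / 2 * (r / 2)) by field; lra.
    apply: Rmult_le_compat; try lra.
    + apply: Rmult_le_pos => //. apply: Rmult_le_pos; first lra. apply: Rlt_le; apply: Rinv_0_lt_compat; nra.
    + apply: Rmult_le_compat_r => //. apply: Rmult_le_compat_r; last lra. apply: Rlt_le; apply: Rinv_0_lt_compat; nra.
Qed.

(** The constant involves [f] only through its bound [M] on the circle, so for a series or a
    parameter integral the bounds of the terms add up to the hypothesis of
    [cdiff_of_slope_lipschitz]. *)
Lemma slope_lip (f : C -> C) (c : C) r M l (z z' : C) : 0 < r -> (forall w, Cmod (w - c)%C <= r -> cdiff f w) ->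
  (forall t, 0 <= t <= 2 * PI -> Cmod (f (circ c r t)) <= M) -> z <> c -> z' <> c ->
  Cmod (z - c)%C <= r / 2 -> Cmod (z' - c)%C <= r / 2 ->
  Cmod (slope f c l z - slope f c l z')%C <= 4 * M / (r * r) * Cmod (z - z')%C.
Proof.
  move=> Hr H HM N N' Hz Hz'. rewrite !(slope_transform f c _ r) //; try lra. exact: transform_lip.
Qed.

Lemma ccont_eq_punctured (f g : C -> C) z d : 0 < d -> ccont f z -> ccont g z ->
  (forall w, w <> z -> Cmod (w - z)%C < d -> f w = g w) -> f z = g z.
Proof.
  move=> Hd Hf Hg E. apply: C_eq_small => e He.
  have [d1 [Hd1 H1]] := Hf (e / 2) ltac:(lra). have [d2 [Hd2 H2]] := Hg (e / 2) ltac:(lra).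
  set m := Rmin d (Rmin d1 d2).
  have m0 : 0 < m by rewrite /m; repeat apply: Rmin_glb_lt.
  have m1 : m <= d by exact: Rmin_l. have m2 : m <= d1 by apply: Rle_trans (Rmin_r _ _) (Rmin_l _ _).
  have m3 : m <= d2 by apply: Rle_trans (Rmin_r _ _) (Rmin_r _ _).
  set w := (z + RtoC (m / 2))%C.
  have Hw : Cmod (w - z)%C = m / 2.
  { have -> : (w - z = RtoC (m / 2))%C by rewrite /w; ring. rewrite Cmod_R Rabs_pos_eq; lra. }
  have N : w <> z by move=> h; move: Hw; rewrite h Cmod_self; lra.
  have A := H1 w ltac:(lra). have B := H2 w ltac:(lra). rewrite (E w N ltac:(lra)) Cmod_minus_sym in A.
  have := Cmod_triangle3 (f z) (g z) (g w). lra.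
Qed.

Lemma transform_cdiff (f : C -> C) (c : C) r : 0 < r -> (forall w, Cmod (w - c)%C <= r -> cdiff f w) ->
  cdiff (circ_transform f c r) c.
Proof.
  move=> Hr H. have P0 := PI_RGT_0.
  have [M [M0 HM]] := circ_bounded f c r ltac:(lra) H.
  have Hc : Cmod (c - c)%C < r by rewrite Cmod_self.
  have rr : 0 < r * r * r by repeat apply: Rmult_lt_0_compat.
  apply: (cdiff_of_slope_lipschitz _ c (r / 2) (4 * M / (r * r * r))); first lra.
  { apply: Rmult_le_pos; first lra. apply: Rlt_le; exact: Rinv_0_lt_compat. }
  have cz : forall h : C, (c + h - c = h)%C by move=> h; ring.
  have E : forall h : C, 0 < Cmod h < r / 2 -> ((circ_transform f c r (c + h) - circ_transform f c r c) / h
     = / RtoC (2 * PI) * circ_int (fun w => f w / ((w - c) * (w - (c + h)))) c r)%C.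
  { move=> h Hh. have h0 : h <> 0%C by apply: Cmod_pos_neq0; lra.
    have Hch : Cmod (c + h - c)%C < r by rewrite cz; lra.
    have -> : ((circ_transform f c r (c + h) - circ_transform f c r c) / h = / RtoC (2 * PI) * (/ h *
      (circ_int (fun w => f w / (w - (c + h))) c r - circ_int (fun w => f w / (w - c)) c r)))%C.
    { rewrite /circ_transform. field. split => //. exact: RtoC_2PI_neq0. }
    congr (_ * _)%C. rewrite /circ_int -CI_minus; try (apply: exCI_cont_all => t; exact: rcont_kernel).
    rewrite -CI_scal.
    - apply: CI_ext_all => t. field. repeat split => //; apply: circ_neq; lra.
    - apply: exCI_cont_all => t. apply: rcont_minus; exact: rcont_kernel. }
  move=> h h' Hh Hh'. rewrite !E //.
  have Hch : Cmod (c + h - c)%C < r by rewrite cz; lra. have Hch' : Cmod (c + h' - c)%C < r by rewrite cz; lra.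
  have rc : forall h : C, Cmod (c + h - c)%C < r -> forall t, rcont (fun t => f (circ c r t) / ((circ c r t - c) * (circ c r t - (c + h))))%C t.
  { move=> k Hk t. apply: rcont_div.
    + apply: Cmult_neq_0; apply: circ_neq; lra.
    + exact: rcont_f_circ (Rlt_le _ _ Hr) H t.
    + apply: rcont_mult; apply: rcont_minus; try exact: rcont_circ; exact: rcont_const. }
  have -> : forall a b k : C, (k * a - k * b = k * (a - b))%C by move=> *; ring.
  rewrite Cmod_mult Cmod_inv; last exact: RtoC_2PI_neq0. rewrite Cmod_R Rabs_pos_eq; last lra.
  apply: (Rmult_le_reg_l (2 * PI)); first lra. rewrite -Rmult_assoc Rinv_r ?Rmult_1_l; last lra.
  rewrite /circ_int -CI_minus; try (apply: exCI_cont_all => t; exact: rc).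
  apply: (circ_int_norm (fun w => f w / ((w - c) * (w - (c + h))) - f w / ((w - c) * (w - (c + h'))))%C c r).
  { move=> t. apply: rcont_minus; exact: rc. }
  move=> t Ht.
  have N1 := circ_neq c r t c (Rlt_le _ _ Hr) Hc. have N2 := circ_neq c r t _ (Rlt_le _ _ Hr) Hch. have N3 := circ_neq c r t _ (Rlt_le _ _ Hr) Hch'.
  have -> : (f (circ c r t) / ((circ c r t - c) * (circ c r t - (c + h))) - f (circ c r t) / ((circ c r t - c) * (circ c r t - (c + h')))
    = f (circ c r t) * (h - h') / ((circ c r t - c) * (circ c r t - (c + h)) * (circ c r t - (c + h'))))%C.
  { field. by repeat split. }
  rewrite Cmod_div; last by repeat apply: Cmult_neq_0.
  rewrite !Cmod_mult Cmod_circ_minus; last lra.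
  have A := circ_avoid c r t _ (Rlt_le _ _ Hr) Hch. have A' := circ_avoid c r t _ (Rlt_le _ _ Hr) Hch'. rewrite cz in A. rewrite cz in A'.
  set D := Cmod (circ c r t - (c + h))%C in A *. set D' := Cmod (circ c r t - (c + h'))%C in A' *.
  have B := HM t Ht. have B0 := Cmod_ge_0 (f (circ c r t)).
  set X := Cmod (f (circ c r t)) in B B0 *. set Z := (Cmod h + Cmod h').
  have Z0 : 0 <= Z by rewrite /Z; lra.
  have ZZ : Cmod (h - h')%C <= Z by exact: Cmod_triangle_minus.
  have DD : r * (r / 2 * (r / 2)) <= r * (D * D') by apply: Rmult_le_compat_l; [lra|apply: Rmult_le_compat; lra].
  have DD0 : 0 < r * (r / 2 * (r / 2)) by repeat apply: Rmult_lt_0_compat; lra.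
  apply: (Rmult_le_reg_r (r * D * D')); first lra.
  have -> : X * Cmod (h - h')%C / (r * D * D') * (r * D * D') = X * Cmod (h - h')%C by field; repeat split; nra.
  apply: (Rle_trans _ (M * Z)). { apply: Rmult_le_compat => //. exact: Cmod_ge_0. }
  have -> : M * Z = 4 * M / (r * r * r) * Z * (r * (r / 2 * (r / 2))) by field; lra.
  apply: Rmult_le_compat; try lra.
  apply: Rmult_le_pos => //. apply: Rmult_le_pos; first lra. apply: Rlt_le; apply: Rinv_0_lt_compat; nra.
Qed.

(** Riemann's removable singularity theorem in the case needed: near [c] the quotient coincides with
    [circ_transform], at [c] itself by continuity. *)
Lemma slope_cdiff (f : C -> C) (c : C) l R0 : 0 < R0 -> (forall w, Cmod (w - c)%C < R0 -> cdiff f w) -> cderiv f c l ->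
  forall w, Cmod (w - c)%C < R0 -> cdiff (slope f c l) w.
Proof.
  move=> HR H Hl w Hw. case: (classic (w = c)) => [->|N]; last by apply: slope_cdiff_off => //; exact: H.
  set r := R0 / 2. have Hr : forall w, Cmod (w - c)%C <= r -> cdiff f w by move=> v Hv; apply: H; rewrite /r in Hv; lra.
  have r0 : 0 < r by rewrite /r; lra.
  have E : forall v, v <> c -> Cmod (v - c)%C < r -> circ_transform f c r v = slope f c l v.
  { move=> v Nv Hv. by rewrite (slope_transform f c v r). }
  have D := transform_cdiff f c r r0 Hr.
  apply: (cdiff_ext_loc (circ_transform f c r) _ c r) => // v Hv.
  case: (classic (v = c)) => [->|Nv]; last exact: E.
  apply: (ccont_eq_punctured _ _ c r) => //. exact: cdiff_ccont. exact: slope_ccont.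
Qed.

Lemma division (f : C -> C) (c : C) R0 : 0 < R0 -> (forall w, Cmod (w - c)%C < R0 -> cdiff f w) ->
  exists g, (forall w, Cmod (w - c)%C < R0 -> cdiff g w) /\ cderiv f c (g c) /\ forall w, (f w = f c + (w - c) * g w)%C.
Proof.
  move=> HR H. have [l Hl] := proj1 (cdiff_cderiv _ _) (H c ltac:(rewrite Cmod_self; lra)).
  exists (slope f c l). split; last split.
  - exact: slope_cdiff.
  - by rewrite slope_eq.
  - move=> w. exact: slope_mult.
Qed.

(** * The identity theorem *)

Definition zeros_cluster (f : C -> C) (c : C) : Prop :=
  forall e, 0 < e -> exists w, w <> c /\ Cmod (w - c)%C < e /\ f w = 0%C.

Lemma zeros_cluster_zero f c : ccont f c -> zeros_cluster f c -> f c = 0%C.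
Proof.
  move=> Hf H. apply: C_eq_small => e He. have [d [Hd K]] := Hf e He. have [w [_ [Hw E]]] := H d Hd.
  have := K w Hw. rewrite E Cmod_minus_sym. lra.
Qed.

(** A quotient by [w - c] inherits the nearby zeros, hence vanishes at [c] again and can be divided
    once more. *)
Lemma zeros_cluster_divide (f : C -> C) (c : C) R0 : 0 < R0 -> (forall w, Cmod (w - c)%C < R0 -> cdiff f w) -> zeros_cluster f c ->
  forall k, exists g, (forall w, Cmod (w - c)%C < R0 -> cdiff g w) /\ zeros_cluster g c /\ forall w, (f w = (w - c) ^ k * g w)%C.
Proof.
  move=> HR H Z. elim=> [|k [g [G1 [G2 G3]]]].
  - exists f. split => //. split => // w /=. ring.
  - have [q [Q1 [_ Q3]]] := division g c R0 HR G1.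
    have g0 : g c = 0%C. { apply: zeros_cluster_zero => //. apply: cdiff_ccont. apply: G1. rewrite Cmod_self; lra. }
    exists q. split => //. split.
    + move=> e He. have [w [Nw [Hw E]]] := G2 e He. exists w. split => //. split => //.
      rewrite Q3 g0 Cplus_0_l in E. case: (Cmult_eq_0 _ _ E) => // h. by case: (Cminus_neq_0 _ _ Nw).
    + move=> w. rewrite G3 Q3 g0 /=. ring.
Qed.

(** With [f w = (w - c)^k g w] the Cauchy estimate bounds [g] by [2 M / r^k], so
    [|f w| <= 2 M (|w - c| / r)^k] for every [k], with a ratio of at most 1/2. This takes the place
    of power series. *)
Lemma identity_local (f : C -> C) (c : C) R0 : 0 < R0 -> (forall w, Cmod (w - c)%C < R0 -> cdiff f w) -> zeros_cluster f c ->
  forall w, Cmod (w - c)%C < R0 / 2 -> f w = 0%C.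
Proof.
  move=> HR H Z w Hw.
  (* Any radius with [2 |w - c| < r < R0] serves. *)
  set r := R0 / 2 + Cmod (w - c)%C. have w0 := Cmod_ge_0 (w - c)%C.
  have r1 : r < R0 by rewrite /r; lra. have r0 : 0 < r by rewrite /r; lra. have r2 : 2 * Cmod (w - c)%C < r by rewrite /r; lra.
  have H' : forall w, Cmod (w - c)%C <= r -> cdiff f w by move=> v Hv; apply: H; lra.
  have [M [M0 HM]] := circ_bounded f c r ltac:(lra) H'.
  set q := Cmod (w - c)%C / r.
  have q0 : 0 <= q by apply: Rmult_le_pos => //; apply: Rlt_le; exact: Rinv_0_lt_compat.
  have q1 : q <= / 2. { apply: (Rmult_le_reg_r r) => //. have -> : q * r = Cmod (w - c)%C by rewrite /q; field; lra. lra. }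
  have K : forall k, Cmod (f w) <= 2 * M / 2 ^ k.
  { move=> k. have [g [G1 [_ G3]]] := zeros_cluster_divide f c R0 HR H Z k.
    have rk : 0 < r ^ k by exact: pow_lt.
    have B : forall z, Cmod (z - c)%C <= r / 2 -> Cmod (g z) <= 2 * (M / r ^ k).
    { apply: cauchy_estimate => //; first by move=> v Hv; apply: G1; lra.
      move=> t Ht. have := HM t Ht. rewrite G3 Cmod_mult Cmod_pow Cmod_circ_minus; last lra.
      move=> b. apply: (Rmult_le_reg_l (r ^ k)) => //. have -> : r ^ k * (M / r ^ k) = M by field; lra. exact: b. }
    have {}B := B w ltac:(lra).
    rewrite G3 Cmod_mult Cmod_pow.
    have -> : Cmod (w - c)%C = q * r by rewrite /q; field; lra.
    rewrite Rpow_mult_distr.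
    have qk : q ^ k <= / 2 ^ k by rewrite -pow_inv; apply: pow_incr.
    have qk0 : 0 <= q ^ k by exact: pow_le.
    have -> : 2 * M / 2 ^ k = / 2 ^ k * (r ^ k * (2 * (M / r ^ k))) by field; split; [lra|apply: pow_nonzero; lra].
    rewrite Rmult_assoc. apply: Rmult_le_compat => //.
    - apply: Rmult_le_pos; [lra|exact: Cmod_ge_0].
    - apply: Rmult_le_compat_l; lra. }
  apply: Cmod_le_0. apply: Rnot_lt_le => h. have [k Hk] := pow_half_small (2 * M) _ h. have := K k. lra.
Qed.

Lemma segment_connected (P : R -> Prop) : P 0 ->
  (forall t, 0 <= t <= 1 -> exists n, 0 < n /\ forall t' t'', 0 <= t' <= 1 -> 0 <= t'' <= 1 ->
     Rabs (t' - t) < n -> Rabs (t'' - t) < n -> P t' -> P t'') -> P 1.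
Proof.
  move=> P0 H.
  have [s [S1 S2]] : {s | is_lub (fun t => 0 <= t <= 1 /\ P t) s}.
  { apply: completeness. exists 1 => t. lra. exists 0. split => //. lra. }
  have s0 : 0 <= s by apply: S1; split => //; lra.
  have s1 : s <= 1 by apply: S2 => t; lra.
  have [n [Hn K]] := H s ltac:(lra).
  have [t [[Ht Pt] Hts]] : exists t, (0 <= t <= 1 /\ P t) /\ s - n < t.
  { apply: NNPP => Hno. have : s <= s - n; last lra. apply: S2 => t Ht. apply: Rnot_lt_le => h. apply: Hno. by exists t. }
  have ts : t <= s by apply: S1.
  set u := Rmin 1 (s + n / 2).
  have u1 : u <= 1 by exact: Rmin_l. have u2 : u <= s + n / 2 by exact: Rmin_r.
  have u3 : s <= u by apply: Rmin_glb; lra.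
  have Pu : P u. { apply: (K t u) => //; try lra; apply Rabs_def1; lra. }
  have us : u <= s by apply: S1; split => //; lra.
  have <- : u = 1; last exact: Pu.
  move: us. rewrite /u /Rmin. case: Rle_dec; lra.
Qed.

Lemma convex_lt a b c t : a < c -> b < c -> 0 <= t <= 1 -> a + t * (b - a) < c.
Proof. move=> H1 H2 Ht. case: (Rle_lt_dec a b) => h; nra. Qed.

Definition seg (z0 z1 : C) (t : R) : C := (z0 + RtoC t * (z1 - z0))%C.

Lemma seg_dist z0 z1 t t' : Cmod (seg z0 z1 t' - seg z0 z1 t)%C = Rabs (t' - t) * Cmod (z1 - z0)%C.
Proof.
  have -> : (seg z0 z1 t' - seg z0 z1 t = RtoC (t' - t) * (z1 - z0))%C by rewrite /seg RtoC_minus; ring.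
  by rewrite Cmod_mult Cmod_R.
Qed.

Lemma seg_close z0 z1 t t' e : 0 < e -> Rabs (t' - t) < e / (Cmod (z1 - z0)%C + 1) -> Cmod (seg z0 z1 t' - seg z0 z1 t)%C < e.
Proof.
  move=> He H. have D0 := Cmod_ge_0 (z1 - z0)%C. rewrite seg_dist. set D := Cmod _ in H D0 *.
  have -> : e = e / (D + 1) * (D + 1) by field; lra.
  have := Rabs_pos (t' - t). have : 0 < e / (D + 1) by apply: Rdiv_lt_0_compat; lra. nra.
Qed.

Lemma identity_segment (f : C -> C) (z0 z1 : C) :
  (forall t, 0 <= t <= 1 -> exists r, 0 < r /\ forall w, Cmod (w - seg z0 z1 t)%C < r -> cdiff f w) ->
  (exists e, 0 < e /\ forall w, Cmod (w - z0)%C < e -> f w = 0%C) ->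
  exists e, 0 < e /\ forall w, Cmod (w - z1)%C < e -> f w = 0%C.
Proof.
  move=> H H0.
  have S0 : seg z0 z1 0 = z0 by rewrite /seg; ring. have S1 : seg z0 z1 1 = z1 by rewrite /seg; ring.
  have := segment_connected (fun t => exists e, 0 < e /\ forall w, Cmod (w - seg z0 z1 t)%C < e -> f w = 0%C).
  rewrite S0 S1. apply => // t Ht.
  have [r [Hr K]] := H t Ht.
  (* The points [p'] and [p''] are then within [r / 8] of each other, so the disc of radius [r / 4]
     about [p'], on which [identity_local] gives zeros, contains a disc about [p'']. *)
  exists (r / 16 / (Cmod (z1 - z0)%C + 1)). split.
  { apply: Rdiv_lt_0_compat; first lra. have := Cmod_ge_0 (z1 - z0)%C; lra. }
  move=> t' t'' Ht' Ht'' C1 C2 [e [He Z]].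
  have {}C1 := seg_close z0 z1 t t' (r / 16) ltac:(lra) C1. have {}C2 := seg_close z0 z1 t t'' (r / 16) ltac:(lra) C2.
  set p := seg z0 z1 t in K C1 C2. set p' := seg z0 z1 t' in C1 Z. set p'' := seg z0 z1 t'' in C2 *.
  have I : forall w, Cmod (w - p')%C < r / 2 / 2 -> f w = 0%C.
  { apply: identity_local; first lra.
    - move=> w Hw. apply: K. have := Cmod_triangle3 w p p'. lra.
    - move=> e' He'. set m := Rmin e e'.
      have m0 : 0 < m by exact: Rmin_glb_lt. have m1 : m <= e by exact: Rmin_l. have m2 : m <= e' by exact: Rmin_r.
      exists (p' + RtoC (m / 2))%C.
      have E : Cmod (p' + RtoC (m / 2) - p')%C = m / 2.
      { have -> : (p' + RtoC (m / 2) - p' = RtoC (m / 2))%C by ring. rewrite Cmod_R Rabs_pos_eq; lra. }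
      split. { move=> h. move: E. rewrite h Cmod_self. lra. }
      split; first lra. apply: Z. lra. }
  exists (r / 100). split; first lra.
  move=> w Hw. apply: I. have := Cmod_triangle3 w p' p''. have := Cmod_triangle3 p'' p' p. rewrite (Cmod_minus_sym p p'). lra.
Qed.

Lemma identity_convex (U : C -> Prop) (f : C -> C) (z0 z1 : C) :
  (forall z w t, U z -> U w -> 0 <= t <= 1 -> U (seg z w t)) ->
  (forall z, U z -> exists r, 0 < r /\ forall w, Cmod (w - z)%C < r -> cdiff f w) ->
  U z0 -> U z1 -> (exists e, 0 < e /\ forall w, Cmod (w - z0)%C < e -> f w = 0%C) -> f z1 = 0%C.
Proof.
  move=> Hc H U0 U1 H0.
  have [e [He K]] := identity_segment f z0 z1 ltac:(move=> t Ht; apply: H; exact: Hc) H0.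
  apply: K. by rewrite Cmod_self.
Qed.

(* The covering [v |-> c + exp v] of a punctured disc by a half-plane turns connectedness into convexity. *)
Lemma identity_punctured_disc (h : C -> C) (c w1 w2 : C) d :
  (forall w, 0 < Cmod (w - c)%C < d -> cdiff h w) ->
  0 < Cmod (w1 - c)%C < d -> 0 < Cmod (w2 - c)%C < d ->
  (exists e, 0 < e /\ forall w, Cmod (w - w1)%C < e -> h w = 0%C) -> h w2 = 0%C.
Proof.
  move=> H H1 H2 [e [He Z]].
  have [v1 [E1 [_ R1]]] := Cexp_surj (w1 - c)%C (Cmod_pos_neq0 _ (proj1 H1)).
  have [v2 [E2 [_ R2]]] := Cexp_surj (w2 - c)%C (Cmod_pos_neq0 _ (proj1 H2)).
  have d0 : 0 < d by lra.
  have -> : w2 = (c + Cexp v2)%C by rewrite E2; ring.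
  have cc : forall v, ccont (fun v => c + Cexp v)%C v by move=> v; apply: cdiff_ccont; cdiff_tac.
  apply: (identity_convex (fun v => Re v < ln d) (fun v => h (c + Cexp v)%C) v1 v2).
  - move=> z w t Hz Hw Ht. rewrite /seg /=. rewrite Rmult_0_l Rminus_0_r.
    exact: convex_lt.
  - move=> z Hz. exists (ln d - Re z). split; first lra. move=> w Hw.
    apply: (cdiff_comp h (fun v => c + Cexp v)%C); last by cdiff_tac.
    apply: H. have -> : (c + Cexp w - c = Cexp w)%C by ring. rewrite Cmod_Cexp. split; first exact: exp_pos.
    rewrite -(exp_ln d d0). apply: exp_increasing. have := Re_le_Cmod (w - z)%C.
    have := Rle_abs (Re (w - z)%C). have -> : Re (w - z)%C = Re w - Re z by []. lra.
  - rewrite R1. apply: ln_increasing; lra.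
  - rewrite R2. apply: ln_increasing; lra.
  - have [d' [Hd' K]] := cc v1 e He. exists d'. split => // w Hw. apply: Z.
    have := K w Hw. by have -> : (c + Cexp v1 = w1)%C by rewrite E1; ring.
Qed.

Definition isolated_sing (f : C -> C) (z : C) : Prop :=
  exists d, 0 < d /\ forall w, 0 < Cmod (w - z)%C < d -> cdiff f w.

Definition punctured_zero (f : C -> C) (z : C) : Prop :=
  exists d, 0 < d /\ forall w, 0 < Cmod (w - z)%C < d -> f w = 0%C.

(** Each singular point of the segment sits in a punctured disc, and punctured discs are connected,
    so vanishing on one side passes around the singularity to the other. *)
Lemma identity_isolated (h : C -> C) (z0 z1 : C) :
  (forall t, 0 <= t <= 1 -> isolated_sing h (seg z0 z1 t)) -> punctured_zero h z0 -> punctured_zero h z1.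
Proof.
  move=> H H0.
  have S0 : seg z0 z1 0 = z0 by rewrite /seg; ring. have S1 : seg z0 z1 1 = z1 by rewrite /seg; ring.
  have := segment_connected (fun t => punctured_zero h (seg z0 z1 t)). rewrite S0 S1. apply => // t Ht.
  have [d [Hd K]] := H t Ht.
  exists (d / 2 / (Cmod (z1 - z0)%C + 1)). split.
  { apply: Rdiv_lt_0_compat; first lra. have := Cmod_ge_0 (z1 - z0)%C; lra. }
  move=> t' t'' Ht' Ht'' C1 C2 [e [He Z]].
  have {}C1 := seg_close z0 z1 t t' (d / 2) ltac:(lra) C1. have {}C2 := seg_close z0 z1 t t'' (d / 2) ltac:(lra) C2.
  set p := seg z0 z1 t in K C1 C2. set p' := seg z0 z1 t' in C1 Z. set p'' := seg z0 z1 t'' in C2 *.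
  set m := Rmin e (d / 2).
  have m0 : 0 < m by apply: Rmin_glb_lt; lra. have m1 : m <= e by exact: Rmin_l. have m2 : m <= d / 2 by exact: Rmin_r.
  (* A point near [p'], distinct from [p], with a whole disc of zeros around it; the choice [m / 4]
     covers the case where [p' + m / 2] is [p]. *)
  have [w1 [W1 W2]] : exists w1, w1 <> p /\ m / 8 <= Cmod (w1 - p')%C <= m / 2.
  { have E : forall x, 0 <= x -> Cmod (p' + RtoC x - p')%C = x.
    { move=> x Hx. have -> : (p' + RtoC x - p' = RtoC x)%C by ring. rewrite Cmod_R Rabs_pos_eq; lra. }
    case: (classic ((p' + RtoC (m / 2))%C = p)) => N.
    - exists (p' + RtoC (m / 4))%C. split; last by rewrite E; lra.
      rewrite -N => Q. have := E (m / 2) ltac:(lra). rewrite -Q E; lra.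
    - exists (p' + RtoC (m / 2))%C. split => //. rewrite E; lra. }
  have Wp := Cmod_minus_gt0 _ _ W1.
  have A : forall w, 0 < Cmod (w - p)%C < d -> h w = 0%C.
  { move=> w Hw. apply: (identity_punctured_disc h p w1 w d) => //.
    - split => //. have := Cmod_triangle3 w1 p p'. lra.
    - exists (m / 8). split; first lra. move=> v Hv. apply: Z.
      have := Cmod_triangle3 w1 p' v. have := Cmod_triangle3 v p' w1. rewrite (Cmod_minus_sym w1 v). lra. }
  case: (classic (p'' = p)) => N; first by exists d; rewrite N.
  have Np := Cmod_minus_gt0 _ _ N.
  exists (Rmin (Cmod (p'' - p)%C) (d / 2)). split; first by apply: Rmin_glb_lt; lra.
  move=> w [Hw0 Hw]. have h1 := Rlt_le_trans _ _ _ Hw (Rmin_l _ _). have h2 := Rlt_le_trans _ _ _ Hw (Rmin_r _ _).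
  apply: A. have := Cmod_triangle3 w p p''. have := Cmod_triangle3 p'' p w. rewrite (Cmod_minus_sym p'' w). lra.
Qed.

(** At each [z] a local extension is chosen and evaluated at its own centre; by continuity
    neighbouring choices agree, so these values glue. *)
Lemma entire_extension (f : C -> C) :
  (forall z, exists g d, 0 < d /\ (forall w, Cmod (w - z)%C < d -> cdiff g w) /\ forall w, 0 < Cmod (w - z)%C < d -> f w = g w) ->
  exists F, (forall z, cdiff F z) /\ forall z, cdiff f z -> F z = f z.
Proof.
  move=> H.
  pose G := fun z => epsilon (inhabits f) (fun g => exists d, 0 < d /\ (forall w, Cmod (w - z)%C < d -> cdiff g w) /\ forall w, 0 < Cmod (w - z)%C < d -> f w = g w).
  have HG : forall z, exists d, 0 < d /\ (forall w, Cmod (w - z)%C < d -> cdiff (G z) w) /\ forall w, 0 < Cmod (w - z)%C < d -> f w = G z w.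
  { move=> z. exact: (epsilon_spec (inhabits f) _ (H z)). }
  exists (fun z => G z z). split.
  - move=> z. have [d [Hd [D E]]] := HG z.
    apply: (cdiff_ext_loc (G z) _ z d) => //; last by apply: D; rewrite Cmod_self.
    move=> w Hw. case: (classic (w = z)) => [->|N] //.
    have Nw := Cmod_minus_gt0 _ _ N.
    have [d' [Hd' [D' E']]] := HG w.
    set m := Rmin d' (Rmin (Cmod (w - z)%C) (d - Cmod (w - z)%C)).
    have m0 : 0 < m by rewrite /m; repeat apply: Rmin_glb_lt; lra.
    have m1 : m <= d' by exact: Rmin_l.
    have m2 : m <= Cmod (w - z)%C by apply: Rle_trans (Rmin_r _ _) (Rmin_l _ _).
    have m3 : m <= d - Cmod (w - z)%C by apply: Rle_trans (Rmin_r _ _) (Rmin_r _ _).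
    apply: (ccont_eq_punctured _ _ w m) => //.
    + apply: cdiff_ccont. exact: D.
    + apply: cdiff_ccont. apply: D'. by rewrite Cmod_self.
    + move=> v Nv Hv. have Nv' := Cmod_minus_gt0 _ _ Nv. rewrite -E' ?E //; try lra.
      have := Cmod_triangle3 v z w. have := Cmod_triangle3 w z v. rewrite (Cmod_minus_sym w v). lra.
  - move=> z Hz. have [d [Hd [D E]]] := HG z.
    apply: (ccont_eq_punctured _ _ z d) => //.
    + apply: cdiff_ccont. apply: D. by rewrite Cmod_self.
    + exact: cdiff_ccont.
    + move=> w N Hw. rewrite E //. split => //. exact: Cmod_minus_gt0.
Qed.

(** Three divisions by [w] leave a quotient that decays like [T / |w|]; Cauchy's estimate on large
    circles makes it vanish. *)
Lemma liouville_quadratic (f : C -> C) K : (forall z, cdiff f z) -> (forall z, Cmod (f z) <= K * (1 + Cmod z) ^ 2) ->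
  exists c0 c1 c2 : C, forall z, (f z = c0 + c1 * z + c2 * z ^ 2)%C.
Proof.
  move=> Hf HK.
  have dv : forall f : C -> C, (forall z, cdiff f z) -> exists g, (forall z, cdiff g z) /\ forall w, (f w = f 0%C + w * g w)%C.
  { move=> q Hq. have [l Hl] := proj1 (cdiff_cderiv _ _) (Hq 0%C).
    exists (slope q 0%C l). split.
    - move=> z. have z0 := Cmod_ge_0 (z - 0)%C.
      apply: (slope_cdiff q 0%C l (Cmod (z - 0)%C + 1)) => //; lra.
    - move=> w. have := slope_mult q 0%C l w. by have -> : (w - 0 = w)%C by ring. }
  have [g1 [D1 E1]] := dv f Hf. have [g2 [D2 E2]] := dv g1 D1. have [g3 [D3 E3]] := dv g2 D2.
  exists (f 0%C), (g1 0%C), (g2 0%C) => z.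
  suff Z : g3 z = 0%C. { rewrite E1 E2 E3 Z /=. ring. }
  set T := 4 * Rabs K + Cmod (f 0%C) + Cmod (g1 0%C) + Cmod (g2 0%C).
  have T0 : 0 <= T.
  { have := Rabs_pos K. have := Cmod_ge_0 (f 0%C). have := Cmod_ge_0 (g1 0%C). have := Cmod_ge_0 (g2 0%C). rewrite /T. lra. }
  have B : forall w, 1 <= Cmod w -> Cmod (g3 w) <= T / Cmod w.
  { move=> w Hw. set r := Cmod w in Hw *.
    have Ew : (w * w * w * g3 w = f w - f 0%C - w * g1 0%C - w * w * g2 0%C)%C by rewrite (E1 w) (E2 w) (E3 w); ring.
    have L : r * r * r * Cmod (g3 w) <= T * (r * r).
    { have -> : r * r * r * Cmod (g3 w) = Cmod (w * w * w * g3 w)%C by rewrite !Cmod_mult.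
      rewrite Ew. apply: Rle_trans (Cmod_triangle_minus _ _) _.
      apply: Rle_trans (Rplus_le_compat_r _ _ _ (Cmod_triangle_minus _ _)) _.
      apply: Rle_trans (Rplus_le_compat_r _ _ _ (Rplus_le_compat_r _ _ _ (Cmod_triangle_minus _ _))) _.
      rewrite !Cmod_mult -/r.
      have hk : Cmod (f w) <= 4 * Rabs K * (r * r).
      { apply: Rle_trans (HK w) _. rewrite -/r. apply: (Rle_trans _ (Rabs K * (1 + r) ^ 2)).
        - apply: Rmult_le_compat_r; [nra|exact: Rle_abs].
        - have := Rabs_pos K. have : (1 + r) ^ 2 <= 4 * (r * r) by nra. nra. }
      have := Cmod_ge_0 (f 0%C). have := Cmod_ge_0 (g1 0%C). have := Cmod_ge_0 (g2 0%C). rewrite /T.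
      move: (Cmod (f 0%C)) (Cmod (g1 0%C)) (Cmod (g2 0%C)) => a b c c0 b0 a0.
      have rr : 1 <= r * r by nra. have rr' : r <= r * r by nra.
      have : a <= a * (r * r) by nra. have : b * r <= b * (r * r) by apply: Rmult_le_compat_l. lra. }
    apply: (Rmult_le_reg_l (r * r * r)); first by repeat apply: Rmult_lt_0_compat; lra.
    have -> : r * r * r * (T / r) = T * (r * r) by field; lra. exact: L. }
  apply: C_eq_small => e He. have -> : (g3 z - 0 = g3 z)%C by ring.
  set r := 1 + 2 * Cmod z + 2 * T / e. have z0 := Cmod_ge_0 z.
  have te : 0 <= 2 * T / e by apply: Rmult_le_pos; [lra|apply: Rlt_le; exact: Rinv_0_lt_compat].
  have r1 : 1 <= r by rewrite /r; lra.
  have zz : (z - 0 = z)%C by ring.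
  apply: (Rle_trans _ (2 * (T / r))).
  { apply: (cauchy_estimate g3 (RtoC 0) r (T / r)) => //; first lra.
    - move=> t Ht. have Er : Cmod (circ 0%C r t) = r.
      { rewrite -[RHS](Cmod_circ_minus 0%C r t); last lra. congr Cmod. ring. }
      have -> : T / r = T / Cmod (circ 0%C r t) by rewrite Er. apply: B. lra.
    - rewrite zz /r; lra. }
  apply: (Rmult_le_reg_r r); first lra. have -> : 2 * (T / r) * r = 2 * T by field; lra.
  have : e * (2 * T / e) = 2 * T by field; lra. rewrite /r. nra.
Qed.

(** * Dominated series and integrals over the real line *)

Fixpoint psum (f : nat -> C) (n : nat) : C :=
  match n with O => 0%C | S m => (psum f m + f m)%C end.

Fixpoint rpsum (f : nat -> R) (n : nat) : R :=
  match n with O => 0 | S m => rpsum f m + f m end.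

(** [S0] is the sum of the majorant and [S0 - rpsum B n] its tail; this tail is the error bound in
    the exchanges of limits below. *)
Definition dom_sum (B : nat -> R) (S0 : R) : Prop :=
  (forall n, 0 <= B n) /\ (forall n, rpsum B n <= S0) /\
  forall e, 0 < e -> exists N, forall n, (N <= n)%nat -> S0 - rpsum B n < e.

Lemma rpsum_mono B n m : (forall n, 0 <= B n) -> (n <= m)%nat -> rpsum B n <= rpsum B m.
Proof. move=> H. elim=> [|k _ IH] /=; first lra. have := H k. lra. Qed.

Lemma bounded_dom_sum B M : (forall n, 0 <= B n) -> (forall n, rpsum B n <= M) -> exists S0, dom_sum B S0.
Proof.
  move=> H0 HM.
  have [s [S1 S2]] : {s | is_lub (fun x => exists n, x = rpsum B n) s}.
  { apply: completeness. exists M => x [n ->]. exact: HM. by exists 0, O. }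
  exists s. split => //. split; first by move=> n; apply: S1; exists n.
  move=> e He.
  have [N HN] : exists N, s - e < rpsum B N.
  { apply: NNPP => Hno. have : s <= s - e; last lra. apply: S2 => x [n ->]. apply: Rnot_lt_le => h. apply: Hno. by exists n. }
  exists N => n Hn. have := rpsum_mono B N n H0 Hn. lra.
Qed.

Lemma dom_sum_scal B S0 c : 0 <= c -> dom_sum B S0 -> dom_sum (fun n => c * B n) (c * S0).
Proof.
  move=> Hc [H0 [H1 H2]].
  have E : forall n, rpsum (fun n => c * B n) n = c * rpsum B n by elim=> [|n IH] /=; [ring|rewrite IH; ring].
  split; first by move=> n; apply: Rmult_le_pos.
  split; first by move=> n; rewrite E; apply: Rmult_le_compat_l.
  move=> e He. have [N HN] := H2 (e / (c + 1)) ltac:(apply: Rdiv_lt_0_compat; lra).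
  exists N => n Hn. rewrite E. have := HN n Hn. have := H1 n.
  have E1 : e = (c + 1) * (e / (c + 1)) by field; lra.
  have : 0 < e / (c + 1) by apply: Rdiv_lt_0_compat; lra. move: (e / (c + 1)) E1 => q -> q0 h1 h2.
  have : c * (S0 - rpsum B n) <= c * q by apply: Rmult_le_compat_l; lra. lra.
Qed.

Lemma dom_sum_le A B SB : (forall n, 0 <= A n <= B n) -> dom_sum B SB -> exists SA, dom_sum A SA.
Proof.
  move=> H [_ [H1 _]]. apply: (bounded_dom_sum A SB); first by move=> n; have := H n; lra.
  move=> n. apply: Rle_trans (H1 n). elim: n => [|n IH] /=; first lra. have := H n. lra.
Qed.

Lemma dom_sum_ge0 B S0 : dom_sum B S0 -> 0 <= S0.
Proof. move=> [_ [H _]]. exact: (H O). Qed.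

Lemma psum_minus_norm f B n m : (forall n, Cmod (f n) <= B n) -> (n <= m)%nat -> Cmod (psum f m - psum f n)%C <= rpsum B m - rpsum B n.
Proof.
  move=> H. elim=> [|k _ IH] /=; first by rewrite Cmod_self; lra.
  have -> : (psum f k + f k - psum f n = (psum f k - psum f n) + f k)%C by ring.
  apply: Rle_trans (Cmod_triangle _ _) _. have := H k. lra.
Qed.

Lemma CSeries_eq f l : Ccvg (psum f) l -> CSeries f = l.
Proof.
  move=> H.
  have K : forall g : C -> R, (forall z w, g (z + w)%C = g z + g w) -> g 0%C = 0 -> (forall z w, Rabs (g z - g w) <= Cmod (z - w)%C) ->
     Series (fun m => g (f m)) = g l.
  { move=> g g1 g0 g2. apply: is_series_unique.
    have E : forall n, sum_n (fun m => g (f m)) n = g (psum f (S n)).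
    { elim=> [|n IH]; first by rewrite sum_O /= g1 g0; ring.
      rewrite sum_Sn IH /plus /= !g1. ring. }
    apply: (filterlim_ext (fun n => g (psum f (S n)))); first by move=> n; rewrite E.
    apply (is_lim_seq_incr_1 (fun n => g (psum f n)) (g l)).
    apply is_lim_seq_spec => e. have [N HN] := H e (cond_pos e).
    exists N => n Hn. apply: Rle_lt_trans (g2 _ _) _. exact: HN. }
  rewrite /CSeries (K Re) //; last by move=> z w; exact: (Re_le_Cmod (z - w)%C).
  rewrite (K Im) //; last by move=> z w; exact: (Im_le_Cmod (z - w)%C).
  by case: (l).
Qed.

Lemma CSeries_dom f B S0 : dom_sum B S0 -> (forall n, Cmod (f n) <= B n) ->
  Ccvg (psum f) (CSeries f) /\ forall n, Cmod (psum f n - CSeries f)%C <= S0 - rpsum B n.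
Proof.
  move=> [B0 [B1 B2]] H.
  have [l Hl] : exists l, Ccvg (psum f) l.
  { apply: Ccauchy_cvg => e He. have [N HN] := B2 e He.
    exists N => n m Hn Hm.
    have W : forall a b, (N <= a)%nat -> (a <= b)%nat -> Cmod (psum f b - psum f a)%C < e.
    { move=> a b ha hab. have := psum_minus_norm f B a b H hab. have := HN a ha. have := B1 b. lra. }
    case: (Nat.le_ge_cases n m) => h; last exact: W. rewrite Cmod_minus_sym. exact: W. }
  have E := CSeries_eq _ _ Hl. rewrite E. split => // n.
  apply: Rnot_lt_le => h.
  have [N HN] := Hl (Cmod (psum f n - l)%C - (S0 - rpsum B n)) ltac:(lra).
  have := HN (N + n)%nat ltac:(lia). have := psum_minus_norm f B n (N + n)%nat H ltac:(lia). have := B1 (N + n)%nat.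
  have := Cmod_triangle3 (psum f n) l (psum f (N + n)%nat). rewrite (Cmod_minus_sym (psum f n) (psum f (N + n)%nat)). lra.
Qed.

Lemma CSeries_norm f B S0 : dom_sum B S0 -> (forall n, Cmod (f n) <= B n) -> Cmod (CSeries f) <= S0.
Proof.
  move=> HB H. have [_ K] := CSeries_dom f B S0 HB H. have := K O. rewrite /= Cmod_minus_sym.
  have -> : (CSeries f - 0 = CSeries f)%C by ring. lra.
Qed.

Lemma CSeries_ext f g : (forall n, f n = g n) -> CSeries f = CSeries g.
Proof. move=> H. rewrite /CSeries. by congr (_, _); apply: Series_ext => n; rewrite H. Qed.

Lemma Ccvg_plus u v l m : Ccvg u l -> Ccvg v m -> Ccvg (fun n => u n + v n)%C (l + m)%C.
Proof.
  move=> H K e He. have [N1 H1] := H (e / 2) ltac:(lra). have [N2 H2] := K (e / 2) ltac:(lra).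
  exists (N1 + N2)%nat => n Hn. have := H1 n ltac:(lia). have := H2 n ltac:(lia).
  have -> : (u n + v n - (l + m) = (u n - l) + (v n - m))%C by ring.
  have := Cmod_triangle (u n - l)%C (v n - m)%C. lra.
Qed.

Lemma Ccvg_scal (c : C) u l : Ccvg u l -> Ccvg (fun n => c * u n)%C (c * l)%C.
Proof.
  move=> H e He. have c0 := Cmod_ge_0 c.
  have [N HN] := H (e / (Cmod c + 1)) ltac:(apply: Rdiv_lt_0_compat; lra).
  exists N => n Hn. have -> : (c * u n - c * l = c * (u n - l))%C by ring. rewrite Cmod_mult.
  have := HN n Hn. have := Cmod_ge_0 (u n - l)%C.
  have E1 : e = (Cmod c + 1) * (e / (Cmod c + 1)) by field; lra.
  have : 0 < e / (Cmod c + 1) by apply: Rdiv_lt_0_compat; lra. move: (e / (Cmod c + 1)) E1 => q -> q0 h1 h2.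
  have : Cmod c * Cmod (u n - l)%C <= Cmod c * q by apply: Rmult_le_compat_l; lra. lra.
Qed.

Lemma Ccvg_ext u v l : (forall n, u n = v n) -> Ccvg u l -> Ccvg v l.
Proof. move=> E H e He. have [N HN] := H e He. exists N => n Hn. rewrite -E. exact: HN. Qed.

Lemma psum_ext f g n : (forall n, f n = g n) -> psum f n = psum g n.
Proof. move=> H. elim: n => [//|n IH] /=. by rewrite IH H. Qed.

Lemma psum_plus f g n : psum (fun k => f k + g k)%C n = (psum f n + psum g n)%C.
Proof. elim: n => [|n IH] /=; first ring. rewrite IH. ring. Qed.

Lemma psum_scal (c : C) f n : psum (fun k => c * f k)%C n = (c * psum f n)%C.
Proof. elim: n => [|n IH] /=; first ring. rewrite IH. ring. Qed.

Lemma CSeries_plus f g l m : Ccvg (psum f) l -> Ccvg (psum g) m -> CSeries (fun k => f k + g k)%C = (l + m)%C.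
Proof. move=> H K. apply: CSeries_eq. apply: Ccvg_ext (Ccvg_plus _ _ _ _ H K) => n. by rewrite psum_plus. Qed.

Lemma CSeries_scal (c : C) f l : Ccvg (psum f) l -> CSeries (fun k => c * f k)%C = (c * l)%C.
Proof. move=> H. apply: CSeries_eq. apply: Ccvg_ext (Ccvg_scal c _ _ H) => n. by rewrite psum_scal. Qed.

Lemma dom_sum_ex_series B S0 : dom_sum B S0 -> ex_series B.
Proof.
  move=> [B0 [B1 B2]]. exists S0.
  have E : forall n, sum_n B n = rpsum B (S n).
  { elim=> [|n IH]; first by rewrite sum_O /=; ring. rewrite sum_Sn IH /plus /=. ring. }
  apply: (filterlim_ext (fun n => rpsum B (S n))); first by move=> n; rewrite E.
  apply (is_lim_seq_incr_1 (fun n => rpsum B n) S0).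
  apply is_lim_seq_spec => e. have [N HN] := B2 e (cond_pos e).
  exists N => n Hn. have := HN n Hn. have := B1 n. rewrite Rabs_minus_sym. move=> h1 h2. rewrite Rabs_pos_eq; lra.
Qed.

(** Weierstrass' theorem. By [slope_lip] the difference quotients of [f n] are Lipschitz with
    constant [4 * B n / (r * r)], and these constants are summable. *)
Lemma CSeries_holo (f : nat -> C -> C) (z : C) r B S0 : 0 < r -> dom_sum B S0 ->
  (forall n w, Cmod (w - z)%C <= r -> cdiff (f n) w) -> (forall n w, Cmod (w - z)%C <= r -> Cmod (f n w) <= B n) ->
  cdiff (fun w => CSeries (fun n => f n w)) z.
Proof.
  move=> Hr HB Hd Hb.
  have rr : 0 < r * r by apply: Rmult_lt_0_compat.
  have S1 := dom_sum_ge0 _ _ HB.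
  have K0 : 0 <= 4 / (r * r) by apply: Rlt_le; apply: Rdiv_lt_0_compat; lra.
  apply: (cdiff_of_slope_lipschitz _ z (r / 2) (4 / (r * r) * S0)); first lra.
  { exact: Rmult_le_pos. }
  move=> h h' Hh Hh'.
  have h0 : h <> 0%C by apply: Cmod_pos_neq0; lra. have h0' : h' <> 0%C by apply: Cmod_pos_neq0; lra.
  have zh : forall k : C, (z + k - z = k)%C by move=> k; ring.
  have cv : forall w, Cmod (w - z)%C <= r -> Ccvg (psum (fun n => f n w)) (CSeries (fun n => f n w)).
  { move=> w Hw. apply: (proj1 (CSeries_dom _ B S0 HB _)) => n. exact: Hb. }
  have c0 := cv z ltac:(rewrite Cmod_self; lra). have c1 := cv (z + h)%C ltac:(rewrite zh; lra). have c2 := cv (z + h')%C ltac:(rewrite zh; lra).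
  have E : ((CSeries (fun n => f n (z + h)) - CSeries (fun n => f n z)) / h - (CSeries (fun n => f n (z + h')) - CSeries (fun n => f n z)) / h')%C
    = CSeries (fun n => (f n (z + h) - f n z) / h - (f n (z + h') - f n z) / h')%C.
  { symmetry. apply: CSeries_eq.
    have c3 := Ccvg_plus _ _ _ _ (Ccvg_plus _ _ _ _ (Ccvg_scal (/ h)%C _ _ c1) (Ccvg_scal (- / h + / h')%C _ _ c0)) (Ccvg_scal (- / h')%C _ _ c2).
    have -> : ((CSeries (fun n => f n (z + h)) - CSeries (fun n => f n z)) / h - (CSeries (fun n => f n (z + h')) - CSeries (fun n => f n z)) / h')%C
     = (/ h * CSeries (fun n => f n (z + h)) + (- / h + / h') * CSeries (fun n => f n z) + - / h' * CSeries (fun n => f n (z + h')))%C by field.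
    apply: Ccvg_ext c3 => n. rewrite -!psum_scal -!psum_plus. apply: psum_ext => k. field. by split. }
  rewrite E.
  have HB' := dom_sum_scal B S0 (4 / (r * r) * (Cmod h + Cmod h')) ltac:(apply: Rmult_le_pos; lra) HB.
  have -> : 4 / (r * r) * S0 * (Cmod h + Cmod h') = 4 / (r * r) * (Cmod h + Cmod h') * S0 by ring.
  apply: (CSeries_norm _ _ _ HB') => n.
  have [l Hl] := proj1 (cdiff_cderiv _ _) (Hd n z ltac:(rewrite Cmod_self; lra)).
  have nz : forall k : C, k <> 0%C -> (z + k)%C <> z by move=> k Hk Q; apply: Hk; rewrite -(zh k) Q; ring.
  have SL := slope_lip (f n) z r (B n) l (z + h)%C (z + h')%C Hr ltac:(move=> w Hw; exact: Hd)
    ltac:(move=> t Ht; apply: Hb; rewrite Cmod_circ_minus; lra) (nz h h0) (nz h' h0') ltac:(rewrite zh; lra) ltac:(rewrite zh; lra).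
  rewrite !slope_neq in SL; try exact: nz. rewrite !zh in SL. apply: Rle_trans SL _.
  have -> : (z + h - (z + h') = h - h')%C by ring.
  have -> : 4 / (r * r) * (Cmod h + Cmod h') * B n = 4 * B n / (r * r) * (Cmod h + Cmod h') by field; lra.
  apply: Rmult_le_compat_l; last exact: Cmod_triangle_minus.
  have := (proj1 HB) n => b0. apply: Rmult_le_pos; first lra. apply: Rlt_le; exact: Rinv_0_lt_compat.
Qed.

(** The terms are [(i + 1)^(-1-k)]. From the second on, the term with base [x + 1] is at most
    [(x^(-k) - (x + 1)^(-k)) / k], and these differences telescope. *)
Lemma zeta_terms_summable k : 0 < k -> exists S0, dom_sum (fun i => exp (- (1 + k) * ln (INR i + 1))) S0.
Proof.
  move=> Hk. apply: (bounded_dom_sum _ (1 + 1 / k)); first by move=> n; apply: Rlt_le; exact: exp_pos.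
  have T : forall n, rpsum (fun i => exp (- (1 + k) * ln (INR i + 1))) (S n) <= 1 + 1 / k * (1 - exp (- k * ln (INR n + 1))).
  { elim=> [|n IH].
    - rewrite /= Rplus_0_l !Rplus_0_l ln_1 !Rmult_0_r exp_0. lra.
    - rewrite [rpsum _ _]/= -/(rpsum _ (S n)). change (rpsum (fun i => exp (- (1 + k) * ln (INR i + 1))) (S n) + exp (- (1 + k) * ln (INR (S n) + 1)) <= 1 + 1 / k * (1 - exp (- k * ln (INR (S n) + 1)))).
      suff : exp (- (1 + k) * ln (INR (S n) + 1)) <= 1 / k * (exp (- k * ln (INR n + 1)) - exp (- k * ln (INR (S n) + 1))) by lra.
      rewrite S_INR. have p := pos_INR n. set x := INR n + 1. have x1 : 1 <= x by rewrite /x; lra.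
      have L : ln (x / (x + 1)) <= - / (x + 1).
      { have q : 0 < x / (x + 1) by apply: Rdiv_lt_0_compat; lra.
        have := exp_ineq1_le (ln (x / (x + 1))). rewrite exp_ln // => h.
        have : x / (x + 1) = 1 - / (x + 1) by field; lra. lra. }
      rewrite Rcomplements.ln_div in L; try lra.
      set v := exp (- k * ln (x + 1)).
      have E1 : exp (- (1 + k) * ln (x + 1)) = v / (x + 1).
      { have -> : - (1 + k) * ln (x + 1) = - k * ln (x + 1) + - ln (x + 1) by ring. rewrite exp_plus exp_Ropp exp_ln; [done|lra]. }
      have E2 : exp (- k * ln x) = v * exp (k * (ln (x + 1) - ln x)).
      { rewrite /v -exp_plus. congr exp. ring. }
      rewrite E1 E2.
      have L2 : / (x + 1) <= ln (x + 1) - ln x by lra.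
      have := exp_ineq1_le (k * (ln (x + 1) - ln x)) => L3.
      have v0 : 0 < v by exact: exp_pos.
      apply: (Rmult_le_reg_l k) => //.
      have -> : k * (1 / k * (v * exp (k * (ln (x + 1) - ln x)) - v)) = v * (exp (k * (ln (x + 1) - ln x)) - 1) by field; lra.
      have -> : k * (v / (x + 1)) = v * (k * / (x + 1)) by field; lra.
      apply: Rmult_le_compat_l; first lra. nra. }
  have k1 : 0 < 1 / k by apply: Rdiv_lt_0_compat; lra.
  case=> [|n]; first by rewrite /=; lra.
  apply: Rle_trans (T n) _.
  have := exp_pos (- k * ln (INR n + 1)). nra.
Qed.

(** * Absolutely convergent integrals over the real line *)

Definition is_LI (f : R -> C) (l : C) : Prop :=
  forall e, 0 < e -> exists A, 0 < A /\ forall a b, a <= - A -> A <= b -> Cmod (CI f a b - l)%C < e.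

(* Meaningful for the integrands satisfying [ldom] below, for which the limit exists. *)
Definition LI (f : R -> C) : C := epsilon (inhabits (RtoC 0)) (is_LI f).

(** The constant [K] acts as a norm: [Cmod (LI f) <= 4 * K] by [LI_norm], and [K] adds up under sums
    and series of integrands. *)
Definition ldom (f : R -> C) (K : R) : Prop :=
  (forall a b, exCI f a b) /\ forall x, Cmod (f x) <= K / (1 + x * x).

Lemma is_LI_unique f l l' : is_LI f l -> is_LI f l' -> l = l'.
Proof.
  move=> H H'. apply: C_eq_small => e He.
  have [A [HA K]] := H (e / 2) ltac:(lra). have [A' [HA' K']] := H' (e / 2) ltac:(lra).
  have := K (- (A + A')) (A + A') ltac:(lra) ltac:(lra). have := K' (- (A + A')) (A + A') ltac:(lra) ltac:(lra).
  have := Cmod_triangle3 l l' (CI f (- (A + A')) (A + A')). rewrite (Cmod_minus_sym l (CI _ _ _)). lra.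
Qed.

Lemma LI_eq f l : is_LI f l -> LI f = l.
Proof. move=> H. apply: (is_LI_unique f) => //. exact: (epsilon_spec (inhabits (RtoC 0)) (is_LI f) (ex_intro _ l H)). Qed.

Lemma ldom_K_ge0 f K : ldom f K -> 0 <= K.
Proof. move=> [_ H]. have := H 0. have := Cmod_ge_0 (f 0). have -> : K / (1 + 0 * 0) = K by field. lra. Qed.

Lemma is_RInt_inv_sq (K a b : R) : a <= b -> (0 < a \/ b < 0) -> is_RInt (fun x => K / (x * x)) a b (K / a - K / b).
Proof.
  move=> Hab H.
  have -> : K / a - K / b = minus (- K / b) (- K / a) by rewrite /minus /plus /opp /=; field; lra.
  apply: (is_RInt_derive (V := R_CompleteNormedModule) (fun x => - K / x)) => x; rewrite Rmin_left // Rmax_right // => Hx.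
  - have x0 : x <> 0 by lra. auto_derive => //. field. lra.
  - have x0 : x <> 0 by lra. apply: (ex_derive_continuous (V := R_NormedModule)). auto_derive. nra.
Qed.

Lemma ldom_tail f K a b : ldom f K -> a <= b -> (0 < a \/ b < 0) -> Cmod (CI f a b) <= K / a - K / b.
Proof.
  move=> H Hab Ha. have K0 := ldom_K_ge0 _ _ H. case: H => [H1 H2].
  apply: (CI_norm_le f (fun x => K / (x * x)) a b) => //; first exact: is_RInt_inv_sq.
  move=> x Hx. apply: Rle_trans (H2 x) _. apply: Rmult_le_compat_l => //. apply: Rinv_le_contravar; nra.
Qed.

(** The interval [[-1, 1]] contributes [2 K] and each tail at most [K]. *)
Lemma ldom_window f K a b : ldom f K -> a <= -1 -> 1 <= b -> Cmod (CI f a b) <= 4 * K.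
Proof.
  move=> H Ha Hb. have K0 := ldom_K_ge0 _ _ H.
  have T1 := ldom_tail f K a (-1) H ltac:(lra) ltac:(lra). have T2 := ldom_tail f K 1 b H ltac:(lra) ltac:(lra).
  have T3 : Cmod (CI f (-1) 1) <= K * (1 - -1).
  { case: H => [H1 H2]. apply: CI_norm => //; first lra. move=> x _. apply: Rle_trans (H2 x) _.
    have -> : K = K / 1 by field. have -> : K / 1 / (1 + x * x) = K / (1 + x * x) by field; nra.
    apply: Rmult_le_compat_l => //. apply: Rinv_le_contravar; nra. }
  case: H => [H1 _]. rewrite (CI_Chasles f a (-1) b) // (CI_Chasles f (-1) 1 b) //.
  apply: Rle_trans (Cmod_triangle _ _) _. apply: Rle_trans (Rplus_le_compat_l _ _ _ (Cmod_triangle _ _)) _.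
  have : K / a <= 0.
  { have := Rinv_lt_0_compat a ltac:(lra). rewrite /Rdiv. nra. }
  have : 0 <= K / b. { apply: Rmult_le_pos => //. apply: Rlt_le; apply: Rinv_0_lt_compat; lra. }
  move: T1 T2. have -> : K / -1 = - K by field. have -> : K / 1 = K by field. lra.
Qed.

Lemma is_LI_LI f K : ldom f K -> is_LI f (LI f).
Proof.
  move=> H. have K0 := ldom_K_ge0 _ _ H.
  suff [l Hl] : exists l, is_LI f l by rewrite (LI_eq _ _ Hl).
  have W : forall A a b a' b', 0 < A -> a <= - A -> A <= b -> a' <= - A -> A <= b' -> Cmod (CI f a b - CI f a' b')%C <= 4 * (K / A).
  { have inv : forall A x, 0 < A -> A <= x -> 0 <= K / x <= K / A.
    { move=> A x HA Hx. split. apply: Rmult_le_pos => //. apply: Rlt_le; apply: Rinv_0_lt_compat; lra.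
      apply: Rmult_le_compat_l => //. apply: Rinv_le_contravar; lra. }
    have P : forall A b b', 0 < A -> A <= b -> A <= b' -> Cmod (CI f b b') <= K / A.
    { move=> A b b' HA Hb Hb'. have := inv A b HA Hb. have := inv A b' HA Hb'.
      case: (Rle_lt_dec b b') => h.
      - have := ldom_tail f K b b' H h ltac:(lra). lra.
      - have := ldom_tail f K b' b H ltac:(lra) ltac:(lra). rewrite (CI_swap f b b'); last exact: (proj1 H). rewrite Cmod_opp. lra. }
    have N : forall A b b', 0 < A -> b <= - A -> b' <= - A -> Cmod (CI f b b') <= K / A.
    { move=> A b b' HA Hb Hb'. have := inv A (- b) HA ltac:(lra). have := inv A (- b') HA ltac:(lra).
      have -> : K / - b = - (K / b) by field; lra. have -> : K / - b' = - (K / b') by field; lra.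
      case: (Rle_lt_dec b b') => h.
      - have := ldom_tail f K b b' H h ltac:(lra). lra.
      - have := ldom_tail f K b' b H ltac:(lra) ltac:(lra). rewrite (CI_swap f b b'); last exact: (proj1 H). rewrite Cmod_opp. lra. }
    move=> A a b a' b' HA h1 h2 h3 h4.
    rewrite (CI_Chasles f a a' b) ?(CI_Chasles f a' b b'); try exact: (proj1 H).
    have -> : (CI f a a' + CI f a' b - (CI f a' b + CI f b b') = CI f a a' - CI f b b')%C by ring.
    apply: Rle_trans (Cmod_triangle_minus _ _) _.
    have := P A b b' HA h2 h4. have := N A a a' HA h1 h3. have := inv A A HA ltac:(lra). lra. }
  have ka : forall e, 0 < e -> 4 * (K / (4 * (K + 1) / e)) < e.
  { move=> e He. apply: (Rmult_lt_reg_r ((K + 1) / e)); first by apply: Rdiv_lt_0_compat; lra.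
    have -> : 4 * (K / (4 * (K + 1) / e)) * ((K + 1) / e) = K by field; lra.
    have -> : e * ((K + 1) / e) = K + 1 by field; lra. lra. }
  have [l Hl] : exists l, Ccvg (fun n => CI f (- INR n) (INR n)) l.
  { apply: Ccauchy_cvg => e He. set A := 4 * (K + 1) / e. have A0 : 0 < A by apply: Rdiv_lt_0_compat; lra.
    have [N HN] := INR_unbounded A. exists N => n m Hn Hm.
    have := le_INR _ _ Hn. have := le_INR _ _ Hm => *.
    apply: Rle_lt_trans (W A _ _ _ _ A0 _ _ _ _) _; try lra. exact: ka. }
  exists l => e He. set A := 4 * (K + 1) / (e / 2). have A0 : 0 < A by apply: Rdiv_lt_0_compat; lra.
  exists A. split => // a b Ha Hb.
  have [N HN] := Hl (e / 2) ltac:(lra). have [M HM] := INR_unbounded A.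
  have := HN (N + M)%nat ltac:(lia). have : INR M <= INR (N + M) by apply: le_INR; lia. move=> h1 h2.
  have := W A a b (- INR (N + M)) (INR (N + M)) A0 Ha Hb ltac:(lra) ltac:(lra). have := ka (e / 2) ltac:(lra). rewrite -/A.
  have := Cmod_triangle3 (CI f a b) l (CI f (- INR (N + M)) (INR (N + M))). lra.
Qed.

Lemma LI_norm f K : ldom f K -> Cmod (LI f) <= 4 * K.
Proof.
  move=> H. apply: Rnot_lt_le => h.
  have [A [HA W]] := is_LI_LI f K H (Cmod (LI f) - 4 * K) ltac:(lra).
  have := W (- (A + 1)) (A + 1) ltac:(lra) ltac:(lra). have := ldom_window f K (- (A + 1)) (A + 1) H ltac:(lra) ltac:(lra).
  have := Cmod_triangle_rev_minus (LI f) (CI f (- (A + 1)) (A + 1)). rewrite (Cmod_minus_sym (LI f)). lra.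
Qed.

Lemma is_LI_ext f g l : (forall x, f x = g x) -> is_LI f l -> is_LI g l.
Proof. move=> E H e He. have [A [HA W]] := H e He. exists A. split => // a b Ha Hb. rewrite -(CI_ext_all f g) //. exact: W. Qed.

Lemma LI_ext f g : (forall x, f x = g x) -> LI f = LI g.
Proof. move=> E. rewrite /LI. congr epsilon. apply: functional_extensionality_dep => l. apply: propositional_extensionality. split; apply: is_LI_ext => //. Qed.

Lemma is_LI_plus f g l m K K' : ldom f K -> ldom g K' -> is_LI f l -> is_LI g m -> is_LI (fun x => f x + g x)%C (l + m)%C.
Proof.
  move=> Df Dg Hf Hg e He. have [A [HA W]] := Hf (e / 2) ltac:(lra). have [A' [HA' W']] := Hg (e / 2) ltac:(lra).
  exists (A + A'). split; first lra. move=> a b Ha Hb. rewrite CI_plus; [|exact: (proj1 Df)|exact: (proj1 Dg)].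
  have -> : (CI f a b + CI g a b - (l + m) = (CI f a b - l) + (CI g a b - m))%C by ring.
  apply: Rle_lt_trans (Cmod_triangle _ _) _. have := W a b ltac:(lra) ltac:(lra). have := W' a b ltac:(lra) ltac:(lra). lra.
Qed.

Lemma is_LI_scal (c : C) f l K : ldom f K -> is_LI f l -> is_LI (fun x => c * f x)%C (c * l)%C.
Proof.
  move=> Df Hf e He. have c0 := Cmod_ge_0 c.
  have [A [HA W]] := Hf (e / (Cmod c + 1)) ltac:(apply: Rdiv_lt_0_compat; lra).
  exists A. split => // a b Ha Hb. rewrite CI_scal; last exact: (proj1 Df).
  have -> : (c * CI f a b - c * l = c * (CI f a b - l))%C by ring. rewrite Cmod_mult.
  have := W a b Ha Hb. have := Cmod_ge_0 (CI f a b - l)%C.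
  have E1 : e = (Cmod c + 1) * (e / (Cmod c + 1)) by field; lra.
  have : 0 < e / (Cmod c + 1) by apply: Rdiv_lt_0_compat; lra. move: (e / (Cmod c + 1)) E1 => q -> q0 h1 h2.
  have : Cmod c * Cmod (CI f a b - l)%C <= Cmod c * q by apply: Rmult_le_compat_l; lra. lra.
Qed.

Lemma ldom_plus f g K K' : ldom f K -> ldom g K' -> ldom (fun x => f x + g x)%C (K + K').
Proof.
  move=> [H1 H2] [G1 G2]. split; first by move=> a b; exact: exCI_plus.
  move=> x. apply: Rle_trans (Cmod_triangle _ _) _. have := H2 x. have := G2 x.
  have -> : (K + K') / (1 + x * x) = K / (1 + x * x) + K' / (1 + x * x) by field; nra. lra.
Qed.

Lemma ldom_scal (c : C) f K : ldom f K -> ldom (fun x => c * f x)%C (Cmod c * K).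
Proof.
  move=> [H1 H2]. split; first by move=> a b; exact: exCI_scal.
  move=> x. rewrite Cmod_mult /Rdiv Rmult_assoc. apply: Rmult_le_compat_l; first exact: Cmod_ge_0. exact: H2.
Qed.

Lemma ldom_ext f g K : (forall x, f x = g x) -> ldom f K -> ldom g K.
Proof.
  move=> E [H1 H2]. split; last by move=> x; rewrite -E.
  move=> a b. apply: (exCI_ext f) => //.
Qed.

Lemma ldom_minus f g K K' : ldom f K -> ldom g K' -> ldom (fun x => f x - g x)%C (K + K').
Proof.
  move=> H G. apply: (ldom_ext (fun x => f x + - (1) * g x)%C); first by move=> x; ring.
  have -> : K + K' = K + Cmod (- (1))%C * K' by rewrite Cmod_m1; ring.
  apply: ldom_plus => //. exact: ldom_scal.
Qed.

Lemma LI_plus f g K K' : ldom f K -> ldom g K' -> LI (fun x => f x + g x)%C = (LI f + LI g)%C.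
Proof. move=> H G. apply: LI_eq. apply: (is_LI_plus _ _ _ _ K K') => //; [exact: is_LI_LI H|exact: is_LI_LI G]. Qed.

Lemma LI_scal (c : C) f K : ldom f K -> LI (fun x => c * f x)%C = (c * LI f)%C.
Proof. move=> H. apply: LI_eq. apply: (is_LI_scal _ _ _ K) => //. exact: is_LI_LI H. Qed.

Lemma LI_minus f g K K' : ldom f K -> ldom g K' -> LI (fun x => f x - g x)%C = (LI f - LI g)%C.
Proof.
  move=> H G. rewrite (LI_ext _ (fun x => f x + - (1) * g x)%C); last by move=> x; ring.
  rewrite (LI_plus _ _ K (Cmod (- (1))%C * K')) //; last exact: ldom_scal.
  rewrite (LI_scal _ _ K') //. ring.
Qed.

Lemma is_LI_translate f l c : (forall a b, exCI f a b) -> is_LI f l -> is_LI (fun x => f (x + c)) l.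
Proof.
  move=> Hx H e He. have [A [HA W]] := H e He. have c0 := Rabs_pos c.
  exists (A + Rabs c). split; first lra. move=> a b Ha Hb.
  have E : CI (fun x => f (x + c)) a b = CI f (a + c) (b + c).
  { have -> : a + c = 1 * a + c by ring. have -> : b + c = 1 * b + c by ring.
    apply: CI_eq. have := isCI_comp_lin f 1 c a b _ (isCI_CI f _ _ (Hx _ _)).
    apply: isCI_ext => x _. rewrite Cmult_1_l. congr f. ring. }
  rewrite E. have := Rabs_le_between c (Rabs c) => [[B _]]. have {}B := B (Rle_refl _). apply: W; lra.
Qed.

Lemma is_LI_dilate f l u : 0 < u -> (forall a b, exCI f a b) -> is_LI f l -> is_LI (fun x => RtoC u * f (u * x)%R)%C l.
Proof.
  move=> Hu Hx H e He. have [A [HA W]] := H e He.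
  exists (A / u). split; first exact: Rdiv_lt_0_compat. move=> a b Ha Hb.
  have E : CI (fun x => RtoC u * f (u * x)%R)%C a b = CI f (u * a) (u * b).
  { have -> : u * a = u * a + 0 by ring. have -> : u * b = u * b + 0 by ring.
    apply: CI_eq. have := isCI_comp_lin f u 0 a b _ (isCI_CI f _ _ (Hx _ _)).
    apply: isCI_ext => x _. by rewrite Rplus_0_r. }
  have E1 : A = u * (A / u) by field; lra.
  rewrite E. apply: W; rewrite E1; nra.
Qed.

Lemma is_LI_FTC (F f : R -> C) (L L' : C) : (forall x, rderiv F x (f x)) -> (forall x, rcont f x) ->
  (forall e, 0 < e -> exists A, 0 < A /\ forall x, A <= x -> Cmod (F x - L)%C < e) ->
  (forall e, 0 < e -> exists A, 0 < A /\ forall x, x <= - A -> Cmod (F x - L')%C < e) ->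
  is_LI f (L - L')%C.
Proof.
  move=> HF Hf HL HL' e He. have [A [HA W]] := HL (e / 2) ltac:(lra). have [A' [HA' W']] := HL' (e / 2) ltac:(lra).
  exists (A + A'). split; first lra. move=> a b Ha Hb. rewrite (CI_FTC F) //; last lra.
  have -> : (F b - F a - (L - L') = (F b - L) - (F a - L'))%C by ring.
  apply: Rle_lt_trans (Cmod_triangle_minus _ _) _. have := W b ltac:(lra). have := W' a ltac:(lra). lra.
Qed.

Lemma one_plus_sq_le_exp d x : 0 < d -> d <= 1 -> 1 + x * x <= 4 / (d * d) * exp (d * Rabs x).
Proof.
  move=> Hd Hd1.
  have E : exp (d * Rabs x) = exp (d * Rabs x / 2) * exp (d * Rabs x / 2) by rewrite -exp_plus; congr exp; field.
  have := exp_ineq1_le (d * Rabs x / 2). have x0 := Rabs_pos x. set y := d * Rabs x / 2 => h.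
  have y0 : 0 <= y by rewrite /y; nra.
  have h2 : 1 + y * y <= exp (d * Rabs x) by rewrite E -/y; nra.
  have dd : 0 < d * d by nra.
  apply: (Rmult_le_reg_l (d * d)) => //. rewrite -Rmult_assoc.
  have -> : d * d * (4 / (d * d)) = 4 by field; lra.
  have xx : x * x = Rabs x * Rabs x by rewrite -Rabs_mult Rabs_pos_eq; nra.
  have yy : 4 * (y * y) = d * d * (x * x) by rewrite xx /y; field.
  nra.
Qed.

Lemma exp_decay_dom (v : R) C0 d x : 0 < d -> d <= 1 -> 0 <= C0 -> v <= C0 * exp (d * x) -> v <= C0 * exp (- d * x) ->
  v <= C0 * (4 / (d * d)) / (1 + x * x).
Proof.
  move=> Hd Hd1 HC h1 h2.
  have h3 : v <= C0 * exp (- (d * Rabs x)).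
  { rewrite /Rabs. case: Rcase_abs => h.
    - have -> : - (d * - x) = d * x by ring. exact: h1.
    - have -> : - (d * x) = - d * x by ring. exact: h2. }
  have := one_plus_sq_le_exp d x Hd Hd1 => h4.
  have p : 0 < 1 + x * x by nra. have q := exp_pos (d * Rabs x).
  apply: Rle_trans h3 _. rewrite /Rdiv Rmult_assoc. apply: Rmult_le_compat_l => //.
  rewrite exp_Ropp. apply: (Rmult_le_reg_r ((1 + x * x) * exp (d * Rabs x))); first exact: Rmult_lt_0_compat.
  have -> : / exp (d * Rabs x) * ((1 + x * x) * exp (d * Rabs x)) = 1 + x * x by field; lra.
  have -> : 4 * / (d * d) * / (1 + x * x) * ((1 + x * x) * exp (d * Rabs x)) = 4 / (d * d) * exp (d * Rabs x) by field; split; nra.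
  exact: h4.
Qed.

Lemma ldom_exp (f : R -> C) C0 d : 0 < d -> d <= 1 -> 0 <= C0 -> (forall a b, exCI f a b) ->
  (forall x, Cmod (f x) <= C0 * exp (d * x)) -> (forall x, Cmod (f x) <= C0 * exp (- d * x)) ->
  ldom f (C0 * (4 / (d * d))).
Proof. move=> Hd Hd1 HC Hx h1 h2. split => // x. exact: exp_decay_dom. Qed.

(** As for series: at each [x] the quotients of the integrand are Lipschitz with constant
    [4 / (r * r)] times [K / (1 + x * x)], and this bound is integrated. *)
Lemma LI_holo (k : C -> R -> C) (z : C) r K : 0 < r ->
  (forall x w, Cmod (w - z)%C <= r -> cdiff (fun w => k w x) w) -> (forall w, Cmod (w - z)%C <= r -> ldom (k w) K) ->
  cdiff (fun w => LI (k w)) z.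
Proof.
  move=> Hr Hd Hk.
  have rr : 0 < r * r by apply: Rmult_lt_0_compat.
  have zz : Cmod (z - z)%C <= r by rewrite Cmod_self; lra.
  have K0 := ldom_K_ge0 _ _ (Hk z zz).
  have K4 : 0 <= 4 / (r * r) by apply: Rlt_le; apply: Rdiv_lt_0_compat; lra.
  apply: (cdiff_of_slope_lipschitz _ z (r / 2) (4 * (4 / (r * r) * K))); first lra.
  { apply: Rmult_le_pos; first lra. exact: Rmult_le_pos. }
  move=> h h' Hh Hh'.
  have h0 : h <> 0%C by apply: Cmod_pos_neq0; lra. have h0' : h' <> 0%C by apply: Cmod_pos_neq0; lra.
  have zh : forall k : C, (z + k - z = k)%C by move=> q; ring.
  have D0 := Hk z zz. have D1 := Hk (z + h)%C ltac:(rewrite zh; lra). have D2 := Hk (z + h')%C ltac:(rewrite zh; lra).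
  set g := fun x => ((k (z + h) x - k z x) / h - (k (z + h') x - k z x) / h')%C.
  have Eg : forall x, g x = (/ h * k (z + h) x + ((- / h + / h') * k z x + - / h' * k (z + h') x))%C.
  { move=> x. rewrite /g. field. by split. }
  have E : ((LI (k (z + h)) - LI (k z)) / h - (LI (k (z + h')) - LI (k z)) / h')%C = LI g.
  { rewrite (LI_ext _ _ Eg).
    rewrite (LI_plus _ _ _ _ (ldom_scal (/ h)%C _ _ D1) (ldom_plus _ _ _ _ (ldom_scal (- / h + / h')%C _ _ D0) (ldom_scal (- / h')%C _ _ D2))).
    rewrite (LI_plus _ _ _ _ (ldom_scal (- / h + / h')%C _ _ D0) (ldom_scal (- / h')%C _ _ D2)).
    rewrite (LI_scal _ _ K) // (LI_scal _ _ K) // (LI_scal _ _ K) //. field. by split. }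
  have Dg : ldom g (4 / (r * r) * (Cmod h + Cmod h') * K).
  { split.
    - have Dg0 := ldom_plus _ _ _ _ (ldom_scal (/ h)%C _ _ D1) (ldom_plus _ _ _ _ (ldom_scal (- / h + / h')%C _ _ D0) (ldom_scal (- / h')%C _ _ D2)).
      exact: (proj1 (ldom_ext _ _ _ (fun x => eq_sym (Eg x)) Dg0)).
    - move=> x.
      have [l Hl] := proj1 (cdiff_cderiv _ _) (Hd x z zz).
      have nz : forall k : C, k <> 0%C -> (z + k)%C <> z by move=> q Hq Q; apply: Hq; rewrite -(zh q) Q; ring.
      have SL := slope_lip (fun w => k w x) z r (K / (1 + x * x)) l (z + h)%C (z + h')%C Hr ltac:(move=> w Hw; exact: Hd)
        ltac:(move=> t Ht; apply: (proj2 (Hk _ _)); rewrite Cmod_circ_minus; lra) (nz h h0) (nz h' h0') ltac:(rewrite zh; lra) ltac:(rewrite zh; lra).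
      rewrite !slope_neq in SL; try exact: nz. rewrite !zh in SL. apply: Rle_trans SL _.
      have -> : (z + h - (z + h') = h - h')%C by ring.
      have px : 0 < 1 + x * x by nra.
      have -> : 4 / (r * r) * (Cmod h + Cmod h') * K / (1 + x * x) = 4 * (K / (1 + x * x)) / (r * r) * (Cmod h + Cmod h') by field; split; nra.
      apply: Rmult_le_compat_l; last exact: Cmod_triangle_minus.
      apply: Rmult_le_pos; last by apply: Rlt_le; exact: Rinv_0_lt_compat.
      apply: Rmult_le_pos; first lra. apply: Rmult_le_pos => //. apply: Rlt_le; exact: Rinv_0_lt_compat. }
  rewrite E. apply: Rle_trans (LI_norm _ _ Dg) _. apply: Req_le. ring.
Qed.

Lemma LI_psum (f : nat -> R -> C) (B : nat -> R) n : (forall i, ldom (f i) (B i)) ->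
  LI (fun x => psum (fun i => f i x) n) = psum (fun i => LI (f i)) n /\ ldom (fun x => psum (fun i => f i x) n) (rpsum B n).
Proof.
  move=> H. elim: n => [|n [IH1 IH2]] /=.
  - have D : ldom (fun _ => RtoC 0) 0.
    { split. move=> a b; apply: exCI_cont_all => x; exact: rcont_const. move=> x. rewrite Cmod_0 /Rdiv Rmult_0_l. lra. }
    split => //. apply: Cmod_le_0. have := LI_norm _ _ D. lra.
  - split; last exact: ldom_plus. by rewrite (LI_plus _ _ _ _ IH2 (H n)) IH1.
Qed.

(** The series minus its partial sum is dominated with constant [S0 - rpsum B n], so the integral of
    the difference is at most four times the tail. *)
Lemma LI_series (f : nat -> R -> C) B S0 : dom_sum B S0 -> (forall i, ldom (f i) (B i)) ->
  (forall a b, exCI (fun x => CSeries (fun i => f i x)) a b) ->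
  ldom (fun x => CSeries (fun i => f i x)) S0 /\
  LI (fun x => CSeries (fun i => f i x)) = CSeries (fun i => LI (f i)).
Proof.
  move=> HB H Hex.
  have HBx : forall x, dom_sum (fun i => / (1 + x * x) * B i) (/ (1 + x * x) * S0).
  { move=> x. apply: dom_sum_scal => //. apply: Rlt_le; apply: Rinv_0_lt_compat; nra. }
  have Hfx : forall x i, Cmod (f i x) <= / (1 + x * x) * B i by move=> x i; rewrite Rmult_comm; exact: (proj2 (H i)).
  have D : ldom (fun x => CSeries (fun i => f i x)) S0.
  { split => // x. rewrite /Rdiv Rmult_comm. exact: (CSeries_norm _ _ _ (HBx x) (Hfx x)). }
  split => //. symmetry. apply: CSeries_eq => e He.
  have [B0 [B1 B2]] := HB. have [N HN] := B2 (e / 5) ltac:(lra). exists N => n Hn.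
  have [P1 P2] := LI_psum f B n H.
  rewrite -P1 -(LI_minus _ _ _ _ P2 D).
  suff T : ldom (fun x => psum (fun i => f i x) n - CSeries (fun i => f i x))%C (S0 - rpsum B n).
  { apply: Rle_lt_trans (LI_norm _ _ T) _. have := HN n Hn. lra. }
  split; first exact: (proj1 (ldom_minus _ _ _ _ P2 D)).
  move=> x. have := proj2 (CSeries_dom _ _ _ (HBx x) (Hfx x)) n.
  have -> : rpsum (fun i => / (1 + x * x) * B i) n = / (1 + x * x) * rpsum B n.
  { elim: (n) => [|m IH] /=; [ring|rewrite IH; ring]. }
  have -> : / (1 + x * x) * S0 - / (1 + x * x) * rpsum B n = (S0 - rpsum B n) / (1 + x * x) by rewrite /Rdiv; ring. done.
Qed.

(** * Mellin transforms, the Gamma function and its reflection formula *)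

Lemma Cmod_Cexp_R (s : C) (x : R) : Cmod (Cexp (s * RtoC x)) = exp (Re s * x).
Proof. rewrite Cmod_Cexp /=. congr exp. rewrite /Re. ring. Qed.

Lemma rcont_exp_lin (s : C) x : rcont (fun x => Cexp (s * RtoC x)) x.
Proof. rcont_tac. Qed.

Lemma rderiv_exp_lin (s : C) x : rderiv (fun x => Cexp (s * RtoC x)) x (s * Cexp (s * RtoC x))%C.
Proof.
  rewrite Cmult_comm. apply: (rderiv_comp Cexp (fun x => s * RtoC x)%C); first exact: cderiv_Cexp.
  have h := rderiv_scal s _ x _ (rderiv_id x). rewrite Cmult_1_r in h. exact: h.
Qed.

(* The Mellin transform [int_0^oo u^(s-1) g(ln u) du] in the variable [x = ln u]. *)
Definition Mel (g : R -> C) (s : C) : C := LI (fun x => Cexp (s * RtoC x) * g x)%C.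

Definition mel_int (g : R -> C) : Prop := forall (s : C) a b, exCI (fun x => Cexp (s * RtoC x) * g x)%C a b.

Lemma mel_int_cont g : (forall x, rcont g x) -> mel_int g.
Proof. move=> H s a b. apply: exCI_cont_all => x. apply: rcont_mult => //. exact: rcont_exp_lin. Qed.

Lemma mel_ldom g al be C0 d (s : C) : mel_int g -> 0 < d -> d <= 1 -> 0 <= C0 -> al + d <= Re s <= be - d ->
  (forall x, Cmod (g x) <= C0 * exp (- al * x)) -> (forall x, Cmod (g x) <= C0 * exp (- be * x)) ->
  ldom (fun x => Cexp (s * RtoC x) * g x)%C (C0 * (4 / (d * d))).
Proof.
  move=> Hi Hd Hd1 HC Hs Ha Hb.
  have M : forall a b, a <= b -> exp a <= exp b.
  { move=> a b [h|->]; [apply: Rlt_le; exact: exp_increasing|lra]. }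
  apply: ldom_exp; [exact: Hd|exact: Hd1|exact: HC|exact: (Hi s)| |].
  - move=> x. rewrite Cmod_mult Cmod_Cexp_R. case: (Rle_lt_dec 0 x) => hx.
    + apply: Rle_trans (Rmult_le_compat_l _ _ _ (Rlt_le _ _ (exp_pos _)) (Hb x)) _.
      have -> : exp (Re s * x) * (C0 * exp (- be * x)) = C0 * exp (Re s * x + - be * x) by rewrite exp_plus; ring.
      apply: Rmult_le_compat_l => //. apply: M. nra.
    + apply: Rle_trans (Rmult_le_compat_l _ _ _ (Rlt_le _ _ (exp_pos _)) (Ha x)) _.
      have -> : exp (Re s * x) * (C0 * exp (- al * x)) = C0 * exp (Re s * x + - al * x) by rewrite exp_plus; ring.
      apply: Rmult_le_compat_l => //. apply: M. nra.
  - move=> x. rewrite Cmod_mult Cmod_Cexp_R. case: (Rle_lt_dec 0 x) => hx.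
    + apply: Rle_trans (Rmult_le_compat_l _ _ _ (Rlt_le _ _ (exp_pos _)) (Hb x)) _.
      have -> : exp (Re s * x) * (C0 * exp (- be * x)) = C0 * exp (Re s * x + - be * x) by rewrite exp_plus; ring.
      apply: Rmult_le_compat_l => //. apply: M. nra.
    + apply: Rle_trans (Rmult_le_compat_l _ _ _ (Rlt_le _ _ (exp_pos _)) (Ha x)) _.
      have -> : exp (Re s * x) * (C0 * exp (- al * x)) = C0 * exp (Re s * x + - al * x) by rewrite exp_plus; ring.
      apply: Rmult_le_compat_l => //. apply: M. nra.
Qed.

(** In the variable [u = exp x] and for [al < be] this says [g = O(u^(-al))] at 0 and
    [g = O(u^(-be))] at infinity; the Mellin transform then converges in the strip
    [al < Re s < be]. *)
Definition mel_bounded (g : R -> C) (al be : R) : Prop :=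
  mel_int g /\ exists C0, 0 <= C0 /\ (forall x, Cmod (g x) <= C0 * exp (- al * x)) /\ (forall x, Cmod (g x) <= C0 * exp (- be * x)).

Lemma strip_margin al be x : al < x < be -> exists d, 0 < d /\ d <= 1 /\ al + 2 * d <= x <= be - 2 * d.
Proof.
  move=> H. exists (Rmin 1 (Rmin ((x - al) / 2) ((be - x) / 2))).
  have h1 := Rmin_l 1 (Rmin ((x - al) / 2) ((be - x) / 2)). have h2 := Rmin_r 1 (Rmin ((x - al) / 2) ((be - x) / 2)).
  have h3 := Rmin_l ((x - al) / 2) ((be - x) / 2). have h4 := Rmin_r ((x - al) / 2) ((be - x) / 2).
  split; last lra. repeat apply: Rmin_glb_lt; lra.
Qed.

Lemma mel_ldom_ex g al be (s : C) : mel_bounded g al be -> al < Re s < be -> exists K, ldom (fun x => Cexp (s * RtoC x) * g x)%C K.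
Proof.
  move=> [Hi [C0 [HC [Ha Hb]]]] Hs. have [d [d0 [d1 d2]]] := strip_margin _ _ _ Hs.
  exists (C0 * (4 / (d * d))). apply: (mel_ldom g al be) => //; lra.
Qed.

Lemma mel_holo g al be (s : C) : mel_bounded g al be -> al < Re s < be -> cdiff (Mel g) s.
Proof.
  move=> [Hi [C0 [HC [Ha Hb]]]] Hs. have [d [d0 [d1 d2]]] := strip_margin _ _ _ Hs.
  apply: (LI_holo (fun s x => Cexp (s * RtoC x) * g x)%C s d (C0 * (4 / (d * d)))) => //.
  - move=> x w _. cdiff_tac.
  - move=> w Hw. apply: (mel_ldom g al be) => //.
    have := Re_le_Cmod (w - s)%C. have -> : Re (w - s)%C = Re w - Re s by []. move/Rabs_le_between => h. lra.
Qed.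

Lemma ldom_vanish (F : R -> C) K : (forall x, Cmod (F x) <= K / (1 + x * x)) ->
  forall e, 0 < e -> exists A, 0 < A /\ forall x, A <= Rabs x -> Cmod (F x - 0)%C < e.
Proof.
  move=> H e He. have K0 : 0 <= K.
  { have := H 0. have := Cmod_ge_0 (F 0). have -> : K / (1 + 0 * 0) = K by field. lra. }
  have q0 : 0 <= K / e by apply: Rmult_le_pos => //; apply: Rlt_le; exact: Rinv_0_lt_compat.
  exists (K / e + 1). split; first lra. move=> x Hx.
  have -> : (F x - 0 = F x)%C by ring. apply: Rle_lt_trans (H x) _.
  have xx : x * x = Rabs x * Rabs x by rewrite -Rabs_mult Rabs_pos_eq; nra. rewrite xx. set y := Rabs x in Hx *.
  apply: (Rmult_lt_reg_r (1 + y * y)); first nra. have -> : K / (1 + y * y) * (1 + y * y) = K by field; nra.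
  have E : K = e * (K / e) by field; lra. rewrite {1}E. apply: Rmult_lt_compat_l => //. nra.
Qed.

Lemma is_LI_FTC_0 (F f : R -> C) K : (forall x, rderiv F x (f x)) -> (forall x, rcont f x) ->
  (forall x, Cmod (F x) <= K / (1 + x * x)) -> is_LI f 0%C.
Proof.
  move=> H1 H2 H3. have -> : (RtoC 0 = 0 - 0)%C by ring.
  apply: (is_LI_FTC F) => // e He; have [A [HA W]] := ldom_vanish F K H3 e He; exists A; split => // x Hx; apply: W; rewrite /Rabs; case: Rcase_abs => ?; lra.
Qed.

(** [b * x - exp x] is largest at [x = ln b]. *)
Lemma exp_super_decay (b x : R) : 0 < b -> exp (b * x) * exp (- exp x) <= exp (b * (ln b - 1)).
Proof.
  move=> Hb. rewrite -exp_plus.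
  have h : b * x + - exp x <= b * (ln b - 1).
  { have := exp_ineq1_le (x - ln b). rewrite exp_plus exp_Ropp exp_ln // => h.
    have : b * (1 + (x - ln b)) <= b * (exp x * / b) by apply: Rmult_le_compat_l; lra.
    have -> : b * (exp x * / b) = exp x by field; lra. lra. }
  case: h => [h|->]; [apply: Rlt_le; exact: exp_increasing|lra].
Qed.

Lemma exp_double_decay (c b x : R) : 0 < c -> 0 < b ->
  exp (- (c * exp x)) <= exp (b * (ln b - 1) - b * ln c) * exp (- b * x).
Proof.
  move=> Hc Hb. have := exp_super_decay b (x + ln c) Hb. rewrite [exp (x + ln c)]exp_plus exp_ln // (Rmult_comm (exp x)) => h.
  have -> : exp (b * (ln b - 1) - b * ln c) * exp (- b * x) = exp (b * (ln b - 1)) * exp (- (b * (x + ln c))).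
  { rewrite -!exp_plus. congr exp. ring. }
  rewrite (exp_Ropp (b * (x + ln c))). apply: (Rmult_le_reg_l (exp (b * (x + ln c)))); first exact: exp_pos.
  have := exp_pos (b * (x + ln c)) => p.
  have -> : exp (b * (x + ln c)) * (exp (b * (ln b - 1)) * / exp (b * (x + ln c))) = exp (b * (ln b - 1)) by field; lra. exact: h.
Qed.

(** Euler's integral in the variable [x = ln t]: the weight [exp (- t)], while [Mel] supplies the
    power [t ^ s]. *)
Definition gam_k (x : R) : C := RtoC (exp (- exp x)).
Definition Gam : C -> C := Mel gam_k.

Lemma rcont_expR (x : R) : rcont (fun x => RtoC (exp x)) x.
Proof. apply: rcont_R. apply: (ex_derive_continuous (V := R_NormedModule)). auto_derive. done. Qed.

Lemma rcont_gam_k x : rcont gam_k x.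
Proof. apply: rcont_R. apply: (ex_derive_continuous (V := R_NormedModule)). auto_derive. done. Qed.

Lemma exp_neg_le1 u : 0 <= u -> exp (- u) <= 1.
Proof. move=> [h|<-]; last by rewrite Ropp_0 exp_0; lra. rewrite -exp_0. apply: Rlt_le. apply: exp_increasing. lra. Qed.

Lemma gam_bounded be : 0 < be -> mel_bounded gam_k 0 be.
Proof.
  move=> Hb. split; first by apply: mel_int_cont => x; exact: rcont_gam_k.
  set Cb := exp (be * (ln be - 1) - be * ln 1). have p : 0 < Cb by exact: exp_pos.
  exists (1 + Cb). split; first lra.
  have E : forall x, Cmod (gam_k x) = exp (- exp x) by move=> x; rewrite /gam_k Cmod_R Rabs_pos_eq //; apply: Rlt_le; exact: exp_pos.
  split => x; rewrite E.
  - rewrite Ropp_0 Rmult_0_l exp_0. have := exp_neg_le1 (exp x) (Rlt_le _ _ (exp_pos x)). lra.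
  - have := exp_double_decay 1 be x Rlt_0_1 Hb. rewrite Rmult_1_l -/Cb. have := exp_pos (- be * x). nra.
Qed.

Lemma Gam_cdiff (s : C) : 0 < Re s -> cdiff Gam s.
Proof. move=> H. apply: (mel_holo gam_k 0 (Re s + 1)); [apply: gam_bounded; lra|lra]. Qed.

Lemma Gam_ldom (s : C) : 0 < Re s -> exists K, ldom (fun x => Cexp (s * RtoC x) * gam_k x)%C K.
Proof. move=> H. apply: (mel_ldom_ex gam_k 0 (Re s + 1)); [apply: gam_bounded; lra|lra]. Qed.

Lemma Cexp_s1 (s : C) x : Cexp ((s + 1) * RtoC x)%C = (Cexp (s * RtoC x) * RtoC (exp x))%C.
Proof. by rewrite Cmult_plus_distr_r Cexp_plus Cmult_1_l Cexp_R. Qed.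

(** The derivative of [exp (s x) * exp (- exp x)] integrates to 0 over the line. *)
Lemma Gam_succ (s : C) : 0 < Re s -> Gam (s + 1)%C = (s * Gam s)%C.
Proof.
  move=> H. have [K D] := Gam_ldom s H. have [K1 D1] := Gam_ldom (s + 1)%C ltac:(rewrite Re_plus /=; lra).
  have Z : is_LI (fun x => s * (Cexp (s * RtoC x) * gam_k x) - Cexp ((s + 1) * RtoC x) * gam_k x)%C 0%C.
  { apply: (is_LI_FTC_0 (fun x => Cexp (s * RtoC x) * gam_k x)%C _ K).
    - move=> x.
      have D2 : rderiv (fun x => Cexp (s * RtoC x + RtoC (- exp x)))%C x (Cexp (s * RtoC x + RtoC (- exp x)) * (s * 1 + RtoC (- exp x)))%C.
      { apply: (rderiv_comp Cexp (fun x => s * RtoC x + RtoC (- exp x))%C); first exact: cderiv_Cexp.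
        apply: rderiv_plus; first by apply: rderiv_scal; exact: rderiv_id.
        apply: (rderiv_RtoC (fun x => - exp x)). auto_derive => //. ring. }
      have E : forall y, Cexp (s * RtoC y + RtoC (- exp y))%C = (Cexp (s * RtoC y) * gam_k y)%C by move=> y; rewrite Cexp_plus Cexp_R.
      apply: (rderiv_ext _ _ _ _ E). rewrite Cexp_s1.
      have -> : (s * (Cexp (s * x) * gam_k x) - Cexp (s * x) * RtoC (exp x) * gam_k x = Cexp (s * RtoC x + RtoC (- exp x)) * (s * 1 + RtoC (- exp x)))%C.
      { rewrite E RtoC_opp. ring. }
      exact: D2.
    - move=> x. apply: rcont_minus; first apply: rcont_mult; try exact: rcont_const; (apply: rcont_mult; [exact: rcont_exp_lin|exact: rcont_gam_k]).
    - exact: (proj2 D). }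
  have := LI_eq _ _ Z. rewrite (LI_minus _ _ _ _ (ldom_scal s _ _ D) D1) (LI_scal _ _ _ D).
  move/Cminus_eq_0 => E. symmetry. exact: E.
Qed.

Lemma Gam_1 : Gam 1%C = 1%C.
Proof.
  apply: LI_eq. have E1 : (RtoC 1 = 0 - (- (1)))%C by ring. rewrite [X in is_LI _ X]E1.
  have lim : forall e, 0 < e -> exists A, 0 < A /\ forall x, A <= x -> exp (- x) < e.
  { move=> e He. exists (Rabs (ln e) + 1). split; first by have := Rabs_pos (ln e); lra.
    move=> x Hx. rewrite -(exp_ln e) //. apply: exp_increasing. have := Rle_abs (- ln e). rewrite Rabs_Ropp. lra. }
  apply: (is_LI_FTC (fun x => - gam_k x)%C).
  - move=> x. change (rderiv (fun x => - gam_k x)%C x (Cexp (1 * RtoC x) * gam_k x)%C).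
    have -> : (Cexp (1 * RtoC x) * gam_k x = RtoC (exp x * exp (- exp x)))%C by rewrite Cmult_1_l Cexp_R /gam_k RtoC_mult.
    apply: (rderiv_ext (fun x => RtoC (- exp (- exp x)))); first by move=> y; rewrite /gam_k RtoC_opp.
    apply: (rderiv_RtoC (fun x => - exp (- exp x))). auto_derive => //. ring.
  - move=> x. apply: rcont_mult; [exact: rcont_exp_lin|exact: rcont_gam_k].
  - move=> e He. have [A [HA W]] := lim e He. exists A. split => // x Hx.
    have -> : (- gam_k x - 0 = - gam_k x)%C by ring. rewrite Cmod_opp /gam_k Cmod_R Rabs_pos_eq; last by apply: Rlt_le; exact: exp_pos.
    apply: W. have := exp_ineq1_le x. lra.
  - move=> e He. have [A [HA W]] := lim e He. exists A. split => // x Hx.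
    have -> : (- gam_k x - - (1) = RtoC (1 - exp (- exp x)))%C by rewrite RtoC_minus /gam_k; ring.
    have := exp_neg_le1 (exp x) (Rlt_le _ _ (exp_pos x)). have := exp_ineq1_le (- exp x).
    have := W (- x) ltac:(lra). rewrite Ropp_involutive Cmod_R => h1 h2 h3. rewrite Rabs_pos_eq; lra.
Qed.

Lemma Gamma_integral_Gam (s : C) : 0 < Re s -> Gamma_integral s = Gam s.
Proof.
  move=> H. have [K D] := Gam_ldom s H.
  suff G : is_RInt_gen (V := C_R_NormedModule) (fun t : R => (Cexp ((s - 1) * ln t) * exp (- t))%C) (at_right 0) (Rbar_locally p_infty) (Gam s).
  { exact (is_RInt_gen_unique (V := C_R_CompleteNormedModule) _ _ G). }
  move=> P [e He].
  have [A [HA W]] := is_LI_LI _ _ D (e : R) (cond_pos e).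
  exists (fun a => 0 < a < exp (- A)) (fun b => exp A < b).
  - exists (mkposreal _ (exp_pos (- A))) => y Hy hy. split => //.
    have := Rle_abs (minus y 0). have : Rabs (minus y 0) < exp (- A) by exact: Hy. rewrite /minus /plus /opp /=. lra.
  - by exists (exp A).
  - move=> a b [Ha Ha'] Hb /=.
    have la : ln a <= - A by rewrite -(ln_exp (- A)); apply: ln_le => //; lra.
    have lb : A <= ln b by rewrite -{1}(ln_exp A); apply: ln_le; [exact: exp_pos|lra].
    have b0 : 0 < b by have := exp_pos A; lra.
    set f := fun t : R => (Cexp ((s - 1) * ln t) * exp (- t))%C.
    have ea : exp (ln a) = a by exact: exp_ln. have eb : exp (ln b) = b by exact: exp_ln.
    have cf : forall t, 0 < t -> rcont f t.
    { move=> t Ht. apply: rcont_mult.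
      - apply: rcont_Cexp. apply: rcont_mult; first exact: rcont_const.
        apply: rcont_R. apply: (ex_derive_continuous (V := R_NormedModule)). by auto_derive.
      - apply: rcont_R. apply: (ex_derive_continuous (V := R_NormedModule)). by auto_derive. }
    have I1 : exCI f a b.
    { apply: (ex_RInt_continuous (V := C_R_CompleteNormedModule)) => t Ht. apply: cf.
      have := Rmin_glb_lt a b 0 Ha b0. lra. }
    exists (CI f a b). split; first exact: isCI_CI.
    apply: He. apply: ball_C_Cmod.
    have -> : CI f a b = CI (fun x => Cexp (s * RtoC x) * gam_k x)%C (ln a) (ln b); last exact: W.
    symmetry. apply: CI_eq.
    have := is_RInt_comp (V := C_R_CompleteNormedModule) f exp exp (ln a) (ln b). rewrite ea eb => C1.
    apply: (is_RInt_ext (V := C_R_NormedModule) (fun y => scal (exp y) (f (exp y)))); last first.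
    + apply: C1.
      * move=> x _. apply: cf. exact: exp_pos.
      * move=> x _. split; first by apply: is_derive_exp. apply: (ex_derive_continuous (V := R_NormedModule)). by auto_derive.
    + move=> x _. rewrite scal_R_Cmult /f ln_exp /gam_k.
      have -> : Cexp (s * RtoC x)%C = (RtoC (exp x) * Cexp ((s - 1) * RtoC x))%C.
      { rewrite -Cexp_R -Cexp_plus. congr Cexp. ring. }
      apply: Cminus_eq_0. ring.
Qed.

(** Zeros on the real axis accumulate at 0, so an identity known for real parameters, where it is a
    change of variables, extends to all of [U]. *)
Lemma identity_real_line (U : C -> Prop) (f : C -> C) (z : C) :
  (forall z w t, U z -> U w -> 0 <= t <= 1 -> U (seg z w t)) ->
  (forall z, U z -> exists r, 0 < r /\ forall w, Cmod (w - z)%C < r -> U w) ->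
  (forall z, U z -> cdiff f z) -> U 0%C -> (forall x : R, f (RtoC x) = 0%C) -> U z -> f z = 0%C.
Proof.
  move=> Hc Ho Hd U0 Hx Uz.
  apply: (identity_convex U f 0%C z) => //.
  - move=> w Uw. have [r [Hr K]] := Ho w Uw. exists r. split => // v Hv. apply: Hd. exact: K.
  - have [r [Hr K]] := Ho _ U0. exists (r / 2). split; first lra.
    apply: identity_local => //.
    + move=> w Hw. apply: Hd. exact: K.
    + move=> e He. exists (RtoC (e / 2)). split; first by apply: RtoC_neq0; lra.
      split => //. have -> : (RtoC (e / 2) - 0 = RtoC (e / 2))%C by ring. rewrite Cmod_R Rabs_pos_eq; lra.
Qed.

(** * Laplace and Stieltjes kernels with a logarithmic parameter *)

Lemma strip_convex b (z w : C) t : Rabs (Im z) < b -> Rabs (Im w) < b -> 0 <= t <= 1 -> Rabs (Im (seg z w t)) < b.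
Proof.
  move=> /Rabs_def2 Hz /Rabs_def2 Hw Ht.
  have -> : Im (seg z w t) = Im z + t * (Im w - Im z) by rewrite /seg /= /Im; ring.
  apply Rabs_def1; first by apply: convex_lt; lra.
  have := convex_lt (- Im z) (- Im w) b t ltac:(lra) ltac:(lra) Ht. lra.
Qed.

Lemma strip_open b (z : C) : Rabs (Im z) < b -> exists r, 0 < r /\ forall w, Cmod (w - z)%C < r -> Rabs (Im w) < b.
Proof.
  move=> Hz. exists (b - Rabs (Im z)). split; first lra. move=> w Hw.
  have h := Im_le_Cmod (w - z)%C. have -> : Im w = Im (w - z)%C + Im z by rewrite /Im /Re /=; ring.
  apply: Rle_lt_trans (Rabs_triang _ _) _. lra.
Qed.

Lemma strip_disc (w w' : C) r : Cmod (w' - w)%C <= r -> Rabs (Im w') <= Rabs (Im w) + r /\ Re w - r <= Re w' <= Re w + r.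
Proof.
  move=> H. have h := Im_le_Cmod (w' - w)%C. have k := Re_le_Cmod (w' - w)%C. split.
  - have -> : Im w' = Im (w' - w)%C + Im w by rewrite /Im /Re /=; ring. apply: Rle_trans (Rabs_triang _ _) _. lra.
  - move: k. have -> : Re (w' - w)%C = Re w' - Re w by []. move/Rabs_le_between => k. lra.
Qed.

Lemma cos_ge_cos x b : Rabs x <= b -> b <= PI -> cos b <= cos x.
Proof.
  move=> H Hb. have -> : cos x = cos (Rabs x).
  { rewrite /Rabs. case: Rcase_abs => _ //. by rewrite cos_neg. }
  case: H => [H|->]; last lra. apply: Rlt_le. have := Rabs_pos x => p. apply: cos_decreasing_1; lra.
Qed.

Lemma exp_le a b : a <= b -> exp a <= exp b.
Proof. move=> [h|->]; [apply: Rlt_le; exact: exp_increasing|lra]. Qed.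

Lemma Re_Cexp (z : C) : Re (Cexp z) = exp (Re z) * cos (Im z).
Proof. by rewrite Cexp_eq. Qed.

(** The integral of [t^(s-1) exp (- z t)] over [t > 0] with [z = Cexp w]. Using [w] instead of [z]
    turns sectors into strips and makes every power single valued. *)
Definition Lap (s w : C) : C := LI (fun x => Cexp (s * RtoC x) * Cexp (- Cexp (w + RtoC x)))%C.

Lemma rcont_lap_k (w : C) x : rcont (fun x => Cexp (- Cexp (w + RtoC x)))%C x.
Proof. rcont_tac. Qed.

Lemma lap_ldom_unif (s w : C) b r : 0 < Re s -> 0 <= r -> Rabs (Im w) + r <= b -> b < PI / 2 ->
  exists K, forall w', Cmod (w' - w)%C <= r -> ldom (fun x => Cexp (s * RtoC x) * Cexp (- Cexp (w' + RtoC x)))%C K.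
Proof.
  move=> Hs Hr Hb HP. have P0 := PI_RGT_0. have i0 := Rabs_pos (Im w).
  have cb : 0 < cos b by apply: cos_gt_0; lra.
  set c := exp (Re w - r) * cos b. have c0 : 0 < c by apply: Rmult_lt_0_compat => //; exact: exp_pos.
  set be := Re s + 1.
  set Cb := exp (be * (ln be - 1) - be * ln c). have p : 0 < Cb by exact: exp_pos.
  have [d [d0 [d1 d2]]] := strip_margin 0 be (Re s) ltac:(rewrite /be; lra).
  exists ((1 + Cb) * (4 / (d * d))) => w' Hw'.
  have [h1 h2] := strip_disc w w' r Hw'.
  have E : forall x, Cmod (Cexp (- Cexp (w' + RtoC x)))%C <= exp (- (c * exp x)).
  { move=> x. rewrite Cmod_Cexp. apply: exp_le.
    have -> : Re (- Cexp (w' + RtoC x))%C = - (exp (Re w' + x) * cos (Im w' + 0)) by change (- Re (Cexp (w' + RtoC x))%C = - (exp (Re w' + x) * cos (Im w' + 0))); rewrite Re_Cexp.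
    rewrite Rplus_0_r /c exp_plus. apply: Ropp_le_contravar.
    have -> : exp (Re w' ) * exp x * cos (Im w') = exp (Re w') * cos (Im w') * exp x by ring.
    apply: Rmult_le_compat_r; first exact: Rlt_le (exp_pos _).
    apply: Rmult_le_compat; [exact: Rlt_le (exp_pos _)|lra|apply: exp_le; lra|apply: cos_ge_cos; lra]. }
  apply: (mel_ldom _ 0 be) => //; try lra.
  - apply: mel_int_cont => x. exact: rcont_lap_k.
  - move=> x. apply: Rle_trans (E x) _. rewrite Ropp_0 Rmult_0_l exp_0.
    have := exp_neg_le1 (c * exp x) ltac:(apply: Rmult_le_pos; [lra|exact: Rlt_le (exp_pos _)]). lra.
  - move=> x. apply: Rle_trans (E x) _. have := exp_double_decay c be x c0 ltac:(rewrite /be; lra). rewrite -/Cb. have := exp_pos (- be * x). nra.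
Qed.

Lemma lap_radius (b0 x : R) : Rabs x < b0 -> exists r b, 0 < r /\ Rabs x + r <= b /\ b < b0 /\ 0 < b /\ r <= 1.
Proof.
  move=> H. have := Rabs_pos x => p. set q := Rmin 1 ((b0 - Rabs x) / 2).
  have q1 : q <= 1 by exact: Rmin_l. have q2 : q <= (b0 - Rabs x) / 2 by exact: Rmin_r.
  have q3 : 0 < q by apply: Rmin_glb_lt; lra.
  exists q, ((b0 + Rabs x) / 2). lra.
Qed.

Lemma Lap_cdiff (s w : C) : 0 < Re s -> Rabs (Im w) < PI / 2 -> cdiff (Lap s) w.
Proof.
  move=> Hs Hw. have [r [b [r0 [rb [bP [b0 _]]]]]] := lap_radius _ _ Hw.
  have [K HK] := lap_ldom_unif s w b r Hs ltac:(lra) rb bP.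
  apply: (LI_holo (fun w x => Cexp (s * RtoC x) * Cexp (- Cexp (w + RtoC x)))%C w r K) => //.
  move=> x w' _. cdiff_tac.
Qed.

Lemma lap_ldom (s w : C) : 0 < Re s -> Rabs (Im w) < PI / 2 -> exists K, ldom (fun x => Cexp (s * RtoC x) * Cexp (- Cexp (w + RtoC x)))%C K.
Proof.
  move=> Hs Hw. have [r [b [r0 [rb [bP [b0 _]]]]]] := lap_radius _ _ Hw.
  have [K HK] := lap_ldom_unif s w b r Hs ltac:(lra) rb bP. exists K. apply: HK. rewrite Cmod_self. lra.
Qed.

(** For real [w] this is the translation [x -> x + w]; both sides are holomorphic in the strip, so
    the real axis decides. *)
Lemma Lap_eq (s w : C) : 0 < Re s -> Rabs (Im w) < PI / 2 -> Lap s w = (Cexp (- (s * w)) * Gam s)%C.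
Proof.
  move=> Hs Hw. have P0 := PI_RGT_0. apply: Cminus_eq_0.
  apply: (identity_real_line (fun w => Rabs (Im w) < PI / 2) (fun w => Lap s w - Cexp (- (s * w)) * Gam s)%C) => //.
  - exact: strip_convex.
  - exact: strip_open.
  - move=> z Hz. apply: cdiff_minus; [exact: Lap_cdiff|cdiff_tac].
  - rewrite /= Rabs_R0. lra.
  - move=> c.
    have [K D] := lap_ldom s (RtoC c) Hs ltac:(rewrite /= Rabs_R0; lra).
    have [K' D'] := Gam_ldom s Hs.
    have T := LI_eq _ _ (is_LI_translate _ _ c (proj1 D') (is_LI_LI _ _ D')).
    have E : Gam s = (Cexp (s * RtoC c) * Lap s (RtoC c))%C.
    { rewrite /Lap -(LI_scal _ _ _ D) -[LHS]T. apply: LI_ext => x.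
      have -> : (s * RtoC (x + c) = s * RtoC c + s * RtoC x)%C by rewrite RtoC_plus; ring.
      rewrite Cexp_plus /gam_k -RtoC_plus Cexp_R -RtoC_opp Cexp_R (Rplus_comm c). ring. }
    rewrite E. have N := Cexp_neq0 (s * RtoC c)%C. rewrite Cexp_opp. field. exact: N.
Qed.

Lemma le_Cmod_sq a (z : C) : a * a <= Re z * Re z + Im z * Im z -> a <= Cmod z.
Proof.
  move=> H. have h0 := Cmod_ge_0 z.
  have E : Cmod z * Cmod z = Re z * Re z + Im z * Im z by have := Cmod2_alt z; rewrite /=; lra.
  apply: Rnot_lt_le => h. nra.
Qed.

(** With [r = exp (Re w)] and [t = Im w], the difference of the squares is [(1 - cos t) / 2] times
    [(u - r)^2]. *)
Lemma Cmod_sum_lower u (w : C) : 0 <= u -> cos (Im w / 2) * (u + exp (Re w)) <= Cmod (RtoC u + Cexp w)%C.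
Proof.
  move=> Hu. apply: le_Cmod_sq. rewrite Cexp_eq /=. have e0 := exp_pos (fst w).
  rewrite /Re /Im. set r := exp (fst w) in e0 *. set t := snd w.
  have E : cos t = 2 * cos (t / 2) * cos (t / 2) - 1.
  { have {1}-> : t = 2 * (t / 2) by field. by rewrite cos_2a_cos. }
  have S := sin2_cos2 t. rewrite /Rsqr in S.
  have Cb := COS_bound t. set ct := cos t in E S Cb *. set st := sin t in S *. set ch := cos (t / 2) in E *.
  have cc : ch * ch = (1 + ct) / 2 by lra.
  have -> : ch * (u + r) * (ch * (u + r)) = ch * ch * ((u + r) * (u + r)) by ring. rewrite cc.
  have -> : (u + r * ct) * (u + r * ct) + (0 + r * st) * (0 + r * st) = u * u + 2 * u * r * ct + r * r * (st * st + ct * ct) by ring.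
  rewrite S. have : 0 <= (1 - ct) * ((u - r) * (u - r)) by apply: Rmult_le_pos; [lra|exact: Rle_0_sqr]. lra.
Qed.

Lemma Cmod_sum_lower_strip u (w : C) b : 0 <= u -> Rabs (Im w) <= b -> b < PI -> cos (b / 2) * (u + exp (Re w)) <= Cmod (RtoC u + Cexp w)%C.
Proof.
  move=> Hu Hw Hb. apply: Rle_trans (Cmod_sum_lower u w Hu). have e := exp_pos (Re w).
  apply: Rmult_le_compat_r; first lra. apply: cos_ge_cos; last by have := PI_RGT_0; lra.
  rewrite /Rdiv Rabs_mult (Rabs_pos_eq (/ 2)); lra.
Qed.

Lemma strip_sum_neq0 u (w : C) : 0 <= u -> Rabs (Im w) < PI -> (RtoC u + Cexp w)%C <> 0%C.
Proof.
  move=> Hu Hw. apply: Cmod_pos_neq0. apply: Rlt_le_trans (Cmod_sum_lower_strip u w (Rabs (Im w)) Hu (Rle_refl _) Hw).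
  have := Rabs_pos (Im w) => p. have := exp_pos (Re w) => e. apply: Rmult_lt_0_compat; last lra. apply: cos_gt_0; lra.
Qed.

(** The integral of [u^(s-1) / (u + z)] over [u > 0] with [z = Cexp w], again parametrized by the
    logarithm. *)
Definition Stj (s w : C) : C := LI (fun x => Cexp (s * RtoC x) * / (RtoC (exp x) + Cexp w))%C.

Lemma rcont_stj_k (w : C) x : Rabs (Im w) < PI -> rcont (fun x => / (RtoC (exp x) + Cexp w))%C x.
Proof.
  move=> H. apply: rcont_inv; first by apply: strip_sum_neq0 => //; exact: Rlt_le (exp_pos _).
  apply: rcont_plus; [exact: rcont_expR|exact: rcont_const].
Qed.

Lemma stj_ldom_unif (s w : C) b r : 0 < Re s < 1 -> 0 <= r -> Rabs (Im w) + r <= b -> b < PI ->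
  exists K, forall w', Cmod (w' - w)%C <= r -> ldom (fun x => Cexp (s * RtoC x) * / (RtoC (exp x) + Cexp w'))%C K.
Proof.
  move=> Hs Hr Hb HP. have P0 := PI_RGT_0. have i0 := Rabs_pos (Im w).
  have cb : 0 < cos (b / 2) by apply: cos_gt_0; lra.
  have [d [d0 [d1 d2]]] := strip_margin 0 1 (Re s) Hs.
  have er := exp_pos (Re w - r).
  have q1 : 0 < / cos (b / 2) by exact: Rinv_0_lt_compat.
  have q2 : 0 < / (cos (b / 2) * exp (Re w - r)) by apply: Rinv_0_lt_compat; exact: Rmult_lt_0_compat.
  set C0 := / cos (b / 2) + / (cos (b / 2) * exp (Re w - r)).
  have C00 : 0 < C0 by rewrite /C0; lra.
  exists (C0 * (4 / (d * d))) => w' Hw'.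
  have [h1 h2] := strip_disc w w' r Hw'.
  have E : forall x, Cmod (/ (RtoC (exp x) + Cexp w'))%C <= / (cos (b / 2) * (exp x + exp (Re w - r))).
  { move=> x. have ex := exp_pos x. rewrite Cmod_inv; last by apply: strip_sum_neq0; lra.
    apply: Rinv_le_contravar. apply: Rmult_lt_0_compat; lra.
    apply: Rle_trans (Cmod_sum_lower_strip (exp x) w' b _ _ _); try lra.
    apply: Rmult_le_compat_l; first lra. have := exp_le (Re w - r) (Re w') ltac:(lra). lra. }
  apply: (mel_ldom _ 0 1) => //; try lra.
  - apply: mel_int_cont => x. apply: rcont_stj_k. lra.
  - move=> x. have ex := exp_pos x. apply: Rle_trans (E x) _. rewrite Ropp_0 Rmult_0_l exp_0 Rmult_1_r.
    apply: (Rle_trans _ (/ (cos (b / 2) * exp (Re w - r)))); last by rewrite /C0; lra.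
    apply: Rinv_le_contravar; first exact: Rmult_lt_0_compat. apply: Rmult_le_compat_l; lra.
  - move=> x. have ex := exp_pos x. apply: Rle_trans (E x) _.
    have -> : - (1) * x = - x by ring. rewrite exp_Ropp.
    apply: (Rle_trans _ (/ cos (b / 2) * / exp x)).
    + rewrite -Rinv_mult. apply: Rinv_le_contravar; first exact: Rmult_lt_0_compat. apply: Rmult_le_compat_l; lra.
    + apply: Rmult_le_compat_r; first by apply: Rlt_le; exact: Rinv_0_lt_compat. rewrite /C0; lra.
Qed.

Lemma stj_ldom (s w : C) : 0 < Re s < 1 -> Rabs (Im w) < PI -> exists K, ldom (fun x => Cexp (s * RtoC x) * / (RtoC (exp x) + Cexp w))%C K.
Proof.
  move=> Hs Hw. have [r [b [r0 [rb [bP [b0 _]]]]]] := lap_radius _ _ Hw.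
  have [K HK] := stj_ldom_unif s w b r Hs ltac:(lra) rb bP. exists K. apply: HK. rewrite Cmod_self. lra.
Qed.

Lemma Stj_cdiff (s w : C) : 0 < Re s < 1 -> Rabs (Im w) < PI -> cdiff (Stj s) w.
Proof.
  move=> Hs Hw. have [r [b [r0 [rb [bP [b0 _]]]]]] := lap_radius _ _ Hw.
  have [K HK] := stj_ldom_unif s w b r Hs ltac:(lra) rb bP.
  apply: (LI_holo (fun w x => Cexp (s * RtoC x) * / (RtoC (exp x) + Cexp w))%C w r K) => //.
  move=> x w' Hw'. cdiff_tac. apply: strip_sum_neq0; first exact: Rlt_le (exp_pos _).
  have [h1 _] := strip_disc w w' r Hw'. lra.
Qed.

(** A dilation of [u] settles real [w]; the identity theorem reaches [|Im w| < PI], that is every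
    [z = Cexp w] off the negative half line. *)
Lemma Stj_eq (s w : C) : 0 < Re s < 1 -> Rabs (Im w) < PI -> Stj s w = (Cexp ((s - 1) * w) * Stj s 0)%C.
Proof.
  move=> Hs Hw. have P0 := PI_RGT_0. apply: Cminus_eq_0.
  apply: (identity_real_line (fun w => Rabs (Im w) < PI) (fun w => Stj s w - Cexp ((s - 1) * w) * Stj s 0)%C) => //.
  - exact: strip_convex.
  - exact: strip_open.
  - move=> z Hz. apply: cdiff_minus; [exact: Stj_cdiff|cdiff_tac].
  - rewrite /= Rabs_R0. lra.
  - move=> c.
    have [K D] := stj_ldom s (RtoC c) Hs ltac:(rewrite /= Rabs_R0; lra).
    have [K' D'] := stj_ldom s 0%C Hs ltac:(rewrite /= Rabs_R0; lra).
    have T := LI_eq _ _ (is_LI_translate _ _ c (proj1 D) (is_LI_LI _ _ D)).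
    suff -> : Stj s (RtoC c) = (Cexp ((s - 1) * RtoC c) * Stj s 0)%C by ring.
    rewrite /Stj -(LI_scal _ _ _ D') -[LHS]T. apply: LI_ext => x.
    have -> : (s * RtoC (x + c) = (s - 1) * RtoC c + (RtoC c + s * RtoC x))%C by rewrite RtoC_plus; ring.
    rewrite !Cexp_plus !Cexp_R exp_0 exp_plus RtoC_mult.
    have ec : RtoC (exp c) <> 0%C by apply: RtoC_neq0; have := exp_pos c; lra.
    have ex : (RtoC (exp x) + 1)%C <> 0%C by rewrite -RtoC_plus; apply: RtoC_neq0; have := exp_pos x; lra.
    field. split => //. have -> : (RtoC (exp x) * RtoC (exp c) + RtoC (exp c) = RtoC (exp c) * (RtoC (exp x) + 1))%C by ring.
    exact: Cmult_neq_0.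
Qed.

(* [Kf s = pi / sin (pi s)]. *)
Definition Kf (s : C) : C := Stj s 0%C.
(** This is [2 i sin (pi s)]. *)
Definition sn (s : C) : C := (Cexp (Ci * PI * s) - Cexp (- (Ci * PI * s)))%C.

Lemma Kf_ldom (s : C) : 0 < Re s < 1 -> exists K, ldom (fun x => Cexp (s * RtoC x) * / (RtoC (exp x) + Cexp 0))%C K.
Proof. move=> H. apply: stj_ldom => //. rewrite /= Rabs_R0. exact: PI_RGT_0. Qed.

Lemma Csq_plus_1 (u : C) : (u * u + 1 = (u + Ci) * (u + - Ci))%C.
Proof. apply: C_ext; rewrite /=; ring. Qed.

Lemma Cinv_Ci : (/ Ci = - Ci)%C.
Proof. have -> : (- Ci = - (Ci * Ci) * / Ci)%C by field; exact: Ci_neq0. rewrite Ci2. ring. Qed.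

Lemma Cmult_reg_r (z w c : C) : c <> 0%C -> (z * c = w * c)%C -> z = w.
Proof. move=> N H. have -> : z = (z * c / c)%C by field. rewrite H. field. exact: N. Qed.

Lemma RtoC_half (x : R) : RtoC (x / 2) = (RtoC x / 2)%C.
Proof. apply: C_ext; rewrite /=; field. Qed.

Lemma Cexp_half_PI : Cexp (Ci * RtoC (PI / 2))%C = Ci.
Proof. rewrite Cexp_Ci cos_PI2 sin_PI2. done. Qed.

Lemma Cexp_PI : Cexp (Ci * RtoC PI)%C = (- (1))%C.
Proof. rewrite Cexp_Ci cos_PI sin_PI. apply: C_ext; rewrite /=; ring. Qed.

(* [1/(u+i) - 1/(u-i) = -2i/(u^2+1)], and [u -> u^2] halves the Mellin variable. *)
Lemma Kf_half (s : C) : 0 < Re s < 1 -> Kf (s / 2)%C = (Kf s * (Cexp (Ci * PI * (s / 2)) + Cexp (- (Ci * PI * (s / 2)))))%C.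
Proof.
  move=> Hs. have P0 := PI_RGT_0.
  set w := (Ci * RtoC (PI / 2))%C.
  have Iw : Im w = PI / 2 by rewrite /w /=; ring.
  have Hw : Rabs (Im w) < PI by rewrite Iw Rabs_pos_eq; lra.
  have Hw' : Rabs (Im (- w)%C) < PI by (have -> : Im (- w)%C = - Im w by []); rewrite Rabs_Ropp.
  have [K D] := stj_ldom s w Hs Hw. have [K' D'] := stj_ldom s _ Hs Hw'.
  have Hs2 : Re (s / 2)%C = Re s / 2 by rewrite /=; rewrite /Re; field.
  have [K2 D2] := Kf_ldom (s / 2)%C ltac:(rewrite Hs2; lra).
  have A := LI_eq _ _ (is_LI_dilate _ _ 2 ltac:(lra) (proj1 D2) (is_LI_LI _ _ D2)).
  have E : (Stj s w - Stj s (- w) = - Ci * Kf (s / 2))%C.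
  { rewrite /Stj -(LI_minus _ _ _ _ D D') /Kf /Stj -(LI_scal _ _ _ D2).
    rewrite -(LI_eq _ _ (is_LI_dilate _ _ 2 ltac:(lra) (proj1 (ldom_scal (- Ci)%C _ _ D2)) (is_LI_LI _ _ (ldom_scal (- Ci)%C _ _ D2)))).
    apply: LI_ext => x.
    have -> : (s / 2 * RtoC (2 * x) = s * RtoC x)%C by rewrite RtoC_mult; field.
    rewrite Cexp_0. have -> : 2 * x = x + x by ring. rewrite exp_plus RtoC_mult.
    have Hx := Rlt_le _ _ (exp_pos x).
    have N1 := strip_sum_neq0 (exp x) w Hx Hw. have N2 := strip_sum_neq0 (exp x) _ Hx Hw'.
    move: N1 N2. rewrite Cexp_opp /w Cexp_half_PI.
    rewrite Cinv_Ci.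
    set u := RtoC (exp x) => N1 N2.
    have N3 : (u * u + 1)%C <> 0%C.
    { rewrite Csq_plus_1. exact: Cmult_neq_0. }
    apply: (Cmult_reg_r _ _ ((u + Ci) * (u + - Ci))%C); first exact: Cmult_neq_0.
    have -> : ((Cexp (s * x) * / (u + Ci) - Cexp (s * x) * / (u + - Ci)) * ((u + Ci) * (u + - Ci)) = Cexp (s * x) * (- (2) * Ci))%C by field; split.
    rewrite -Csq_plus_1.
    field. exact: N3. }
  have E2 : (Stj s w - Stj s (- w) = (Cexp ((s - 1) * w) - Cexp ((s - 1) * - w)) * Kf s)%C.
  { rewrite (Stj_eq s w Hs Hw) (Stj_eq s (- w)%C Hs Hw') /Kf. ring. }
  have W1 : Cexp ((s - 1) * w)%C = (- Ci * Cexp (Ci * PI * (s / 2)))%C.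
  { have -> : ((s - 1) * w = Ci * PI * (s / 2) + - w)%C by rewrite /w RtoC_half; field.
    rewrite Cexp_plus Cexp_opp /w Cexp_half_PI.
    rewrite Cinv_Ci.
    ring. }
  have W2 : Cexp ((s - 1) * - w)%C = (Ci * Cexp (- (Ci * PI * (s / 2))))%C.
  { have -> : ((s - 1) * - w = - (Ci * PI * (s / 2)) + w)%C by rewrite /w RtoC_half; field.
    rewrite Cexp_plus /w Cexp_half_PI. ring. }
  rewrite E W1 W2 in E2.
  have -> : Kf (s / 2)%C = (- (- Ci * Kf (s / 2)) * / Ci)%C by field; exact: Ci_neq0.
  rewrite E2. field. exact: Ci_neq0.
Qed.

Lemma sn_half (s : C) : sn s = (sn (s / 2) * (Cexp (Ci * PI * (s / 2)) + Cexp (- (Ci * PI * (s / 2)))))%C.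
Proof.
  rewrite /sn. have -> : (Ci * PI * s = Ci * PI * (s / 2) + Ci * PI * (s / 2))%C by field.
  have -> : (- (Ci * PI * (s / 2) + Ci * PI * (s / 2)) = - (Ci * PI * (s / 2)) + - (Ci * PI * (s / 2)))%C by ring.
  rewrite !Cexp_plus. ring.
Qed.

(** Minus the derivative of [1 / (1 + exp x)]. Integration by parts turns [s * Kf s] into its Mellin
    transform, which is defined around [s = 0]. *)
Definition k2_k (x : R) : C := RtoC (exp x / ((1 + exp x) * (1 + exp x))).

Lemma k2_bounded : mel_bounded k2_k (-1) 1.
Proof.
  split.
  - apply: mel_int_cont => x. apply: rcont_R. apply: (ex_derive_continuous (V := R_NormedModule)). auto_derive. have := exp_pos x. nra.
  - exists 1. split; first lra.
    have E : forall x, Cmod (k2_k x) = exp x / ((1 + exp x) * (1 + exp x)).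
    { move=> x. rewrite Cmod_R Rabs_pos_eq //. have p := exp_pos x. apply: Rlt_le; apply: Rdiv_lt_0_compat; nra. }
    split => x; rewrite E; have p := exp_pos x; set u := exp x in p *.
    + have -> : - -1 * x = x by ring. rewrite -/u. apply: (Rmult_le_reg_r ((1 + u) * (1 + u))); first nra.
      have -> : u / ((1 + u) * (1 + u)) * ((1 + u) * (1 + u)) = u by field; lra. nra.
    + have -> : - (1) * x = - x by ring. rewrite exp_Ropp -/u. apply: (Rmult_le_reg_r (u * ((1 + u) * (1 + u)))); first nra.
      have -> : u / ((1 + u) * (1 + u)) * (u * ((1 + u) * (1 + u))) = u * u by field; lra.
      have -> : 1 * / u * (u * ((1 + u) * (1 + u))) = (1 + u) * (1 + u) by field; lra. nra.
Qed.

Lemma Cinv_RtoC (x : R) : x <> 0 -> (/ RtoC x)%C = RtoC (/ x).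
Proof. move=> H. by rewrite RtoC_inv. Qed.

Lemma is_derive_logistic x : is_derive (fun x => / (exp x + 1)) x (- (exp x / ((1 + exp x) * (1 + exp x)))).
Proof. have p := exp_pos x. auto_derive; first lra. field. lra. Qed.

Lemma Kf_mul (s : C) : 0 < Re s < 1 -> (s * Kf s)%C = Mel k2_k s.
Proof.
  move=> Hs. have [K D] := Kf_ldom s Hs.
  have [K2 D2] := mel_ldom_ex k2_k (-1) 1 s k2_bounded ltac:(lra).
  have E : forall x, (Cexp (s * RtoC x) * / (RtoC (exp x) + Cexp 0) = Cexp (s * RtoC x) * RtoC (/ (exp x + 1)))%C.
  { move=> x. rewrite Cexp_0 -RtoC_plus Cinv_RtoC //. have := exp_pos x. lra. }
  have rcl : forall x, rcont (fun x => RtoC (/ (exp x + 1))) x.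
  { move=> x. apply: rcont_R. apply: (ex_derive_continuous (V := R_NormedModule)). eexists. exact: is_derive_logistic. }
  have Z : is_LI (fun x => s * (Cexp (s * RtoC x) * / (RtoC (exp x) + Cexp 0)) - Cexp (s * RtoC x) * k2_k x)%C 0%C.
  { apply: (is_LI_FTC_0 (fun x => Cexp (s * RtoC x) * RtoC (/ (exp x + 1)))%C _ K).
    - move=> x. apply rderiv_eps => e He. rewrite !E.
      set q := fun y => RtoC (/ (exp y + 1)).
      have dq : rderiv q x (- k2_k x)%C.
      { rewrite /k2_k -RtoC_opp. apply: rderiv_RtoC. exact: is_derive_logistic. }
      have dp := rderiv_exp_lin s x.
      have H0 : rderiv (fun y => Cexp (s * RtoC y) * q y)%C x (s * Cexp (s * RtoC x) * q x + Cexp (s * RtoC x) * - k2_k x)%C.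
      { exact: rderiv_mult. }
      have -> : (s * (Cexp (s * x) * RtoC (/ (exp x + 1))) - Cexp (s * x) * k2_k x = s * Cexp (s * RtoC x) * q x + Cexp (s * RtoC x) * - k2_k x)%C by rewrite /q; ring.
      exact: (proj1 (rderiv_eps _ _ _) H0).
    - move=> x. apply: rcont_minus.
      + apply: rcont_mult; first exact: rcont_const. apply: rcont_mult; first exact: rcont_exp_lin.
        apply: rcont_inv; first by rewrite Cexp_0 -RtoC_plus; apply: RtoC_neq0; have := exp_pos x; lra.
        apply: rcont_plus; [exact: rcont_expR|exact: rcont_const].
      + apply: rcont_mult; first exact: rcont_exp_lin.
        apply: rcont_R. apply: (ex_derive_continuous (V := R_NormedModule)). auto_derive. have := exp_pos x. nra.
    - move=> x. rewrite -E. exact: (proj2 D). }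
  have := LI_eq _ _ Z. rewrite (LI_minus _ _ _ _ (ldom_scal s _ _ D) D2) (LI_scal _ _ _ D).
  by move/Cminus_eq_0.
Qed.

Lemma Mel_k2_0 : Mel k2_k 0%C = 1%C.
Proof.
  apply: LI_eq. have E1 : (RtoC 1 = 0 - - (1))%C by ring. rewrite [X in is_LI _ X]E1.
  have lim : forall e, 0 < e -> exists A, 0 < A /\ forall x, A <= x -> exp (- x) < e.
  { move=> e He. exists (Rabs (ln e) + 1). split; first by have := Rabs_pos (ln e); lra.
    move=> x Hx. rewrite -(exp_ln e) //. apply: exp_increasing. have := Rle_abs (- ln e). rewrite Rabs_Ropp. lra. }
  apply: (is_LI_FTC (fun x => RtoC (- / (exp x + 1)))).
  - move=> x. have -> : (Cexp (0 * x) * k2_k x = RtoC (exp x / ((1 + exp x) * (1 + exp x))))%C by rewrite Cmult_0_l Cexp_0 Cmult_1_l.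
    apply: (rderiv_RtoC (fun x => - / (exp x + 1))). have p := exp_pos x. auto_derive; first lra. field. lra.
  - move=> x. apply: rcont_mult; first exact: rcont_exp_lin. apply: rcont_R. apply: (ex_derive_continuous (V := R_NormedModule)). auto_derive. have := exp_pos x. nra.
  - move=> e He. have [A [HA W]] := lim e He. exists A. split => // x Hx.
    have -> : (RtoC (- / (exp x + 1)) - 0 = RtoC (- / (exp x + 1)))%C by ring. rewrite Cmod_R Rabs_Ropp.
    have p := exp_pos x. rewrite Rabs_pos_eq; last by apply: Rlt_le; apply: Rinv_0_lt_compat; lra.
    apply: Rle_lt_trans (W x Hx). rewrite exp_Ropp. apply: Rinv_le_contravar; lra.
  - move=> e He. have [A [HA W]] := lim e He. exists A. split => // x Hx. have p := exp_pos x.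
    have -> : (RtoC (- / (exp x + 1)) - - (1) = RtoC (exp x / (exp x + 1)))%C.
    { apply: C_ext; rewrite /=; [field; lra|ring]. }
    rewrite Cmod_R Rabs_pos_eq; last by apply: Rlt_le; apply: Rdiv_lt_0_compat; lra.
    have := W (- x) ltac:(lra). rewrite Ropp_involutive. apply: Rle_lt_trans.
    apply: (Rmult_le_reg_r (exp x + 1)); first lra. have -> : exp x / (exp x + 1) * (exp x + 1) = exp x by field; lra. nra.
Qed.

Lemma sn_cdiff z : cdiff sn z.
Proof. rewrite /sn. cdiff_tac. Qed.

Lemma cderiv_sn_0 : cderiv sn 0%C (2 * PI * Ci)%C.
Proof.
  have D : forall k z : C, cderiv (fun w => Cexp (k * w))%C z (Cexp (k * z) * k)%C.
  { move=> k z. apply: (cderiv_comp Cexp (fun w => k * w)%C); first exact: cderiv_Cexp.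
    move=> e He. exists 1. split; first lra. move=> w _.
    have -> : (k * w - k * z - k * (w - z) = 0)%C by ring. rewrite Cmod_0. have := Cmod_ge_0 (w - z)%C. nra. }
  apply cderiv_is_derive. have H1 := proj1 (cderiv_is_derive _ _ _) (D (Ci * PI)%C 0%C). have H2 := proj1 (cderiv_is_derive _ _ _) (D (- (Ci * PI))%C 0%C).
  have H3 := is_derive_minus _ _ _ _ _ H1 H2.
  apply cderiv_is_derive. apply cderiv_is_derive in H3.
  apply: (cderiv_ext_loc _ sn 0%C _ 1 Rlt_0_1); last first.
  - have -> : (2 * PI * Ci)%C = minus (Cexp (Ci * PI * 0) * (Ci * PI))%C (Cexp (- (Ci * PI) * 0) * - (Ci * PI))%C.
    { rewrite !Cmult_0_r Cexp_0 /minus /plus /opp /=. ring. }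
    exact: H3.
  - move=> w _. rewrite /sn /minus /plus /opp /=. have -> : (- (Ci * PI * w) = - (Ci * PI) * w)%C by ring. done.
Qed.

Lemma sn_0 : sn 0%C = 0%C.
Proof. rewrite /sn !Cmult_0_r. have -> : (- 0 = 0)%C by ring. ring. Qed.

Lemma ccont_mult (f g : C -> C) z : cdiff f z -> ccont g z -> ccont (fun w => f w * g w)%C z.
Proof.
  move=> Hf Hg e He. have Cf := cdiff_ccont _ _ Hf.
  set A := Cmod (f z) + 1. set B := Cmod (g z) + 1.
  have A0 := Cmod_ge_0 (f z). have B0 := Cmod_ge_0 (g z).
  have [d1 [Hd1 H1]] := Cf (Rmin 1 (e / (2 * B))) ltac:(apply: Rmin_glb_lt; [lra|apply: Rdiv_lt_0_compat; rewrite /B; lra]).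
  have [d2 [Hd2 H2]] := Hg (e / (2 * A)) ltac:(apply: Rdiv_lt_0_compat; rewrite /A; lra).
  exists (Rmin d1 d2). split; first exact: Rmin_glb_lt.
  move=> w Hw. have {}H1 := H1 w (Rlt_le_trans _ _ _ Hw (Rmin_l _ _)). have {}H2 := H2 w (Rlt_le_trans _ _ _ Hw (Rmin_r _ _)).
  have h1 := Rlt_le_trans _ _ _ H1 (Rmin_l _ _). have h2 := Rlt_le_trans _ _ _ H1 (Rmin_r _ _).
  have -> : (f w * g w - f z * g z = f w * (g w - g z) + (f w - f z) * g z)%C by ring.
  apply: Rle_lt_trans (Cmod_triangle _ _) _. rewrite !Cmod_mult.
  have fw : Cmod (f w) <= A by have := Cmod_triangle_rev_minus (f w) (f z); rewrite /A; lra.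
  have p1 : Cmod (f w) * Cmod (g w - g z)%C <= A * Cmod (g w - g z)%C by apply: Rmult_le_compat_r => //; exact: Cmod_ge_0.
  have p1' : A * Cmod (g w - g z)%C < A * (e / (2 * A)) by apply: Rmult_lt_compat_l => //; rewrite /A; lra.
  have p2 : Cmod (f w - f z)%C * Cmod (g z) <= e / (2 * B) * B.
  { apply: Rmult_le_compat; try exact: Cmod_ge_0; try lra. rewrite /B; lra. }
  have E1 : A * (e / (2 * A)) = e / 2 by field; rewrite /A; lra.
  have E2 : e / (2 * B) * B = e / 2 by field; rewrite /B; lra.
  lra.
Qed.

(** The halving formulas of [Kf] and [sn] carry the same factor on opposite sides, so the product is
    unchanged when [s] is replaced by [z = s / 2 ^ n]. As [z] tends to 0, [z * Kf z] tends to
    [Mel k2_k 0 = 1] and [sn z / z] to the derivative [2 PI Ci]. *)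
Lemma Kf_sn (s : C) : 0 < Re s < 1 -> (Kf s * sn s = 2 * PI * Ci)%C.
Proof.
  move=> Hs.
  have h2 : forall n, 0 < 2 ^ n by move=> n; apply: pow_lt; lra.
  have I : forall n, (Kf (s / RtoC (2 ^ n)) * sn (s / RtoC (2 ^ n)) = Kf s * sn s)%C /\ 0 < Re (s / RtoC (2 ^ n))%C < 1.
  { elim=> [|n [IH1 IH2]].
    - have -> : (s / RtoC (2 ^ 0) = s)%C by rewrite /=; field. done.
    - have N : RtoC (2 ^ n) <> 0%C by apply: RtoC_neq0; have := h2 n; lra.
      have -> : (s / RtoC (2 ^ S n) = s / RtoC (2 ^ n) / 2)%C by rewrite /= RtoC_mult; field.
      split; first by rewrite -IH1 Kf_half // (sn_half (s / RtoC (2 ^ n))%C); ring.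
      have -> : forall z : C, Re (z / 2)%C = Re z / 2 by move=> z; rewrite /= /Re; field. lra. }
  apply: C_eq_small => e He.
  set g := slope sn 0%C (2 * PI * Ci)%C.
  have Gg : ccont (fun w => Mel k2_k w * g w)%C 0%C.
  { apply: ccont_mult; first by apply: (mel_holo k2_k (-1) 1 _ k2_bounded); rewrite /=; lra.
    apply: slope_ccont. exact: cderiv_sn_0. }
  have [d [Hd K]] := Gg e He. rewrite Mel_k2_0 /g slope_eq Cmult_1_l -/g in K.
  have [n Hn] := pow_half_small (Cmod s) d Hd.
  have [I1 I2] := I n. set z := (s / RtoC (2 ^ n))%C in I1 I2.
  have Hz : Cmod (z - 0)%C < d.
  { have -> : (z - 0 = z)%C by ring. rewrite /z Cmod_div; last by apply: RtoC_neq0; have := h2 n; lra.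
    rewrite Cmod_R Rabs_pos_eq //. exact: Rlt_le. }
  have z0 : z <> 0%C by move=> E; move: I2; rewrite E /=; lra.
  have := K z Hz. rewrite -Kf_mul // /g slope_neq // sn_0.
  have -> : (z * Kf z * ((sn z - 0) / (z - 0)) = Kf z * sn z)%C by (have -> : (z - 0 = z)%C by ring); field.
  rewrite I1. lra.
Qed.

Lemma exp_taylor_abs y : Rabs (exp y - 1 - y) <= y * y * exp (Rabs y).
Proof.
  have h1 := exp_ineq1_le y. have h2 := exp_ineq1_le (- y). have p := exp_pos y.
  have h3 : exp y * (1 - y) <= 1.
  { rewrite exp_Ropp in h2. have : exp y * / exp y = 1 by field; lra. nra. }
  rewrite Rabs_pos_eq; last lra.
  case: (Rle_lt_dec 0 y) => hy.
  - rewrite Rabs_pos_eq //. nra.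
  - have q : 1 <= exp (Rabs y) by rewrite -exp_0; apply: exp_le; exact: Rabs_pos.
    apply: (Rle_trans _ (y * y)); last nra.
    apply: (Rmult_le_reg_r (1 - y)); first lra. nra.
Qed.

(** [1 - exp (- u)] is at most [min(1, u)], hence at most [u^k]. *)
Lemma one_minus_exp_le k u : 0 < u -> 0 < k <= 1 -> 0 <= 1 - exp (- u) <= exp (k * ln u).
Proof.
  move=> Hu Hk. have := exp_neg_le1 u ltac:(lra). have := exp_ineq1_le (- u) => h1 h2. split; first lra.
  case: (Rle_lt_dec 1 u) => h.
  - have : 0 <= ln u by rewrite -ln_1; apply: ln_le; lra. move=> l. have : exp 0 <= exp (k * ln u) by apply: exp_le; nra. rewrite exp_0. have := exp_pos (- u). lra.
  - have l : ln u < 0 by rewrite -ln_1; apply: ln_increasing.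
    apply: (Rle_trans _ u); first lra. rewrite -{1}(exp_ln u Hu). apply: exp_le. nra.
Qed.

(** The integrand [1 / (1 + u)] of [Kf], with [u = exp x], damped by [exp (- v (1 + u))] so that
    differentiation in [v] removes the denominator and leaves a Laplace kernel. *)
Definition jk (v x : R) : C := RtoC (exp (- (v * (1 + exp x))) / (1 + exp x)).
Definition Jf (s : C) (v : R) : C := Mel (jk v) s.

Lemma rcont_jk v x : rcont (jk v) x.
Proof. apply: rcont_R. apply: (ex_derive_continuous (V := R_NormedModule)). auto_derive. have := exp_pos x. lra. Qed.

Lemma Cmod_jk v x : Cmod (jk v x) = exp (- (v * (1 + exp x))) / (1 + exp x).
Proof. rewrite /jk Cmod_R Rabs_pos_eq //. have := exp_pos x => p. apply: Rlt_le; apply: Rdiv_lt_0_compat; [exact: exp_pos|lra]. Qed.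

Lemma inv_1p_exp_bounds x : / (1 + exp x) <= 1 /\ / (1 + exp x) <= exp (- x).
Proof.
  have p := exp_pos x. split.
  - rewrite -Rinv_1. apply: Rinv_le_contravar; lra.
  - rewrite exp_Ropp. apply: Rinv_le_contravar; lra.
Qed.

Lemma jk_dom (s : C) : 0 < Re s < 1 -> exists K, 0 <= K /\ forall v, 0 <= v -> ldom (fun x => Cexp (s * RtoC x) * jk v x)%C (exp (- v) * K).
Proof.
  move=> Hs. have [d [d0 [d1 d2]]] := strip_margin 0 1 (Re s) Hs.
  exists (4 / (d * d)). split; first by apply: Rlt_le; apply: Rdiv_lt_0_compat; nra.
  move=> v Hv. have E : forall x, Cmod (jk v x) <= exp (- v) * / (1 + exp x).
  { move=> x. rewrite Cmod_jk. have p := exp_pos x. apply: Rmult_le_compat_r; first by apply: Rlt_le; apply: Rinv_0_lt_compat; lra.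
    apply: exp_le. nra. }
  have ev := exp_pos (- v).
  apply: (mel_ldom _ 0 1) => //; try lra.
  - apply: mel_int_cont => x. exact: rcont_jk.
  - move=> x. apply: Rle_trans (E x) _. rewrite Ropp_0 Rmult_0_l exp_0. apply: Rmult_le_compat_l; first lra. exact: (proj1 (inv_1p_exp_bounds x)).
  - move=> x. apply: Rle_trans (E x) _. have -> : - (1) * x = - x by ring. apply: Rmult_le_compat_l; first lra. exact: (proj2 (inv_1p_exp_bounds x)).
Qed.

Lemma Jf_norm (s : C) : 0 < Re s < 1 -> exists K, 0 <= K /\ forall v, 0 <= v -> Cmod (Jf s v) <= K * exp (- v).
Proof.
  move=> Hs. have [K [K0 H]] := jk_dom s Hs. exists (4 * K). split; first lra.
  move=> v Hv. have := LI_norm _ _ (H v Hv). rewrite /Jf /Mel. lra.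
Qed.

Lemma Jf_0 (s : C) : Jf s 0 = Kf s.
Proof.
  apply: LI_ext => x. congr (_ * _)%C. rewrite /jk Cexp_0 Rmult_0_l Ropp_0 exp_0 -RtoC_plus.
  have p := exp_pos x. rewrite Cinv_RtoC; last lra. congr RtoC. field. lra.
Qed.

(** Hoelder continuity at [v = 0]: the bound [1 - exp (- v X) <= (v X)^k] with [X = 1 + u] leaves
    [X^(k-1)], and [k = (1 - Re s) / 2] satisfies [Re s < 1 - k], so the Mellin integral still
    converges. *)
Lemma Jf_near_0 (s : C) : 0 < Re s < 1 -> exists K k, 0 < k /\ 0 <= K /\ forall v, 0 < v -> Cmod (Jf s v - Jf s 0)%C <= K * exp (k * ln v).
Proof.
  move=> Hs. set k := (1 - Re s) / 2.
  have [d [d0 [d1 d2]]] := strip_margin 0 (1 - k) (Re s) ltac:(rewrite /k; lra).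
  exists (4 * (4 / (d * d))), k. split; first by rewrite /k; lra.
  split. { apply: Rmult_le_pos; first lra. apply: Rlt_le; apply: Rdiv_lt_0_compat; nra. }
  move=> v Hv. have [K [K0 H]] := jk_dom s Hs.
  rewrite /Jf /Mel -(LI_minus _ _ _ _ (H v ltac:(lra)) (H 0 ltac:(lra))).
  set C0 := exp (k * ln v). have C00 : 0 < C0 by exact: exp_pos.
  have D : ldom (fun x => Cexp (s * RtoC x) * (jk v x - jk 0 x))%C (C0 * (4 / (d * d))).
  { have E : forall x, Cmod (jk v x - jk 0 x)%C <= C0 * exp (- ((1 - k) * ln (1 + exp x))).
    { move=> x. have p := exp_pos x. set X := 1 + exp x. have X1 : 0 < X by rewrite /X; lra.
      have -> : (jk v x - jk 0 x = RtoC (- ((1 - exp (- (v * X))) / X)))%C.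
      { rewrite /jk -/X -RtoC_minus Rmult_0_l Ropp_0 exp_0. congr RtoC. field. lra. }
      rewrite Cmod_R Rabs_Ropp. have [q1 q2] := one_minus_exp_le k (v * X) ltac:(apply: Rmult_lt_0_compat; lra) ltac:(rewrite /k; lra).
      rewrite Rabs_pos_eq; last by apply: Rmult_le_pos => //; apply: Rlt_le; apply: Rinv_0_lt_compat; lra.
      have -> : C0 * exp (- ((1 - k) * ln X)) = exp (k * ln (v * X)) / X.
      { have eX : / X = exp (- ln X) by rewrite exp_Ropp exp_ln.
        rewrite /Rdiv eX ln_mult // /C0 -!exp_plus. congr exp. ring. }
      apply: Rmult_le_compat_r => //. apply: Rlt_le; exact: Rinv_0_lt_compat. }
    apply: (mel_ldom _ 0 (1 - k)) => //; try lra.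
    - apply: mel_int_cont => x. apply: rcont_minus; exact: rcont_jk.
    - move=> x. apply: Rle_trans (E x) _. apply: Rmult_le_compat_l; first lra. apply: exp_le.
      have p := exp_pos x. have : 0 <= ln (1 + exp x) by rewrite -ln_1; apply: ln_le; lra.
      have : 0 < 1 - k by rewrite /k; lra. nra.
    - move=> x. apply: Rle_trans (E x) _. apply: Rmult_le_compat_l; first lra. apply: exp_le.
      have p := exp_pos x. have : x <= ln (1 + exp x) by rewrite -{1}(ln_exp x); apply: ln_le; lra.
      have : 0 < 1 - k by rewrite /k; lra. nra. }
  rewrite (LI_ext _ (fun x => Cexp (s * RtoC x) * (jk v x - jk 0 x))%C); last by move=> x; ring.
  apply: Rle_trans (LI_norm _ _ D) _. rewrite -/C0. lra.
Qed.

(** Differentiation under the integral: for [|h| < v / 2] the second order error is [h^2] times a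
    function dominated independently of [h]. *)
Lemma rderiv_Jf (s : C) v : 0 < Re s < 1 -> 0 < v -> rderiv (Jf s) v (- (RtoC (exp (- v)) * Lap s (RtoC (ln v))))%C.
Proof.
  move=> Hs Hv.
  have [K [K0 H]] := jk_dom s Hs.
  have [KL DL] := lap_ldom s (RtoC (ln v)) ltac:(lra) ltac:(rewrite /= Rabs_R0; have := PI_RGT_0; lra).
  have [d [d0 [d1 d2]]] := strip_margin 0 1 (Re s) Hs.
  set Cb := exp (1 * (ln 1 - 1) - 1 * ln (v / 4)). have p : 0 < Cb by exact: exp_pos.
  set C1 := 4 / v * (1 + Cb). have v4 : 0 < 4 / v by apply: Rdiv_lt_0_compat; lra.
  have C10 : 0 < C1 by apply: Rmult_lt_0_compat; lra.
  set M := 4 * (C1 * (4 / (d * d))).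
  have M0 : 0 <= M by apply: Rmult_le_pos; first lra; apply: Rmult_le_pos; first lra; apply: Rlt_le; apply: Rdiv_lt_0_compat; nra.
  have Key : forall h, Rabs h < v / 2 -> Cmod (Jf s (v + h) - Jf s v - - (RtoC (exp (- v)) * Lap s (RtoC (ln v))) * RtoC h)%C <= M * (h * h).
  { move=> h /Rabs_def2 Hh.
    have Dv := H v ltac:(lra). have Dvh := H (v + h) ltac:(lra).
    set psi := fun x => RtoC ((exp (- ((v + h) * (1 + exp x))) - exp (- (v * (1 + exp x)))) / (1 + exp x) + h * exp (- (v * (1 + exp x)))).
    have Dl := ldom_scal (RtoC (h * exp (- v))) _ _ DL.
    have -> : (Jf s (v + h) - Jf s v - - (RtoC (exp (- v)) * Lap s (RtoC (ln v))) * RtoC h = LI (fun x => Cexp (s * RtoC x) * psi x))%C.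
    { have -> : (Jf s (v + h) - Jf s v - - (RtoC (exp (- v)) * Lap s (RtoC (ln v))) * RtoC h = (Jf s (v + h) - Jf s v) + RtoC (h * exp (- v)) * Lap s (RtoC (ln v)))%C by rewrite RtoC_mult; ring.
      rewrite /Lap -(LI_scal _ _ _ DL) /Jf /Mel -(LI_minus _ _ _ _ Dvh Dv) -(LI_plus _ _ _ _ (ldom_minus _ _ _ _ Dvh Dv) Dl).
      apply: LI_ext => x. have px := exp_pos x.
      have -> : Cexp (- Cexp (RtoC (ln v) + RtoC x))%C = RtoC (exp (- (v * exp x))) by rewrite -RtoC_plus Cexp_R -RtoC_opp Cexp_R exp_plus exp_ln.
      rewrite /jk /psi.
      have -> : exp (- (v * (1 + exp x))) = exp (- v) * exp (- (v * exp x)) by rewrite -exp_plus; congr exp; ring.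
      set a := exp (- ((v + h) * (1 + exp x))). set e2 := exp (- (v * exp x)).
      have -> : RtoC ((a - exp (- v) * e2) / (1 + exp x) + h * (exp (- v) * e2)) = (RtoC (a / (1 + exp x)) - RtoC (exp (- v) * e2 / (1 + exp x)) + RtoC (h * exp (- v)) * RtoC e2)%C.
      { rewrite -RtoC_minus -RtoC_mult -RtoC_plus. congr RtoC. field. lra. }
      ring. }
    have Dp : ldom (fun x => Cexp (s * RtoC x) * psi x)%C (h * h * C1 * (4 / (d * d))).
    { have E : forall x, Cmod (psi x) <= h * h * (4 / v) * exp (- (v / 4 * exp x)).
      { move=> x. have px := exp_pos x. rewrite /psi Cmod_R. set X := 1 + exp x. have X1 : 1 < X by rewrite /X; lra.
        have -> : (exp (- ((v + h) * X)) - exp (- (v * X))) / X + h * exp (- (v * X)) = exp (- (v * X)) * (exp (- (h * X)) - 1 - - (h * X)) / X.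
        { have -> : exp (- ((v + h) * X)) = exp (- (v * X)) * exp (- (h * X)) by rewrite -exp_plus; congr exp; ring. field. lra. }
        have T := exp_taylor_abs (- (h * X)).
        rewrite /Rdiv !Rabs_mult (Rabs_pos_eq (exp (- (v * X)))); last exact: Rlt_le (exp_pos _).
        rewrite (Rabs_pos_eq (/ X)); last by apply: Rlt_le; apply: Rinv_0_lt_compat; lra.
        have Ah : Rabs (- (h * X)) <= v / 2 * X.
        { rewrite Rabs_Ropp Rabs_mult (Rabs_pos_eq X); last lra. apply: Rmult_le_compat_r; first lra. apply: Rabs_le; lra. }
        have T2 : Rabs (exp (- (h * X)) - 1 - - (h * X)) <= h * h * (X * X) * exp (v / 2 * X).
        { apply: Rle_trans T _. have -> : - (h * X) * - (h * X) = h * h * (X * X) by ring.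
          apply: Rmult_le_compat_l; first nra. exact: exp_le. }
        apply: (Rle_trans _ (exp (- (v * X)) * (h * h * (X * X) * exp (v / 2 * X)) * / X)).
        { apply: Rmult_le_compat_r; first by apply: Rlt_le; apply: Rinv_0_lt_compat; lra.
          apply: Rmult_le_compat_l => //. exact: Rlt_le (exp_pos _). }
        have -> : exp (- (v * X)) * (h * h * (X * X) * exp (v / 2 * X)) * / X = h * h * (X * (exp (- (v * X)) * exp (v / 2 * X))) by field; lra.
        rewrite -exp_plus (Rmult_assoc (h * h)). apply: Rmult_le_compat_l; first exact: Rle_0_sqr.
        (* Of the remaining decay [exp (- v X / 2)], one half absorbs the factor [X], the other
           provides the decay in [exp x]. *)
        have -> : - (v * X) + v / 2 * X = - (v / 4 * X) + - (v / 4 * X) by field.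
        rewrite exp_plus.
        have L : v / 4 * X * exp (- (v / 4 * X)) <= 1.
        { have y0 : 0 < v / 4 * X by apply: Rmult_lt_0_compat; lra. have := exp_ineq1_le (v / 4 * X). have := exp_pos (v / 4 * X) => py q.
          rewrite exp_Ropp. apply: (Rmult_le_reg_r (exp (v / 4 * X))) => //. have -> : v / 4 * X * / exp (v / 4 * X) * exp (v / 4 * X) = v / 4 * X by field; lra. lra. }
        have Q : exp (- (v / 4 * X)) <= exp (- (v / 4 * exp x)) by apply: exp_le; rewrite /X; nra.
        have -> : X * (exp (- (v / 4 * X)) * exp (- (v / 4 * X))) = (v / 4 * X * exp (- (v / 4 * X))) * (4 / v * exp (- (v / 4 * X))) by field; lra.
        have e1 := exp_pos (- (v / 4 * X)).
        have r0 : 0 <= 4 / v * exp (- (v / 4 * X)) by apply: Rmult_le_pos; lra.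
        apply: (Rle_trans _ (1 * (4 / v * exp (- (v / 4 * X))))); first exact: Rmult_le_compat_r.
        rewrite Rmult_1_l. apply: Rmult_le_compat_l => //. exact: Rlt_le. }
      have hh : 0 <= h * h by exact: Rle_0_sqr.
      have hv : 0 <= h * h * (4 / v) by apply: Rmult_le_pos; lra.
      apply: (mel_ldom _ 0 1) => //; try lra.
      - apply: mel_int_cont => x. apply: rcont_R. apply: (ex_derive_continuous (V := R_NormedModule)). auto_derive. have := exp_pos x. lra.
      - apply: Rmult_le_pos; lra.
      - move=> x. apply: Rle_trans (E x) _. rewrite Ropp_0 Rmult_0_l exp_0 /C1.
        have := exp_neg_le1 (v / 4 * exp x) ltac:(have := exp_pos x; nra) => q.
        have -> : h * h * (4 / v * (1 + Cb)) * 1 = h * h * (4 / v) * (1 + Cb) by ring. apply: Rmult_le_compat_l; lra.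
      - move=> x. apply: Rle_trans (E x) _. have := exp_double_decay (v / 4) 1 x ltac:(lra) Rlt_0_1. rewrite -/Cb => q.
        have ex := exp_pos (- (1) * x). rewrite /C1.
        have -> : h * h * (4 / v * (1 + Cb)) * exp (- (1) * x) = h * h * (4 / v) * ((1 + Cb) * exp (- (1) * x)) by ring.
        apply: Rmult_le_compat_l => //. lra. }
    apply: Rle_trans (LI_norm _ _ Dp) _. rewrite /M. apply: Req_le. ring. }
  apply rderiv_eps => e He. exists (Rmin (v / 2) (e / (M + 1))). split.
  { apply: Rmin_glb_lt; first lra. apply: Rdiv_lt_0_compat; lra. }
  move=> y Hy. have h1 := Rlt_le_trans _ _ _ Hy (Rmin_l _ _). have h2 := Rlt_le_trans _ _ _ Hy (Rmin_r _ _).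
  have := Key (y - v) h1. have -> : v + (y - v) = y by ring. move=> k. apply: Rle_trans k _.
  have -> : (y - v) * (y - v) = Rabs (y - v) * Rabs (y - v) by rewrite -Rabs_mult Rabs_pos_eq //; exact: Rle_0_sqr.
  have a0 := Rabs_pos (y - v). rewrite -Rmult_assoc. apply: Rmult_le_compat_r => //.
  have E : e = (M + 1) * (e / (M + 1)) by field; lra. rewrite E. nra.
Qed.

Lemma rderiv_comp_R (F : R -> C) (g : R -> R) x l m : rderiv F (g x) l -> is_derive g x m -> rderiv (fun y => F (g y)) x (RtoC m * l)%C.
Proof. move=> HF Hg. rewrite -scal_R_Cmult. exact: (is_derive_comp (K := R_AbsRing) (V := C_R_NormedModule) F g). Qed.

Lemma exp_le_eventually K k e : 0 <= K -> 0 < k -> 0 < e -> exists A, 0 < A /\ forall x, A <= x -> K * exp (- (k * x)) < e.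
Proof.
  move=> HK Hk He. exists (Rabs (ln (e / (K + 1))) / k + 1). have q : 0 < e / (K + 1) by apply: Rdiv_lt_0_compat; lra.
  have a0 := Rabs_pos (ln (e / (K + 1))).
  split. { have : 0 <= Rabs (ln (e / (K + 1))) / k by apply: Rmult_le_pos => //; apply: Rlt_le; exact: Rinv_0_lt_compat. lra. }
  move=> x Hx. have h : exp (- (k * x)) < e / (K + 1).
  { rewrite -(exp_ln (e / (K + 1))) //. apply: exp_increasing. have := Rle_abs (- ln (e / (K + 1))). rewrite Rabs_Ropp => h.
    have : k * (Rabs (ln (e / (K + 1))) / k + 1) <= k * x by apply: Rmult_le_compat_l; lra.
    have -> : k * (Rabs (ln (e / (K + 1))) / k + 1) = Rabs (ln (e / (K + 1))) + k by field; lra. lra. }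
  have p := exp_pos (- (k * x)).
  have E : (K + 1) * (e / (K + 1)) = e by field; lra.
  have : (K + 1) * exp (- (k * x)) < (K + 1) * (e / (K + 1)) by apply: Rmult_lt_compat_l; lra. lra.
Qed.

(* With [J v] the Mellin transform of [e^(-v(1+u))/(1+u)]: [Kf = J 0] and [Gam (1-s) Gam s] is the integral of [-J'] over [v > 0]. *)
Lemma Gam_reflection_K (s : C) : 0 < Re s < 1 -> (Gam (1 - s) * Gam s)%C = Kf s.
Proof.
  move=> Hs.
  have Hs1 : 0 < Re (1 - s)%C by have -> : Re (1 - s)%C = 1 - Re s by []; lra.
  have [K D] := Gam_ldom _ Hs1.
  have H1 := is_LI_LI _ _ D.
  have H2 := is_LI_scal (Gam s) _ _ _ D H1.
  have -> : (Gam (1 - s) * Gam s = Gam s * LI (fun x => Cexp ((1 - s) * RtoC x) * gam_k x))%C by rewrite /Gam /Mel; ring.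
  apply: (is_LI_unique _ _ _ H2).
  have -> : (Kf s = 0 - (- Kf s))%C by ring.
  have [K1 [K10 B1]] := Jf_norm s Hs. have [K2 [k [k0 [K20 B2]]]] := Jf_near_0 s Hs.
  apply: (is_LI_FTC (fun y => - (1) * Jf s (exp y))%C).
  - move=> y. have ey := exp_pos y.
    have J1 := rderiv_scal (- (1)) _ _ _ (rderiv_comp_R (Jf s) exp y _ _ (rderiv_Jf s (exp y) Hs ey) (is_derive_exp y)).
    rewrite ln_exp (Lap_eq s) in J1; [|lra|rewrite /= Rabs_R0; have := PI_RGT_0; lra].
    have -> : (Gam s * (Cexp ((1 - s) * y) * gam_k y) = - (1) * (RtoC (exp y) * - (RtoC (exp (- exp y)) * (Cexp (- (s * y)) * Gam s))))%C; last exact: J1.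
    have -> : ((1 - s) * y = RtoC y + - (s * y))%C by ring. rewrite Cexp_plus Cexp_R /gam_k. ring.
  - move=> y. apply: rcont_mult; first exact: rcont_const. apply: rcont_mult; [exact: rcont_exp_lin|exact: rcont_gam_k].
  - move=> e He. have [A [HA W]] := exp_le_eventually K1 1 e K10 Rlt_0_1 He. exists A. split => // x Hx.
    have -> : (- (1) * Jf s (exp x) - 0 = - Jf s (exp x))%C by ring. rewrite Cmod_opp.
    apply: Rle_lt_trans (B1 _ (Rlt_le _ _ (exp_pos x))) _. apply: Rle_lt_trans (W x Hx).
    apply: Rmult_le_compat_l => //. apply: exp_le. have := exp_ineq1_le x. lra.
  - move=> e He. have [A [HA W]] := exp_le_eventually K2 k e K20 k0 He. exists A. split => // x Hx.
    rewrite -Jf_0. have -> : (- (1) * Jf s (exp x) - - Jf s 0 = - (Jf s (exp x) - Jf s 0))%C by ring. rewrite Cmod_opp.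
    apply: Rle_lt_trans (B2 _ (exp_pos x)) _. rewrite ln_exp. have := W (- x) ltac:(lra). by have -> : - (k * - x) = k * x by ring.
Qed.

Lemma Gam_reflection (s : C) : 0 < Re s < 1 -> (Gam (1 - s) * Gam s * sn s = 2 * PI * Ci)%C.
Proof. move=> Hs. rewrite Gam_reflection_K //. exact: Kf_sn. Qed.

(** * Nonvanishing and shifts of the Gamma function *)

Lemma half_plane_convex (c : R) (z w : C) t : Re z < c -> Re w < c -> 0 <= t <= 1 -> Re (seg z w t) < c.
Proof.
  move=> Hz Hw Ht. have -> : Re (seg z w t) = Re z + t * (Re w - Re z) by rewrite /seg /= /Re; ring.
  exact: convex_lt.
Qed.

Lemma half_plane_convex_gt (c : R) (z w : C) t : c < Re z -> c < Re w -> 0 <= t <= 1 -> c < Re (seg z w t).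
Proof.
  move=> Hz Hw Ht. have -> : Re (seg z w t) = Re z + t * (Re w - Re z) by rewrite /seg /= /Re; ring.
  have := convex_lt (- Re z) (- Re w) (- c) t ltac:(lra) ltac:(lra) Ht. lra.
Qed.

Lemma Re_close (z w : C) r : Cmod (w - z)%C < r -> Re z - r < Re w < Re z + r.
Proof. move=> H. have := Re_le_Cmod (w - z)%C. have -> : Re (w - z)%C = Re w - Re z by []. move/Rabs_le_between => h. lra. Qed.

(** The reflection formula multiplied by [1 - s], which turns [Gam (1 - s)] into [Gam (2 - s)]: both
    sides are then holomorphic for [0 < Re s < 2]. *)
Lemma Gam_reflection_2 (s : C) : 0 < Re s < 2 -> (Gam s * Gam (2 - s) * sn s = (1 - s) * (2 * PI * Ci))%C.
Proof.
  move=> Hs. apply: Cminus_eq_0.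
  have R2 : forall w : C, Re (2 - w)%C = 2 - Re w by [].
  apply: (identity_convex (fun w => 0 < Re w /\ Re w < 2) (fun s => Gam s * Gam (2 - s) * sn s - (1 - s) * (2 * PI * Ci))%C (RtoC (1 / 2))) => //.
  - move=> z w t [z1 z2] [w1 w2] Ht. split; [exact: half_plane_convex_gt|exact: half_plane_convex].
  - move=> z [z1 z2]. exists (Rmin (Re z) (2 - Re z)). split; first by apply: Rmin_glb_lt; lra.
    move=> w Hw. have h1 := Re_close _ _ _ (Rlt_le_trans _ _ _ Hw (Rmin_l _ _)). have h2 := Re_close _ _ _ (Rlt_le_trans _ _ _ Hw (Rmin_r _ _)).
    apply: cdiff_minus; last by cdiff_tac. apply: cdiff_mult; last exact: sn_cdiff.
    apply: cdiff_mult; first by apply: Gam_cdiff; lra.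
    apply: (cdiff_comp Gam (fun w => 2 - w)%C); last by cdiff_tac. apply: Gam_cdiff. rewrite R2. lra.
  - rewrite /=. lra.
  - exists (1 / 2). split; first lra. move=> w Hw. have h := Re_close _ _ _ Hw. rewrite /= in h.
    have R : (Gam (1 - w) * Gam w * sn w = 2 * PI * Ci)%C by apply: Gam_reflection; lra.
    have -> : (2 - w = (1 - w) + 1)%C by ring.
    rewrite Gam_succ; last by have -> : Re (1 - w)%C = 1 - Re w by []; lra.
    rewrite -R. ring.
Qed.

Lemma two_PI_Ci_neq0 : (2 * PI * Ci)%C <> 0%C.
Proof.
  apply: Cmult_neq_0; last exact: Ci_neq0. apply: Cmult_neq_0; apply: RtoC_neq0; first lra. have := PI_RGT_0; lra.
Qed.

(** At a zero with [0 < Re s < 2] the right side [(1 - s) 2 pi i] of the reflection formula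
    vanishes, so [s = 1], where [Gam] is 1. The functional equation carries this to larger real
    parts. *)
Lemma Gam_neq0 (s : C) : 0 < Re s -> Gam s <> 0%C.
Proof.
  move=> Hs.
  have base : forall s : C, 0 < Re s < 2 -> Gam s <> 0%C.
  { move=> z Hz E. case: (classic (z = 1%C)) => [Ez|N].
    - move: E. rewrite Ez Gam_1. exact: RtoC_neq0 R1_neq_R0.
    - have := Gam_reflection_2 z Hz. rewrite E. have -> : (0 * Gam (2 - z) * sn z = 0)%C by ring. move=> Q.
      have N1 : (1 - z)%C <> 0%C by apply: Cminus_neq_0 => h; apply: N.
      case: (Cmult_eq_0 (1 - z)%C (2 * PI * Ci)%C) => //. exact: two_PI_Ci_neq0. }
  have I : forall n (s : C), 0 < Re s < INR n + 2 -> Gam s <> 0%C.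
  { elim=> [|n IH] z Hz; first by apply: base; rewrite /= in Hz; lra.
    case: (Rlt_le_dec (Re z) 2) => h; first by apply: base; lra.
    rewrite S_INR in Hz. have R1 : Re (z - 1)%C = Re z - 1 by [].
    have -> : (z = (z - 1) + 1)%C by ring. rewrite Gam_succ; last by rewrite R1; lra.
    apply: Cmult_neq_0; last by apply: IH; rewrite R1; lra.
    move=> q. have := f_equal Re q. rewrite R1 /=. lra. }
  have [n Hn] := INR_unbounded (Re s). apply: (I n). lra.
Qed.

Lemma Cprod_seq_succ (f : nat -> C) N : Cprod f (seq 0 (S N)) = (Cprod f (seq 0 N) * f N)%C.
Proof.
  rewrite seq_S /Cprod map_app fold_right_app /=.
  have : forall l (c : C), fold_right Cmult c l = (fold_right Cmult 1 l * c)%C.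
  { elim=> [|a l IH] c /=; first ring. rewrite IH. ring. }
  move=> ->. ring.
Qed.

Lemma Cprod_shift_neq0 (s : C) N : (forall k, (k < N)%nat -> (s + INR k)%C <> 0%C) -> Cprod (fun k => s + INR k)%C (seq 0 N) <> 0%C.
Proof.
  elim: N => [|N IH] H; first exact: RtoC_neq0 R1_neq_R0.
  rewrite Cprod_seq_succ. apply: Cmult_neq_0; last by apply: H; lia. apply: IH => k Hk. apply: H. lia.
Qed.

Lemma Gam_shift (s : C) M N : 0 < Re s + INR M -> (M <= N)%nat ->
  (Cprod (fun k => s + INR k) (seq 0 N) * Gam (s + INR M) = Cprod (fun k => s + INR k) (seq 0 M) * Gam (s + INR N))%C.
Proof.
  move=> H. elim=> [//|N' HN IH].
  have h : INR M <= INR N' by exact: le_INR.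
  have -> : (s + INR (S N') = (s + INR N') + 1)%C by rewrite S_INR RtoC_plus; ring.
  rewrite Gam_succ; last by rewrite Re_plus /=; lra.
  rewrite Cprod_seq_succ.
  have -> : (Cprod (fun k => s + INR k) (seq 0 N') * (s + INR N') * Gam (s + INR M) = (s + INR N') * (Cprod (fun k => s + INR k) (seq 0 N') * Gam (s + INR M)))%C by ring.
  rewrite IH. ring.
Qed.

(** [CGamma] uses the least admissible shift, which jumps with [Re s]; every admissible shift gives
    the same value, so one [N] can serve on a whole disc. *)
Lemma CGamma_shift (s : C) N : 0 < Re s + INR N -> (forall k, (k < N)%nat -> (s + INR k)%C <> 0%C) ->
  CGamma s = (Gam (s + INR N) / Cprod (fun k => s + INR k) (seq 0 N))%C.
Proof.
  move=> H N0. rewrite /CGamma. set M := Z.to_nat _.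
  have [A1 A2] := archimed (- Re s).
  have HM : 0 < Re s + INR M.
  { rewrite /M INR_IZR_INZ. case: (Z_le_gt_dec 0 (up (- Re s))) => h.
    - rewrite Z2Nat.id //. lra.
    - have -> : Z.to_nat (up (- Re s)) = O by lia. have : IZR (up (- Re s)) < 0 by apply: IZR_lt; lia. rewrite /=. lra. }
  have HMN : (M <= N)%nat.
  { rewrite /M. suff : (Z.to_nat (up (- Re s)) < S N)%nat by lia. apply: INR_lt. rewrite S_INR INR_IZR_INZ.
    case: (Z_le_gt_dec 0 (up (- Re s))) => h.
    - rewrite Z2Nat.id //. lra.
    - have -> : Z.to_nat (up (- Re s)) = O by lia. have := pos_INR N. rewrite /=. lra. }
  rewrite Gamma_integral_Gam; last by rewrite Re_plus /=.
  have P1 := Cprod_shift_neq0 s N N0. have P2 := Cprod_shift_neq0 s M ltac:(move=> k Hk; apply: N0; lia).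
  have E := Gam_shift s M N HM HMN.
  apply: (Cmult_reg_r _ _ (Cprod (fun k => s + INR k) (seq 0 N) * Cprod (fun k => s + INR k) (seq 0 M))%C); first exact: Cmult_neq_0.
  transitivity (Cprod (fun k => s + INR k) (seq 0 N) * Gam (s + INR M))%C; first by field.
  rewrite E. field. exact: P1.
Qed.

Lemma CGamma_strip (s : C) : -1 < Re s < 0 -> CGamma s = (Gam (s + 1) / s)%C.
Proof.
  move=> H. have s0 : s <> 0%C by move=> E; move: H; rewrite E /=; lra.
  rewrite (CGamma_shift s 1) /=; [|lra|].
  - rewrite /Cprod /=. field. exact: s0.
  - move=> k Hk. have -> : k = O by lia. have -> : (s + INR 0 = s)%C by rewrite /=; ring. exact: s0.
Qed.

(** * Mellin representation of the Barnes series *)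

Lemma Re_mult_R (w : C) (x : R) : Re (w * RtoC x)%C = Re w * x.
Proof. rewrite Re_mult /=. ring. Qed.

Lemma Cpow_in_eq (I : R -> Prop) (z w : C) (phi : R) : z <> 0%C -> I phi -> z = (Cmod z * Cexp (Ci * phi))%C ->
  (forall phi', I phi' -> z = (Cmod z * Cexp (Ci * phi'))%C -> phi' = phi) ->
  Cpow_in I z w = Cexp (w * (ln (Cmod z) + Ci * phi))%C.
Proof.
  move=> Hz HI E U. rewrite /Cpow_in. have -> // : arg_in I z = phi.
  have [S1 S2] := epsilon_spec (inhabits 0) (fun phi => I phi /\ z = (Cmod z * Cexp (Ci * phi))%C) (ex_intro _ phi (conj HI E)).
  exact: U.
Qed.

Lemma angle_unique (z : C) (a b : R) : z <> 0%C -> z = (Cmod z * Cexp (Ci * a))%C -> z = (Cmod z * Cexp (Ci * b))%C ->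
  - (2 * PI) < a - b < 2 * PI -> a = b.
Proof.
  move=> Hz Ea Eb H.
  have N : RtoC (Cmod z) <> 0%C by apply: RtoC_neq0; have := proj1 (Cmod_gt_0 z) Hz; lra.
  have E : Cexp (Ci * a)%C = Cexp (Ci * b)%C.
  { apply: (Cmult_reg_r _ _ (Cmod z) N). rewrite !(Cmult_comm _ (RtoC (Cmod z))) -Ea. exact: Eb. }
  have := Cexp_inj_strip _ _ _ E. move=> Q.
  have I : forall c : R, Im (Ci * c)%C = c by move=> c; rewrite /=; ring.
  rewrite !I in Q. have := f_equal Im (Q H). by rewrite !I.
Qed.

Lemma Cexp_split (w : C) : Cexp w = (RtoC (exp (Re w)) * Cexp (Ci * Im w))%C.
Proof. rewrite -Cexp_R -Cexp_plus. congr Cexp. apply: C_ext; rewrite /= /Re /Im; ring. Qed.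

Lemma Cmod_mult_Cexp_Ci (t : R) (z : C) : Cmod (Cexp (Ci * t) * z)%C = Cmod z.
Proof. rewrite Cmod_mult Cmod_Cexp /=. have -> : 0 * t - 1 * 0 = 0 by ring. rewrite exp_0. ring. Qed.

Lemma polar_half_plane (z : C) : 0 < Re z -> exists w, Cexp w = z /\ Rabs (Im w) < PI / 2.
Proof.
  move=> H. have z0 : z <> 0%C by move=> E; move: H; rewrite E /=; lra.
  have [w [E [I _]]] := Cexp_surj z z0. exists w. split => //.
  have hr : 0 < cos (Im w).
  { move: H. rewrite -E Re_Cexp. have := exp_pos (Re w) => e h. nra. }
  apply: Rnot_le_lt => h. have := cos_ge_cos (PI / 2) (PI / 2) ltac:(rewrite Rabs_pos_eq; have := PI_RGT_0; lra) ltac:(have := PI_RGT_0; lra).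
  have c2 : cos (Rabs (Im w)) <= 0.
  { rewrite -cos_PI2. apply: cos_ge_cos; first by rewrite Rabs_pos_eq //; have := PI_RGT_0; lra. apply: Rabs_le; lra. }
  have : cos (Im w) = cos (Rabs (Im w)) by rewrite /Rabs; case: Rcase_abs => _ //; rewrite cos_neg.
  lra.
Qed.

Lemma Cpow_half_plane (theta : R) (w s : C) : Rabs (Im w) < PI / 2 ->
  Cpow_in (fun phi => theta - PI / 2 < phi < theta + PI / 2) (Cexp (Ci * theta) * Cexp w)%C s = (Cexp (s * (Ci * theta)) * Cexp (s * w))%C.
Proof.
  move=> /Rabs_def2 H. have P0 := PI_RGT_0.
  set z := (Cexp (Ci * theta) * Cexp w)%C.
  have Mz : Cmod z = exp (Re w) by rewrite /z Cmod_mult_Cexp_Ci Cmod_Cexp.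
  have z0 : z <> 0%C by apply: Cmod_pos_neq0; rewrite Mz; exact: exp_pos.
  have Ez : z = (Cmod z * Cexp (Ci * RtoC (theta + Im w)))%C.
  { rewrite Mz /z (Cexp_split w) RtoC_plus Cmult_plus_distr_l Cexp_plus. ring. }
  rewrite (Cpow_in_eq _ z s (theta + Im w)) //; last first.
  - move=> phi Hphi E. apply: (angle_unique z) => //. lra.
  - lra.
  rewrite Mz ln_exp -Cexp_plus. congr Cexp. rewrite RtoC_plus.
  have Ew : w = (RtoC (Re w) + Ci * RtoC (Im w))%C by apply: C_ext; rewrite /=; ring.
  transitivity (s * (Ci * theta) + s * (RtoC (Re w) + Ci * RtoC (Im w)))%C; first ring.
  by rewrite -Ew.
Qed.

(** With [u = exp x], geometric expansion of the factors shows this as the sum of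
    [exp (- (a + m_1 w_1 + ... + m_n w_n) u)], the Mellin kernel of the Barnes series. *)
Fixpoint bk (ws : list C) (a : C) (x : R) : C :=
  match ws with
  | nil => Cexp (- (a * RtoC (exp x)))%C
  | w :: ws' => (/ (1 - Cexp (- (w * RtoC (exp x)))) * bk ws' a x)%C
  end.

Definition pos_list (ws : list C) : Prop := forall w, In w ws -> 0 < Re w.

Lemma Cmod_Cexp_neg (w : C) u : Cmod (Cexp (- (w * RtoC u)))%C = exp (- (Re w * u)).
Proof. rewrite Cmod_Cexp. congr exp. rewrite /= /Re. ring. Qed.

Lemma one_minus_Cexp_lower (w : C) u : 0 < Re w -> 0 < u -> Re w * u / (1 + Re w * u) <= Cmod (1 - Cexp (- (w * RtoC u)))%C.
Proof.
  move=> Hw Hu. have p : 0 < Re w * u by exact: Rmult_lt_0_compat.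
  apply: Rle_trans (Cmod_triangle_rev_minus _ _). rewrite Cmod_1 Cmod_Cexp_neg exp_Ropp.
  have := exp_ineq1_le (Re w * u) => h. have : / exp (Re w * u) <= / (1 + Re w * u) by apply: Rinv_le_contravar; lra.
  have : Re w * u / (1 + Re w * u) = 1 - / (1 + Re w * u) by field; lra. lra.
Qed.

Lemma one_minus_Cexp_neq0 (w : C) x : 0 < Re w -> (1 - Cexp (- (w * RtoC (exp x))))%C <> 0%C.
Proof.
  move=> Hw. apply: Cmod_pos_neq0. apply: Rlt_le_trans (one_minus_Cexp_lower w _ Hw (exp_pos x)).
  have := exp_pos x => e. apply: Rdiv_lt_0_compat; nra.
Qed.

Lemma rcont_bk ws a x : pos_list ws -> rcont (bk ws a) x.
Proof.
  elim: ws => [|w ws IH] H.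
  - apply: rcont_Cexp. apply: rcont_opp. apply: rcont_mult; [exact: rcont_const|exact: rcont_expR].
  - apply: (rcont_mult (fun x => / (1 - Cexp (- (w * RtoC (exp x)))))%C (bk ws a)); last by apply: IH => v Hv; apply: H; right.
    apply: rcont_inv; first by apply: one_minus_Cexp_neq0; apply: H; left.
    apply: rcont_minus; first exact: rcont_const. apply: rcont_Cexp. apply: rcont_opp. apply: rcont_mult; [exact: rcont_const|exact: rcont_expR].
Qed.

(** [|1 - exp (- w u)| >= p / (1 + p)] with [p = Re w * u], so each period contributes one factor
    [O(1 + 1 / u)]. Uniformity in [a] is for the shifts of [a] in the series. *)
Lemma bk_bound ws : pos_list ws -> exists K, 0 < K /\ forall a x, Cmod (bk ws a x) <= K * (1 + exp (- x)) ^ (length ws) * exp (- (Re a * exp x)).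
Proof.
  elim: ws => [|w ws IH] H.
  - exists 1. split; first lra. move=> a x. rewrite /= Cmod_Cexp_neg. lra.
  - have [K [K0 HK]] := IH (fun v Hv => H v (or_intror Hv)). have w0 : 0 < Re w by apply: H; left.
    exists ((1 + / Re w) * K). have iw : 0 < / Re w by exact: Rinv_0_lt_compat.
    split; first by apply: Rmult_lt_0_compat; lra.
    move=> a x. rewrite [bk _ _ _]/= Cmod_mult. have ex := exp_pos x. have exn := exp_pos (- x).
    have N := one_minus_Cexp_neq0 w x w0.
    have L := one_minus_Cexp_lower w (exp x) w0 ex.
    have B : Cmod (/ (1 - Cexp (- (w * RtoC (exp x)))))%C <= (1 + / Re w) * (1 + exp (- x)).
    { rewrite Cmod_inv //. set p := Re w * exp x in L. have p0 : 0 < p by exact: Rmult_lt_0_compat.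
      apply: (Rle_trans _ (/ (p / (1 + p)))).
      - apply: Rinv_le_contravar => //. apply: Rdiv_lt_0_compat; lra.
      - have -> : / (p / (1 + p)) = 1 + / Re w * / exp x by rewrite /p; field; rewrite -/p; lra.
        rewrite exp_Ropp. have : 0 < / exp x by exact: Rinv_0_lt_compat. nra. }
    have -> : (1 + / Re w) * K * (1 + exp (- x)) ^ length (w :: ws) * exp (- (Re a * exp x)) =
      (1 + / Re w) * (1 + exp (- x)) * (K * (1 + exp (- x)) ^ length ws * exp (- (Re a * exp x))) by rewrite /=; ring.
    apply: Rmult_le_compat => //; exact: Cmod_ge_0.
Qed.

Lemma exp_poly_decay g al : 0 <= g -> 0 < al -> exists C0, 0 < C0 /\ forall x, exp (- (al * exp x)) <= C0 * exp (- g * x).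
Proof.
  move=> [Hg|<-] Hal.
  - exists (exp (g * (ln g - 1) - g * ln al)). split; first exact: exp_pos. move=> x. exact: exp_double_decay.
  - exists 1. split; first lra. move=> x. rewrite Ropp_0 Rmult_0_l exp_0. have := exp_neg_le1 (al * exp x) ltac:(have := exp_pos x; nra). lra.
Qed.

Lemma exp_pow (x : R) n : exp x ^ n = exp (INR n * x).
Proof.
  elim: n => [|n IH]; first by rewrite /= Rmult_0_l exp_0.
  rewrite S_INR [_ ^ _]/= IH -exp_plus. congr exp. ring.
Qed.

Lemma bk_majorant_decay n al g : 0 < al -> INR n <= g -> exists C0, 0 < C0 /\ forall x, (1 + exp (- x)) ^ n * exp (- (al * exp x)) <= C0 * exp (- g * x).
Proof.
  move=> Hal Hg. have n0 := pos_INR n.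
  have [C1 [C10 H1]] := exp_poly_decay g al ltac:(lra) Hal.
  have [C2 [C20 H2]] := exp_poly_decay (g - INR n) al ltac:(lra) Hal.
  have p2 : 0 < 2 ^ n by apply: pow_lt; lra.
  exists (2 ^ n * (C1 + C2)). split; first by apply: Rmult_lt_0_compat; lra.
  move=> x. have ea := exp_pos (- (al * exp x)). have exn := exp_pos (- x). have eg := exp_pos (- g * x).
  case: (Rle_lt_dec 0 x) => hx.
  - have le2 : (1 + exp (- x)) ^ n <= 2 ^ n by apply: pow_incr; have := exp_neg_le1 x hx; lra.
    apply: (Rle_trans _ (2 ^ n * (C1 * exp (- g * x)))).
    + apply: Rmult_le_compat => //; try lra. apply: pow_le. lra.
    + rewrite !Rmult_assoc. apply: Rmult_le_compat_l; first lra. apply: Rmult_le_compat_r; lra.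
  - have le2 : (1 + exp (- x)) ^ n <= (2 * exp (- x)) ^ n.
    { apply: pow_incr. have := exp_ineq1_le (- x). lra. }
    rewrite Rpow_mult_distr exp_pow in le2.
    apply: (Rle_trans _ (2 ^ n * exp (INR n * - x) * (C2 * exp (- (g - INR n) * x)))).
    + apply: Rmult_le_compat => //; try lra. apply: pow_le. lra.
    + have -> : 2 ^ n * exp (INR n * - x) * (C2 * exp (- (g - INR n) * x)) = 2 ^ n * C2 * exp (- g * x).
      { have -> : - g * x = INR n * - x + - (g - INR n) * x by ring. rewrite exp_plus. ring. }
      apply: Rmult_le_compat_r; first lra. apply: Rmult_le_compat_l; lra.
Qed.

(** The kernel is of order at most [u^(- length ws)] at 0 and decays exponentially at infinity, so
    every larger exponent [g] is admissible. *)
Lemma bk_decay ws a g : pos_list ws -> 0 < Re a -> INR (length ws) <= g -> exists C0, 0 <= C0 /\ forall x, Cmod (bk ws a x) <= C0 * exp (- g * x).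
Proof.
  move=> H Ha Hg. have [K [K0 HK]] := bk_bound ws H. have [C0 [C00 HC]] := bk_majorant_decay _ _ _ Ha Hg.
  exists (K * C0). split; first nra. move=> x. apply: Rle_trans (HK a x) _. rewrite !Rmult_assoc.
  apply: Rmult_le_compat_l; first lra. exact: HC.
Qed.

Lemma bk_bounded ws a be : pos_list ws -> 0 < Re a -> INR (length ws) <= be -> mel_bounded (bk ws a) (INR (length ws)) be.
Proof.
  move=> H Ha Hb. split; first by apply: mel_int_cont => x; exact: rcont_bk.
  have [C1 [C10 H1]] := bk_decay ws a _ H Ha (Rle_refl _). have [C2 [C20 H2]] := bk_decay ws a _ H Ha Hb.
  exists (C1 + C2). split; first lra.
  split => x; [apply: Rle_trans (H1 x) _|apply: Rle_trans (H2 x) _]; (apply: Rmult_le_compat_r; [exact: Rlt_le (exp_pos _)|lra]).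
Qed.

Lemma bk_ldom ws a (s : C) : pos_list ws -> 0 < Re a -> INR (length ws) < Re s -> exists K, ldom (fun x => Cexp (s * RtoC x) * bk ws a x)%C K.
Proof. move=> H Ha Hs. apply: (mel_ldom_ex _ (INR (length ws)) (Re s + 1)); [apply: bk_bounded => //; lra|lra]. Qed.

Lemma bk_add ws (a w : C) x : bk ws (a + w)%C x = (Cexp (- (w * RtoC (exp x))) * bk ws a x)%C.
Proof.
  elim: ws => [|v ws IH] /=.
  - rewrite -Cexp_plus. congr Cexp. ring.
  - rewrite IH. ring.
Qed.

Lemma bk_telescope ws (a w : C) x : 0 < Re w -> (bk (w :: ws) a x - bk (w :: ws) (a + w) x = bk ws a x)%C.
Proof. move=> Hw. rewrite bk_add /=. field. exact: one_minus_Cexp_neq0. Qed.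

(** The shift contributes [exp (- Re w N u)], at most [(Re w N u)^(-k)] for [0 < k <= 1]; [k] is
    small enough for the extra [u^(-k)] to be absorbed by the gap between [Re s] and [length ws]. *)
Lemma bk_shift_small ws (a w s : C) : pos_list ws -> 0 < Re a -> 0 < Re w -> INR (length ws) < Re s ->
  Ccvg (fun N => Mel (bk ws (a + w * INR N)) s) 0%C.
Proof.
  move=> H Ha Hw Hs. set n := length ws in Hs.
  set k := Rmin 1 ((Re s - INR n) / 2). have k0 : 0 < k by apply: Rmin_glb_lt; lra.
  have k1 : k <= 1 by exact: Rmin_l. have k2 : k <= (Re s - INR n) / 2 by exact: Rmin_r.
  have [K [K0 HK]] := bk_bound ws H.
  have [C1 [C10 H1]] := bk_majorant_decay n (Re a) (INR n) Ha (Rle_refl _).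
  have [C2 [C20 H2]] := bk_majorant_decay n (Re a) (Re s + 1) Ha ltac:(lra).
  have [d [d0 [d1 d2]]] := strip_margin (INR n + k) (Re s + 1 + k) (Re s) ltac:(lra).
  set D := 4 * (K * (C1 + C2) * (4 / (d * d))).
  have D0 : 0 <= D.
  { apply: Rmult_le_pos; first lra. apply: Rmult_le_pos; first nra. apply: Rlt_le; apply: Rdiv_lt_0_compat; nra. }
  have B : forall N, Cmod (Mel (bk ws (a + w * INR (S N))) s) <= D * exp (- (k * ln (Re w * INR (S N)))).
  { move=> N. have N0 : 0 < INR (S N) by apply: lt_0_INR; lia. have wN : 0 < Re w * INR (S N) by exact: Rmult_lt_0_compat.
    set q := exp (- (k * ln (Re w * INR (S N)))). have q0 : 0 < q by exact: exp_pos.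
    have Ra : Re (a + w * INR (S N))%C = Re a + Re w * INR (S N).
    { by rewrite Re_plus Re_mult_R. }
    have E : forall x, Cmod (bk ws (a + w * INR (S N)) x) <= K * (q * exp (- k * x)) * ((1 + exp (- x)) ^ n * exp (- (Re a * exp x))).
    { move=> x. apply: Rle_trans (HK _ x) _. rewrite Ra -/n. have ex := exp_pos x. have exn := exp_pos (- x).
      have -> : exp (- ((Re a + Re w * INR (S N)) * exp x)) = exp (- (Re a * exp x)) * exp (- (Re w * INR (S N) * exp x)) by rewrite -exp_plus; congr exp; ring.
      have -> : K * (q * exp (- k * x)) * ((1 + exp (- x)) ^ n * exp (- (Re a * exp x))) = K * (1 + exp (- x)) ^ n * exp (- (Re a * exp x)) * (q * exp (- k * x)) by ring.
      rewrite -Rmult_assoc. apply: Rmult_le_compat_l.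
      - apply: Rmult_le_pos; last exact: Rlt_le (exp_pos _). apply: Rmult_le_pos; first lra. apply: pow_le; lra.
      - rewrite /q -exp_plus. set m := Re w * INR (S N) in wN *.
        have m0 : 0 < m * exp x by exact: Rmult_lt_0_compat.
        have -> : - (k * ln m) + - k * x = - (k * ln (m * exp x)) by rewrite ln_mult // ln_exp; ring.
        case: (Rle_lt_dec 1 (m * exp x)) => hm.
        + apply: exp_le. have : 0 <= ln (m * exp x) by rewrite -ln_1; apply: ln_le; lra.
          have := exp_ineq1_le (ln (m * exp x)). rewrite exp_ln // => h1 h2. nra.
        + have : ln (m * exp x) < 0 by rewrite -ln_1; apply: ln_increasing; lra.
          move=> h. apply: exp_le. nra. }
    have L : ldom (fun x => Cexp (s * RtoC x) * bk ws (a + w * INR (S N)) x)%C (q * K * (C1 + C2) * (4 / (d * d))).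
    { have qK : 0 < q * K by exact: Rmult_lt_0_compat.
      apply: (mel_ldom _ (INR n + k) (Re s + 1 + k)) => //.
      - apply: mel_int_cont => x. exact: rcont_bk.
      - nra.
      - lra.
      - move=> x. apply: Rle_trans (E x) _.
        have -> : q * K * (C1 + C2) * exp (- (INR n + k) * x) = K * (q * exp (- k * x)) * ((C1 + C2) * exp (- INR n * x)).
        { have -> : - (INR n + k) * x = - k * x + - INR n * x by ring. rewrite exp_plus. ring. }
        apply: Rmult_le_compat_l. { have := exp_pos (- k * x) => e. apply: Rmult_le_pos; nra. }
        apply: Rle_trans (H1 x) _. apply: Rmult_le_compat_r; [exact: Rlt_le (exp_pos _)|lra].
      - move=> x. apply: Rle_trans (E x) _.
        have -> : q * K * (C1 + C2) * exp (- (Re s + 1 + k) * x) = K * (q * exp (- k * x)) * ((C1 + C2) * exp (- (Re s + 1) * x)).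
        { have -> : - (Re s + 1 + k) * x = - k * x + - (Re s + 1) * x by ring. rewrite exp_plus. ring. }
        apply: Rmult_le_compat_l. { have := exp_pos (- k * x) => e. apply: Rmult_le_pos; nra. }
        apply: Rle_trans (H2 x) _. apply: Rmult_le_compat_r; [exact: Rlt_le (exp_pos _)|lra]. }
    apply: Rle_trans (LI_norm _ _ L) _. rewrite /D. apply: Req_le. ring. }
  move=> e He. have [A [HA W]] := exp_le_eventually D k e D0 k0 He.
  have [N HN] := INR_unbounded (exp A / Re w). exists (S N) => m Hm.
  have -> : m = S (pred m) by lia. have -> : forall z : C, (z - 0 = z)%C by move=> z; ring.
  apply: Rle_lt_trans (B _) _. apply: W. rewrite -{1}(ln_exp A). apply: ln_le; first exact: exp_pos.
  have h : INR N <= INR (S (pred m)) by apply: le_INR; lia.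
  have -> : exp A = Re w * (exp A / Re w) by field; lra. apply: Rmult_le_compat_l; lra.
Qed.

(** By [bk_telescope] the partial sums of the outermost series are differences of two Mellin
    transforms, the second of which tends to 0. This takes the place of an exchange of sum and
    integral. *)
Lemma barnes_series_Mel (theta : R) ws (a s : C) : pos_list ws -> 0 < Re a -> INR (length ws) < Re s ->
  (barnes_series theta (map (fun w => Cexp (Ci * theta) * w) ws) (Cexp (Ci * theta) * a) s * Gam s = Cexp (- s * (Ci * theta)) * Mel (bk ws a) s)%C.
Proof.
  elim: ws a => [|w ws IH] a H Ha Hs.
  - have [v [Ev Iv]] := polar_half_plane a Ha. rewrite /= in Hs.
    rewrite /= -Ev Cpow_half_plane //.
    have -> : Mel (fun x => Cexp (- (Cexp v * RtoC (exp x)))) s = Lap s v.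
    { apply: LI_ext => x. by rewrite Cexp_plus Cexp_R. }
    rewrite Lap_eq //. have -> : (- s * v = - (s * v))%C by ring. ring.
  - have w0 : 0 < Re w by apply: H; left. have H' : pos_list ws by move=> v Hv; apply: H; right.
    have Hs' : INR (length ws) < Re s. { move: Hs. rewrite [length _]/= S_INR. lra. }
    have s0 : 0 < Re s by have := pos_INR (length ws); lra.
    have G0 := Gam_neq0 s s0.
    set c := (Cexp (- s * (Ci * theta)))%C.
    have Ra : forall N, 0 < Re (a + w * INR N)%C.
    { move=> N. rewrite Re_plus Re_mult_R. have := pos_INR N. nra. }
    have E : CSeries (fun m => barnes_series theta (map (fun w => Cexp (Ci * theta) * w)%C ws) (Cexp (Ci * theta) * a + Cexp (Ci * theta) * w * INR m) s) = (c / Gam s * Mel (bk (w :: ws) a) s)%C.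
    { apply: CSeries_eq.
      have P : forall N, psum (fun m => barnes_series theta (map (fun w => Cexp (Ci * theta) * w)%C ws) (Cexp (Ci * theta) * a + Cexp (Ci * theta) * w * INR m) s) N
        = (c / Gam s * Mel (bk (w :: ws) a) s + - (c / Gam s) * Mel (bk (w :: ws) (a + w * INR N)) s)%C.
      { elim=> [|N IHN].
        - rewrite [psum _ _]/=. have -> : (a + w * INR 0 = a)%C by rewrite /=; ring. ring.
        - rewrite [psum _ _]/= IHN.
          have -> : (Cexp (Ci * theta) * a + Cexp (Ci * theta) * w * INR N = Cexp (Ci * theta) * (a + w * INR N))%C by ring.
          have I1 := IH (a + w * INR N)%C H' (Ra N) Hs'.
          have T : Mel (bk ws (a + w * INR N)) s = (Mel (bk (w :: ws) (a + w * INR N)) s - Mel (bk (w :: ws) (a + w * INR (S N))) s)%C.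
          { have [K1 D1] := bk_ldom (w :: ws) _ s H (Ra N) Hs. have [K2 D2] := bk_ldom (w :: ws) _ s H (Ra (S N)) Hs.
            rewrite /Mel -(LI_minus _ _ _ _ D1 D2). apply: LI_ext => x.
            rewrite -(bk_telescope ws _ w x w0). have -> : (a + w * INR N + w = a + w * INR (S N))%C by rewrite S_INR RtoC_plus; ring. ring. }
          rewrite T in I1.
          have -> : barnes_series theta (map (fun w => Cexp (Ci * theta) * w)%C ws) (Cexp (Ci * theta) * (a + w * INR N)) s
            = (c * (Mel (bk (w :: ws) (a + w * INR N)) s - Mel (bk (w :: ws) (a + w * INR (S N))) s) / Gam s)%C.
          { rewrite -I1. field. exact: G0. }
          field. exact: G0. }
      apply: (Ccvg_ext _ _ _ (fun N => eq_sym (P N))).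
      have Z : (c / Gam s * Mel (bk (w :: ws) a) s = c / Gam s * Mel (bk (w :: ws) a) s + - (c / Gam s) * 0)%C by ring.
      rewrite [X in Ccvg _ X]Z.
      apply: Ccvg_plus.
      - move=> e He. exists O => N _. cbv beta. rewrite Cmod_self. exact: He.
      - apply: Ccvg_scal. exact: bk_shift_small. }
    rewrite [barnes_series _ _ _ _]/= E. field. exact: G0.
Qed.

(** * Mittag-Leffler expansion of the generating function *)

(** [z * gq y z] is the generating function of the Bernoulli polynomials at [y]. *)
Definition gq (y : R) (z : C) : C := (Cexp (z * y) / (Cexp z - 1))%C.

Lemma mod_2PI (v : R) : exists m : Z, Rabs (v - 2 * PI * IZR m) <= PI.
Proof.
  have P0 := PI_RGT_0. have [A1 A2] := archimed (v / (2 * PI) - 1 / 2).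
  exists (up (v / (2 * PI) - 1 / 2)). set k := IZR _ in A1 A2 *.
  have E : v = 2 * PI * (v / (2 * PI)) by field; lra.
  apply: Rabs_le. rewrite {1 2}E. split; nra.
Qed.

Lemma Cmod_exp_ratio y (z : C) : Cexp z <> 1%C -> Cmod (gq y z) = exp (Re z * y) / Cmod (Cexp z - 1)%C.
Proof.
  move=> H. rewrite /gq Cmod_div; last exact: Cminus_neq_0. rewrite Cmod_Cexp Re_mult_R. done.
Qed.

(** The modulus behaves like [exp ((y - 1) Re z)] to the right and like [exp (y Re z)] to the left;
    the common rate is the smaller of [1 - y] and [y], which is 0 for [y = 0]. *)
Lemma gq_decay y (z : C) d : 0 <= y < 1 -> 0 < d -> d <= Rabs (Re z) ->
  Cexp z <> 1%C /\ Cmod (gq y z) <= / (1 - exp (- d)) * exp (- Rmin y (1 - y) * Rabs (Re z)).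
Proof.
  move=> Hy Hd Hz.
  have e1 : exp (- d) < 1 by rewrite -exp_0; apply: exp_increasing; lra.
  set x := Re z in Hz.
  have N : Cexp z <> 1%C.
  { move=> E. have := Cmod_Cexp z. rewrite E Cmod_1 -/x => h. have : x = 0 by apply: exp_inv; rewrite exp_0.
    move=> h0. move: Hz. rewrite h0 Rabs_R0. lra. }
  split => //. rewrite Cmod_exp_ratio // -/x.
  have m1 := Rmin_l y (1 - y). have m2 := Rmin_r y (1 - y). set q := Rmin y (1 - y) in m1 m2 *.
  have i0 : 0 < / (1 - exp (- d)) by apply: Rinv_0_lt_compat; lra.
  case: (Rle_lt_dec 0 x) => hx.
  - rewrite (Rabs_pos_eq x) // in Hz *.
    have L : exp x * (1 - exp (- d)) <= Cmod (Cexp z - 1)%C.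
    { apply: Rle_trans (Cmod_triangle_rev_minus _ _). rewrite Cmod_Cexp Cmod_1 -/x.
      have -> : exp x * (1 - exp (- d)) = exp x - exp (x + - d) by rewrite exp_plus; ring.
      have : exp 0 <= exp (x + - d) by apply: exp_le; lra. rewrite exp_0. lra. }
    have ex := exp_pos x. have L0 : 0 < exp x * (1 - exp (- d)) by apply: Rmult_lt_0_compat; lra.
    apply: (Rle_trans _ (exp (x * y) * / (exp x * (1 - exp (- d))))).
    { apply: Rmult_le_compat_l; first exact: Rlt_le (exp_pos _). exact: Rinv_le_contravar. }
    have -> : exp (x * y) * / (exp x * (1 - exp (- d))) = / (1 - exp (- d)) * exp (x * y + - x).
    { rewrite exp_plus (exp_Ropp x). field. lra. }
    apply: Rmult_le_compat_l; first lra. apply: exp_le. nra.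
  - rewrite (Rabs_left x) // in Hz *.
    have L : 1 - exp (- d) <= Cmod (Cexp z - 1)%C.
    { rewrite Cmod_minus_sym. apply: Rle_trans (Cmod_triangle_rev_minus _ _). rewrite Cmod_Cexp Cmod_1 -/x.
      have : exp x <= exp (- d) by apply: exp_le; lra. lra. }
    rewrite /Rdiv Rmult_comm. apply: Rmult_le_compat; try exact: Rlt_le (exp_pos _).
    + apply: Rlt_le; apply: Rinv_0_lt_compat; lra.
    + apply: Rinv_le_contravar => //. lra.
    + apply: exp_le. nra.
Qed.

Lemma gq_decay0 y (z : C) d : 0 <= y < 1 -> 0 < d -> d <= Rabs (Re z) -> Cmod (gq y z) <= / (1 - exp (- d)).
Proof.
  move=> Hy Hd Hz. have [_ H] := gq_decay y z d Hy Hd Hz. apply: Rle_trans H _.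
  have e1 : exp (- d) < 1 by rewrite -exp_0; apply: exp_increasing; lra.
  have i0 : 0 < / (1 - exp (- d)) by apply: Rinv_0_lt_compat; lra.
  have : 0 <= Rmin y (1 - y) by apply: Rmin_glb; lra. have := Rabs_pos (Re z) => a b.
  have q : exp (- Rmin y (1 - y) * Rabs (Re z)) <= 1 by rewrite -[X in _ <= X]exp_0; apply: exp_le; nra.
  have := exp_pos (- Rmin y (1 - y) * Rabs (Re z)). nra.
Qed.

(** If [|Re z|] is small, [z] is far from the poles vertically. Reducing [Im z] into [[-pi, pi]] and
    shifting it by [pi] writes [Cexp z - 1 = - (1 + Cexp w)] with [|Im w| <= pi - d / 2], where
    [Cmod_sum_lower_strip] applies. *)
Lemma gq_bound y d : 0 <= y < 1 -> 0 < d <= 1 -> exists K, 0 <= K /\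
  forall z : C, (forall m : Z, d <= Cmod (z - IZR m * (2 * PI * Ci))%C) -> Cexp z <> 1%C /\ Cmod (gq y z) <= K.
Proof.
  move=> Hy Hd. have P0 := PI_RGT_0. have P4 : 3 < PI by have := PI2_3_2; lra.
  have e1 : exp (- (d / 2)) < 1 by rewrite -exp_0; apply: exp_increasing; lra.
  have i0 : 0 < / (1 - exp (- (d / 2))) by apply: Rinv_0_lt_compat; lra.
  have c0 : 0 < cos ((PI - d / 2) / 2) by apply: cos_gt_0; lra.
  have j0 : 0 < / cos ((PI - d / 2) / 2) by exact: Rinv_0_lt_compat.
  have e0 := exp_pos 1.
  exists (/ (1 - exp (- (d / 2))) + exp 1 * / cos ((PI - d / 2) / 2)). split; first nra.
  move=> z Hz.
  case: (Rle_lt_dec (d / 2) (Rabs (Re z))) => h.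
  { split; first by have [] := gq_decay y z (d / 2) Hy ltac:(lra) h.
    have := gq_decay0 y z (d / 2) Hy ltac:(lra) h. nra. }
  have [m Hm] := mod_2PI (Im z).
  set z' := (z - IZR m * (2 * PI * Ci))%C.
  have Ez : Cexp z = Cexp z'.
  { rewrite /z' Cexp_minus Cexp_2PI_Z. field. }
  have Rz : Re z' = Re z by rewrite /z' /= /Re; ring.
  have Iz : Im z' = Im z - 2 * PI * IZR m by rewrite /z' /= /Im; ring.
  have Dz : d / 2 <= Rabs (Im z').
  { have := Hz m. rewrite -/z'. have := Cmod_le_sum z'. rewrite Rz. lra. }
  rewrite -Iz in Hm.
  have [s [Hs1 Hs2]] : exists s : R, Cexp (Ci * s)%C = (- (1))%C /\ Rabs (Im z' + s) <= PI - d / 2.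
  { case: (Rle_lt_dec 0 (Im z')) => hi.
    - exists (- PI). rewrite Rabs_pos_eq // in Hm Dz. split; last by apply: Rabs_le; lra.
      have -> : (Ci * RtoC (- PI) = - (Ci * RtoC PI))%C by rewrite RtoC_opp; ring. rewrite Cexp_opp Cexp_PI. field.
    - exists PI. rewrite Rabs_left // in Hm Dz. split; last by apply: Rabs_le; lra. exact: Cexp_PI. }
  set w := (z' + Ci * s)%C.
  have Ew : Cexp w = (- Cexp z)%C by rewrite /w Cexp_plus Hs1 Ez; ring.
  have Iw : Im w = Im z' + s by rewrite /w /= /Im; ring.
  have L : cos ((PI - d / 2) / 2) <= Cmod (Cexp z - 1)%C.
  { have := Cmod_sum_lower_strip 1 w (PI - d / 2) ltac:(lra) ltac:(rewrite Iw; exact: Hs2) ltac:(lra).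
    rewrite Ew Cmod_minus_sym. have -> : (1 - Cexp z = 1 + - Cexp z)%C by ring. have := exp_pos (Re w). nra. }
  have N : Cexp z <> 1%C. { move=> E. move: L. rewrite E Cmod_self. lra. }
  split => //. rewrite Cmod_exp_ratio //.
  have : exp (Re z * y) / Cmod (Cexp z - 1)%C <= exp 1 * / cos ((PI - d / 2) / 2).
  { apply: Rmult_le_compat; first exact: Rlt_le (exp_pos _).
    - apply: Rlt_le; apply: Rinv_0_lt_compat; lra.
    - apply: exp_le. have := Rle_abs (Re z). have := Rabs_pos (Re z). nra.
    - exact: Rinv_le_contravar. }
  lra.
Qed.

Definition pole (w : C) (m : Z) : C := (2 * IZR m * PI * Ci * / w)%C.

Lemma pole_mul (w : C) m : w <> 0%C -> (w * pole w m = IZR m * (2 * PI * Ci))%C.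
Proof. move=> H. rewrite /pole. field. exact: H. Qed.

Lemma IZR_abs m : Rabs (IZR m) = IZR (Z.abs m).
Proof. by rewrite abs_IZR. Qed.

Lemma IZR_abs_ge1 m : m <> 0%Z -> 1 <= Rabs (IZR m).
Proof. move=> H. rewrite IZR_abs. apply: IZR_le. lia. Qed.

Lemma Cmod_pl (w : C) m : w <> 0%C -> Cmod (pole w m) = 2 * PI / Cmod w * Rabs (IZR m).
Proof.
  move=> H. have P0 := PI_RGT_0. rewrite /pole !Cmod_mult Cmod_Ci Cmod_inv // !Cmod_R (Rabs_pos_eq PI); last lra.
  rewrite (Rabs_pos_eq 2); last lra. field. have := proj1 (Cmod_gt_0 w) H. lra.
Qed.

Lemma pole_unit_pos (w : C) : w <> 0%C -> 0 < 2 * PI / Cmod w.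
Proof. move=> H. have := PI_RGT_0 => P0. apply: Rdiv_lt_0_compat; [lra|exact: (proj1 (Cmod_gt_0 w))]. Qed.

Lemma pole_neq0 (w : C) m : w <> 0%C -> m <> 0%Z -> pole w m <> 0%C.
Proof.
  move=> H Hm. apply: Cmod_pos_neq0. rewrite Cmod_pl //. apply: Rmult_lt_0_compat; first exact: pole_unit_pos.
  have := IZR_abs_ge1 m Hm. lra.
Qed.

Lemma pole_minus_same (w : C) m m' : w <> 0%C -> Cmod (pole w m - pole w m')%C = 2 * PI / Cmod w * Rabs (IZR (m - m')).
Proof. move=> H. rewrite -Cmod_pl //. congr Cmod. rewrite /pole minus_IZR RtoC_minus. field. exact: H. Qed.

Lemma Re_pl (w w' : C) m : w <> 0%C -> Re (w' * pole w m)%C = - (2 * PI * IZR m * Im (w' / w)%C).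
Proof.
  move=> H. have -> : (w' * pole w m = RtoC (2 * PI * IZR m) * Ci * (w' / w))%C by rewrite /pole !RtoC_mult; field.
  rewrite Re_mult /=. ring.
Qed.

(** Multiplied by [w'], the second pole becomes purely imaginary while the first acquires the real
    part [- 2 pi m Im (w' / w)], bounded away from 0 for [m <> 0]; for [m = 0] the first pole is 0
    and the second is not. *)
Lemma pole_separated (w w' : C) : w <> 0%C -> w' <> 0%C -> Im (w' / w)%C <> 0 ->
  exists d, 0 < d /\ forall m m', m <> 0%Z \/ m' <> 0%Z -> d <= Cmod (pole w m - pole w' m')%C.
Proof.
  move=> H H' HI. have P0 := PI_RGT_0. have mw := proj1 (Cmod_gt_0 w) H. have mw' := proj1 (Cmod_gt_0 w') H'.
  have ip : 0 < Rabs (Im (w' / w)%C) by exact: Rabs_pos_lt.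
  set d1 := 2 * PI * Rabs (Im (w' / w)%C) / Cmod w'. have d10 : 0 < d1 by apply: Rdiv_lt_0_compat => //; nra.
  have d20 := pole_unit_pos w' H'. set d2 := 2 * PI / Cmod w' in d20.
  exists (Rmin d1 d2). split; first exact: Rmin_glb_lt.
  move=> m m' Hm. case: (Z.eq_dec m 0) => E.
  - have Hm' : m' <> 0%Z by lia. rewrite E. have -> : (pole w 0 - pole w' m' = - pole w' m')%C by rewrite /pole; ring.
    rewrite Cmod_opp Cmod_pl // -/d2. have := IZR_abs_ge1 m' Hm'. have := Rmin_r d1 d2. nra.
  - have h : Rabs (Re (w' * (pole w m - pole w' m'))%C) <= Cmod w' * Cmod (pole w m - pole w' m')%C by rewrite -Cmod_mult; exact: Re_le_Cmod.
    have E2 : (w' * (pole w m - pole w' m') = w' * pole w m - w' * pole w' m')%C by ring.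
    rewrite E2 in h. have E3 : Re (w' * pole w m - w' * pole w' m')%C = - (2 * PI * IZR m * Im (w' / w)%C).
    { have -> : forall a b : C, Re (a - b)%C = Re a - Re b by []. rewrite !Re_pl //.
      have -> : (w' / w')%C = RtoC 1 by field. rewrite /=. ring. }
    rewrite E3 Rabs_Ropp (Rabs_mult (2 * PI * IZR m)) (Rabs_mult (2 * PI)) (Rabs_pos_eq (2 * PI)) in h; last lra.
    have := IZR_abs_ge1 m E. have := Rmin_l d1 d2. move=> h1 h2.
    apply: Rle_trans h1 _. apply: (Rmult_le_reg_l (Cmod w')) => //. apply: Rle_trans h.
    have -> : Cmod w' * d1 = 2 * PI * 1 * Rabs (Im (w' / w)%C) by rewrite /d1; field; lra.
    apply: Rmult_le_compat_r; first exact: Rabs_pos. apply: Rmult_le_compat_l; lra.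
Qed.

(** The logarithm of [- pole w m] has imaginary part [pi / 2] or [- pi / 2] minus [arg w], so it
    stays in a strip inside [|Im v| < pi] independent of [m]: the poles keep an angular distance
    from the positive half line. The Stieltjes kernel and the branch of the powers both rely on
    this. *)
Lemma pole_log (w : C) : 0 < Re w -> exists b, 0 < b < PI /\ forall m, m <> 0%Z ->
  exists v, Cexp v = (- pole w m)%C /\ Rabs (Im v) <= b /\ exp (Re v) = Cmod (pole w m).
Proof.
  move=> Hw. have P0 := PI_RGT_0.
  have w0 : w <> 0%C by move=> E; move: Hw; rewrite E /=; lra.
  have [u [Eu Iu]] := polar_half_plane w Hw. have au := Rabs_pos (Im u).
  exists (PI / 2 + Rabs (Im u)). split; first lra.
  move=> m Hm. have Hm1 := IZR_abs_ge1 m Hm.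
  have [s [Hs1 Hs2]] : exists s : R, Rabs s = PI / 2 /\ (Cexp (Ci * s) * RtoC (Rabs (IZR m)) = - (RtoC (IZR m) * Ci))%C.
  { case: (Rle_lt_dec 0 (IZR m)) => h.
    - exists (- (PI / 2)). rewrite Rabs_Ropp !Rabs_pos_eq //; last lra. split => //.
      have -> : (Ci * RtoC (- (PI / 2)) = - (Ci * RtoC (PI / 2)))%C by rewrite RtoC_opp; ring. rewrite Cexp_opp Cexp_half_PI Cinv_Ci. ring.
    - exists (PI / 2). rewrite (Rabs_left (IZR m)) // Rabs_pos_eq; last lra. split => //. rewrite Cexp_half_PI RtoC_opp. ring. }
  set v := (RtoC (ln (2 * PI * Rabs (IZR m))) + Ci * s - u)%C.
  have E : Cexp v = (- pole w m)%C.
  { rewrite /v Cexp_minus Cexp_plus Cexp_R exp_ln; last by nra. rewrite Eu /pole.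
    have -> : (RtoC (2 * PI * Rabs (IZR m)) * Cexp (Ci * s) / w = 2 * PI * (Cexp (Ci * s) * RtoC (Rabs (IZR m))) / w)%C by rewrite !RtoC_mult; field.
    rewrite Hs2. field. exact: w0. }
  exists v. split => //. split.
  - have -> : Im v = s - Im u by rewrite /v /= /Im; ring. apply: Rle_trans (Rabs_triang _ _) _. rewrite Rabs_Ropp. lra.
  - by rewrite -Cmod_Cexp E Cmod_opp.
Qed.

(** Each member must accept all smaller [e], so that the minimum over the list serves every
    member. *)
Lemma finite_min (A : Type) (l : list A) (P : A -> R -> Prop) :
  (forall a, In a l -> exists d, 0 < d /\ forall e, 0 < e -> e <= d -> P a e) -> exists d, 0 < d /\ d <= 1 /\ forall a, In a l -> forall e, 0 < e -> e <= d -> P a e.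
Proof.
  elim: l => [|a l IH] H; first by exists 1; split; [lra|split; [lra|]].
  have [d1 [p1 [q1 K1]]] := IH (fun b Hb => H b (or_intror Hb)). have [d2 [p2 K2]] := H a (or_introl eq_refl).
  exists (Rmin d1 d2). split; first exact: Rmin_glb_lt. have m1 := Rmin_l d1 d2. have m2 := Rmin_r d1 d2. split; first lra.
  move=> b [<-|Hb] e He Hle; [apply: K2|apply: K1] => //; lra.
Qed.

Lemma finite_max (A : Type) (l : list A) (P : A -> R -> Prop) :
  (forall a, In a l -> exists K, 0 <= K /\ forall K', K <= K' -> P a K') -> exists K, 0 <= K /\ forall a, In a l -> P a K.
Proof.
  elim: l => [|a l IH] H; first by exists 0; split; [lra|].
  suff [K [p Q]] : exists K, 0 <= K /\ forall a', In a' (a :: l) -> forall K', K <= K' -> P a' K'.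
  { exists K. split => // b Hb. apply: (Q b Hb). lra. }
  elim: l {IH} H => [|b l IH] H.
  - have [K [p Q]] := H a (or_introl eq_refl). exists K. split => // c [<-|[]]. exact: Q.
  - have [K1 [p1 Q1]] := IH ltac:(move=> c [<-|Hc]; apply: H; [by left|by right; right]).
    have [K2 [p2 Q2]] := H b (or_intror (or_introl eq_refl)).
    exists (K1 + K2). split; first lra. move=> c Hc K' HK'. case: Hc => [<-|[<-|Hc]].
    + apply: (Q1 a (or_introl eq_refl)). lra.
    + apply: Q2. lra.
    + apply: (Q1 c (or_intror Hc)). lra.
Qed.

(** * Series over the nonzero integers *)

Definition zdom (f : Z -> C) (B : nat -> R) : Prop :=
  (forall i, Cmod (f (- Z.of_nat (S i))%Z) <= B i) /\ (forall i, Cmod (f (Z.of_nat (S i))) <= B i).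

Lemma Zsum_norm f B S0 : dom_sum B S0 -> zdom f B -> Cmod (Zstar_sum f) <= 2 * S0.
Proof.
  move=> HB [H1 H2]. rewrite /Zstar_sum. apply: Rle_trans (Cmod_triangle _ _) _.
  have := CSeries_norm _ B S0 HB H1. have := CSeries_norm _ B S0 HB H2. lra.
Qed.

Lemma Zsum_ext f g : (forall m, m <> 0%Z -> f m = g m) -> Zstar_sum f = Zstar_sum g.
Proof. move=> H. rewrite /Zstar_sum. by congr (_ + _)%C; apply: CSeries_ext => i; apply: H; lia. Qed.

Lemma Zsum_plus f g B S0 B' S' : dom_sum B S0 -> dom_sum B' S' -> zdom f B -> zdom g B' ->
  Zstar_sum (fun m => f m + g m)%C = (Zstar_sum f + Zstar_sum g)%C.
Proof.
  move=> HB HB' [F1 F2] [G1 G2]. rewrite /Zstar_sum.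
  rewrite (CSeries_plus (fun i => f (- Z.of_nat (S i))%Z) (fun i => g (- Z.of_nat (S i))%Z) _ _ (proj1 (CSeries_dom _ _ _ HB F1)) (proj1 (CSeries_dom _ _ _ HB' G1))).
  rewrite (CSeries_plus (fun i => f (Z.of_nat (S i))) (fun i => g (Z.of_nat (S i))) _ _ (proj1 (CSeries_dom _ _ _ HB F2)) (proj1 (CSeries_dom _ _ _ HB' G2))).
  ring.
Qed.

Lemma Zsum_scal (c : C) f B S0 : dom_sum B S0 -> zdom f B -> Zstar_sum (fun m => c * f m)%C = (c * Zstar_sum f)%C.
Proof.
  move=> HB [F1 F2]. rewrite /Zstar_sum.
  rewrite (CSeries_scal c (fun i => f (- Z.of_nat (S i))%Z) _ (proj1 (CSeries_dom _ _ _ HB F1))).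
  rewrite (CSeries_scal c (fun i => f (Z.of_nat (S i))) _ (proj1 (CSeries_dom _ _ _ HB F2))). ring.
Qed.

Lemma Zsum_holo (f : Z -> C -> C) (z : C) r B S0 : 0 < r -> dom_sum B S0 ->
  (forall m w, m <> 0%Z -> Cmod (w - z)%C <= r -> cdiff (f m) w) -> (forall w, Cmod (w - z)%C <= r -> zdom (fun m => f m w) B) ->
  cdiff (fun w => Zstar_sum (fun m => f m w)) z.
Proof.
  move=> Hr HB Hd Hb. rewrite /Zstar_sum. apply: cdiff_plus.
  - apply: (CSeries_holo (fun i => f (- Z.of_nat (S i))%Z) z r B S0) => // [n w Hw|n w Hw]; [apply: Hd => //; lia|exact: (proj1 (Hb w Hw))].
  - apply: (CSeries_holo (fun i => f (Z.of_nat (S i))) z r B S0) => // [n w Hw|n w Hw]; [apply: Hd => //; lia|exact: (proj2 (Hb w Hw))].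
Qed.

Lemma CSeries_single (f : nat -> C) i0 : (forall i, i <> i0 -> f i = 0%C) -> CSeries f = f i0.
Proof.
  move=> H. apply: CSeries_eq => e He. exists (S i0) => n Hn.
  have P0 : forall k, (k <= i0)%nat -> psum f k = 0%C.
  { elim=> [//|k IH] Hk /=. rewrite IH; last lia. rewrite H; last lia. ring. }
  have -> : psum f n = f i0; last by rewrite Cmod_self.
  elim: n Hn => [|n IH] Hn; first lia. rewrite /=.
  case: (Nat.eq_dec n i0) => [->|N]; first by rewrite P0 //; ring.
  rewrite IH; last lia. rewrite (H n N). ring.
Qed.

Lemma Zsum_single (f : Z -> C) m0 : m0 <> 0%Z -> (forall m, m <> m0 -> f m = 0%C) -> Zstar_sum f = f m0.
Proof.
  move=> H0 H. have Z0 : forall g : nat -> C, (forall i, g i = 0%C) -> CSeries g = 0%C.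
  { move=> g Hg. rewrite (CSeries_single g O) => //. }
  rewrite /Zstar_sum. case: (Z_lt_le_dec m0 0) => h.
  - rewrite (CSeries_single (fun i => f (- Z.of_nat (S i))%Z) (pred (Z.to_nat (- m0)))); last by move=> i Hi; apply: H; lia.
    have -> : (- Z.of_nat (S (pred (Z.to_nat (- m0)))))%Z = m0 by lia.
    rewrite (Z0 (fun i => f (Z.of_nat (S i)))); last by move=> i; apply: H; lia. ring.
  - rewrite (CSeries_single (fun i => f (Z.of_nat (S i))) (pred (Z.to_nat m0))); last by move=> i Hi; apply: H; lia.
    have -> : Z.of_nat (S (pred (Z.to_nat m0))) = m0 by lia.
    rewrite (Z0 (fun i => f (- Z.of_nat (S i))%Z)); last by move=> i; apply: H; lia. ring.
Qed.

(** Deleting the term [m0] makes a series over the poles regular near the pole of index [m0]. *)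
Definition zskip (m0 : Z) (f : Z -> C) (m : Z) : C := match Z.eq_dec m m0 with left _ => 0%C | right _ => f m end.

Lemma zskip_eq m0 f : zskip m0 f m0 = 0%C.
Proof. by rewrite /zskip; case: Z.eq_dec. Qed.

Lemma Zsum_skip (f : Z -> C) m0 B S0 : m0 <> 0%Z -> dom_sum B S0 -> zdom f B -> Zstar_sum f = (Zstar_sum (zskip m0 f) + f m0)%C.
Proof.
  move=> H0 HB [F1 F2]. set g := fun m => match Z.eq_dec m m0 with left _ => f m | right _ => 0%C end.
  have nb : forall m, Cmod (zskip m0 f m) <= Cmod (f m) /\ Cmod (g m) <= Cmod (f m).
  { move=> m. rewrite /zskip /g. have := Cmod_ge_0 (f m). case: Z.eq_dec => _; rewrite Cmod_0; lra. }
  rewrite -[X in (_ + X)%C](_ : g m0 = f m0); last by rewrite /g; case: Z.eq_dec.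
  rewrite -(Zsum_single g m0 H0); last by move=> m Hm; rewrite /g; case: Z.eq_dec.
  rewrite -(Zsum_plus _ _ B S0 B S0) //.
  - apply: Zsum_ext => m _. rewrite /zskip /g. case: Z.eq_dec => _; ring.
  - split=> i; [apply: Rle_trans (F1 i)|apply: Rle_trans (F2 i)]; exact: (proj1 (nb _)).
  - split=> i; [apply: Rle_trans (F1 i)|apply: Rle_trans (F2 i)]; exact: (proj2 (nb _)).
Qed.

Lemma LI_Zsum (f : Z -> R -> C) B S0 : dom_sum B S0 -> (forall m i, Z.abs m = Z.of_nat (S i) -> ldom (f m) (B i)) ->
  (forall a b, exCI (fun x => CSeries (fun i => f (- Z.of_nat (S i))%Z x)) a b) -> (forall a b, exCI (fun x => CSeries (fun i => f (Z.of_nat (S i)) x)) a b) ->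
  (exists K, ldom (fun x => Zstar_sum (fun m => f m x)) K) /\ LI (fun x => Zstar_sum (fun m => f m x)) = Zstar_sum (fun m => LI (f m)).
Proof.
  move=> HB H E1 E2.
  have [D1 L1] := LI_series (fun i => f (- Z.of_nat (S i))%Z) B S0 HB ltac:(move=> i; apply: H; lia) E1.
  have [D2 L2] := LI_series (fun i => f (Z.of_nat (S i))) B S0 HB ltac:(move=> i; apply: H; lia) E2.
  split; first by eexists; exact: (ldom_plus _ _ _ _ D1 D2).
  by rewrite /Zstar_sum (LI_plus _ _ _ _ D1 D2) L1 L2.
Qed.

Definition isq (i : nat) : R := / ((INR i + 1) * (INR i + 1)).

Lemma isq_sum : exists S0, dom_sum isq S0.
Proof.
  have [S0 H] := zeta_terms_summable 1 Rlt_0_1.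
  apply: (dom_sum_le isq _ S0 _ H) => i. have p := pos_INR i.
  have -> : exp (- (1 + 1) * ln (INR i + 1)) = isq i.
  { have -> : - (1 + 1) * ln (INR i + 1) = - ln (INR i + 1) + - ln (INR i + 1) by ring.
    rewrite exp_plus exp_Ropp exp_ln; last lra. rewrite /isq. field. lra. }
  split; last lra. apply: Rlt_le; apply: Rinv_0_lt_compat; nra.
Qed.

Lemma abs_IZR_S i m : Z.abs m = Z.of_nat (S i) -> Rabs (IZR m) = INR i + 1.
Proof. move=> H. rewrite -abs_IZR H -INR_IZR_INZ S_INR. done. Qed.

Lemma abs_neg_S i : Z.abs (- Z.of_nat (S i)) = Z.of_nat (S i). Proof. lia. Qed.
Lemma abs_pos_S i : Z.abs (Z.of_nat (S i)) = Z.of_nat (S i). Proof. lia. Qed.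

Lemma zdom_abs (f : Z -> C) B : (forall m i, Z.abs m = Z.of_nat (S i) -> Cmod (f m) <= B i) -> zdom f B.
Proof. move=> H. split=> i; apply: H; lia. Qed.

(* [r / (t - p)] minus its Taylor polynomial of degree 1 at 0: bounded residues [r] then give a convergent series. *)
Definition ml_term (r : Z -> C) (w : C) (t : C) (m : Z) : C := (r m * t ^ 2 / (pole w m ^ 2 * (t - pole w m)))%C.

(** The distance to the pole is asked for only where [r m <> 0], so that a series with one residue
    deleted is still controlled near the deleted pole. *)
Lemma ml_term_norm (r : Z -> C) (w t : C) Cr d m i : w <> 0%C -> Z.abs m = Z.of_nat (S i) -> 0 < d -> Cmod (r m) <= Cr ->
  (r m <> 0%C -> d <= Cmod (t - pole w m)%C) ->
  Cmod (ml_term r w t m) <= Cr * (Cmod t * Cmod t) / (d * (2 * PI / Cmod w * (2 * PI / Cmod w))) * isq i.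
Proof.
  move=> Hw Hm Hd Hr Ht. have c0 := pole_unit_pos w Hw. set c := 2 * PI / Cmod w in c0 *.
  have p := pos_INR i. have t0 := Cmod_ge_0 t. have r0 := Cmod_ge_0 (r m).
  have i0 : 0 < isq i by apply: Rinv_0_lt_compat; nra.
  case: (classic (r m = 0%C)) => [E|N].
  - rewrite /ml_term E. have -> : (0 * t ^ 2 / (pole w m ^ 2 * (t - pole w m)) = 0)%C by rewrite /Cdiv; ring. rewrite Cmod_0.
    apply: Rmult_le_pos; last lra. apply: Rmult_le_pos; first by apply: Rmult_le_pos; nra.
    apply: Rlt_le; apply: Rinv_0_lt_compat. apply: Rmult_lt_0_compat => //; exact: Rmult_lt_0_compat.
  - have D := Ht N. have Hm0 : m <> 0%Z by lia.
    have P := Cmod_pl w m Hw. rewrite (abs_IZR_S i m Hm) -/c in P.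
    have N1 := pole_neq0 w m Hw Hm0. have N2 : (t - pole w m)%C <> 0%C by apply: Cmod_pos_neq0; lra.
    rewrite /ml_term. move: (pole w m) D P N1 N2 => pm D P N1 N2.
    rewrite Cmod_div; last by rewrite /= Cmult_1_r; apply: Cmult_neq_0 => //; apply: Cmult_neq_0.
    rewrite /= !Cmult_1_r !Cmod_mult P. set n := INR i + 1. set y := Cmod (t - pm)%C in D *.
    have n1 : 1 <= n by rewrite /n; lra.
    have -> : Cr * (Cmod t * Cmod t) / (d * (c * c)) * isq i = Cr * (Cmod t * Cmod t) * / (c * n * (c * n) * d) by rewrite /isq -/n; field; repeat split; lra.
    have cn : 0 < c * n by apply: Rmult_lt_0_compat; lra. have cnn : 0 < c * n * (c * n) by apply: Rmult_lt_0_compat.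
    apply: Rmult_le_compat.
    + by apply: Rmult_le_pos => //; apply: Rmult_le_pos.
    + apply: Rlt_le; apply: Rinv_0_lt_compat; apply: Rmult_lt_0_compat; lra.
    + apply: Rmult_le_compat_r => //. exact: Rmult_le_pos.
    + apply: Rinv_le_contravar; first exact: Rmult_lt_0_compat. apply: Rmult_le_compat_l; lra.
Qed.

Lemma ml_term_sum_norm (r : Z -> C) (w : C) Cr d : w <> 0%C -> 0 < d -> 0 <= Cr -> exists K, 0 <= K /\
  forall t : C, (forall m, m <> 0%Z -> Cmod (r m) <= Cr) -> (forall m, m <> 0%Z -> d <= Cmod (t - pole w m)%C) ->
    Cmod (Zstar_sum (ml_term r w t)) <= K * (Cmod t * Cmod t).
Proof.
  move=> Hw Hd HCr. have [S0 HS] := isq_sum. have c0 := pole_unit_pos w Hw. have S1 := dom_sum_ge0 _ _ HS.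
  set q := / (d * (2 * PI / Cmod w * (2 * PI / Cmod w))).
  have q0 : 0 < q by apply: Rinv_0_lt_compat; apply: Rmult_lt_0_compat => //; exact: Rmult_lt_0_compat.
  exists (2 * (Cr * q * S0)). split; first by apply: Rmult_le_pos; [lra|apply: Rmult_le_pos => //; nra].
  move=> t Hr Ht. have t0 : 0 <= Cmod t * Cmod t by exact: Rle_0_sqr.
  have HB := dom_sum_scal isq S0 (Cr * (Cmod t * Cmod t) * q) ltac:(apply: Rmult_le_pos; [exact: Rmult_le_pos|lra]) HS.
  apply: Rle_trans (Zsum_norm _ _ _ HB _) _; last by apply: Req_le; ring.
  apply: zdom_abs => m i Hm. apply: (ml_term_norm r w t Cr d m i) => //; [apply: Hr; lia|move=> _; apply: Ht; lia].
Qed.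

Lemma ml_term_zdom (r : Z -> C) (w t : C) Cr d : w <> 0%C -> 0 < d -> 0 <= Cr -> (forall m, m <> 0%Z -> Cmod (r m) <= Cr) ->
  (forall m, m <> 0%Z -> r m <> 0%C -> d <= Cmod (t - pole w m)%C) -> exists B S0, dom_sum B S0 /\ zdom (ml_term r w t) B.
Proof.
  move=> Hw Hd HCr Hr Ht. have [S0 HS] := isq_sum. have c0 := pole_unit_pos w Hw.
  eexists; eexists. split; last first.
  - apply: zdom_abs => m i Hm. apply: (ml_term_norm r w t Cr d m i) => //; [apply: Hr; lia|apply: Ht; lia].
  - apply: dom_sum_scal HS. apply: Rmult_le_pos; first by apply: Rmult_le_pos => //; exact: Rle_0_sqr.
    apply: Rlt_le; apply: Rinv_0_lt_compat; apply: Rmult_lt_0_compat => //; exact: Rmult_lt_0_compat.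
Qed.

Lemma ml_term_sum_cdiff (r : Z -> C) (w t0 : C) Cr d rho : w <> 0%C -> 0 < d -> 0 < rho -> 0 <= Cr -> (forall m, m <> 0%Z -> Cmod (r m) <= Cr) ->
  (forall m t, m <> 0%Z -> r m <> 0%C -> Cmod (t - t0)%C <= rho -> d <= Cmod (t - pole w m)%C) ->
  cdiff (fun t => Zstar_sum (ml_term r w t)) t0.
Proof.
  move=> Hw Hd Hrho HCr Hr Ht. have [S0 HS] := isq_sum. have c0 := pole_unit_pos w Hw.
  set q := / (d * (2 * PI / Cmod w * (2 * PI / Cmod w))).
  have q0 : 0 < q by apply: Rinv_0_lt_compat; apply: Rmult_lt_0_compat => //; exact: Rmult_lt_0_compat.
  set M := Cmod t0 + rho. have M0 := Cmod_ge_0 t0.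
  have HB := dom_sum_scal isq S0 (Cr * (M * M) * q) ltac:(apply: Rmult_le_pos; [apply: Rmult_le_pos => //; exact: Rle_0_sqr|lra]) HS.
  apply: (Zsum_holo (fun m t => ml_term r w t m) t0 rho _ _ Hrho HB).
  - move=> m t Hm Hd'. case: (classic (r m = 0%C)) => [E|N].
    + apply: (cdiff_ext (fun _ => RtoC 0)); last exact: cdiff_const. move=> v. rewrite /ml_term E /Cdiv. ring.
    + have D := Ht m t Hm N Hd'. have N1 := pole_neq0 w m Hw Hm. have N2 : (t - pole w m)%C <> 0%C by apply: Cmod_pos_neq0; lra.
      rewrite /ml_term. move: (pole w m) N1 N2 => pm N1 N2. cdiff_tac. rewrite /= Cmult_1_r. by apply: Cmult_neq_0 => //; apply: Cmult_neq_0.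
  - move=> t Hd'. apply: zdom_abs => m i Hm. have Hm0 : m <> 0%Z by lia.
    apply: Rle_trans (ml_term_norm r w t Cr d m i Hw Hm Hd (Hr m Hm0) (fun h => Ht m t Hm0 h Hd')) _.
    have p := pos_INR i. apply: Rmult_le_compat_r; first by apply: Rlt_le; apply: Rinv_0_lt_compat; nra.
    apply: Rmult_le_compat_r; first exact: (Rlt_le _ _ q0). apply: Rmult_le_compat_l => //.
    have h : Cmod t <= M. { have := Cmod_triangle_rev_minus t t0. rewrite /M. lra. }
    have := Cmod_ge_0 t. move=> h0. apply: Rmult_le_compat; lra.
Qed.

Lemma Csum_ext (f g : nat -> C) l : (forall k, In k l -> f k = g k) -> Csum f l = Csum g l.
Proof.
  elim: l => [//|k l IH] H. rewrite /Csum /= (H k); last by left. congr (_ + _)%C. apply: IH => j Hj. apply: H. by right.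
Qed.

Lemma Cprod_ext (f g : nat -> C) l : (forall k, In k l -> f k = g k) -> Cprod f l = Cprod g l.
Proof.
  elim: l => [//|k l IH] H. rewrite /Cprod /= (H k); last by left. congr (_ * _)%C. apply: IH => j Hj. apply: H. by right.
Qed.

Lemma Csum_change (f g : nat -> C) l k0 : NoDup l -> In k0 l -> (forall k, In k l -> k <> k0 -> f k = g k) ->
  Csum f l = (Csum g l + (f k0 - g k0))%C.
Proof.
  elim: l => [|k l IH] ND Hin H; first by case: Hin.
  rewrite /Csum /= -/(Csum f l) -/(Csum g l). inversion ND as [|? ? Nk NDl]; subst.
  case: (Nat.eq_dec k k0) => E.
  - subst k. rewrite (Csum_ext f g l); first ring. move=> j Hj. apply: H; first by right. by move=> q; subst j.
  - rewrite (H k (or_introl eq_refl) E). have Hin' : In k0 l by case: Hin.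
    rewrite IH //; first ring. move=> j Hj. apply: H. by right.
Qed.

Lemma Cprod_norm (f : nat -> C) l M : 0 <= M -> (forall k, In k l -> Cmod (f k) <= M) -> Cmod (Cprod f l) <= M ^ length l.
Proof.
  move=> HM. elim: l => [|k l IH] H; first by rewrite /Cprod /= Cmod_1; lra.
  rewrite /Cprod /= Cmod_mult. apply: Rmult_le_compat; try exact: Cmod_ge_0. apply: H; by left. apply: IH => j Hj. apply: H. by right.
Qed.

Lemma Csum_norm (f : nat -> C) l M : (forall k, In k l -> Cmod (f k) <= M) -> Cmod (Csum f l) <= INR (length l) * M.
Proof.
  elim: l => [|k l IH] H; first by rewrite /Csum /= Cmod_0; lra.
  rewrite [length _]/= S_INR. change (Cmod (f k + Csum f l)%C <= (INR (length l) + 1) * M).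
  apply: Rle_trans (Cmod_triangle _ _) _. have := H k (or_introl eq_refl). have := IH (fun j Hj => H j (or_intror Hj)). lra.
Qed.

Lemma Cprod_but (f : nat -> C) l k : NoDup l -> In k l -> Cprod f l = (f k * Cprod f (filter (fun j => negb (Nat.eqb j k)) l))%C.
Proof.
  elim: l => [|j l IH] ND Hin; first by case: Hin.
  inversion ND as [|? ? Nj NDl]; subst. rewrite [filter _ _]/=. case: Nat.eqb_spec => E.
  - subst j. rewrite /Cprod /=. congr (_ * _)%C. rewrite -/(Cprod f l) -/(Cprod f (filter _ l)).
    have -> // : filter (fun j => negb (Nat.eqb j k)) l = l.
    elim: (l) Nj => [//|i l' IH'] Ni /=. case: Nat.eqb_spec => E; first by case: Ni; left.
    rewrite /= IH' // => q. by apply: Ni; right.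
  - rewrite /Cprod /= -/(Cprod f l) -/(Cprod f (filter _ l)). rewrite IH //; first ring. by case: Hin.
Qed.

(** * Residues and separation of the poles *)

Definition periods (n : nat) (om : nat -> C) : Prop :=
  (forall k, In k (indices n) -> 0 < Re (om k)) /\
  (forall j k, In j (indices n) -> In k (indices n) -> j <> k -> Im (om j / om k)%C <> 0).

Definition gen_fun (n : nat) (om : nat -> C) (y : R) (t : C) : C := Cprod (fun j => gq y (om j * t)%C) (indices n).

(* The residue of [gen_fun] at [pole (om k) m]. *)
Definition res (n : nat) (om : nat -> C) (y : R) (k : nat) (m : Z) : C :=
  (/ om k * Cprod (fun j => gq y (om j * pole (om k) m)) (indices_but n k) * Cexp (IZR m * (2 * PI * Ci) * y))%C.

Lemma NoDup_indices n : NoDup (indices n).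
Proof. exact: seq_NoDup. Qed.

Lemma In_indices_but n k j : In j (indices_but n k) <-> In j (indices n) /\ j <> k.
Proof.
  rewrite /indices_but filter_In. case: Nat.eqb_spec => E /=.
  - split; [by move=> []|by move=> [_ /(_ E)]].
  - by split=> [[]|[]].
Qed.

Lemma Re_pos_neq0 (w : C) : 0 < Re w -> w <> 0%C.
Proof. move=> H E. move: H. rewrite E /=. lra. Qed.

Lemma Cmod_Cexp_unit m (y : R) : Cmod (Cexp (IZR m * (2 * PI * Ci) * y))%C = 1.
Proof. rewrite Cmod_Cexp. rewrite -exp_0. congr exp. rewrite /=. ring. Qed.

Lemma res_norm n om y : periods n om -> 0 <= y < 1 -> exists Cr d, 0 <= Cr /\ 0 < d /\
  forall k m, In k (indices n) -> m <> 0%Z ->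
    Cmod (res n om y k m) <= Cr * exp (- (Rmin y (1 - y) * d * Rabs (IZR m) * INR (length (indices_but n k)))).
Proof.
  move=> [H1 H2] Hy. have P0 := PI_RGT_0.
  have [d [d0 [_ Hd]]] := finite_min (nat * nat) (list_prod (indices n) (indices n))
    (fun p e => fst p <> snd p -> e <= 2 * PI * Rabs (Im (om (fst p) / om (snd p))%C))
    ltac:(idtac; move=> [j k] /in_prod_iff [Hj Hk] /=; case: (Nat.eq_dec j k) => [E|N];
      [by exists 1; split; [lra|]|exists (2 * PI * Rabs (Im (om j / om k)%C)); split; [|by move=> e _ He _]];
      apply: Rmult_lt_0_compat; [lra|apply: Rabs_pos_lt; exact: H2]).
  set M := / (1 - exp (- d)). have e1 : exp (- d) < 1 by rewrite -exp_0; apply: exp_increasing; lra.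
  have M0 : 0 < M by apply: Rinv_0_lt_compat; lra.
  have [Cr [C0 HC]] := finite_max nat (indices n) (fun k K => Cmod (/ om k)%C * M ^ length (indices_but n k) <= K)
    ltac:(move=> k Hk; exists (Cmod (/ om k)%C * M ^ length (indices_but n k)); split;
      [apply: Rmult_le_pos; [exact: Cmod_ge_0|apply: pow_le; lra]|by move=> K' h]).
  exists Cr, d. split => //. split => // k m Hk Hm.
  set q := Rmin y (1 - y). have q0 : 0 <= q by apply: Rmin_glb; lra.
  rewrite /res Cmod_mult Cmod_Cexp_unit Rmult_1_r Cmod_mult.
  have B : Cmod (Cprod (fun j => gq y (om j * pole (om k) m)) (indices_but n k)) <= (M * exp (- (q * d * Rabs (IZR m)))) ^ length (indices_but n k).
  { apply: Cprod_norm; first by apply: Rmult_le_pos; [lra|exact: Rlt_le (exp_pos _)].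
    move=> j /In_indices_but [Hj Njk]. have m1 := IZR_abs_ge1 m Hm.
    have wk := Re_pos_neq0 _ (H1 k Hk).
    have D : d * Rabs (IZR m) <= Rabs (Re (om j * pole (om k) m)%C).
    { rewrite Re_pl // Rabs_Ropp (Rabs_mult (2 * PI * IZR m)) (Rabs_mult (2 * PI)) (Rabs_pos_eq (2 * PI)); last lra.
      have h : d <= 2 * PI * Rabs (Im (om j / om k)%C) by exact: (Hd (j, k) ltac:(by apply/in_prod_iff) d d0 (Rle_refl _) Njk).
      have := Rmult_le_compat_r (Rabs (IZR m)) _ _ (Rabs_pos _) h. lra. }
    have D1 : d <= d * Rabs (IZR m) by nra.
    have [_ E] := gq_decay y _ d Hy d0 (Rle_trans _ _ _ D1 D).
    apply: Rle_trans E _. apply: Rmult_le_compat_l; first exact: (Rlt_le _ _ M0). apply: exp_le. rewrite -/q.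
    have := Rmult_le_compat_l q _ _ q0 D. lra. }
  apply: Rle_trans (Rmult_le_compat_l _ _ _ (Cmod_ge_0 _) B) _.
  rewrite Rpow_mult_distr exp_pow -Rmult_assoc.
  have -> : INR (length (indices_but n k)) * - (q * d * Rabs (IZR m)) = - (q * d * Rabs (IZR m) * INR (length (indices_but n k))) by ring.
  apply: Rmult_le_compat_r; first exact: Rlt_le (exp_pos _). exact: HC.
Qed.

Lemma res_bounded n om y : periods n om -> 0 <= y < 1 -> exists Cr, 0 <= Cr /\
  forall k m, In k (indices n) -> m <> 0%Z -> Cmod (res n om y k m) <= Cr.
Proof.
  move=> H Hy. have [Cr [d [C0 [d0 HC]]]] := res_norm n om y H Hy. exists Cr. split => // k m Hk Hm.
  apply: Rle_trans (HC k m Hk Hm) _. rewrite -{2}(Rmult_1_r Cr). apply: Rmult_le_compat_l => //. apply: exp_neg_le1.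
  have : 0 <= Rmin y (1 - y) by apply: Rmin_glb; lra. have := Rabs_pos (IZR m). have := pos_INR (length (indices_but n k)) => a b c.
  by repeat apply: Rmult_le_pos => //; lra.
Qed.

(** The factor 3 puts every point within [d] of one pole at distance at least [2 d] from all others.
    Poles rather than indices are compared, because [m = 0] gives the pole 0 for every period. *)
Definition poles_sep (n : nat) (om : nat -> C) (d : R) : Prop :=
  0 < d /\ d <= 1 /\
  (forall j k m m', In j (indices n) -> In k (indices n) -> pole (om j) m <> pole (om k) m' -> 3 * d <= Cmod (pole (om j) m - pole (om k) m')%C).

Lemma poles_sep_ex n om : periods n om -> exists d, poles_sep n om d.
Proof.
  move=> [H1 H2].
  case: (finite_min (nat * nat) (list_prod (indices n) (indices n))
    (fun p e => forall m m', pole (om (fst p)) m <> pole (om (snd p)) m' -> e <= Cmod (pole (om (fst p)) m - pole (om (snd p)) m')%C)).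
  - move=> [j k] /in_prod_iff [Hj Hk] /=. have wj := Re_pos_neq0 _ (H1 j Hj). have wk := Re_pos_neq0 _ (H1 k Hk).
    case: (Nat.eq_dec j k) => E.
    + subst k. exists (2 * PI / Cmod (om j)). split; first exact: pole_unit_pos.
      move=> e _ He m m' N. rewrite pole_minus_same //. have c := pole_unit_pos _ wj.
      have Nm : (m - m')%Z <> 0%Z by move=> q; apply: N; congr pole; lia.
      have := IZR_abs_ge1 _ Nm. nra.
    + have Nk : k <> j by move=> q; apply: E.
      have [d [d0 Hd]] := pole_separated (om j) (om k) wj wk (H2 k j Hk Hj Nk).
      exists d. split => // e _ He m m' N. apply: Rle_trans He _. apply: Hd.
      case: (Z.eq_dec m 0) => Em; last by left. case: (Z.eq_dec m' 0) => Em'; last by right.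
      case: N. by rewrite Em Em' /pole !Cmult_0_r !Cmult_0_l.
  - move=> d [d0 [d1 Hd]]. exists (d / 3). split; first lra. split; first lra. move=> j k m m' Hj Hk N.
    have := Hd (j, k) ltac:(by apply/in_prod_iff) d d0 (Rle_refl _) m m' N. rewrite /=. lra.
Qed.

Definition regular (n : nat) (om : nat -> C) (eta : R) (t : C) : Prop :=
  forall k m, In k (indices n) -> eta <= Cmod (t - pole (om k) m)%C.

Lemma regular_near n om eta t w r : regular n om eta t -> Cmod (w - t)%C <= r -> regular n om (eta - r) w.
Proof.
  move=> H Hw k m Hk. have := H k m Hk. have := Cmod_triangle3 t (pole (om k) m) w. rewrite (Cmod_minus_sym t w). lra.
Qed.

Lemma pole_dichotomy n om d t : poles_sep n om d ->
  regular n om d t \/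
  exists k0 m0, In k0 (indices n) /\ Cmod (t - pole (om k0) m0)%C < d /\ forall k m, In k (indices n) -> pole (om k) m <> pole (om k0) m0 -> 2 * d <= Cmod (t - pole (om k) m)%C.
Proof.
  move=> [d0 [d1 Hs]]. case: (classic (regular n om d t)) => h; [by left|right].
  have [k0 [m0 [Hk0 Hm0]]] : exists k0 m0, In k0 (indices n) /\ Cmod (t - pole (om k0) m0)%C < d.
  { apply: NNPP => N. apply: h => k m Hk. apply: Rnot_lt_le => q. apply: N. by exists k, m. }
  exists k0, m0. split => //. split => // k m Hk N.
  have := Hs k k0 m m0 Hk Hk0 N. have := Cmod_triangle3 (pole (om k) m) (pole (om k0) m0) t.
  rewrite (Cmod_minus_sym (pole (om k) m) t). lra.
Qed.

Lemma Cexp_1_pole (z : C) : Cexp z = 1%C -> exists m : Z, z = (IZR m * (2 * PI * Ci))%C.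
Proof.
  move=> H. have P0 := PI_RGT_0. have [m Hm] := mod_2PI (Im z). exists m. apply: Cminus_eq_0. apply: Cexp_eq1.
  - have -> : Im (z - IZR m * (2 * PI * Ci))%C = Im z - 2 * PI * IZR m by rewrite /= /Im; ring.
    move/Rabs_le_between: Hm => Hm. lra.
  - rewrite Cexp_minus Cexp_2PI_Z H. field.
Qed.

Lemma Cexp_1_pl (w t : C) : w <> 0%C -> Cexp (w * t)%C = 1%C -> exists m, t = pole w m.
Proof.
  move=> Hw /Cexp_1_pole [m Hm]. exists m. have -> : t = (w * t / w)%C by field. rewrite Hm /pole. field. exact: Hw.
Qed.

Lemma regular_Cexp n om eta t k : periods n om -> 0 < eta -> regular n om eta t -> In k (indices n) -> Cexp (om k * t)%C <> 1%C.
Proof.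
  move=> [H1 _] He H Hk E. have [m Em] := Cexp_1_pl _ _ (Re_pos_neq0 _ (H1 k Hk)) E.
  have := H k m Hk. rewrite Em Cmod_self. lra.
Qed.

Lemma cdiff_gq y (w t : C) : Cexp (w * t)%C <> 1%C -> cdiff (fun t => gq y (w * t)%C) t.
Proof. move=> H. rewrite /gq. cdiff_tac. exact: Cminus_neq_0. Qed.

Lemma gen_fun_cdiff n om y eta t : periods n om -> 0 < eta -> regular n om eta t -> cdiff (gen_fun n om y) t.
Proof.
  move=> H He Hr. apply: (cdiff_Cprod (fun j t => gq y (om j * t)%C)) => k Hk. apply: cdiff_gq. exact: regular_Cexp H He Hr Hk.
Qed.

Lemma gen_fun_bounded n om y d : periods n om -> 0 <= y < 1 -> 0 < d -> exists K, 0 <= K /\ forall t, regular n om d t -> Cmod (gen_fun n om y t) <= K.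
Proof.
  move=> [H1 H2] Hy Hd.
  have [e [e0 [e1 He]]] := finite_min nat (indices n) (fun k e => e <= Cmod (om k) * d)
    ltac:(move=> k Hk; exists (Cmod (om k) * d); split; [apply: Rmult_lt_0_compat => //; exact: (proj1 (Cmod_gt_0 _) (Re_pos_neq0 _ (H1 k Hk)))|by move=> ? _ ?]).
  have [K [K0 HK]] := gq_bound y e Hy (conj e0 e1).
  exists (K ^ length (indices n)). split; first exact: pow_le.
  move=> t Ht. apply: Cprod_norm => // k Hk. apply: (proj2 (HK _ _)) => m.
  have wk := Re_pos_neq0 _ (H1 k Hk).
  rewrite -(pole_mul (om k) m wk). have -> : (om k * t - om k * pole (om k) m = om k * (t - pole (om k) m))%C by ring.
  rewrite Cmod_mult. apply: Rle_trans (He k Hk e e0 (Rle_refl _)) _. apply: Rmult_le_compat_l; first exact: Cmod_ge_0. exact: Ht.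
Qed.

(** * Subtraction of the polar parts *)

Lemma Csum_app f l1 l2 : Csum f (l1 ++ l2) = (Csum f l1 + Csum f l2)%C.
Proof.
  elim: l1 => [|k l1 IH]; first by rewrite /Csum /=; ring.
  change (f k + Csum f (l1 ++ l2) = f k + Csum f l1 + Csum f l2)%C. rewrite IH. ring.
Qed.

Lemma laurent (F : C -> C) R0 N : 0 < R0 -> (forall t, Cmod (t - 0)%C < R0 -> cdiff F t) ->
  exists (cc : nat -> C) (B : C -> C), (forall t, Cmod (t - 0)%C < R0 -> cdiff B t) /\ forall t : C, t <> 0%C -> (F t / t ^ N = Csum (fun i => cc i * (/ t) ^ i) (seq 1 N) + B t)%C.
Proof.
  move=> HR. elim: N F => [|N IH] F HF.
  - exists (fun _ => 0%C), F. split => // t _. rewrite /Csum /=. field.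
  - have [F1 [D1 [_ E1]]] := division F 0%C R0 HR HF. have [cc [B [DB EB]]] := IH F1 D1.
    exists (fun i => match Nat.eq_dec i (S N) with left _ => F 0%C | right _ => cc i end), B. split => // t Ht.
    have pN : forall k, (t ^ k)%C <> 0%C by elim=> [|k IHk] /=; [exact: RtoC_neq0 R1_neq_R0|by apply: Cmult_neq_0].
    have pI : forall k, ((/ t) ^ k = / t ^ k)%C.
    { elim=> [|k IHk] /=; first by field. rewrite IHk. field. split => //. }
    have -> : (F t / t ^ S N = F1 t / t ^ N + F 0%C * (/ t) ^ S N)%C.
    { rewrite pI (E1 t) /=. have := pN N => p. field. by split. }
    rewrite EB //.
    rewrite seq_S Csum_app. change (1 + N)%nat with (S N).
    have -> : Csum (fun i => match Nat.eq_dec i (S N) with left _ => F 0%C | right _ => cc i end * (/ t) ^ i)%C (S N :: nil) = (F 0%C * (/ t) ^ S N)%C.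
    { rewrite /Csum [map _ _]/= [fold_right _ _ _]/=. case: Nat.eq_dec => //= _. ring. }
    rewrite (Csum_ext _ (fun i => cc i * (/ t) ^ i)%C (seq 1 N)); first ring.
    move=> i /in_seq Hi. case: Nat.eq_dec => // q. lia.
Qed.

Definition polar (n : nat) (cc : nat -> C) (t : C) : C := Csum (fun i => cc i * (/ t) ^ i)%C (seq 1 n).

Definition ml_rest (n : nat) (om : nat -> C) (y : R) (cc : nat -> C) (t : C) : C :=
  (gen_fun n om y t - polar n cc t - Csum (fun k => Zstar_sum (ml_term (res n om y k) (om k) t)) (indices n))%C.

Lemma cderiv_expm1 (w z : C) : cderiv (fun t => Cexp (w * t) - 1)%C z (Cexp (w * z) * w)%C.
Proof.
  apply: (cderiv_comp (fun u => Cexp u - 1)%C (fun t => w * t)%C).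
  - move=> e He. have [d [Hd K]] := cderiv_Cexp (w * z)%C e He. exists d. split => // v Hv.
    have -> : (Cexp v - 1 - (Cexp (w * z) - 1) - Cexp (w * z) * (v - w * z) = Cexp v - Cexp (w * z) - Cexp (w * z) * (v - w * z))%C by ring.
    exact: K.
  - move=> e He. exists 1. split; first lra. move=> v _.
    have -> : (w * v - w * z - w * (v - z) = 0)%C by ring. rewrite Cmod_0. have := Cmod_ge_0 (v - z)%C. nra.
Qed.

Lemma expm1_factor (w p : C) : w <> 0%C -> Cexp (w * p)%C = 1%C -> exists s : C -> C,
  (forall t, cdiff s t) /\ s p = w /\ (forall t, Cexp (w * t) - 1 = (t - p) * s t)%C /\
  exists d, 0 < d /\ forall t, Cmod (t - p)%C < d -> s t <> 0%C.
Proof.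
  move=> Hw Hp. have D := cderiv_expm1 w p. rewrite Hp Cmult_1_l in D.
  set s := slope (fun t => Cexp (w * t) - 1)%C p w.
  have Ds : forall t, cdiff s t.
  { move=> t. have := Cmod_ge_0 (t - p)%C => h. apply: (slope_cdiff _ p w (Cmod (t - p)%C + 1)) => //; try lra. move=> v _. cdiff_tac. }
  have sp : s p = w by exact: slope_eq.
  exists s. split => //. split => //. split.
  - move=> t. rewrite (slope_mult (fun t => Cexp (w * t) - 1)%C p w t) Hp. rewrite -/s. ring.
  - have mw := proj1 (Cmod_gt_0 w) Hw. have [d [Hd K]] := cdiff_ccont _ _ (Ds p) (Cmod w) mw.
    exists d. split => // t Ht E. have := K t Ht. rewrite E sp Cmod_minus_sym. have -> : (w - 0 = w)%C by ring. lra.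
Qed.

Lemma gq_factor y (w p t s : C) : s <> 0%C -> t <> p -> (Cexp (w * t) - 1 = (t - p) * s)%C -> gq y (w * t)%C = (Cexp (w * t * y) / s / (t - p))%C.
Proof. move=> Hs Ht E. rewrite /gq E. have h := Cminus_neq_0 _ _ Ht. move: (t - p)%C h => v h. field. by split. Qed.

Lemma Cprod_div (h : nat -> C) (t : C) l : t <> 0%C -> Cprod (fun k => h k / t)%C l = (Cprod h l / t ^ length l)%C.
Proof.
  move=> Ht. have pN : forall k, (t ^ k)%C <> 0%C by elim=> [|k IHk] /=; [exact: RtoC_neq0 R1_neq_R0|by apply: Cmult_neq_0].
  elim: l => [|k l IH]; first by rewrite /Cprod /=; field.
  change ((h k / t * Cprod (fun k => h k / t) l)%C = (h k * Cprod h l / (t * t ^ length l))%C). rewrite IH. field. by split.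
Qed.

(** Writing [Cexp (om k * t) - 1 = t * s k t] with [s k] nonzero near 0 gives [gen_fun = F / t^n]
    with [F] differentiable near 0, and [laurent] splits off the negative powers. *)
Lemma polar_at_0 n om y : periods n om -> exists cc R0 B, 0 < R0 /\ (forall t, Cmod (t - 0)%C < R0 -> cdiff B t) /\
  forall t : C, t <> 0%C -> Cmod (t - 0)%C < R0 -> (gen_fun n om y t = polar n cc t + B t)%C.
Proof.
  move=> [H1 _].
  have Hs : forall k, exists s : C -> C, In k (indices n) -> (forall t, cdiff s t) /\ (forall t, Cexp (om k * t) - 1 = (t - 0) * s t)%C /\
     exists d, 0 < d /\ forall t, Cmod (t - 0)%C < d -> s t <> 0%C.
  { move=> k. case: (classic (In k (indices n))) => Hk; last by exists (fun z => z).
    have [s [S1 [_ [S3 S4]]]] := expm1_factor (om k) 0%C (Re_pos_neq0 _ (H1 k Hk)) ltac:(by rewrite Cmult_0_r Cexp_0). by exists s. }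
  pose s := fun k => proj1_sig (constructive_indefinite_description _ (Hs k)).
  have Ps : forall k, In k (indices n) -> (forall t, cdiff (s k) t) /\ (forall t, Cexp (om k * t) - 1 = (t - 0) * s k t)%C /\
     exists d, 0 < d /\ forall t, Cmod (t - 0)%C < d -> s k t <> 0%C.
  { move=> k. exact: (proj2_sig (constructive_indefinite_description _ (Hs k))). }
  case: (finite_min nat (indices n) (fun k e => forall t, Cmod (t - 0)%C < e -> s k t <> 0%C)).
  { move=> k Hk. have [_ [_ [d [d0 Hd]]]] := Ps k Hk. exists d. split => // e _ He t Ht. apply: Hd. lra. }
  move=> R0 [R00 [_ HR]].
  set F := fun t => Cprod (fun k => Cexp (om k * t * y) / s k t)%C (indices n).
  have DF : forall t, Cmod (t - 0)%C < R0 -> cdiff F t.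
  { move=> t Ht. apply: (cdiff_Cprod (fun k t => Cexp (om k * t * y) / s k t)%C) => k Hk. have D := proj1 (Ps k Hk) t.
    apply: cdiff_div => //; last by cdiff_tac. exact: (HR k Hk R0 R00 (Rle_refl _)). }
  have [cc [B [DB EB]]] := laurent F R0 n R00 DF.
  exists cc, R0, B. split => //. split => // t Nt Ht. rewrite /polar -EB //.
  have Ln : length (indices n) = n by exact: length_seq.
  rewrite -{2}Ln /F -Cprod_div //. apply: Cprod_ext => k Hk.
  have [_ [E2 _]] := Ps k Hk. have N := HR k Hk R0 R00 (Rle_refl _) t Ht.
  rewrite (gq_factor y (om k) 0%C t (s k t)) //. have -> : (t - 0 = t)%C by ring. done.
Qed.

Lemma cdiff_polar n cc (t : C) : t <> 0%C -> cdiff (polar n cc) t.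
Proof. move=> H. apply: (cdiff_Csum (fun i t => cc i * (/ t) ^ i)%C) => i _. cdiff_tac. Qed.

Lemma regular_neq0 n om eta t : (1 <= n)%nat -> 0 < eta -> regular n om eta t -> eta <= Cmod t.
Proof.
  move=> Hn He H. have := H 1%nat 0%Z ltac:(apply/in_seq; lia). by have -> : (t - pole (om 1%nat) 0 = t)%C by rewrite /pole; ring.
Qed.

Lemma ml_term_sums_cdiff n om y eta t : periods n om -> 0 <= y < 1 -> 0 < eta -> regular n om eta t ->
  cdiff (fun t => Csum (fun k => Zstar_sum (ml_term (res n om y k) (om k) t)) (indices n)) t.
Proof.
  move=> H Hy He Hr. have [Cr [C0 HC]] := res_bounded n om y H Hy.
  apply: (cdiff_Csum (fun k t => Zstar_sum (ml_term (res n om y k) (om k) t))) => k Hk.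
  apply: (ml_term_sum_cdiff _ _ t Cr (eta - eta / 2) (eta / 2)) => //; try lra.
  - exact: Re_pos_neq0 (proj1 H k Hk).
  - move=> m Hm. exact: HC.
  - move=> m t' Hm _ Ht. exact: (regular_near n om eta t t' (eta / 2) Hr Ht k m Hk).
Qed.

Lemma ml_rest_cdiff n om y cc eta t : (1 <= n)%nat -> periods n om -> 0 <= y < 1 -> 0 < eta -> regular n om eta t -> cdiff (ml_rest n om y cc) t.
Proof.
  move=> Hn H Hy He Hr. apply: cdiff_minus; last exact: ml_term_sums_cdiff He Hr.
  apply: cdiff_minus; first exact: gen_fun_cdiff He Hr. apply: cdiff_polar. apply: Cmod_pos_neq0. have := regular_neq0 n om eta t Hn He Hr. lra.
Qed.

Lemma regular_off_pole n om d t k0 m0 : poles_sep n om d -> In k0 (indices n) -> 0 < Cmod (t - pole (om k0) m0)%C < d ->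
  regular n om (Cmod (t - pole (om k0) m0)%C) t.
Proof.
  move=> [d0 [d1 Hs]] Hk0 Ht k m Hk. case: (classic (pole (om k) m = pole (om k0) m0)) => [->|N]; first lra.
  have := Hs k k0 m m0 Hk Hk0 N. have := Cmod_triangle3 (pole (om k) m) (pole (om k0) m0) t. rewrite (Cmod_minus_sym (pole (om k) m) t). lra.
Qed.

Lemma ml_rest_ext_0 n om y : (1 <= n)%nat -> periods n om -> 0 <= y < 1 -> exists cc g d, 0 < d /\ (forall w, Cmod (w - 0)%C < d -> cdiff g w) /\
  forall w, 0 < Cmod (w - 0)%C < d -> ml_rest n om y cc w = g w.
Proof.
  move=> Hn H Hy. have [cc [R0 [B [R00 [DB EB]]]]] := polar_at_0 n om y H. have [d [d0 [d1 Hs]]] := poles_sep_ex n om H.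
  have [Cr [C0 HC]] := res_bounded n om y H Hy.
  exists cc, (fun w => B w - Csum (fun k => Zstar_sum (ml_term (res n om y k) (om k) w)) (indices n))%C, (Rmin R0 d).
  split; first exact: Rmin_glb_lt. split.
  - move=> w Hw. have h1 := Rlt_le_trans _ _ _ Hw (Rmin_l _ _). have h2 := Rlt_le_trans _ _ _ Hw (Rmin_r _ _).
    apply: cdiff_minus; first exact: DB.
    apply: (cdiff_Csum (fun k t => Zstar_sum (ml_term (res n om y k) (om k) t))) => k Hk.
    apply: (ml_term_sum_cdiff _ _ w Cr d d) => //; try lra.
    + exact: Re_pos_neq0 (proj1 H k Hk).
    + move=> m Hm. exact: HC.
    + move=> m t' Hm _ Ht. have wk := Re_pos_neq0 _ (proj1 H k Hk).
      have p0 : pole (om k) 0 = 0%C by rewrite /pole; ring.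
      have N : pole (om k) m <> pole (om k) 0 by rewrite p0; exact: pole_neq0.
      have := Hs k k m 0%Z Hk Hk N. rewrite p0 => q.
      have := Cmod_triangle3 (pole (om k) m) 0%C t'. have := Cmod_triangle3 t' 0%C w. rewrite (Cmod_minus_sym t' (pole (om k) m)). lra.
  - move=> w [Hw0 Hw]. have h1 := Rlt_le_trans _ _ _ Hw (Rmin_l _ _).
    rewrite /ml_rest EB //; first ring. move=> q. move: Hw0. rewrite q Cmod_self. lra.
Qed.

Lemma ml_term_skip m0 (r : Z -> C) w t m : ml_term (zskip m0 r) w t m = zskip m0 (ml_term r w t) m.
Proof. rewrite /ml_term /zskip. case: Z.eq_dec => // _. rewrite /Cdiv. ring. Qed.

Lemma ml_rest_ext_pole n om y cc k0 m0 : (1 <= n)%nat -> periods n om -> 0 <= y < 1 -> In k0 (indices n) -> m0 <> 0%Z ->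
  exists g d, 0 < d /\ (forall w, Cmod (w - pole (om k0) m0)%C < d -> cdiff g w) /\
  forall w, 0 < Cmod (w - pole (om k0) m0)%C < d -> ml_rest n om y cc w = g w.
Proof.
  move=> Hn H Hy Hk0 Hm0. have Hsep := poles_sep_ex n om H. case: Hsep => d Hsep. have [d0 [d1 Hs]] := Hsep.
  have [Cr [C0 HC]] := res_bounded n om y H Hy.
  have w0 := Re_pos_neq0 _ (proj1 H k0 Hk0). set p := pole (om k0) m0.
  have Ep : Cexp (om k0 * p)%C = 1%C by rewrite /p pole_mul // Cexp_2PI_Z.
  have [s [S1 [S2 [S3 [ds [ds0 S4]]]]]] := expm1_factor (om k0) p w0 Ep.
  set dd := Rmin ds d. have dd0 : 0 < dd by exact: Rmin_glb_lt. have dd1 : dd <= ds by exact: Rmin_l. have dd2 : dd <= d by exact: Rmin_r.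
  have far : forall k m t, In k (indices n) -> Cmod (t - p)%C < d -> pole (om k) m <> p -> 2 * d <= Cmod (t - pole (om k) m)%C.
  { move=> k m t Hk Ht N. have := Hs k k0 m m0 Hk Hk0 N. have := Cmod_triangle3 (pole (om k) m) p t. rewrite -/p (Cmod_minus_sym (pole (om k) m) t). lra. }
  have diffp : forall k m, In k (indices n) -> k <> k0 -> pole (om k) m <> p.
  { move=> k m Hk N E. have [dk [dk0 Hdk]] := pole_separated (om k) (om k0) (Re_pos_neq0 _ (proj1 H k Hk)) w0 (proj2 H k0 k Hk0 Hk (not_eq_sym N)).
    have := Hdk m m0 (or_intror Hm0). rewrite E Cmod_self. lra. }
  have diffm : forall m, m <> m0 -> pole (om k0) m <> p.
  { move=> m N E. have := pole_minus_same (om k0) m m0 w0. rewrite E Cmod_self. have c := pole_unit_pos _ w0.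
    have Nm : (m - m0)%Z <> 0%Z by lia. have := IZR_abs_ge1 _ Nm. nra. }
  have oth : forall k t, In k (indices_but n k0) -> Cmod (t - p)%C < d -> Cexp (om k * t)%C <> 1%C.
  { move=> k t /In_indices_but [Hk N] Ht E. have [m Em] := Cexp_1_pl _ _ (Re_pos_neq0 _ (proj1 H k Hk)) E.
    have := far k m t Hk Ht (diffp k m Hk N). rewrite Em Cmod_self. lra. }
  set r := res n om y k0 m0.
  set N := fun t => (Cexp (om k0 * t * y) / s t * Cprod (fun j => gq y (om j * t)) (indices_but n k0))%C.
  have p0 : p <> 0%C by exact: pole_neq0.
  (* Near [p], [gen_fun] is [N t / (t - p)] and the term to be subtracted is
     [r t^2 / (p^2 (t - p))]; [Bf] is the numerator of the difference and vanishes at [p] because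
     [N p = r]. *)
  set Bf := fun t => (N t - r * t ^ 2 / p ^ 2)%C.
  have DB : forall t, Cmod (t - p)%C < dd -> cdiff Bf t.
  { move=> t Ht. have Ds := S1 t. have sn0 := S4 t ltac:(lra). apply: cdiff_minus.
    - apply: cdiff_mult; first by cdiff_tac.
      apply: (cdiff_Cprod (fun j t => gq y (om j * t)%C)) => j Hj. apply: cdiff_gq. apply: oth => //. lra.
    - cdiff_tac. rewrite /= Cmult_1_r. exact: Cmult_neq_0. }
  have B0 : Bf p = 0%C.
  { rewrite /Bf /N S2 /r /res -/p.
    rewrite /p (pole_mul _ _ w0) -/p. move: (Cexp _) (Cprod _ _) => e P. field. by split. }
  have [B1 [DB1 [_ EB1]]] := division Bf p dd dd0 DB.
  (* The residues with the one at [p] deleted; by [diffp] and [diffm] no other index produces the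
     pole [p]. *)
  pose rs := fun k => match Nat.eq_dec k k0 with left _ => zskip m0 (res n om y k) | right _ => res n om y k end.
  have rsC : forall k m, In k (indices n) -> m <> 0%Z -> Cmod (rs k m) <= Cr.
  { move=> k m Hk Hm. rewrite /rs /zskip. case: Nat.eq_dec => E; last exact: HC. case: Z.eq_dec => E2; last exact: HC. by rewrite Cmod_0. }
  exists (fun t => B1 t - polar n cc t - Csum (fun k => Zstar_sum (ml_term (rs k) (om k) t)) (indices n))%C, (dd / 2).
  split; first lra. split.
  - move=> w Hw. apply: cdiff_minus; first apply: cdiff_minus; first by apply: DB1; lra.
    + apply: cdiff_polar. apply: Cmod_pos_neq0.
      have pk : pole (om k0) 0 = 0%C by rewrite /pole; ring.
      have := far k0 0%Z w Hk0 ltac:(lra) ltac:(by rewrite pk => q; apply: p0). rewrite pk. have -> : (w - 0 = w)%C by ring. lra.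
    + apply: (cdiff_Csum (fun k t => Zstar_sum (ml_term (rs k) (om k) t))) => k Hk.
      apply: (ml_term_sum_cdiff _ _ w Cr d (dd / 2)) => //; try lra.
      * exact: Re_pos_neq0 (proj1 H k Hk).
      * move=> m Hm. exact: rsC.
      * move=> m t Hm Nz Ht. have Htp : Cmod (t - p)%C < d by have := Cmod_triangle3 t p w; lra.
        suff : 2 * d <= Cmod (t - pole (om k) m)%C by lra. apply: far => //.
        move: Nz. rewrite /rs. case: Nat.eq_dec => E; last by move=> _; exact: diffp.
        subst k. move=> Nz. apply: diffm => q. apply: Nz. by rewrite q zskip_eq.
  - move=> w [Hw0 Hw]. have Nw : w <> p by move=> q; move: Hw0; rewrite q Cmod_self; lra.
    have Hreg := regular_off_pole n om d w k0 m0 Hsep Hk0 ltac:(rewrite -/p; lra). rewrite -/p in Hreg.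
    have EG : gen_fun n om y w = (N w / (w - p))%C.
    { rewrite /gen_fun (Cprod_but _ _ k0 (NoDup_indices n) Hk0) /N -/(indices_but n k0).
      rewrite (gq_factor y (om k0) p w (s w)) //; last by apply: S4; lra. rewrite /Cdiv. ring. }
    have ES : Csum (fun k => Zstar_sum (ml_term (res n om y k) (om k) w)) (indices n) = (Csum (fun k => Zstar_sum (ml_term (rs k) (om k) w)) (indices n) + ml_term (res n om y k0) (om k0) w m0)%C.
    { rewrite (Csum_change _ (fun k => Zstar_sum (ml_term (rs k) (om k) w)) _ k0 (NoDup_indices n) Hk0); last first.
      - move=> k Hk Nk. rewrite /rs. by case: Nat.eq_dec.
      - congr (_ + _)%C. have -> : rs k0 = zskip m0 (res n om y k0) by rewrite /rs; case: Nat.eq_dec.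
        have [B [S0 [HB HZ]]] := ml_term_zdom (res n om y k0) (om k0) w Cr (Cmod (w - p)%C) w0 Hw0 C0 (fun m Hm => HC k0 m Hk0 Hm) (fun m _ _ => Hreg k0 m Hk0).
        rewrite (Zsum_skip _ m0 B S0 Hm0 HB HZ).
        rewrite (Zsum_ext (ml_term (zskip m0 (res n om y k0)) (om k0) w) (zskip m0 (ml_term (res n om y k0) (om k0) w))); first ring.
        move=> m _. exact: ml_term_skip. }
    rewrite /ml_rest EG ES. have E1 := EB1 w. rewrite B0 Cplus_0_l /Bf in E1.
    have Nw' := Cminus_neq_0 _ _ Nw.
    have -> : B1 w = ((w - p) * B1 w / (w - p))%C by field.
    rewrite -E1 /ml_term -/r -/p. field. by split.
Qed.

Lemma Cmod_polar_bound n cc d : 0 < d -> exists K, 0 <= K /\ forall t : C, d <= Cmod t -> Cmod (polar n cc t) <= K.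
Proof.
  move=> Hd. case: (finite_max nat (seq 1 n) (fun i K => forall t : C, d <= Cmod t -> Cmod (cc i * (/ t) ^ i)%C <= K)).
  { move=> i _. exists (Cmod (cc i) * (/ d) ^ i).
    have h : 0 <= (/ d) ^ i by apply: pow_le; left; apply: Rinv_0_lt_compat.
    split; first by apply: Rmult_le_pos => //; exact: Cmod_ge_0.
    move=> K' HK t Ht. apply: Rle_trans HK. rewrite Cmod_mult Cmod_pow. apply: Rmult_le_compat_l; first exact: Cmod_ge_0.
    apply: pow_incr. split; first exact: Cmod_ge_0. rewrite Cmod_inv; last by apply: Cmod_pos_neq0; lra.
    exact: Rinv_le_contravar. }
  move=> K [K0 HK]. exists (INR n * K). split; first by apply: Rmult_le_pos => //; exact: pos_INR.
  move=> t Ht. rewrite /polar. rewrite -{2}(length_seq n 1). apply: Csum_norm => i Hi. exact: HK.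
Qed.

Lemma ml_rest_bound n om y cc d : (1 <= n)%nat -> periods n om -> 0 <= y < 1 -> 0 < d ->
  exists K, 0 <= K /\ forall t, regular n om d t -> Cmod (ml_rest n om y cc t) <= K * (1 + Cmod t) ^ 2.
Proof.
  move=> Hn H Hy Hd. have [K1 [P1 H1]] := gen_fun_bounded n om y d H Hy Hd. have [K2 [P2 H2]] := Cmod_polar_bound n cc d Hd.
  have [Cr [C0 HC]] := res_bounded n om y H Hy.
  case: (finite_max nat (indices n) (fun k K => forall t : C, (forall m, m <> 0%Z -> d <= Cmod (t - pole (om k) m)%C) ->
     Cmod (Zstar_sum (ml_term (res n om y k) (om k) t)) <= K * (Cmod t * Cmod t))).
  { move=> k Hk. have [K [K0 HK]] := ml_term_sum_norm (res n om y k) (om k) Cr d (Re_pos_neq0 _ (proj1 H k Hk)) Hd C0.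
    exists K. split => // K' HK' t Ht. apply: Rle_trans (HK t _ Ht) _; first by move=> m Hm; exact: HC.
    apply: Rmult_le_compat_r => //. have := Cmod_ge_0 t. nra. }
  move=> K3 [P3 H3]. exists (K1 + K2 + INR n * K3). have pn := pos_INR n. split; first by have := Rmult_le_pos _ _ pn P3; lra.
  move=> t Ht. have h0 := regular_neq0 n om d t Hn Hd Ht.
  have h1 := H1 t Ht. have h2 := H2 t h0.
  have h3 : Cmod (Csum (fun k => Zstar_sum (ml_term (res n om y k) (om k) t)) (indices n)) <= INR n * (K3 * (Cmod t * Cmod t)).
  { have -> : INR n = INR (length (indices n)) by rewrite length_seq. apply: Csum_norm => k Hk. apply: H3 => // m _. exact: Ht. }
  rewrite /ml_rest. apply: Rle_trans (Cmod_triangle_minus _ _) _. apply: Rle_trans (Rplus_le_compat _ _ _ _ (Cmod_triangle_minus _ _) h3) _.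
  have c0 := Cmod_ge_0 t. set a := Cmod t in c0 h3 |- *. have p3 := Rmult_le_pos _ _ pn P3.
  have q : 0 <= INR n * K3 * (1 + 2 * a) by apply: Rmult_le_pos => //; lra.
  have q1 : 0 <= K1 * (2 * a + a * a) by apply: Rmult_le_pos => //; nra.
  have q2 : 0 <= K2 * (2 * a + a * a) by apply: Rmult_le_pos => //; nra. nra.
Qed.

Lemma ml_rest_quadratic n om y : (1 <= n)%nat -> periods n om -> 0 <= y < 1 ->
  exists cc (c0 c1 c2 : C), forall eta t, 0 < eta -> regular n om eta t -> ml_rest n om y cc t = (c0 + c1 * t + c2 * t ^ 2)%C.
Proof.
  move=> Hn H Hy. have [cc [g0 [d0 [Hd0 [Hg0 Eg0]]]]] := ml_rest_ext_0 n om y Hn H Hy. exists cc.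
  have [d Hsep] := poles_sep_ex n om H. have [dpos [d1 Hs]] := Hsep.
  have pk : forall k, pole (om k) 0 = 0%C by move=> k; rewrite /pole; ring.
  case: (entire_extension (ml_rest n om y cc)).
  { move=> z. case: (classic (exists k m, In k (indices n) /\ z = pole (om k) m)) => [[k [m [Hk ->]]]|N].
    - case: (Z.eq_dec m 0) => [->|Hm]; first by rewrite pk; exists g0, d0.
      exact: (ml_rest_ext_pole n om y cc k m Hn H Hy Hk Hm).
    - have [eta [He Hr]] : exists eta, 0 < eta /\ regular n om eta z.
      { case: (pole_dichotomy n om d z Hsep) => [Hr|[k0 [m0 [Hk0 [Hz Hf]]]]]; first by exists d.
        exists (Cmod (z - pole (om k0) m0)%C). have p : 0 < Cmod (z - pole (om k0) m0)%C by apply: Cmod_minus_gt0 => q; apply: N; exists k0, m0.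
        split => //. apply: (regular_off_pole n om d) => //. }
      exists (ml_rest n om y cc), (eta / 2). split; first lra. split => // w Hw.
      apply: (ml_rest_cdiff n om y cc (eta - eta / 2)) => //; first lra.
      apply: (regular_near n om eta z w (eta / 2)) => //. lra. }
  move=> F [HF EF]. have [K [K0 HK]] := ml_rest_bound n om y cc d Hn H Hy dpos.
  have EqF : forall eta t, 0 < eta -> regular n om eta t -> F t = ml_rest n om y cc t by move=> eta t He Hr; apply: EF; exact: (ml_rest_cdiff n om y cc eta).
  case: (liouville_quadratic F (32 * K)) => //.
  { move=> z. have cz := Cmod_ge_0 z. case: (pole_dichotomy n om d z Hsep) => [Hr|[k0 [m0 [Hk0 [Hz Hf]]]]].
    - rewrite (EqF d) //. apply: Rle_trans (HK z Hr) _. have : 0 <= (1 + Cmod z) ^ 2 by exact: pow2_ge_0. nra.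
    (* Inside the discs about the poles the bound is taken from the circle of radius [2 d], all of
       whose points are regular. There [1 + |w| <= 4 (1 + |z|)], which gives 16 after squaring, and
       the Cauchy estimate doubles it to 32. *)
    - set p := pole (om k0) m0 in Hz Hf.
      have cp : Cmod p <= Cmod z + d by have := Cmod_triangle_rev_minus p z; rewrite Cmod_minus_sym; lra.
      apply: Rle_trans (cauchy_estimate F p (2 * d) (16 * K * (1 + Cmod z) ^ 2) _ _ _ z _) _; first lra.
      + move=> w _. exact: HF.
      + move=> t _. set w := circ p (2 * d) t. have Ew : Cmod (w - p)%C = 2 * d by apply: Cmod_circ_minus; lra.
        have Hr : regular n om d w.
        { move=> k m Hk. case: (classic (pole (om k) m = p)) => [->|Np]; first by rewrite Ew; lra.
          have q := Hs k k0 m m0 Hk Hk0 Np. rewrite -/p in q. have tr := Cmod_triangle3 (pole (om k) m) p w.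
          rewrite (Cmod_minus_sym (pole (om k) m) w) Ew in tr. lra. }
        rewrite (EqF d) //. apply: Rle_trans (HK w Hr) _.
        have cw : Cmod w <= Cmod z + 3 by have := Cmod_triangle_rev_minus w p; lra.
        have cw0 := Cmod_ge_0 w. have : (1 + Cmod w) ^ 2 <= (4 * (1 + Cmod z)) ^ 2 by apply: pow_incr; lra. nra.
      + lra.
      + lra. }
  move=> c0 [c1 [c2 E]]. exists c0, c1, c2 => eta t He Hr. by rewrite -(EqF eta) // E.
Qed.

(** * The expansion on the positive half line *)

Lemma pole_dist (w : C) : 0 < Re w -> exists c, 0 < c /\ c <= 1 /\ forall m (u : R), m <> 0%Z -> 0 <= u -> c * (u + Cmod (pole w m)) <= Cmod (u - pole w m)%C.
Proof.
  move=> Hw. have [b [Hb H]] := pole_log w Hw. exists (cos (b / 2)). have := COS_bound (b / 2) => hb.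
  split; first by apply: cos_gt_0; lra. split; first lra.
  move=> m u Hm Hu. have [v [Ev [Hv Rv]]] := H m Hm. rewrite -Rv.
  have -> : (u - pole w m = RtoC u + Cexp v)%C by rewrite Ev; ring.
  apply: (Cmod_sum_lower_strip u v b) => //. lra.
Qed.

(* [r / (t - p) + r / p]: only the constant term is subtracted, so that on the positive half line the term is [O (u^k |p|^(-1-k))] for every [0 <= k <= 1]. *)
Definition st_term (r : Z -> C) (w : C) (u : R) (m : Z) : C := (r m * u / (pole w m * (u - pole w m)))%C.

(** The quotient is at most [min(1, u / q)], hence at most [(u / q)^k]. *)
Lemma ratio_le_exp u q k : 0 < u -> 0 < q -> 0 <= k <= 1 -> u / (u + q) <= exp (k * (ln u - ln q)).
Proof.
  move=> Hu Hq Hk. case: (Rle_dec q u) => H.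
  - apply: (Rle_trans _ 1); first by apply: (Rmult_le_reg_r (u + q)); [lra|field_simplify; lra].
    rewrite -{1}exp_0. apply: exp_le. apply: Rmult_le_pos; first lra. have := ln_le q u Hq H. lra.
  - apply: (Rle_trans _ (exp (ln u - ln q))).
    + rewrite /Rminus exp_plus exp_Ropp !exp_ln //. apply: Rmult_le_compat_l; first lra. apply: Rinv_le_contravar; lra.
    + apply: exp_le. have := ln_le u q Hu ltac:(lra). nra.
Qed.

Lemma st_term_norm (w : C) : 0 < Re w -> exists K, 0 <= K /\ forall r Cr m i u k, Z.abs m = Z.of_nat (S i) -> Cmod (r m) <= Cr -> 0 < u -> 0 <= k <= 1 ->
  Cmod (st_term r w u m) <= K * Cr * exp (k * ln u) * exp (- (1 + k) * ln (INR i + 1)).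
Proof.
  move=> Hw. have [c1 [c1p [_ H]]] := pole_dist w Hw. have w0 := Re_pos_neq0 w Hw. have cp := pole_unit_pos w w0.
  (* Since [|pole w m| = c (i + 1)], a power [c^(-1-k)] appears; [exp (2 * Rabs (ln c))] bounds it
     for all [0 <= k <= 1] at once. *)
  set c := 2 * PI / Cmod w in cp. exists (exp (2 * Rabs (ln c)) / c1).
  split; first by apply: Rlt_le; apply: Rdiv_lt_0_compat => //; exact: exp_pos.
  move=> r Cr m i u k Hm Hr Hu Hk. have m0 : m <> 0%Z by move=> q; move: Hm; rewrite q; lia.
  have i0 : 0 < INR i + 1 by have := pos_INR i; lra.
  have Eq : Cmod (pole w m) = c * (INR i + 1) by rewrite Cmod_pl // (abs_IZR_S i m Hm).
  have d0 := H m u m0 (Rlt_le _ _ Hu). have C0 : 0 <= Cr by apply: Rle_trans Hr; exact: Cmod_ge_0.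
  have p0 := pole_neq0 w m w0 m0. set p := pole w m in Eq d0 p0.
  set q := Cmod p in Eq d0. have q0 : 0 < q by rewrite /q; exact: (proj1 (Cmod_gt_0 p)).
  set D := Cmod (u - p)%C in d0. have D0 : c1 * (u + q) <= D by []. have uq : 0 < c1 * (u + q) by apply: Rmult_lt_0_compat; lra.
  have N : (p * (u - p))%C <> 0%C by apply: Cmult_neq_0 => //; apply: Cmod_pos_neq0; rewrite -/D; lra.
  rewrite /st_term -/p Cmod_div // Cmod_mult Cmod_R Rabs_right; last lra. rewrite Cmod_mult -/q -/D.
  apply: (Rle_trans _ (Cr * (u / (u + q) * / q) / c1)).
  { have -> : Cr * (u / (u + q) * / q) / c1 = Cr * u / (q * (c1 * (u + q))) by field; repeat split; lra.
    apply: Rmult_le_compat.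
    - apply: Rmult_le_pos; [exact: Cmod_ge_0|lra].
    - left. apply: Rinv_0_lt_compat. apply: Rmult_lt_0_compat; lra.
    - apply: Rmult_le_compat_r; lra.
    - apply: Rinv_le_contravar; first by apply: Rmult_lt_0_compat; lra. apply: Rmult_le_compat_l; lra. }
  have e1 := ratio_le_exp u q k Hu q0 Hk.
  have e2 : / q = exp (- ln q) by rewrite exp_Ropp exp_ln.
  have e3 : u / (u + q) * / q <= exp (2 * Rabs (ln c)) * exp (k * ln u) * exp (- (1 + k) * ln (INR i + 1)).
  { rewrite e2. apply: Rle_trans (Rmult_le_compat_r _ _ _ (Rlt_le _ _ (exp_pos _)) e1) _.
    rewrite -!exp_plus. apply: exp_le. rewrite Eq ln_mult //. have := Rle_abs (- ln c). rewrite Rabs_Ropp. have := Rabs_pos (ln c). nra. }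
  have -> : exp (2 * Rabs (ln c)) / c1 * Cr * exp (k * ln u) * exp (- (1 + k) * ln (INR i + 1)) = Cr * (exp (2 * Rabs (ln c)) * exp (k * ln u) * exp (- (1 + k) * ln (INR i + 1))) / c1 by field; lra.
  apply: Rmult_le_compat_r; first by left; apply: Rinv_0_lt_compat. exact: Rmult_le_compat_l.
Qed.

(** The two terms differ by [u r / p^2], linear in [u]; the sum of these corrections is absorbed by
    the linear part of the polynomial from Liouville's theorem. *)
Lemma ml_term_uu (r : Z -> C) w (u : R) m : 0 < Re w -> m <> 0%Z -> 0 <= u -> ml_term r w u m = (st_term r w u m + u * (r m / pole w m ^ 2))%C.
Proof.
  move=> Hw Hm Hu. have p0 := pole_neq0 w m (Re_pos_neq0 w Hw) Hm. have [c [c0 [_ H]]] := pole_dist w Hw.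
  have d := H m u Hm Hu. have q0 := proj1 (Cmod_gt_0 _) p0.
  have N : (u - pole w m)%C <> 0%C by apply: Cmod_pos_neq0; have := Rmult_lt_0_compat c (u + Cmod (pole w m)) c0 ltac:(lra); lra.
  rewrite /ml_term /st_term. field. by split.
Qed.

Lemma zdom_uu (r : Z -> C) w Cr (u : R) k : 0 < Re w -> (forall m, m <> 0%Z -> Cmod (r m) <= Cr) -> 0 < u -> 0 < k <= 1 ->
  exists B S0, dom_sum B S0 /\ zdom (st_term r w u) B.
Proof.
  move=> Hw HC Hu Hk. have [K [K0 H]] := st_term_norm w Hw. have [S0 HS] := zeta_terms_summable k (proj1 Hk).
  have C0 : 0 <= Cr by apply: Rle_trans (HC 1%Z _) => //; exact: Cmod_ge_0.
  have p : 0 <= K * Cr * exp (k * ln u) by apply: Rmult_le_pos; [exact: Rmult_le_pos|left; exact: exp_pos].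
  exists (fun i => K * Cr * exp (k * ln u) * exp (- (1 + k) * ln (INR i + 1))), (K * Cr * exp (k * ln u) * S0).
  split; first exact: (dom_sum_scal _ _ _ p HS).
  apply: zdom_abs => m i Hm. apply: H => //; last lra. apply: HC => q. move: Hm. rewrite q. lia.
Qed.

Lemma zdom_r2 (r : Z -> C) (w : C) Cr : w <> 0%C -> (forall m, m <> 0%Z -> Cmod (r m) <= Cr) -> exists B S0, dom_sum B S0 /\ zdom (fun m => r m / pole w m ^ 2)%C B.
Proof.
  move=> Hw HC. have [S0 HS] := isq_sum. have cp := pole_unit_pos w Hw. set c := 2 * PI / Cmod w in cp.
  have C0 : 0 <= Cr by apply: Rle_trans (HC 1%Z _) => //; exact: Cmod_ge_0.
  have p : 0 <= Cr / (c * c). { apply: Rmult_le_pos => //. left. apply: Rinv_0_lt_compat. exact: Rmult_lt_0_compat. }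
  exists (fun i => Cr / (c * c) * isq i), (Cr / (c * c) * S0). split; first exact: dom_sum_scal.
  apply: zdom_abs => m i Hm. have m0 : m <> 0%Z by move=> q; move: Hm; rewrite q; lia.
  have i0 : 0 < INR i + 1 by have := pos_INR i; lra.
  have p0 := pole_neq0 w m Hw m0. have N : (pole w m ^ 2)%C <> 0%C by rewrite /= Cmult_1_r; exact: Cmult_neq_0.
  rewrite Cmod_div // Cmod_pow Cmod_pl // (abs_IZR_S i m Hm) -/c.
  have -> : Cr / (c * c) * isq i = Cr / (c * (INR i + 1)) ^ 2 by rewrite /isq; field; lra.
  apply: Rmult_le_compat_r; last exact: HC. left. apply: Rinv_0_lt_compat. apply: pow_lt. exact: Rmult_lt_0_compat.
Qed.

Lemma bounded_by_inverse (b K : R) : 0 <= b -> (forall v, 1 <= v -> b * v <= K) -> b = 0.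
Proof.
  move=> Hb H. case: (Req_dec b 0) => // N. have b0 : 0 < b by lra. have K0 : 0 <= K by have := H 1 ltac:(lra); lra.
  have q : 0 <= K / b by apply: Rmult_le_pos => //; left; apply: Rinv_0_lt_compat.
  have := H (K / b + 1) ltac:(lra). rewrite Rmult_plus_distr_l. have -> : b * (K / b) = K by field. lra.
Qed.

(** With [u = v^2] the hypothesis is a bound [O(sqrt u)] on [a u + b u^2]. Dividing by [u] and
    comparing [v] with [2 v] eliminates [a] and leaves [b * v] bounded. *)
Lemma growth_zero (a b : C) K : (forall v : R, 1 <= v -> Cmod (a * v ^ 2 + b * v ^ 4)%C <= K * v) -> a = 0%C /\ b = 0%C.
Proof.
  move=> H.
  have H1 : forall v : R, 1 <= v -> Cmod (a + b * v ^ 2)%C * v <= K.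
  { move=> v Hv. have := H v Hv. have -> : (a * v ^ 2 + b * v ^ 4 = RtoC (v * v) * (a + b * v ^ 2))%C by rewrite RtoC_mult; ring.
    rewrite Cmod_mult Cmod_R Rabs_right; last nra. move=> h. apply: (Rmult_le_reg_r v); lra. }
  have K0 : 0 <= K by have := H1 1 ltac:(lra); have := Cmod_ge_0 (a + b * 1 ^ 2)%C; lra.
  have b0 : b = 0%C.
  { apply: Cmod_le_0. rewrite (bounded_by_inverse (Cmod b) K) //; [lra|exact: Cmod_ge_0|]. move=> v Hv.
    have h1 := H1 v Hv. have h2 := H1 (2 * v) ltac:(lra). have cb := Cmod_ge_0 b.
    have tr := Cmod_triangle_minus (a + b * (2 * v)%R ^ 2)%C (a + b * v ^ 2)%C.
    have E : (a + b * (2 * v)%R ^ 2 - (a + b * v ^ 2) = RtoC (3 * (v * v)) * b)%C by rewrite !RtoC_mult; ring.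
    rewrite E Cmod_mult Cmod_R Rabs_right in tr; last nra.
    set p := Cmod (a + b * v ^ 2)%C in h1 tr. set q := Cmod (a + b * (2 * v)%R ^ 2)%C in h2 tr.
    have h3 : 3 * (v * v) * Cmod b * v <= (q + p) * v by apply: Rmult_le_compat_r; lra.
    have h4 : Cmod b * v * 1 <= Cmod b * v * (v * v) by apply: Rmult_le_compat_l; nra. nra. }
  split => //. apply: Cmod_le_0. rewrite (bounded_by_inverse (Cmod a) K) //; [lra|exact: Cmod_ge_0|]. move=> v Hv.
  have := H1 v Hv. rewrite b0. by have -> : (a + 0 * v ^ 2 = a)%C by ring.
Qed.

Lemma regular_real n om (u : R) : periods n om -> 0 < u -> exists eta, 0 < eta /\ regular n om eta u.
Proof.
  move=> [H _] Hu. case: (finite_min nat (indices n) (fun k e => forall m, e <= Cmod (u - pole (om k) m)%C)).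
  { move=> k Hk. have [c [c0 [c1 Hc]]] := pole_dist (om k) (H k Hk). exists (c * u). split; first exact: Rmult_lt_0_compat.
    move=> e _ He m. case: (Z.eq_dec m 0) => [->|Hm].
    - have -> : (u - pole (om k) 0 = u)%C by rewrite /pole; ring. rewrite Cmod_R Rabs_right; nra.
    - have := Hc m u Hm ltac:(lra). have := Cmod_ge_0 (pole (om k) m). nra. }
  move=> d [d0 [_ Hd]]. exists d. split => // k m Hk. exact: (Hd k Hk d d0 (Rle_refl _)).
Qed.

Lemma gen_fun_real_bounded n om y : periods n om -> 0 <= y < 1 -> exists K, 0 <= K /\ forall u : R, 1 <= u -> Cmod (gen_fun n om y u) <= K.
Proof.
  move=> [H _] Hy. case: (finite_max nat (indices n) (fun k K => forall u : R, 1 <= u -> Cmod (gq y (om k * u)%C) <= K)).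
  { move=> k Hk. have Rk := H k Hk. exists (/ (1 - exp (- Re (om k)))).
    have e : exp (- Re (om k)) < 1 by rewrite -exp_0; apply: exp_increasing; lra.
    split; first by left; apply: Rinv_0_lt_compat; lra.
    move=> K' HK u Hu. apply: Rle_trans HK. apply: gq_decay0 => //. rewrite Re_mult_R Rabs_right; nra. }
  move=> K [K0 HK]. exists (K ^ length (indices n)). split; first exact: pow_le.
  move=> u Hu. apply: Cprod_norm => // k Hk. exact: HK.
Qed.

Lemma Csum_plus (f g : nat -> C) l : Csum (fun k => f k + g k)%C l = (Csum f l + Csum g l)%C.
Proof. elim: l => [|k l IH]; first by rewrite /Csum /=; ring. change ((f k + g k + Csum (fun k => f k + g k) l)%C = (f k + Csum f l + (g k + Csum g l))%C). rewrite IH. ring. Qed.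

Lemma Csum_scal (c : C) (f : nat -> C) l : Csum (fun k => c * f k)%C l = (c * Csum f l)%C.
Proof. elim: l => [|k l IH]; first by rewrite /Csum /=; ring. change ((c * f k + Csum (fun k => c * f k) l)%C = (c * (f k + Csum f l))%C). rewrite IH. ring. Qed.

Definition st_sum (n : nat) (om : nat -> C) (y u : R) : C := Csum (fun k => Zstar_sum (st_term (res n om y k) (om k) u)) (indices n).

Lemma ml_term_sums n om y : periods n om -> 0 <= y < 1 -> exists RR : C, forall u : R, 0 < u ->
  Csum (fun k => Zstar_sum (ml_term (res n om y k) (om k) u)) (indices n) = (st_sum n om y u + u * RR)%C.
Proof.
  move=> H Hy. have [Cr [C0 HC]] := res_bounded n om y H Hy.
  exists (Csum (fun k => Zstar_sum (fun m => res n om y k m / pole (om k) m ^ 2)%C) (indices n)) => u Hu.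
  rewrite -Csum_scal -Csum_plus. apply: Csum_ext => k Hk. have wk := proj1 H k Hk.
  have [B1 [S1 [D1 Z1]]] := zdom_uu (res n om y k) (om k) Cr u 1 wk (fun m => HC k m Hk) Hu ltac:(lra).
  have [B2 [S2 [D2 Z2]]] := zdom_r2 (res n om y k) (om k) Cr (Re_pos_neq0 _ wk) (fun m => HC k m Hk).
  rewrite -(Zsum_scal u _ B2 S2 D2 Z2).
  rewrite -(Zsum_plus _ _ B1 S1 (fun i => Cmod u * B2 i) (Cmod u * S2)) //.
  - apply: Zsum_ext => m Hm. apply: ml_term_uu => //. lra.
  - apply: dom_sum_scal => //. exact: Cmod_ge_0.
  - case: Z2 => Za Zb. by split=> i; rewrite Cmod_mult; apply: Rmult_le_compat_l; try exact: Cmod_ge_0.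
Qed.

Lemma st_sum_norm n om y k : periods n om -> 0 <= y < 1 -> 0 < k <= 1 -> exists K, 0 <= K /\ forall u, 0 < u -> Cmod (st_sum n om y u) <= K * exp (k * ln u).
Proof.
  move=> H Hy Hk. have [Cr [C0 HC]] := res_bounded n om y H Hy. have [S0 HS] := zeta_terms_summable k (proj1 Hk). have S00 := dom_sum_ge0 _ _ HS.
  case: (finite_max nat (indices n) (fun j K => forall u, 0 < u -> Cmod (Zstar_sum (st_term (res n om y j) (om j) u)) <= K * exp (k * ln u))).
  { move=> j Hj. have [K [K0 HK]] := st_term_norm (om j) (proj1 H j Hj). exists (2 * (K * Cr * S0)).
    have p := Rmult_le_pos _ _ K0 C0. split; first by have := Rmult_le_pos _ _ p S00; lra.
    move=> K' HK' u Hu. have e := exp_pos (k * ln u). apply: Rle_trans (Rmult_le_compat_r _ _ _ (Rlt_le _ _ e) HK').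
    have q : 0 <= K * Cr * exp (k * ln u) by apply: Rmult_le_pos => //; lra.
    apply: Rle_trans (Zsum_norm _ _ _ (dom_sum_scal _ _ _ q HS) _) _; last by right; ring.
    apply: zdom_abs => m i Hm. apply: HK => //; last lra. apply: HC => // r. move: Hm. rewrite r. lia. }
  move=> K [K0 HK]. exists (INR n * K). split; first by apply: Rmult_le_pos => //; exact: pos_INR.
  move=> u Hu. rewrite Rmult_assoc. have -> : INR n = INR (length (indices n)) by rewrite length_seq. apply: Csum_norm => j Hj. exact: HK.
Qed.

(** On [[1, oo)] the function and its polar part are bounded and [st_sum] is [O(u^(1/2))], so the
    linear coefficient [c1 + RR] and the quadratic coefficient [c2] vanish; the constant
    survives. *)
Theorem mittag_leffler n om y : (1 <= n)%nat -> periods n om -> 0 <= y < 1 ->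
  exists cc (c0 : C), forall u : R, 0 < u -> (gen_fun n om y u = polar n cc u + c0 + st_sum n om y u)%C.
Proof.
  move=> Hn H Hy. have [cc [c0 [c1 [c2 HE]]]] := ml_rest_quadratic n om y Hn H Hy. have [RR HR] := ml_term_sums n om y H Hy.
  exists cc, c0.
  have E : forall u : R, 0 < u -> (gen_fun n om y u - polar n cc u - st_sum n om y u - c0 = (c1 + RR) * u + c2 * u ^ 2)%C.
  { move=> u Hu. have [eta [He Hr]] := regular_real n om u H Hu. have := HE eta u He Hr. rewrite /ml_rest HR // => q.
    have -> : (gen_fun n om y u - polar n cc u - st_sum n om y u - c0 = (gen_fun n om y u - polar n cc u - (st_sum n om y u + u * RR)) - c0 + u * RR)%C by ring.
    rewrite q. ring. }
  have [K1 [P1 H1]] := gen_fun_real_bounded n om y H Hy. have [K2 [P2 H2]] := Cmod_polar_bound n cc 1 Rlt_0_1.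
  have [K3 [P3 H3]] := st_sum_norm n om y (1 / 2) H Hy ltac:(lra).
  case: (growth_zero (c1 + RR)%C c2 (K1 + K2 + K3 + Cmod c0)).
  { move=> v Hv. have v2 : 1 <= v * v by nra.
    have -> : ((c1 + RR) * v ^ 2 + c2 * v ^ 4 = (c1 + RR) * (v * v)%R + c2 * (v * v)%R ^ 2)%C by rewrite RtoC_mult; ring.
    rewrite -E; last lra.
    have h1 := H1 (v * v) v2. have h2 := H2 (v * v)%R ltac:(rewrite Cmod_R Rabs_right; lra). have h3 := H3 (v * v) ltac:(lra).
    have ev : exp (1 / 2 * ln (v * v)) = v.
    { rewrite ln_mult; try lra. have -> : 1 / 2 * (ln v + ln v) = ln v by field. apply: exp_ln. lra. }
    rewrite ev in h3. apply: Rle_trans (Cmod_triangle_minus _ _) _.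
    apply: Rle_trans (Rplus_le_compat_r _ _ _ (Cmod_triangle_minus _ _)) _.
    apply: Rle_trans (Rplus_le_compat_r _ _ _ (Rplus_le_compat_r _ _ _ (Cmod_triangle_minus _ _))) _.
    have := Cmod_ge_0 c0. nra. }
  move=> A B u Hu. have := E u Hu. rewrite A B => q.
  have -> : gen_fun n om y u = (gen_fun n om y u - polar n cc u - st_sum n om y u - c0 + polar n cc u + c0 + st_sum n om y u)%C by ring.
  rewrite q. ring.
Qed.

(** * Continuation of the Mellin transform *)

(** The constant of [mittag_leffler] is included as the power [u^0]: it cancels under continuation
    like the genuine polar terms. *)
Definition polar0 (n : nat) (cc : nat -> C) (t : C) : C := Csum (fun i => cc i * (/ t) ^ i)%C (0%nat :: indices n).

(** The integral of [u^(s-1)] times the polar part over [(0, 1)] for large [Re s], and minus its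
    integral over [(1, oo)] for [Re s < 0]. *)
Definition polar_mellin (n : nat) (cc : nat -> C) (s : C) : C := Csum (fun i => cc i / (s - INR i))%C (0%nat :: indices n).

Lemma mittag_leffler_pol n om y : (1 <= n)%nat -> periods n om -> 0 <= y < 1 ->
  exists cc, forall u : R, 0 < u -> (gen_fun n om y u = polar0 n cc u + st_sum n om y u)%C.
Proof.
  move=> Hn H Hy. have [cc [c0 E]] := mittag_leffler n om y Hn H Hy.
  exists (fun i => match i with O => c0 | S _ => cc i end) => u Hu. rewrite E // /polar0 /polar.
  have -> : Csum (fun i => cc i * (/ u) ^ i)%C (seq 1 n) = Csum (fun i => (match i with O => c0 | S _ => cc i end) * (/ u) ^ i)%C (indices n).
  { apply: Csum_ext => [[|k]] Hk //. move: Hk => /in_seq. lia. }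
  set h := fun i => _. have -> : Csum h (0%nat :: indices n) = (c0 * 1 + Csum h (indices n))%C by []. ring.
Qed.

Definition gen_exp (n : nat) (om : nat -> C) (y x : R) : C := gen_fun n om y (RtoC (exp x)).

(** [exp (- w (1 - y) u) / (1 - exp (- w u)) = exp (w y u) / (exp (w u) - 1)]: this is where the
    special form of [a(y)] enters. *)
Lemma bk_gq om (y x : R) l : (forall k, In k l -> 0 < Re (om k)) ->
  bk (map om l) (Csum om l * (1 - y))%C x = Cprod (fun j => gq y (om j * RtoC (exp x))%C) l.
Proof.
  elim: l => [|k l IH] H; first by rewrite /Csum /Cprod /= (_ : - (0 * (1 - y) * exp x) = 0)%C; [exact: Cexp_0|ring].
  have -> : Cprod (fun j => gq y (om j * RtoC (exp x))%C) (k :: l) = (gq y (om k * RtoC (exp x))%C * Cprod (fun j => gq y (om j * RtoC (exp x))%C) l)%C by [].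
  rewrite -IH; last by move=> j Hj; apply: H; right.
  have -> : (Csum om (k :: l) * (1 - y) = Csum om l * (1 - y) + om k * (1 - y))%C by rewrite /Csum /=; ring.
  rewrite [map om (k :: l)]/= /bk -/bk bk_add. have N := one_minus_Cexp_neq0 (om k) x (H k (or_introl (eq_refl _))).
  set t := (om k * RtoC (exp x))%C in N |- *. have -> : (- (om k * (1 - y) * exp x) = - t + t * y)%C by rewrite /t; ring.
  rewrite Cexp_plus /gq. have e0 := Cexp_neq0 t. move: (bk _ _ _) => b.
  rewrite Cexp_opp in N |- *. move: (Cexp (t * y)%C) => ty. move: (Cexp t) e0 N => et e0 N.
  have N2 : (et - 1)%C <> 0%C. { move=> q. apply: N. have -> : et = 1%C by exact: Cminus_eq_0. field. }
  field. by split.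
Qed.

Lemma gen_exp_bk n om y x : periods n om -> gen_exp n om y x = bk (map om (indices n)) (Csum om (indices n) * (1 - y))%C x.
Proof. move=> [H _]. by rewrite bk_gq. Qed.

Lemma pos_list_periods n om : periods n om -> pos_list (map om (indices n)).
Proof. move=> [H _] w /in_map_iff [k [<- Hk]]. exact: H. Qed.

Lemma rcont_Gx n om y x : periods n om -> rcont (gen_exp n om y) x.
Proof.
  move=> H. have -> : gen_exp n om y = bk (map om (indices n)) (Csum om (indices n) * (1 - y))%C by apply: functional_extensionality => z; exact: gen_exp_bk.
  apply: rcont_bk. exact: pos_list_periods.
Qed.

Lemma rcont_pol n cc x : rcont (fun x => polar0 n cc (RtoC (exp x))) x.
Proof.
  apply: (rcont_cdiff (polar0 n cc) (fun x => RtoC (exp x))); last exact: rcont_expR.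
  have N : RtoC (exp x) <> RtoC 0 by apply: RtoC_neq0; have := exp_pos x; lra.
  apply: (cdiff_Csum (fun i t => cc i * (/ t) ^ i)%C) => i _. cdiff_tac.
Qed.

(** Splits an integrand in [x = ln u] at [u = 1], so that the behaviour at 0 and at infinity can be
    treated separately. *)
Definition stepf (f g : R -> C) (x : R) : C := match Rlt_dec 0 x with left _ => f x | right _ => g x end.

Lemma stepf_pos f g x : 0 < x -> stepf f g x = f x.
Proof. rewrite /stepf. by case: Rlt_dec. Qed.

Lemma stepf_neg f g x : x <= 0 -> stepf f g x = g x.
Proof. rewrite /stepf. case: Rlt_dec => //. lra. Qed.

Lemma exCI_stepf f g a b : (forall x, rcont f x) -> (forall x, rcont g x) -> exCI (stepf f g) a b.
Proof.
  move=> Hf Hg. have K : forall b, exCI (stepf f g) 0 b.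
  { move=> c. case: (Rle_dec 0 c) => Hc.
    - apply: (exCI_ext f); last exact: exCI_cont_all. move=> x. rewrite Rmin_left // Rmax_right // => Hx. by rewrite stepf_pos; [|lra].
    - apply: (exCI_ext g); last exact: exCI_cont_all. move=> x. rewrite Rmin_right; [|lra]. rewrite Rmax_left; [|lra]. move=> Hx. by rewrite stepf_neg; [|lra]. }
  apply: (exCI_Chasles _ a 0 b) => //. exact: exCI_swap.
Qed.

Lemma CI_stepf f g a b : (forall x, rcont f x) -> (forall x, rcont g x) -> a <= 0 <= b -> CI (stepf f g) a b = (CI g a 0 + CI f 0 b)%C.
Proof.
  move=> Hf Hg Hab. rewrite (CI_Chasles _ a 0 b); try exact: exCI_stepf.
  congr (_ + _)%C; apply: CI_ext => x; (rewrite Rmin_left; last lra); (rewrite Rmax_right; last lra) => Hx.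
  - by rewrite stepf_neg; [|lra].
  - by rewrite stepf_pos; [|lra].
Qed.

Lemma CI_Cexp_lin (z : C) a b : z <> 0%C -> a <= b -> CI (fun x => Cexp (z * RtoC x)) a b = ((Cexp (z * b) - Cexp (z * a)) / z)%C.
Proof.
  move=> Hz Hab. have D : forall x, rderiv (fun x => / z * Cexp (z * RtoC x))%C x (Cexp (z * RtoC x)).
  { move=> x. have -> : Cexp (z * RtoC x) = (/ z * (z * Cexp (z * RtoC x)))%C by field. apply: rderiv_scal. exact: rderiv_exp_lin. }
  rewrite (CI_FTC (fun x => / z * Cexp (z * RtoC x))%C) //; first by field. move=> x _. exact: rcont_exp_lin.
Qed.

Lemma step_exp_neg (z : C) : 0 < Re z -> (exists K, ldom (stepf (fun _ => RtoC 0) (fun x => Cexp (z * RtoC x))) K) /\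
  LI (stepf (fun _ => RtoC 0) (fun x => Cexp (z * RtoC x))) = (/ z)%C.
Proof.
  move=> Hz. have z0 := Re_pos_neq0 z Hz. split.
  - set d := Rmin 1 (Re z). have d0 : 0 < d by apply: Rmin_glb_lt; lra. have d1 : d <= 1 by exact: Rmin_l. have d2 : d <= Re z by exact: Rmin_r.
    exists (1 * (4 / (d * d))). apply: ldom_exp => //; first lra.
    + move=> a b. apply: exCI_stepf => x; [exact: rcont_const|exact: rcont_exp_lin].
    + move=> x. rewrite Rmult_1_l /stepf. case: Rlt_dec => H; first by rewrite Cmod_0; left; exact: exp_pos.
      rewrite Cmod_Cexp_R. apply: exp_le. nra.
    + move=> x. rewrite Rmult_1_l /stepf. case: Rlt_dec => H; first by rewrite Cmod_0; left; exact: exp_pos.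
      rewrite Cmod_Cexp_R. apply: exp_le. nra.
  - apply: LI_eq => e He. have cz := proj1 (Cmod_gt_0 z) z0.
    have [A [A0 HA]] := exp_le_eventually (/ Cmod z) (Re z) e (Rlt_le _ _ (Rinv_0_lt_compat _ cz)) Hz He.
    exists A. split => // a b Ha Hb. rewrite CI_stepf; [|move=> x; exact: rcont_const|move=> x; exact: rcont_exp_lin|lra].
    rewrite CI_const CI_Cexp_lin //; last lra.
    have -> : ((Cexp (z * 0) - Cexp (z * a)) / z + (b - 0)%R * 0 - / z = - (/ z * Cexp (z * a)))%C by rewrite !Cmult_0_r Cexp_0; field.
    rewrite Cmod_opp Cmod_mult Cmod_inv // Cmod_Cexp_R. have := HA (- a) ltac:(lra). by have -> : - (Re z * - a) = Re z * a by ring.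
Qed.

Lemma step_exp_pos (z : C) : Re z < 0 -> (exists K, ldom (stepf (fun x => Cexp (z * RtoC x)) (fun _ => RtoC 0)) K) /\
  LI (stepf (fun x => Cexp (z * RtoC x)) (fun _ => RtoC 0)) = (- / z)%C.
Proof.
  move=> Hz. have z0 : z <> 0%C by move=> q; move: Hz; rewrite q /=; lra. split.
  - set d := Rmin 1 (- Re z). have d0 : 0 < d by apply: Rmin_glb_lt; lra. have d1 : d <= 1 by exact: Rmin_l. have d2 : d <= - Re z by exact: Rmin_r.
    exists (1 * (4 / (d * d))). apply: ldom_exp => //; first lra.
    + move=> a b. apply: exCI_stepf => x; [exact: rcont_exp_lin|exact: rcont_const].
    + move=> x. rewrite Rmult_1_l /stepf. case: Rlt_dec => H; last by rewrite Cmod_0; left; exact: exp_pos.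
      rewrite Cmod_Cexp_R. apply: exp_le. nra.
    + move=> x. rewrite Rmult_1_l /stepf. case: Rlt_dec => H; last by rewrite Cmod_0; left; exact: exp_pos.
      rewrite Cmod_Cexp_R. apply: exp_le. nra.
  - apply: LI_eq => e He. have cz := proj1 (Cmod_gt_0 z) z0.
    have [A [A0 HA]] := exp_le_eventually (/ Cmod z) (- Re z) e (Rlt_le _ _ (Rinv_0_lt_compat _ cz)) ltac:(lra) He.
    exists A. split => // a b Ha Hb. rewrite CI_stepf; [|move=> x; exact: rcont_exp_lin|move=> x; exact: rcont_const|lra].
    rewrite CI_const CI_Cexp_lin //; last lra.
    have -> : ((0 - a)%R * 0 + (Cexp (z * b) - Cexp (z * 0)) / z - - / z = (/ z * Cexp (z * b)))%C by rewrite !Cmult_0_r Cexp_0; field.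
    rewrite Cmod_mult Cmod_inv // Cmod_Cexp_R. have := HA b ltac:(lra). by have -> : - (- Re z * b) = Re z * b by ring.
Qed.

Lemma LI_Csum (f : nat -> R -> C) l : (forall i, In i l -> exists K, ldom (f i) K) ->
  (exists K, ldom (fun x => Csum (fun i => f i x) l) K) /\ LI (fun x => Csum (fun i => f i x) l) = Csum (fun i => LI (f i)) l.
Proof.
  elim: l => [|k l IH] H.
  - have L : ldom (fun _ : R => RtoC 0) 0. { split; first by move=> a b; apply: exCI_cont_all => x; exact: rcont_const. move=> x. rewrite Cmod_0. right. field. nra. }
    split; first by exists 0. apply: LI_eq => e He. exists 1. split; first lra. move=> a b _ _. have -> : CI (fun x => Csum (fun i => f i x) nil) a b = RtoC 0 by rewrite /Csum /= CI_const Cmult_0_r.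
    by rewrite /Csum /= Cmod_self.
  - have [K1 H1] := H k (or_introl (eq_refl _)). have [[K2 H2] E2] := IH (fun i Hi => H i (or_intror Hi)).
    split; first by exists (K1 + K2); exact: (ldom_plus _ _ _ _ H1 H2).
    have := LI_plus _ _ _ _ H1 H2. by rewrite E2.
Qed.

Lemma pol_exp n cc (s : C) x : (Cexp (s * RtoC x) * polar0 n cc (RtoC (exp x)))%C = Csum (fun i => cc i * Cexp ((s - INR i) * RtoC x))%C (0%nat :: indices n).
Proof.
  rewrite /polar0 -Csum_scal. apply: Csum_ext => i _.
  have -> : (Cexp ((s - INR i) * RtoC x) = Cexp (s * RtoC x) * Cexp (- (INR i * RtoC x)))%C by rewrite -Cexp_plus; congr Cexp; ring.
  have -> : Cexp (- (INR i * RtoC x))%C = ((/ RtoC (exp x)) ^ i)%C; last ring.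
  rewrite -Cexp_R -Cexp_opp. elim: i => [|i IH]; first by rewrite /= (_ : - (0 * RtoC x) = 0)%C; [exact: Cexp_0|ring].
  rewrite S_INR RtoC_plus. have -> : (- ((INR i + 1) * RtoC x) = - RtoC x + - (INR i * RtoC x))%C by ring. by rewrite Cexp_plus IH.
Qed.

Lemma Csum_0 l : Csum (fun _ => 0%C) l = 0%C.
Proof. elim: l => [|k l IH] //. change ((0 + Csum (fun _ => RtoC 0) l)%C = 0%C). rewrite IH. ring. Qed.

Lemma pol_mel_neg n cc (s : C) : INR n < Re s ->
  (exists K, ldom (fun x => Cexp (s * RtoC x) * stepf (fun _ => RtoC 0) (fun x => polar0 n cc (RtoC (exp x))) x)%C K) /\
  LI (fun x => Cexp (s * RtoC x) * stepf (fun _ => RtoC 0) (fun x => polar0 n cc (RtoC (exp x))) x)%C = polar_mellin n cc s.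
Proof.
  move=> Hs. have -> : (fun x => Cexp (s * RtoC x) * stepf (fun _ => RtoC 0) (fun x => polar0 n cc (RtoC (exp x))) x)%C =
    (fun x => Csum (fun i => cc i * stepf (fun _ => RtoC 0) (fun x => Cexp ((s - INR i) * RtoC x)) x)%C (0%nat :: indices n)).
  { apply: functional_extensionality => x. rewrite /stepf. case: Rlt_dec => _; last exact: pol_exp.
    rewrite -(Csum_ext (fun _ => RtoC 0)); first by rewrite Csum_0; ring. move=> i _. ring. }
  have Q : forall i, In i (0%nat :: indices n) -> 0 < Re (s - INR i)%C.
  { move=> i Hi. have : INR i <= INR n. { apply: le_INR. case: Hi => [<-|/in_seq]; lia. } rewrite /Re /= -/(Re s). lra. }
  have [E1 E2] := LI_Csum (fun i x => cc i * stepf (fun _ => RtoC 0) (fun x => Cexp ((s - INR i) * RtoC x)) x)%C (0%nat :: indices n)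
    ltac:(by move=> i Hi; have [[K HK] _] := step_exp_neg _ (Q i Hi); exists (Cmod (cc i) * K); exact: ldom_scal).
  split => //. rewrite E2. apply: Csum_ext => i Hi. have [[K HK] E] := step_exp_neg _ (Q i Hi). by rewrite (LI_scal _ _ K HK) E.
Qed.

Lemma pol_mel_pos n cc (s : C) : Re s < 0 ->
  (exists K, ldom (fun x => Cexp (s * RtoC x) * stepf (fun x => polar0 n cc (RtoC (exp x))) (fun _ => RtoC 0) x)%C K) /\
  LI (fun x => Cexp (s * RtoC x) * stepf (fun x => polar0 n cc (RtoC (exp x))) (fun _ => RtoC 0) x)%C = (- polar_mellin n cc s)%C.
Proof.
  move=> Hs. have -> : (fun x => Cexp (s * RtoC x) * stepf (fun x => polar0 n cc (RtoC (exp x))) (fun _ => RtoC 0) x)%C =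
    (fun x => Csum (fun i => cc i * stepf (fun x => Cexp ((s - INR i) * RtoC x)) (fun _ => RtoC 0) x)%C (0%nat :: indices n)).
  { apply: functional_extensionality => x. rewrite /stepf. case: Rlt_dec => _; first exact: pol_exp.
    rewrite -(Csum_ext (fun _ => RtoC 0)); first by rewrite Csum_0; ring. move=> i _. ring. }
  have Q : forall i, In i (0%nat :: indices n) -> Re (s - INR i)%C < 0.
  { move=> i Hi. have : 0 <= INR i by exact: pos_INR. rewrite /Re /= -/(Re s). lra. }
  have [E1 E2] := LI_Csum (fun i x => cc i * stepf (fun x => Cexp ((s - INR i) * RtoC x)) (fun _ => RtoC 0) x)%C (0%nat :: indices n)
    ltac:(by move=> i Hi; have [[K HK] _] := step_exp_pos _ (Q i Hi); exists (Cmod (cc i) * K); exact: ldom_scal).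
  split => //. rewrite E2. have -> : (- polar_mellin n cc s = (- (1)) * polar_mellin n cc s)%C by ring. rewrite /polar_mellin -Csum_scal.
  apply: Csum_ext => i Hi. have [[K HK] E] := step_exp_pos _ (Q i Hi). rewrite (LI_scal _ _ K HK) E /Cdiv. ring.
Qed.

Lemma mel_bounded_ge h be : mel_int h -> 0 <= be -> (exists C1, 0 <= C1 /\ forall x, 0 < x -> Cmod (h x) <= C1 * exp (- be * x)) ->
  (exists C2, 0 <= C2 /\ forall x, x <= 0 -> Cmod (h x) <= C2 * exp x) -> mel_bounded h (-1) be.
Proof.
  move=> Hi Hb [C1 [p1 H1]] [C2 [p2 H2]]. split => //. exists (C1 + C2). split; first lra.
  have aux : forall c e1 e2 v, 0 <= c -> c <= C1 + C2 -> e1 <= e2 -> 0 < e2 -> v <= c * e1 -> v <= (C1 + C2) * e2.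
  { move=> c e1 e2 v Hc Hc2 He He2 Hv. apply: Rle_trans Hv _. apply: (Rle_trans _ (c * e2)); [exact: Rmult_le_compat_l|apply: Rmult_le_compat_r; lra]. }
  split=> x; case: (Rlt_dec 0 x) => Hx.
  - apply: (aux C1 _ _ _ p1 _ _ _ (H1 x Hx)); [lra| |exact: exp_pos]. apply: exp_le. nra.
  - apply: (aux C2 _ _ _ p2 _ _ _ (H2 x _)); [lra| |exact: exp_pos|lra]. apply: exp_le. lra.
  - apply: (aux C1 _ _ _ p1 _ _ _ (H1 x Hx)); [lra|lra|exact: exp_pos].
  - apply: (aux C2 _ _ _ p2 _ _ _ (H2 x _)); [lra| |exact: exp_pos|lra]. apply: exp_le. nra.
Qed.

Lemma Re_Csum (f : nat -> C) l : Re (Csum f l) = fold_right Rplus 0 (map (fun k => Re (f k)) l).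
Proof. elim: l => [|k l IH] //. change (Re (f k + Csum f l)%C = Re (f k) + fold_right Rplus 0 (map (fun k => Re (f k)) l)). by rewrite -IH. Qed.

Lemma Re_periods_sum_pos n om (y : R) : (1 <= n)%nat -> periods n om -> 0 <= y < 1 -> 0 < Re (Csum om (indices n) * (1 - y))%C.
Proof.
  move=> Hn [H _] Hy. rewrite -RtoC_minus Re_mult_R. apply: Rmult_lt_0_compat; last lra. rewrite Re_Csum /indices in H *.
  case: n Hn H => [|n] Hn H; first lia. rewrite /=.
  have h1 := H 1%nat (or_introl (eq_refl _)).
  have h2 : 0 <= fold_right Rplus 0 (map (fun k => Re (om k)) (seq 2 n)).
  { have : forall k, In k (seq 2 n) -> 0 < Re (om k) by move=> k Hk; apply: H; right.
    elim: (seq 2 n) => [|k l IH] G /=; first lra. have := G k (or_introl (eq_refl _)). have := IH (fun j Hj => G j (or_intror Hj)). lra. }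
  rewrite /Re in h1 h2 *. lra.
Qed.

Theorem mellin_split n om y : (1 <= n)%nat -> periods n om -> 0 <= y < 1 -> exists cc H,
  (forall s : C, -1 < Re s -> cdiff H s) /\
  (forall s : C, INR n < Re s -> Mel (gen_exp n om y) s = (H s + polar_mellin n cc s)%C) /\
  (forall s : C, -1 < Re s < 0 -> Mel (fun x => st_sum n om y (exp x)) s = (H s + polar_mellin n cc s)%C).
Proof.
  move=> Hn Hp Hy. have [cc ML] := mittag_leffler_pol n om y Hn Hp Hy.
  have EU : forall x, st_sum n om y (exp x) = (gen_exp n om y x - polar0 n cc (RtoC (exp x)))%C by move=> x; rewrite /gen_exp ML; [ring|exact: exp_pos].
  have cU : forall x, rcont (fun x => st_sum n om y (exp x)) x.
  { move=> x. have -> : (fun x => st_sum n om y (exp x)) = (fun x => gen_exp n om y x - polar0 n cc (RtoC (exp x)))%C by apply: functional_extensionality.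
    apply: rcont_minus; [exact: rcont_Gx|exact: rcont_pol]. }
  have cG : forall x, rcont (gen_exp n om y) x by move=> x; exact: rcont_Gx.
  set h := stepf (gen_exp n om y) (fun x => st_sum n om y (exp x)).
  have dG : forall be, INR n <= be -> exists C0, 0 <= C0 /\ forall x, Cmod (gen_exp n om y x) <= C0 * exp (- be * x).
  { move=> be Hbe. have [C0 [p H0]] := bk_decay (map om (indices n)) (Csum om (indices n) * (1 - y))%C be (pos_list_periods n om Hp) (Re_periods_sum_pos n om y Hn Hp Hy) ltac:(by rewrite length_map length_seq).
    exists C0. split => // x. by rewrite gen_exp_bk. }
  have pn := pos_INR n.
  have hb : forall be, INR n <= be -> mel_bounded h (-1) be.
  { move=> be Hbe. apply: mel_bounded_ge; [|lra| |].
    - move=> s a b. have -> : (fun x => Cexp (s * RtoC x) * h x)%C = stepf (fun x => Cexp (s * RtoC x) * gen_exp n om y x)%C (fun x => Cexp (s * RtoC x) * st_sum n om y (exp x))%C.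
      { apply: functional_extensionality => x. rewrite /h /stepf. by case: Rlt_dec. }
      apply: exCI_stepf => x; apply: rcont_mult => //; exact: rcont_exp_lin.
    - have [C0 [p H0]] := dG be Hbe. exists C0. split => // x Hx. by rewrite /h stepf_pos.
    - have [K [K0 HK]] := st_sum_norm n om y 1 Hp Hy ltac:(lra). exists K. split => // x Hx. rewrite /h stepf_neg //.
      have := HK (exp x) (exp_pos x). by rewrite ln_exp Rmult_1_l. }
  exists cc, (Mel h). split; last split.
  - move=> s Hs. apply: (mel_holo h (-1) (Rmax (INR n) (Re s + 1))); first by apply: hb; exact: Rmax_l.
    have := Rmax_r (INR n) (Re s + 1). lra.
  - move=> s Hs. have [[K1 L1] E1] := pol_mel_neg n cc s Hs.
    have [K2 L2] := mel_ldom_ex h (-1) (Re s + 1) s (hb (Re s + 1) ltac:(lra)) ltac:(lra).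
    rewrite /Mel -E1 -(LI_plus _ _ K2 K1) //. apply: LI_ext => x. rewrite /h /stepf. case: Rlt_dec => _; first ring. rewrite EU. ring.
  - move=> s Hs. have [[K1 L1] E1] := pol_mel_pos n cc s (proj2 Hs).
    have [K2 L2] := mel_ldom_ex h (-1) (INR n + 1) s (hb (INR n + 1) ltac:(lra)) ltac:(lra).
    have -> : (Mel h s + polar_mellin n cc s = Mel h s - - polar_mellin n cc s)%C by ring.
    rewrite /Mel -E1 -(LI_minus _ _ K2 K1) //. apply: LI_ext => x. rewrite /h /stepf. case: Rlt_dec => _; last ring. rewrite EU. ring.
Qed.

(** The branch that [residue_power] takes after the rotation moving [theta] to 0. *)
Definition pole_pow (p w : C) : C := Cpow_in (fun phi => 0 <= phi <= 2 * PI) p w.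

Lemma pole_pow_log (v p w : C) : Cexp v = (- p)%C -> Rabs (Im v) < PI -> pole_pow p w = Cexp (w * (v + Ci * PI))%C.
Proof.
  move=> E Hv. have Ep : p = Cexp (v + Ci * PI)%C by rewrite Cexp_plus E Cexp_PI; ring.
  have Hm : Cmod p = exp (Re v) by rewrite -Cmod_Cexp E Cmod_opp.
  have p0 : p <> 0%C by rewrite Ep; exact: Cexp_neq0.
  have hv := Rabs_def2 _ _ Hv.
  have Epol : p = (Cmod p * Cexp (Ci * (Im v + PI)%R))%C.
  { rewrite Hm Ep -Cexp_R -Cexp_plus. congr Cexp. apply: C_ext; rewrite /= /Re /Im /=; ring. }
  rewrite /pole_pow (Cpow_in_eq _ p w (Im v + PI)) //; first 1 last.
  - lra.
  - move=> phi' Hphi E'. apply: (angle_unique p) => //. lra.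
  - rewrite Hm ln_exp. congr Cexp. congr (w * _)%C. apply: C_ext; rewrite /= /Re /Im /=; ring.
Qed.

(** With [- p = Cexp v] the term is [(r / p) u / (u + Cexp v)], whose transform is [r / p] times
    [Stj (s + 1) v = Cexp (s v) * Kf (s + 1)]. Since [p = Cexp (v + i pi)], [Cexp (s v) / p] is
    [p^(s-1)] times [Cexp (- i pi s)], a factor independent of [m]. *)
Lemma LI_uu_term (r : Z -> C) (w s : C) m : 0 < Re w -> m <> 0%Z -> -1 < Re s < 0 ->
  LI (fun x => Cexp (s * RtoC x) * st_term r w (exp x) m)%C = (Cexp (- (Ci * PI * s)) * Kf (s + 1) * (r m * pole_pow (pole w m) (s - 1)))%C.
Proof.
  move=> Hw Hm Hs. have [b [Hb H]] := pole_log w Hw. have [v [Ev [Hv _]]] := H m Hm.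
  have Hv' : Rabs (Im v) < PI by lra. have p0 := pole_neq0 w m (Re_pos_neq0 w Hw) Hm.
  rewrite (pole_pow_log v) //. have Hs1 : 0 < Re (s + 1)%C < 1 by rewrite Re_plus /=; lra.
  have Ep : pole w m = (- Cexp v)%C by rewrite Ev; ring. have [K HK] := stj_ldom (s + 1)%C v Hs1 Hv'.
  rewrite (LI_ext _ (fun x => r m / pole w m * (Cexp ((s + 1) * RtoC x) * / (RtoC (exp x) + Cexp v)))%C); last first.
  { move=> x. have N := strip_sum_neq0 (exp x) v (Rlt_le _ _ (exp_pos x)) Hv'.
    rewrite /st_term Cexp_s1 Ep. have e0 := Cexp_neq0 v. move: (Cexp v) N e0 => e N e0.
    have -> : (exp x - - e = exp x + e)%C by ring. field. by split. }
  rewrite (LI_scal _ _ K HK) -/(Stj (s + 1)%C v) Stj_eq // -/(Kf (s + 1)%C) Ep.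
  have -> : (Cexp ((s - 1) * (v + Ci * PI)) = Cexp (s * v) / Cexp v * (Cexp (Ci * PI * s) / Cexp (Ci * PI)))%C.
  { rewrite -!Cexp_minus -Cexp_plus. congr Cexp. ring. }
  have -> : ((s + 1 - 1) * v = s * v)%C by ring. rewrite Cexp_PI (Cexp_opp (Ci * PI * s)%C).
  have e1 := Cexp_neq0 v. have e2 := Cexp_neq0 (Ci * PI * s)%C. move: (Cexp v) (Cexp (s * v)%C) (Cexp (Ci * PI * s)%C) (Kf _) e1 e2 => a b' c k e1 e2. field. by split.
Qed.

Lemma rcont_uu (r : Z -> C) (w : C) m x : 0 < Re w -> m <> 0%Z -> rcont (fun x => st_term r w (exp x) m) x.
Proof.
  move=> Hw Hm. have [c [c0 [_ H]]] := pole_dist w Hw. have ex := exp_pos x. have p0 := pole_neq0 w m (Re_pos_neq0 w Hw) Hm.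
  have N : (RtoC (exp x) - pole w m)%C <> 0%C. { apply: Cmod_pos_neq0. have := H m (exp x) Hm ltac:(lra). have := Cmod_ge_0 (pole w m). nra. }
  apply: (rcont_cdiff (fun t => r m * t / (pole w m * (t - pole w m)))%C (fun x => RtoC (exp x))); last exact: rcont_expR.
  cdiff_tac. exact: Cmult_neq_0.
Qed.

Lemma st_term_half_rcont (r : Z -> C) (w : C) Cr (mu : nat -> Z) x : 0 < Re w -> (forall m, m <> 0%Z -> Cmod (r m) <= Cr) -> (forall i, Z.abs (mu i) = Z.of_nat (S i)) ->
  rcont (fun x => CSeries (fun i => st_term r w (exp x) (mu i))) x.
Proof.
  move=> Hw HC Hmu. have m0 : forall i, mu i <> 0%Z by move=> i q; have := Hmu i; rewrite q; lia.
  have C0 : 0 <= Cr by apply: Rle_trans (HC 1%Z _) => //; exact: Cmod_ge_0.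
  have [c [c0 [c1 H]]] := pole_dist w Hw. have w0 := Re_pos_neq0 w Hw. have cp := pole_unit_pos w w0. set q := 2 * PI / Cmod w in cp.
  have [S0 HS] := isq_sum. have u0 := exp_pos x. set u := exp x in u0. set rho := c * u / 2. have r0 : 0 < rho by have := Rmult_lt_0_compat _ _ c0 u0; rewrite /rho; lra.
  have Kp : 0 <= Cr * (2 * u) / (q * q * c / 2) by apply: Rmult_le_pos; [apply: Rmult_le_pos; lra|left; apply: Rinv_0_lt_compat; have h := Rmult_lt_0_compat _ _ cp cp; have := Rmult_lt_0_compat _ _ h c0; lra].
  have far : forall i t, Cmod (t - u)%C <= rho -> c / 2 * Cmod (pole w (mu i)) <= Cmod (t - pole w (mu i))%C.
  { move=> i t Ht. have := H (mu i) u (m0 i) ltac:(lra). have := Cmod_triangle3 u (pole w (mu i)) t. rewrite (Cmod_minus_sym u t). have := Cmod_ge_0 (pole w (mu i)). rewrite /rho in Ht. nra. }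
  apply: (rcont_cdiff (fun t => CSeries (fun i => r (mu i) * t / (pole w (mu i) * (t - pole w (mu i)))))%C (fun x => RtoC (exp x))); last exact: rcont_expR.
  apply: (CSeries_holo (fun i t => r (mu i) * t / (pole w (mu i) * (t - pole w (mu i))))%C _ rho _ _ r0 (dom_sum_scal _ _ _ Kp HS)) => i t Ht; rewrite -/u in Ht;
    have p0 := pole_neq0 w (mu i) w0 (m0 i); have pp := proj1 (Cmod_gt_0 _) p0; have fi := far i t Ht; have dd := Rmult_lt_0_compat (c / 2) _ ltac:(lra) pp;
    have N : (t - pole w (mu i))%C <> 0%C by [apply: Cmod_pos_neq0; lra].
  - cdiff_tac. exact: Cmult_neq_0.
  - rewrite Cmod_div; last exact: Cmult_neq_0. rewrite (Cmod_mult (r _) t) (Cmod_mult (pole w (mu i))).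
    have i0 : 0 < INR i + 1 by have := pos_INR i; lra.
    have Ep : Cmod (pole w (mu i)) = q * (INR i + 1) by rewrite Cmod_pl // (abs_IZR_S i _ (Hmu i)).
    have tu : Cmod t <= 2 * u. { have := Cmod_triangle_rev_minus t u. rewrite Cmod_R Rabs_right; last lra. rewrite /rho in Ht. nra. }
    rewrite Ep in pp fi dd *.
    have -> : Cr * (2 * u) / (q * q * c / 2) * isq i = Cr * (2 * u) / (q * (INR i + 1) * (c / 2 * (q * (INR i + 1)))) by rewrite /isq; field; lra.
    apply: Rmult_le_compat.
    + apply: Rmult_le_pos; exact: Cmod_ge_0.
    + left. apply: Rinv_0_lt_compat. apply: Rmult_lt_0_compat; [exact: pp|exact: (Rlt_le_trans _ _ _ dd fi)].
    + apply: Rmult_le_compat => //; try exact: Cmod_ge_0. exact: HC.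
    + apply: Rinv_le_contravar; first exact: Rmult_lt_0_compat. apply: Rmult_le_compat_l; [exact: Rlt_le|exact: fi].
Qed.

Lemma ln_INR1_ge0 i : 0 <= ln (INR i + 1).
Proof. rewrite -ln_1. apply: ln_le; first lra. have := pos_INR i. lra. Qed.

Lemma st_term_half_exCI (r : Z -> C) (w s : C) Cr (mu : nat -> Z) a b : 0 < Re w -> (forall m, m <> 0%Z -> Cmod (r m) <= Cr) -> (forall i, Z.abs (mu i) = Z.of_nat (S i)) ->
  exCI (fun x => CSeries (fun i => Cexp (s * RtoC x) * st_term r w (exp x) (mu i))%C) a b.
Proof.
  move=> Hw HC Hmu. have C0 : 0 <= Cr by apply: Rle_trans (HC 1%Z _) => //; exact: Cmod_ge_0.
  have m0 : forall i, mu i <> 0%Z by move=> i q; have := Hmu i; rewrite q; lia.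
  have [K [K0 H]] := st_term_norm w Hw. have [S0 HS] := zeta_terms_summable 1 Rlt_0_1.
  have -> : (fun x => CSeries (fun i => Cexp (s * RtoC x) * st_term r w (exp x) (mu i))%C) = (fun x => Cexp (s * RtoC x) * CSeries (fun i => st_term r w (exp x) (mu i)))%C.
  { apply: functional_extensionality => x. apply: CSeries_scal.
    have p : 0 <= K * Cr * exp (1 * ln (exp x)) by apply: Rmult_le_pos; [exact: Rmult_le_pos|left; exact: exp_pos].
    refine (proj1 (CSeries_dom _ _ _ (dom_sum_scal _ _ _ p HS) _)) => i. apply: H => //; [exact: HC|exact: exp_pos|lra]. }
  apply: exCI_cont_all => x. apply: rcont_mult; first exact: rcont_exp_lin. exact: (st_term_half_rcont r w Cr).
Qed.

(** The exponents [k = - Re s + d] and [k = - Re s - d] give bounds by [exp (d x)] and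
    [exp (- d x)], hence decay at both ends. The strip keeps both exponents in [[0, 1]], and
    [- Re s - d > 0] makes the constants summable. *)
Lemma st_term_ldom (w s : C) Cr : 0 < Re w -> 0 <= Cr -> -1 < Re s < 0 -> exists B S0, dom_sum B S0 /\
  forall r m i, (forall m, m <> 0%Z -> Cmod (r m) <= Cr) -> Z.abs m = Z.of_nat (S i) -> ldom (fun x => Cexp (s * RtoC x) * st_term r w (exp x) m)%C (B i).
Proof.
  move=> Hw C0 Hs. have [K [K0 H]] := st_term_norm w Hw.
  set d := Rmin (- Re s / 2) ((1 + Re s) / 2). have d1 : d <= - Re s / 2 by exact: Rmin_l. have d2 : d <= (1 + Re s) / 2 by exact: Rmin_r.
  have d0 : 0 < d by apply: Rmin_glb_lt; lra.
  have kp : 0 < - Re s - d by lra. have [S0 HS] := zeta_terms_summable _ kp.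
  have q1 : 0 <= 4 / (d * d) by apply: Rlt_le; apply: Rdiv_lt_0_compat; nra. have q2 := Rmult_le_pos _ _ K0 C0.
  have P : 0 <= K * Cr * (4 / (d * d)) by apply: Rmult_le_pos.
  exists (fun i => K * Cr * (4 / (d * d)) * exp (- (1 + (- Re s - d)) * ln (INR i + 1))), (K * Cr * (4 / (d * d)) * S0). split; first exact: dom_sum_scal.
  move=> r m i HC Hm. have m0 : m <> 0%Z by move=> q; move: Hm; rewrite q; lia. set e := exp (- (1 + (- Re s - d)) * ln (INR i + 1)).
  have e0 : 0 < e by exact: exp_pos.
  have -> : K * Cr * (4 / (d * d)) * e = K * Cr * e * (4 / (d * d)) by ring.
  have Q : 0 <= K * Cr * e by apply: Rmult_le_pos => //; lra. have li := ln_INR1_ge0 i.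
  have gen : forall k x, 0 <= k <= 1 -> - Re s - d <= k -> Cmod (Cexp (s * RtoC x) * st_term r w (exp x) m)%C <= K * Cr * e * exp ((Re s + k) * x).
  { move=> k x Hk Hk2. rewrite Cmod_mult Cmod_Cexp_R. have h := H r Cr m i (exp x) k Hm (HC m m0) (exp_pos x) Hk. rewrite ln_exp in h.
    apply: Rle_trans (Rmult_le_compat_l _ _ _ (Rlt_le _ _ (exp_pos _)) h) _.
    have -> : exp (Re s * x) * (K * Cr * exp (k * x) * exp (- (1 + k) * ln (INR i + 1))) = K * Cr * exp (- (1 + k) * ln (INR i + 1)) * exp ((Re s + k) * x) by rewrite Rmult_plus_distr_r exp_plus; ring.
    apply: Rmult_le_compat_r; first by left; exact: exp_pos. apply: Rmult_le_compat_l => //. apply: exp_le. nra. }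
  apply: ldom_exp => //; first lra.
  - move=> a b. apply: exCI_cont_all => x. apply: rcont_mult; [exact: rcont_exp_lin|exact: rcont_uu].
  - move=> x. have := gen (- Re s + d) x ltac:(lra) ltac:(lra). by have -> : Re s + (- Re s + d) = d by ring.
  - move=> x. have := gen (- Re s - d) x ltac:(lra) ltac:(lra). by have -> : Re s + (- Re s - d) = - d by ring.
Qed.

Definition res_sum (n : nat) (om : nat -> C) (y : R) (s : C) : C := Csum (fun k => Zstar_sum (fun m => res n om y k m * pole_pow (pole (om k) m) (s - 1))%C) (indices n).

Lemma pole_pow_norm (w : C) m i (s : C) : 0 < Re w -> Z.abs m = Z.of_nat (S i) -> Cmod (pole_pow (pole w m) (s - 1)) <= exp ((Re s - 1) * ln (2 * PI / Cmod w)) * exp (2 * PI * Rabs (Im s)) * exp ((Re s - 1) * ln (INR i + 1)).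
Proof.
  move=> Hw Hm. have [b [Hb H]] := pole_log w Hw. have m0 : m <> 0%Z by move=> q; move: Hm; rewrite q; lia. have [v [Ev [Hv Rv]]] := H m m0.
  have i0 : 0 < INR i + 1 by have := pos_INR i; lra. have w0 := Re_pos_neq0 w Hw. have cp := pole_unit_pos w w0.
  rewrite (pole_pow_log v) //; last lra. rewrite Cmod_Cexp -!exp_plus. apply: exp_le.
  have Er : Re v = ln (2 * PI / Cmod w) + ln (INR i + 1). { rewrite -ln_mult // -(abs_IZR_S i m Hm) -Cmod_pl // -Rv. by rewrite ln_exp. }
  have -> : Re ((s - 1) * (v + Ci * PI))%C = (Re s - 1) * Re v - Im s * (Im v + PI) by rewrite /= /Re /Im; ring.
  rewrite Er. have h : - (Im s * (Im v + PI)) <= 2 * PI * Rabs (Im s).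
  { apply: Rle_trans (Rle_abs _) _. rewrite Rabs_Ropp Rabs_mult Rmult_comm. apply: Rmult_le_compat_r; first exact: Rabs_pos.
    apply: Rle_trans (Rabs_triang _ _) _. rewrite (Rabs_right PI); have := PI_RGT_0; lra. }
  lra.
Qed.

(* Termwise integration: every term is a Stieltjes kernel [1 / (u - p)], whose Mellin transform is a power of [p]. *)
Theorem Mel_st_sum n om y (s : C) : periods n om -> 0 <= y < 1 -> -1 < Re s < 0 ->
  Mel (fun x => st_sum n om y (exp x)) s = (Cexp (- (Ci * PI * s)) * Kf (s + 1) * res_sum n om y s)%C.
Proof.
  move=> Hp Hy Hs. have [Cr [C0 HC]] := res_bounded n om y Hp Hy.
  set f := fun (k : nat) (x : R) => Zstar_sum (fun m => Cexp (s * RtoC x) * st_term (res n om y k) (om k) (exp x) m)%C.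
  have Hk : forall k, In k (indices n) -> (exists K, ldom (f k) K) /\ LI (f k) = Zstar_sum (fun m => LI (fun x => Cexp (s * RtoC x) * st_term (res n om y k) (om k) (exp x) m)%C).
  { move=> k Hk. have wk := proj1 Hp k Hk. have [B [S0 [HB HD]]] := st_term_ldom (om k) s Cr wk C0 Hs.
    apply: (LI_Zsum (fun m x => Cexp (s * RtoC x) * st_term (res n om y k) (om k) (exp x) m)%C B S0 HB).
    - move=> m i Hm. apply: HD => // m' Hm'. exact: HC.
    - move=> a b. apply: (st_term_half_exCI _ _ _ Cr); [done|move=> m Hm; exact: HC|exact: abs_neg_S].
    - move=> a b. apply: (st_term_half_exCI _ _ _ Cr); [done|move=> m Hm; exact: HC|exact: abs_pos_S]. }
  have [_ E] := LI_Csum f (indices n) (fun k Hi => proj1 (Hk k Hi)).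
  have -> : Mel (fun x => st_sum n om y (exp x)) s = LI (fun x => Csum (fun k => f k x) (indices n)).
  { apply: LI_ext => x. rewrite /st_sum -Csum_scal. apply: Csum_ext => k Hi.
    have [B [S0 [HB HD]]] := zdom_uu (res n om y k) (om k) Cr (exp x) 1 (proj1 Hp k Hi) (fun m => HC k m Hi) (exp_pos x) ltac:(lra).
    by rewrite /f (Zsum_scal _ _ B S0). }
  rewrite E /res_sum -Csum_scal. apply: Csum_ext => k Hi. rewrite (proj2 (Hk k Hi)). have wk := proj1 Hp k Hi.
  rewrite (Zsum_ext _ (fun m => Cexp (- (Ci * PI * s)) * Kf (s + 1) * (res n om y k m * pole_pow (pole (om k) m) (s - 1)))%C); last by move=> m Hm; exact: LI_uu_term.
  have [S0 HS] := zeta_terms_summable (- Re s) ltac:(lra).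
  set M := exp ((Re s - 1) * ln (2 * PI / Cmod (om k))) * exp (2 * PI * Rabs (Im s)).
  have M0 : 0 <= Cr * M by apply: Rmult_le_pos => //; apply: Rmult_le_pos; left; exact: exp_pos.
  apply: (Zsum_scal _ _ _ _ (dom_sum_scal _ _ _ M0 HS)). apply: zdom_abs => m i Hm.
  have m0 : m <> 0%Z by move=> q; move: Hm; rewrite q; lia.
  have := pole_pow_norm (om k) m i s wk Hm. have -> : - (1 + - Re s) = Re s - 1 by ring. rewrite -/M Cmod_mult Rmult_assoc => h.
  apply: Rmult_le_compat => //; try exact: Cmod_ge_0. exact: HC.
Qed.

(** * Decay of the residues and the region of convergence *)

Lemma length_but l k : NoDup l -> In k l -> S (length (filter (fun j => negb (Nat.eqb j k)) l)) = length l.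
Proof.
  elim: l => [|a l IH] // /NoDup_cons_iff [Na Nl] Hk. rewrite [filter _ _]/=. case: Hk => [E|Hk].
  - subst a. rewrite Nat.eqb_refl /=. congr S. clear IH Nl. elim: l Na => [|b l IH] Na //=.
    have -> : Nat.eqb b k = false by apply/Nat.eqb_neq => q; apply: Na; left. rewrite /= IH // => q. by apply: Na; right.
  - have -> : Nat.eqb a k = false by apply/Nat.eqb_neq => q; apply: Na; rewrite q. by rewrite /= IH.
Qed.

Lemma length_indices_but n k : In k (indices n) -> S (length (indices_but n k)) = n.
Proof. move=> Hk. rewrite /indices_but length_but //; [exact: length_seq|exact: NoDup_indices]. Qed.

Lemma res_decay n om y R1 : (2 <= n)%nat -> periods n om -> 0 <= y < 1 -> 0 < y \/ R1 < 0 -> exists B S0, dom_sum B S0 /\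
  forall k m i (x : R), In k (indices n) -> Z.abs m = Z.of_nat (S i) -> x <= R1 -> Cmod (res n om y k m) * exp ((x - 1) * ln (INR i + 1)) <= B i.
Proof.
  move=> Hn Hp Hy Hc. have [Cr [d [C0 [d0 H]]]] := res_norm n om y Hp Hy.
  have mono : forall i x, x <= R1 -> exp ((x - 1) * ln (INR i + 1)) <= exp ((R1 - 1) * ln (INR i + 1)) by move=> i x Hx; apply: exp_le; have := ln_INR1_ge0 i; nra.
  have ge1 : forall k, In k (indices n) -> 1 <= INR (length (indices_but n k)).
  { move=> k Hk. apply: (le_INR 1). have := length_indices_but n k Hk. lia. }
  case: (Rlt_dec 0 y) => Hy0.
  - have [S0 HS] := zeta_terms_summable 1 Rlt_0_1. set c := Rmin y (1 - y) * d.
    have c0 : 0 < c by apply: Rmult_lt_0_compat => //; apply: Rmin_glb_lt; lra.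
    (* Exponential decay of the residues allows any power [(i + 1)^(-b)]; [b >= R1 + 1] reduces
       [(i + 1)^(R1 - 1 - b)] to at most [(i + 1)^(-2)]. *)
    set b := Rmax 1 (R1 + 1). have b1 : 1 <= b by exact: Rmax_l. have b2 : R1 + 1 <= b by exact: Rmax_r.
    set E := exp (b * (ln b - 1) - b * ln c). have ml_rest : 0 < E by exact: exp_pos.
    exists (fun i => Cr * E * exp (- (1 + 1) * ln (INR i + 1))), (Cr * E * S0). split; first by apply: dom_sum_scal => //; apply: Rmult_le_pos; lra.
    move=> k m i x Hk Hm Hx. have m0 : m <> 0%Z by move=> q; move: Hm; rewrite q; lia. have i0 : 0 < INR i + 1 by have := pos_INR i; lra.
    have h1 := H k m Hk m0. rewrite (abs_IZR_S i m Hm) -/c in h1.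
    have h2 : exp (- (c * (INR i + 1) * INR (length (indices_but n k)))) <= E * exp (- b * ln (INR i + 1)).
    { apply: (Rle_trans _ (exp (- (c * exp (ln (INR i + 1)))))).
      - rewrite exp_ln //. apply: exp_le. have := ge1 k Hk. have := Rmult_lt_0_compat _ _ c0 i0. nra.
      - apply: exp_double_decay => //. lra. }
    apply: Rle_trans (Rmult_le_compat _ _ _ _ (Cmod_ge_0 _) (Rlt_le _ _ (exp_pos _)) (Rle_trans _ _ _ h1 (Rmult_le_compat_l _ _ _ C0 h2)) (mono i x Hx)) _.
    have -> : Cr * (E * exp (- b * ln (INR i + 1))) * exp ((R1 - 1) * ln (INR i + 1)) = Cr * E * exp ((R1 - 1 - b) * ln (INR i + 1)).
    { have -> : (R1 - 1 - b) * ln (INR i + 1) = - b * ln (INR i + 1) + (R1 - 1) * ln (INR i + 1) by ring. rewrite exp_plus. ring. }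
    apply: Rmult_le_compat_l; first by apply: Rmult_le_pos; lra. apply: exp_le. apply: Rmult_le_compat_r; [exact: ln_INR1_ge0 i|lra].
  (* For [y = 0] the residues are only bounded, and convergence comes from [(i + 1)^(R1 - 1)] with
     [R1 < 0]. *)
  - have R0 : R1 < 0 by case: Hc => //; lra. have [S0 HS] := zeta_terms_summable (- R1) ltac:(lra).
    exists (fun i => Cr * exp (- (1 + - R1) * ln (INR i + 1))), (Cr * S0). split; first exact: dom_sum_scal.
    move=> k m i x Hk Hm Hx. have m0 : m <> 0%Z by move=> q; move: Hm; rewrite q; lia.
    apply: Rmult_le_compat => //; [exact: Cmod_ge_0|left; exact: exp_pos| |].
    + apply: Rle_trans (H k m Hk m0) _. rewrite -{2}(Rmult_1_r Cr). apply: Rmult_le_compat_l => //. apply: Rle_trans (Req_le _ _ exp_0). apply: exp_le.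
      have q : 0 <= Rmin y (1 - y) by apply: Rmin_glb; lra. have := Rabs_pos (IZR m). have := ge1 k Hk => g1 g2.
      have : 0 <= Rmin y (1 - y) * d * Rabs (IZR m) * INR (length (indices_but n k)) by apply: Rmult_le_pos; [apply: Rmult_le_pos => //; apply: Rmult_le_pos; lra|lra]. lra.
    + have -> : - (1 + - R1) = R1 - 1 by ring. exact: mono.
Qed.

Definition res_term (n : nat) (om : nat -> C) (y : R) (k : nat) (m : Z) (s : C) : C := (res n om y k m * pole_pow (pole (om k) m) (s - 1))%C.

Lemma res_term_dom n om y k R1 T : (2 <= n)%nat -> periods n om -> 0 <= y < 1 -> 0 < y \/ R1 < 0 -> In k (indices n) -> exists B S0, dom_sum B S0 /\
  forall s m i, Z.abs m = Z.of_nat (S i) -> Re s <= R1 -> Rabs (Re s) <= T -> Rabs (Im s) <= T -> Cmod (res_term n om y k m s) <= B i.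
Proof.
  move=> Hn Hp Hy Hc Hk. have [B [S0 [HB H]]] := res_decay n om y R1 Hn Hp Hy Hc. have wk := proj1 Hp k Hk.
  set L := ln (2 * PI / Cmod (om k)). set M := exp ((T + 1) * Rabs L) * exp (2 * PI * T).
  have M0 : 0 <= M by apply: Rmult_le_pos; left; exact: exp_pos.
  exists (fun i => M * B i), (M * S0). split; first exact: dom_sum_scal.
  move=> s m i Hm H1 H2 H3. have h := pole_pow_norm (om k) m i s wk Hm. rewrite -/L in h.
  rewrite /res_term Cmod_mult. apply: Rle_trans (Rmult_le_compat_l _ _ _ (Cmod_ge_0 _) h) _.
  have q := H k m i (Re s) Hk Hm H1. set e := exp ((Re s - 1) * ln (INR i + 1)) in q |- *.
  have hM : exp ((Re s - 1) * L) * exp (2 * PI * Rabs (Im s)) <= M.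
  { apply: Rmult_le_compat; try (left; exact: exp_pos); apply: exp_le.
    - apply: Rle_trans (Rle_abs _) _. rewrite Rabs_mult. apply: Rmult_le_compat_r; first exact: Rabs_pos.
      apply: Rle_trans (Rabs_triang _ _) _. rewrite Rabs_Ropp Rabs_R1. lra.
    - apply: Rmult_le_compat_l => //. have := PI_RGT_0. lra. }
  have e0 := exp_pos ((Re s - 1) * ln (INR i + 1)). rewrite -/e in e0.
  have r0 := Cmod_ge_0 (res n om y k m). set rr := Cmod (res n om y k m) in r0 q |- *.
  have -> : rr * (exp ((Re s - 1) * L) * exp (2 * PI * Rabs (Im s)) * e) = exp ((Re s - 1) * L) * exp (2 * PI * Rabs (Im s)) * (rr * e) by ring.
  apply: Rmult_le_compat => //; [apply: Rmult_le_pos; left; exact: exp_pos|apply: Rmult_le_pos; lra].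
Qed.

Lemma region_margin y (s : C) : region y s -> exists R1 r, 0 < r /\ (0 < y \/ R1 < 0) /\ forall w, Cmod (w - s)%C <= r -> Re w <= R1.
Proof.
  have Q : forall r w, Cmod (w - s)%C <= r -> Re w <= Re s + r by move=> r w Hw; have := Re_le_Cmod (w - s)%C; have := Rle_abs (Re (w - s)%C); rewrite /= /Re; lra.
  case=> H.
  - exists (Re s + 1), 1. split; first lra. split; first by left. move=> w Hw. exact: Q.
  - exists (Re s / 2), (- Re s / 2). split; first lra. split; first by right; lra. move=> w Hw. have := Q _ _ Hw. lra.
Qed.

Lemma Re_Im_bound (w s : C) r : Cmod (w - s)%C <= r -> Rabs (Re w) <= Cmod s + r /\ Rabs (Im w) <= Cmod s + r.
Proof. move=> Hw. have := Cmod_triangle_rev_minus w s. have := Re_le_Cmod w. have := Im_le_Cmod w. lra. Qed.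

Lemma res_term_cdiff n om y k m s : cdiff (res_term n om y k m) s.
Proof. rewrite /res_term /pole_pow /Cpow_in. cdiff_tac. Qed.

Lemma res_sum_cdiff n om y s : (2 <= n)%nat -> periods n om -> 0 <= y < 1 -> region y s -> cdiff (res_sum n om y) s.
Proof.
  move=> Hn Hp Hy /region_margin [R1 [r [r0 [Hc Hr]]]].
  apply: (cdiff_Csum (fun k s => Zstar_sum (fun m => res n om y k m * pole_pow (pole (om k) m) (s - 1))%C)) => k Hk.
  have [B [S0 [HB H]]] := res_term_dom n om y k R1 (Cmod s + r) Hn Hp Hy Hc Hk.
  apply: (Zsum_holo (res_term n om y k) s r B S0 r0 HB); first by move=> m w _ _; exact: res_term_cdiff.
  move=> w Hw. apply: zdom_abs => m i Hm. have [h1 h2] := Re_Im_bound w s r Hw. apply: H => //. exact: Hr.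
Qed.

Lemma holomorphic_of_disc (f : C -> C) z d : 0 < d -> (forall w, Cmod (w - z)%C < d -> cdiff f w) -> holomorphic_at f z.
Proof. move=> Hd H. apply/locally_Cmod. by exists d. Qed.

(** * Gluing the meromorphic continuation *)

Lemma pole_of_simple (f g h : C -> C) (z : C) d : 0 < d -> (forall w, Cmod (w - z)%C < d -> cdiff g w) -> (forall w, Cmod (w - z)%C < d -> cdiff h w) ->
  h z <> 0%C -> (forall w, 0 < Cmod (w - z)%C < d -> f w = (g w + h w / (w - z))%C) -> pole_at f z.
Proof.
  move=> Hd Hg Hh Nz E. have dz : Cmod (z - z)%C < d by rewrite Cmod_self. split.
  - apply/locally_Cmod. exists d. split => // w Hw N. have p := Cmod_minus_gt0 w z N. have Nw := Cminus_neq_0 _ _ N.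
    apply: (cdiff_ext_loc (fun w => g w + h w / (w - z))%C f w (Rmin (Cmod (w - z)%C) (d - Cmod (w - z)%C))).
    + apply: Rmin_glb_lt; lra.
    + move=> v Hv. have v1 := Rlt_le_trans _ _ _ Hv (Rmin_l _ _). have v2 := Rlt_le_trans _ _ _ Hv (Rmin_r _ _).
      symmetry. apply: E. have := Cmod_triangle3 v z w. have := Cmod_triangle3 w z v. rewrite (Cmod_minus_sym w v). lra.
    + apply: cdiff_plus; first exact: Hg. apply: cdiff_div => //; first exact: Hh. cdiff_tac.
  - move=> P [M HM]. have hz := proj1 (Cmod_gt_0 (h z)) Nz.
    have [d1 [D1 K1]] := cdiff_ccont _ _ (Hg z dz) 1 Rlt_0_1. have [d2 [D2 K2]] := cdiff_ccont _ _ (Hh z dz) (Cmod (h z) / 2) ltac:(lra).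
    have gz := Cmod_ge_0 (g z). set L := Rabs M + Cmod (g z) + 2. have L0 : 0 < L by rewrite /L; have := Rabs_pos M; lra.
    set d3 := Cmod (h z) / (2 * L). have D3 : 0 < d3 by apply: Rdiv_lt_0_compat; lra.
    apply/locally_Cmod. exists (Rmin (Rmin d d1) (Rmin d2 d3)). split; first by repeat apply: Rmin_glb_lt.
    move=> w Hw N. apply: HM. have p := Cmod_minus_gt0 w z N.
    have w12 := Rlt_le_trans _ _ _ Hw (Rmin_l _ _). have w34 := Rlt_le_trans _ _ _ Hw (Rmin_r _ _).
    have w1 := Rlt_le_trans _ _ _ w12 (Rmin_l _ _). have w2 := Rlt_le_trans _ _ _ w12 (Rmin_r _ _).
    have w3 := Rlt_le_trans _ _ _ w34 (Rmin_l _ _). have w4 := Rlt_le_trans _ _ _ w34 (Rmin_r _ _).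
    rewrite E //. have k1 := K1 w w2. have k2 := K2 w w3.
    have a1 : Cmod (g w) <= Cmod (g z) + 1 by have := Cmod_triangle_rev_minus (g w) (g z); lra.
    have a2 : Cmod (h z) / 2 <= Cmod (h w) by have := Cmod_triangle_rev_minus (h z) (h w); rewrite Cmod_minus_sym; lra.
    have a3 : L <= Cmod (h w / (w - z))%C.
    { rewrite Cmod_div; last exact: Cminus_neq_0. apply: (Rmult_le_reg_r (Cmod (w - z)%C)) => //.
      have -> : Cmod (h w) / Cmod (w - z)%C * Cmod (w - z)%C = Cmod (h w) by field; lra.
      apply: Rle_trans a2. have -> : Cmod (h z) / 2 = L * d3 by rewrite /d3; field; lra. apply: Rmult_le_compat_l; lra. }
    have := Cmod_triangle_rev (h w / (w - z))%C (g w). rewrite Cplus_comm. have := Rle_abs M. rewrite /L in a3. lra.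
Qed.

(* [1 / Gamma] on [Re s > -1], written without the pole of Gamma at 0. *)
Definition igam (s : C) : C := (s / Gam (s + 1))%C.

Lemma Gam1_neq0 (s : C) : -1 < Re s -> Gam (s + 1)%C <> 0%C.
Proof. move=> H. apply: Gam_neq0. rewrite Re_plus /=. lra. Qed.

Lemma Gam1_cdiff (s : C) : -1 < Re s -> cdiff (fun s => Gam (s + 1)%C) s.
Proof. move=> H. apply: (cdiff_comp Gam (fun s => s + 1)%C); last cdiff_tac. apply: Gam_cdiff. rewrite Re_plus /=. lra. Qed.

Lemma igam_cdiff (s : C) : -1 < Re s -> cdiff igam s.
Proof. move=> H. apply: cdiff_div; [exact: Gam1_neq0|cdiff_tac|exact: Gam1_cdiff]. Qed.

(** [igam s] times [H s + polar_mellin n cc s], with the term of index 0 simplified: the factor [s]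
    in [igam] cancels [1 / s], so no singularity at 0 is left. *)
Definition Acont (n : nat) (cc : nat -> C) (H : C -> C) (s : C) : C :=
  (igam s * H s + Csum (fun i => cc i * igam s / (s - INR i)) (indices n) + cc 0%nat / Gam (s + 1))%C.

Lemma Acont_eq n (cc : nat -> C) H (s : C) : -1 < Re s -> s <> 0%C -> (Acont n cc H s * Gam (s + 1) = s * (H s + polar_mellin n cc s))%C.
Proof.
  move=> Hs Ns. have g0 := Gam1_neq0 s Hs.
  have -> : polar_mellin n cc s = (cc 0%nat / s + Csum (fun i => cc i / (s - INR i)) (indices n))%C.
  { rewrite /polar_mellin. set f := fun i : nat => _. have -> : Csum f (0%nat :: indices n) = (f 0%nat + Csum f (indices n))%C by []. congr (_ + _)%C. rewrite /f /=. congr (_ / _)%C. ring. }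
  rewrite /Acont.
  have -> : Csum (fun i => cc i * igam s / (s - INR i))%C (indices n) = (igam s * Csum (fun i => cc i / (s - INR i)) (indices n))%C.
  { rewrite -Csum_scal. apply: Csum_ext => i _. rewrite /Cdiv. ring. }
  rewrite /igam. field. by split.
Qed.

Lemma Acont_cdiff n (cc : nat -> C) H (s : C) : -1 < Re s -> cdiff H s -> (forall i, In i (indices n) -> s <> RtoC (INR i) \/ cc i = 0%C) -> cdiff (Acont n cc H) s.
Proof.
  move=> Hs HH Hi. apply: cdiff_plus; first apply: cdiff_plus.
  - apply: cdiff_mult => //. exact: igam_cdiff.
  - apply: (cdiff_Csum (fun i s => cc i * igam s / (s - INR i))%C) => i Hin. case: (Hi i Hin) => [N|Z].
    + apply: cdiff_div; [exact: Cminus_neq_0|apply: cdiff_mult; [cdiff_tac|exact: igam_cdiff]|cdiff_tac].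
    + apply: (cdiff_ext (fun _ => 0%C)); last exact: cdiff_const. move=> w. rewrite Z /Cdiv. ring.
  - apply: cdiff_div; [exact: Gam1_neq0|cdiff_tac|exact: Gam1_cdiff].
Qed.

Lemma nat_points_sep (w : C) i j : Cmod (w - INR i)%C < 1 -> i <> j -> w <> RtoC (INR j).
Proof.
  move=> H N E. move: H. rewrite E -RtoC_minus Cmod_R !INR_IZR_INZ -minus_IZR.
  have := IZR_abs_ge1 (Z.of_nat j - Z.of_nat i)%Z ltac:(lia). lra.
Qed.

(** [meromorphic_on] demands holomorphy or a genuine pole at every point, so the unknown
    coefficients [cc i] must be distinguished according to whether they vanish. *)
Lemma Acont_merom n (cc : nat -> C) H (U E : C -> C) (z : C) : -1 < Re z -> (forall s : C, -1 < Re s -> cdiff H s) -> (forall s, cdiff E s) -> (forall s, E s <> 0%C) ->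
  (forall s : C, -1 < Re s -> U s = (E s * Acont n cc H s)%C) -> holomorphic_at U z \/ pole_at U z.
Proof.
  move=> Hz HH DE NE EU.
  have near : forall r, r <= Re z + 1 -> forall w, Cmod (w - z)%C < r -> -1 < Re w by move=> r Hr w /Re_close; lra.
  have good : forall c : nat -> C, (forall w d, 0 < d -> d <= Re z + 1 -> (forall w, Cmod (w - z)%C < d -> forall i, In i (indices n) -> w <> RtoC (INR i) \/ c i = 0%C) -> Cmod (w - z)%C < d -> cdiff (fun s => E s * Acont n c H s)%C w).
  { move=> c w d Hd Hd2 Hc Hw. have Rw := near d Hd2 w Hw. apply: cdiff_mult => //. apply: Acont_cdiff => //; [exact: HH|exact: Hc]. }
  case: (classic (exists i0, In i0 (indices n) /\ z = RtoC (INR i0) /\ cc i0 <> 0%C)) => [[i0 [Hi [Ez Nc]]]|Nex].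
  (* [c'] drops the coefficient [cc i0], which becomes the simple polar part at [z]; its numerator
     is nonzero because [igam] does not vanish at [i0 >= 1]. *)
  - right. set c' := fun i => match Nat.eq_dec i i0 with left _ => RtoC 0 | right _ => cc i end.
    have i1 : 1 <= INR i0 by apply: (le_INR 1); move: Hi => /in_seq; lia. have Rz : Re z = INR i0 by rewrite Ez.
    apply: (pole_of_simple U (fun s => E s * Acont n c' H s)%C (fun s => E s * (cc i0 * igam s))%C z 1 Rlt_0_1).
    + move=> w Hw. apply: (good c' w 1) => //; try lra. move=> v Hv i _. rewrite /c'. case: Nat.eq_dec => q; first by right. left. rewrite Ez in Hv. apply: (nat_points_sep v i0 i) => //. exact: not_eq_sym.
    + move=> w Hw. apply: cdiff_mult => //. apply: cdiff_mult; [cdiff_tac|apply: igam_cdiff; apply: (near 1) => //; lra].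
    + apply: Cmult_neq_0 => //. apply: Cmult_neq_0 => //. apply: Cmult_neq_0; first by rewrite Ez; apply: RtoC_neq0; lra.
      apply: Cinv_neq_0. exact: Gam1_neq0.
    + move=> w Hw. rewrite EU; last by apply: (near 1); lra.
      rewrite /Acont (Csum_change (fun i => cc i * igam w / (w - INR i))%C (fun i => c' i * igam w / (w - INR i))%C _ i0 (NoDup_indices n) Hi); last by move=> k _ Nk; rewrite /c'; case: Nat.eq_dec.
      have -> : c' i0 = RtoC 0 by rewrite /c'; case: Nat.eq_dec.
      have -> : c' 0%nat = cc 0%nat by rewrite /c'; case: Nat.eq_dec => // q; move: i1; rewrite -q /=; lra.
      rewrite -Ez /Cdiv. ring.
  - left. set d := Rmin 1 (Re z + 1).
    have [d' [d'0 Hd']] : exists d', 0 < d' /\ forall w, Cmod (w - z)%C < d' -> forall i, In i (indices n) -> w <> RtoC (INR i) \/ cc i = 0%C.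
    { case: (finite_min nat (indices n) (fun i e => forall w, Cmod (w - z)%C < e -> w <> RtoC (INR i) \/ cc i = 0%C)).
      - move=> i Hi. case: (classic (cc i = 0%C)) => [Zc|Nc]; first by exists 1; split; [lra|move=> e _ _ w _; right].
        have Nz : z <> RtoC (INR i) by move=> q; apply: Nex; exists i. have p := Cmod_minus_gt0 _ _ Nz.
        exists (Cmod (z - INR i)%C). split => // e _ He w Hw. left => q. move: Hw. rewrite q Cmod_minus_sym. lra.
      - move=> e [e0 [_ He]]. exists e. split => // w Hw i Hi. exact: (He i Hi e e0 (Rle_refl _)). }
    apply: (holomorphic_of_disc U z (Rmin d' (Re z + 1))); first by apply: Rmin_glb_lt; lra.
    move=> w Hw. have w1 := Rlt_le_trans _ _ _ Hw (Rmin_l _ _). have w2 := Rlt_le_trans _ _ _ Hw (Rmin_r _ _).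
    apply: (cdiff_ext_loc (fun s => E s * Acont n cc H s)%C U w (Re z + 1 - Cmod (w - z)%C)); first lra.
    + move=> v Hv. symmetry. apply: EU. apply: (near (Re z + 1)); first lra. have := Cmod_triangle3 v z w. lra.
    + apply: (good cc w (Rmin d' (Re z + 1))) => //; [apply: Rmin_glb_lt; lra|exact: Rmin_r|].
      move=> v Hv. apply: Hd'. exact: Rlt_le_trans Hv (Rmin_l _ _).
Qed.

(** The product [Gam (1 - s) * Cexp (- (Ci * PI * s))] is the form [gamma_factor] takes in the
    strip, and it has no singularity for [Re s < 0]. *)
Definition Bcont (n : nat) (om : nat -> C) (y : R) (s : C) : C := (- (Gam (1 - s) * Cexp (- (Ci * PI * s)) * res_sum n om y s))%C.

Lemma Bcont_cdiff n om y (s : C) : (2 <= n)%nat -> periods n om -> 0 <= y < 1 -> Re s < 0 -> cdiff (Bcont n om y) s.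
Proof.
  move=> Hn Hp Hy Hs. apply: cdiff_opp. apply: cdiff_mult; last by apply: res_sum_cdiff => //; right.
  apply: cdiff_mult; last cdiff_tac. apply: (cdiff_comp Gam (fun s => 1 - s)%C); last cdiff_tac. apply: Gam_cdiff. rewrite /= /Re in Hs *. lra.
Qed.

Lemma Gam_one_minus (s : C) : Re s < 0 -> Gam (1 - s)%C = (- s * Gam (- s))%C.
Proof. move=> Hs. have -> : (1 - s = - s + 1)%C by ring. apply: Gam_succ. rewrite /= /Re in Hs *. lra. Qed.

Lemma Gam_reflection_strip (s : C) : -1 < Re s < 0 -> (Gam (- s) * Gam (s + 1) = Kf (s + 1))%C.
Proof. move=> Hs. rewrite -Gam_reflection_K; first by congr (Gam _ * _)%C; ring. rewrite Re_plus /=. lra. Qed.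

(** [Acont] serves for [Re s > -1] and [Bcont] for [Re s < 0]; on the common strip they agree by
    [Mel_st_sum] and the reflection formula. The line [Re s = -1/2] at which they are glued is an
    arbitrary one in that strip. *)
Theorem continuation_exists n om y theta : (2 <= n)%nat -> periods n om -> 0 <= y < 1 -> exists F, meromorphic_on (fun _ => True) F /\
  (forall s : C, INR n < Re s -> (F s * Gam s = Cexp (- s * (Ci * theta)) * Mel (gen_exp n om y) s)%C) /\
  (forall s : C, -1 < Re s < 0 -> F s = (Cexp (- s * (Ci * theta)) * Bcont n om y s)%C).
Proof.
  move=> Hn Hp Hy. have [cc [H [H1 [H2 H3]]]] := mellin_split n om y ltac:(lia) Hp Hy.
  set E := fun s => Cexp (- s * (Ci * theta))%C. have DE : forall s, cdiff E s by move=> s; rewrite /E; cdiff_tac.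
  have NE : forall s, E s <> 0%C by move=> s; exact: Cexp_neq0.
  have AB : forall s : C, -1 < Re s < 0 -> Acont n cc H s = Bcont n om y s.
  { move=> s Hs. have Ns : s <> 0%C by move=> q; move: Hs; rewrite q /=; lra.
    apply: (Cmult_reg_r _ _ (Gam (s + 1)%C)); first by apply: Gam1_neq0; lra.
    rewrite Acont_eq // -?H3 //; last lra. rewrite Mel_st_sum // /Bcont Gam_one_minus; last lra. rewrite -(Gam_reflection_strip s Hs). ring. }
  set F := fun s : C => match Rlt_dec (-1 / 2) (Re s) with left _ => (E s * Acont n cc H s)%C | right _ => (E s * Bcont n om y s)%C end.
  have FA : forall s : C, -1 < Re s -> F s = (E s * Acont n cc H s)%C by move=> s Hs; rewrite /F; case: Rlt_dec => q //; rewrite AB //; lra.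
  have FB : forall s : C, Re s < 0 -> F s = (E s * Bcont n om y s)%C by move=> s Hs; rewrite /F; case: Rlt_dec => q //; rewrite AB //; lra.
  exists F. split; last split.
  - move=> z _. case: (Rlt_dec (-1) (Re z)) => Hz; first exact: (Acont_merom n cc H F E).
    left. apply: (holomorphic_of_disc F z 1 Rlt_0_1) => w Hw. have rw := Re_close _ _ _ Hw.
    apply: (cdiff_ext_loc (fun s => E s * Bcont n om y s)%C F w (- Re w)); first lra.
    + move=> v Hv. symmetry. apply: FB. have := Re_close _ _ _ Hv. lra.
    + apply: cdiff_mult => //. apply: Bcont_cdiff => //. lra.
  - move=> s Hs. have pn := pos_INR n. rewrite FA; last lra. have Ns : s <> 0%C by move=> q; move: Hs; rewrite q /=; lra.
    rewrite H2 // -/(E s). apply: (Cmult_reg_r _ _ s) => //.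
    have Eq := Acont_eq n cc H s ltac:(lra) Ns. rewrite Gam_succ in Eq; last lra.
    have -> : (E s * (H s + polar_mellin n cc s) * s = E s * (s * (H s + polar_mellin n cc s)))%C by ring. rewrite -Eq. ring.
  - move=> s Hs. apply: FB. lra.
Qed.

(** * Rotation to the right half plane and comparison with the expansion *)

Definition rot (theta : R) (omega : nat -> C) (k : nat) : C := (Cexp (- (Ci * theta)) * omega k)%C.

Lemma rot_inv (theta : R) (omega : nat -> C) k : omega k = (Cexp (Ci * theta) * rot theta omega k)%C.
Proof. rewrite /rot Cmult_assoc -Cexp_plus (_ : Ci * theta + - (Ci * theta) = 0)%C; [rewrite Cexp_0; ring|ring]. Qed.

Lemma in_indices n k : In k (indices n) <-> (1 <= k <= n)%nat.
Proof. rewrite /indices in_seq. lia. Qed.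

Lemma rot_periods n (theta : R) (omega : nat -> C) : (forall k : nat, (1 <= k <= n)%nat -> half_plane theta (omega k)) ->
  (forall j k : nat, (1 <= j <= n)%nat -> (1 <= k <= n)%nat -> j <> k -> Im (omega j / omega k)%C <> 0) -> periods n (rot theta omega).
Proof.
  move=> H1 H2.
  have P : forall k, In k (indices n) -> 0 < Re (rot theta omega k).
  { move=> k /in_indices /H1 [r [phi [Hr [Hphi E]]]].
    have -> : rot theta omega k = (RtoC r * Cexp (Ci * phi))%C.
    { rewrite /rot E. have -> : (Cexp (- (Ci * theta)) * (r * Cexp (Ci * (theta + phi))) = r * (Cexp (- (Ci * theta)) * Cexp (Ci * (theta + phi))))%C by ring.
      rewrite -Cexp_plus. congr (_ * Cexp _)%C. ring. }
    rewrite Cexp_Ci. have -> : Re (RtoC r * (cos phi, sin phi))%C = r * cos phi by rewrite /= /Re; ring.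
    apply: Rmult_lt_0_compat => //. apply: cos_gt_0; lra. }
  split => // j k Hj Hk N. have w0 := Re_pos_neq0 _ (P k Hk). have e0 := Cexp_neq0 (- (Ci * theta))%C.
  have k0 : omega k <> 0%C by move=> q; apply: w0; rewrite /rot q; ring.
  have -> : (rot theta omega j / rot theta omega k = omega j / omega k)%C by rewrite /rot; field; split.
  by apply: H2 => //; apply/in_indices.
Qed.

Lemma residue_point_rot n (theta : R) (omega : nat -> C) k m : periods n (rot theta omega) -> In k (indices n) ->
  residue_point omega k m = (Cexp (- (Ci * theta)) * pole (rot theta omega k) m)%C.
Proof.
  move=> [P _] Hk. have w0 := Re_pos_neq0 _ (P k Hk). rewrite /residue_point /pole {1}(rot_inv theta omega k) (Cexp_opp (Ci * theta)%C).
  have e0 := Cexp_neq0 (Ci * theta)%C. move: (Cexp _) e0 (rot _ _ _) w0 => e e0 r w0. field. by split.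
Qed.

Lemma residue_power_rot n (theta : R) (omega : nat -> C) k m (s : C) : periods n (rot theta omega) -> In k (indices n) -> m <> 0%Z ->
  residue_power theta omega k m s = (Cexp (- (s - 1) * (Ci * theta)) * pole_pow (pole (rot theta omega k) m) (s - 1))%C.
Proof.
  move=> P Hk Hm. have wk := proj1 P k Hk. have [b [Hb H]] := pole_log _ wk. have [v [Ev [Hv Rv]]] := H m Hm.
  have p0 := pole_neq0 _ m (Re_pos_neq0 _ wk) Hm. have hv := Rabs_def2 _ _ (Rle_lt_trans _ _ _ Hv (proj2 Hb)).
  rewrite (pole_pow_log v) //; last lra. rewrite /residue_power (residue_point_rot n theta) //. set p := pole _ m in Ev p0 Rv *.
  have Mp : Cmod (Cexp (- (Ci * theta)) * p)%C = exp (Re v).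
  { have -> : (- (Ci * theta) = Ci * RtoC (- theta))%C by rewrite RtoC_opp; ring. by rewrite Cmod_mult_Cexp_Ci Rv. }
  (* [Im v + PI] lies strictly between 0 and [2 PI], so the endpoints of the closed interval of
     arguments are never attained and the argument is unique. *)
  rewrite (Cpow_in_eq _ _ _ (Im v + PI - theta)).
  - rewrite Mp ln_exp -Cexp_plus. congr Cexp.
    have -> : v = (RtoC (Re v) + Ci * RtoC (Im v))%C by apply: C_ext; rewrite /= /Re /Im /=; ring.
    rewrite RtoC_minus RtoC_plus. have -> : Re (RtoC (Re v) + Ci * RtoC (Im v))%C = Re v by rewrite /= /Re /Im; ring.
    have -> : Im (RtoC (Re v) + Ci * RtoC (Im v))%C = Im v by rewrite /= /Re /Im; ring. ring.
  - apply: Cmult_neq_0 => //. exact: Cexp_neq0.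
  - lra.
  - rewrite Mp. have -> : p = (- Cexp v)%C by rewrite Ev; ring. rewrite -Cexp_R -Cexp_plus.
    have -> : (- Cexp v = Cexp v * Cexp (Ci * PI))%C by rewrite Cexp_PI; ring. rewrite -!Cexp_plus. congr Cexp.
    apply: C_ext; rewrite /= /Re /Im /=; ring.
  - move=> phi Hphi E'. apply: (angle_unique (Cexp (- (Ci * theta)) * p)%C) => //; last lra.
    + apply: Cmult_neq_0 => //. exact: Cexp_neq0.
    + rewrite Mp. have -> : p = (- Cexp v)%C by rewrite Ev; ring. rewrite -Cexp_R -Cexp_plus.
      have -> : (- Cexp v = Cexp v * Cexp (Ci * PI))%C by rewrite Cexp_PI; ring. rewrite -!Cexp_plus. congr Cexp.
      apply: C_ext; rewrite /= /Re /Im /=; ring.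
Qed.

Lemma expansion_term_rot n (theta : R) (omega : nat -> C) (y : R) k m (s : C) : periods n (rot theta omega) -> In k (indices n) -> m <> 0%Z ->
  expansion_term theta n omega y k m s = (Cexp (- s * (Ci * theta)) * res_term n (rot theta omega) y k m s)%C.
Proof.
  move=> P Hk Hm. have wk := Re_pos_neq0 _ (proj1 P k Hk).
  have k0 : omega k <> 0%C by move=> q; apply: wk; rewrite /rot q; ring. have e0 := Cexp_neq0 (Ci * theta)%C.
  rewrite /expansion_term (residue_power_rot n) // /res_term /res.
  rewrite (Cprod_ext _ (fun j => gq y (rot theta omega j * pole (rot theta omega k) m)%C)); last first.
  { move=> j Hj. rewrite /gq. have -> // : (2 * IZR m * PI * Ci * omega j / omega k = rot theta omega j * pole (rot theta omega k) m)%C.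
    rewrite /pole /rot Cexp_opp. field. by split. }
  have -> : (2 * IZR m * PI * Ci * y = IZR m * (2 * PI * Ci) * y)%C by ring.
  (* The spare factor [Cexp (Ci * theta)] cancels against the rotation of [/ omega k]. *)
  have -> : Cexp (- (s - 1) * (Ci * theta))%C = (Cexp (- s * (Ci * theta)) * Cexp (Ci * theta))%C by rewrite -Cexp_plus; congr Cexp; ring.
  rewrite {1}(rot_inv theta omega k). move: (Cexp (Ci * theta)%C) e0 => e e0.
  set a := Cprod _ _. set b := pole_pow _ _. set c := Cexp (- s * _)%C. set d := Cexp (_ * y)%C. clearbody a b c d. move: (rot theta omega k) wk => r r0. field. by split.
Qed.

Lemma res_term_zdom n om y k s : (2 <= n)%nat -> periods n om -> 0 <= y < 1 -> region y s -> In k (indices n) ->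
  exists B S0, dom_sum B S0 /\ zdom (fun m => res_term n om y k m s) B.
Proof.
  move=> Hn Hp Hy /region_margin [R1 [r [r0 [Hc Hr]]]] Hk. have [B [S0 [HB H]]] := res_term_dom n om y k R1 (Cmod s) Hn Hp Hy Hc Hk.
  exists B, S0. split => //. apply: zdom_abs => m i Hm. apply: H => //; [apply: Hr; rewrite Cmod_self; lra|exact: Re_le_Cmod|exact: Im_le_Cmod].
Qed.

Lemma expansion_rot n (theta : R) (omega : nat -> C) y (s : C) : (2 <= n)%nat -> periods n (rot theta omega) -> 0 <= y < 1 -> region y s ->
  expansion theta n omega y s = (- gamma_factor s * (Cexp (- s * (Ci * theta)) * res_sum n (rot theta omega) y s))%C.
Proof.
  move=> Hn P Hy Hs. rewrite /expansion /res_sum -(Csum_scal (Cexp _)). congr (_ * _)%C. apply: Csum_ext => k Hk.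
  have [B [S0 [HB HZ]]] := res_term_zdom n _ y k s Hn P Hy Hs Hk. rewrite -(Zsum_scal _ _ B S0) //.
  apply: Zsum_ext => m Hm. exact: (expansion_term_rot n).
Qed.

Lemma integers_isolated (z : C) : exists d, 0 < d /\ d <= 1 / 2 /\ forall w, 0 < Cmod (w - z)%C < d -> forall m : Z, w <> RtoC (IZR m).
Proof.
  have near : forall w (m m0 : Z), w = RtoC (IZR m) -> Cmod (w - z)%C < 1 / 2 -> Cmod (z - IZR m0)%C < 1 / 2 -> m = m0.
  { move=> w m m0 -> h1 h2. case: (Z.eq_dec m m0) => // N. have := IZR_abs_ge1 (m - m0)%Z ltac:(lia).
    rewrite minus_IZR -Cmod_R RtoC_minus. have := Cmod_triangle3 (RtoC (IZR m)) (RtoC (IZR m0)) z. lra. }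
  case: (classic (exists m0 : Z, Cmod (z - IZR m0)%C < 1 / 2)) => [[m0 H0]|Nex].
  - case: (classic (z = RtoC (IZR m0))) => E.
    + exists (1 / 2). split; first lra. split; first lra. move=> w [Hw1 Hw2] m q. have q2 := near w m m0 q Hw2 H0. move: Hw1. rewrite q q2 E Cmod_self. lra.
    + have p := Cmod_minus_gt0 _ _ E. exists (Cmod (z - IZR m0)%C). split => //. split; first lra.
      move=> w [Hw1 Hw2] m q. have q2 := near w m m0 q ltac:(lra) H0. move: Hw2. rewrite q q2 Cmod_minus_sym. lra.
  - exists (1 / 2). split; first lra. split; first lra. move=> w [Hw1 Hw2] m q. apply: Nex. exists m. by rewrite -q Cmod_minus_sym.
Qed.

Lemma sine_zero_integer (s : C) : Cexp (2 * PI * Ci * s)%C = 1%C -> exists m : Z, s = RtoC (IZR m).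
Proof.
  move=> /Cexp_1_pole [m E]. exists m. apply: (Cmult_reg_r _ _ (2 * PI * Ci)%C two_PI_Ci_neq0). rewrite -E. ring.
Qed.

(** Off the integers nothing in the quotient degenerates: one shift [N] represents [CGamma] on the
    whole punctured disc, [Gam] has no zeros, and [Cexp (2 pi i s) = 1] only at integers. *)
Lemma gamma_factor_isolated (z : C) : isolated_sing gamma_factor z.
Proof.
  have [d [d0 [d1 Hd]]] := integers_isolated z. exists d. split => // w Hw.
  have [N HN] : exists N, 1 < Re z + INR N. { have [N HN] := INR_unbounded (1 - Re z). exists N. lra. }
  have nz : forall v, 0 < Cmod (v - z)%C < d -> forall k, (v + INR k)%C <> 0%C.
  { move=> v Hv k q. apply: (Hd v Hv (- Z.of_nat k)%Z). rewrite opp_IZR -INR_IZR_INZ RtoC_opp. apply: Cminus_eq_0. rewrite -q. ring. }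
  have Rpos : forall v, Cmod (v - z)%C < d -> 0 < Re v + INR N by move=> v /Re_close; lra.
  set r := Rmin (Cmod (w - z)%C) (d - Cmod (w - z)%C).
  have r0 : 0 < r by apply: Rmin_glb_lt; lra.
  have inn : forall v, Cmod (v - w)%C < r -> 0 < Cmod (v - z)%C < d.
  { move=> v Hv. have v1 := Rlt_le_trans _ _ _ Hv (Rmin_l _ _). have v2 := Rlt_le_trans _ _ _ Hv (Rmin_r _ _).
    have := Cmod_triangle3 v z w. have := Cmod_triangle3 w z v. rewrite (Cmod_minus_sym w v). lra. }
  apply: (cdiff_ext_loc (fun s => 2 * PI * Ci / (Gam (s + INR N) / Cprod (fun k => s + INR k) (seq 0 N) * (Cexp (2 * PI * Ci * s) - 1)))%C _ w r r0).
  - move=> v Hv. rewrite /gamma_factor (CGamma_shift v N) //; [apply: Rpos; exact: (proj2 (inn v Hv))|move=> k _; exact: nz (inn v Hv) k].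
  - have RN := Rpos w (proj2 Hw). have RNN : 0 < Re (w + INR N)%C by rewrite Re_plus /=.
    have P0 : Cprod (fun k => w + INR k)%C (seq 0 N) <> 0%C by apply: Cprod_shift_neq0 => k _; exact: nz.
    have G0 := Gam_neq0 _ RNN.
    have ml_rest : (Cexp (2 * PI * Ci * w) - 1)%C <> 0%C. { move=> q. have [m Em] := sine_zero_integer w (Cminus_eq_0 _ _ q). exact: (Hd w Hw m Em). }
    apply: cdiff_div; [|exact: cdiff_const|].
    + apply: Cmult_neq_0 => //. apply: Cmult_neq_0 => //. exact: Cinv_neq_0.
    + apply: cdiff_mult; last cdiff_tac. apply: cdiff_div => //.
      * apply: (cdiff_comp Gam (fun s => s + INR N)%C); [exact: Gam_cdiff|cdiff_tac].
      * apply: (cdiff_Cprod (fun k s => s + INR k)%C) => k _. cdiff_tac.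
Qed.

(** Reflection gives [Gam (- s) * Gam (s + 1) = Kf (s + 1)], and [sn (s + 1)] is
    [1 - Cexp (2 pi i s)] up to the factor [Cexp (- i pi s)]. *)
Lemma gamma_factor_strip (s : C) : -1 < Re s < 0 -> gamma_factor s = (Gam (1 - s) * Cexp (- (Ci * PI * s)))%C.
Proof.
  move=> Hs. have H1 : 0 < Re (s + 1)%C < 1 by rewrite Re_plus /=; lra. have g0 := Gam_neq0 _ (proj1 H1). have Ns : s <> 0%C by move=> q; move: Hs; rewrite q /=; lra.
  rewrite /gamma_factor CGamma_strip // Gam_one_minus; last lra.
  have R := Kf_sn _ H1. rewrite -(Gam_reflection_strip s Hs) in R.
  have e0 := Cexp_neq0 (Ci * PI * s)%C.
  have S1 : sn (s + 1)%C = (- ((Cexp (2 * PI * Ci * s) - 1) / Cexp (Ci * PI * s)))%C.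
  { rewrite /sn. have -> : (Ci * PI * (s + 1) = Ci * PI * s + Ci * PI)%C by ring. rewrite Cexp_opp Cexp_plus Cexp_PI.
    have -> : (2 * PI * Ci * s = Ci * PI * s + Ci * PI * s)%C by ring. rewrite Cexp_plus. field. exact: e0. }
  have T0 : (Cexp (2 * PI * Ci * s) - 1)%C <> 0%C.
  { move=> q. apply: two_PI_Ci_neq0. rewrite -R S1 q /Cdiv. ring. }
  move: (Cexp (2 * PI * Ci * s) - 1)%C T0 S1 => b b0 S1. rewrite -R S1 Cexp_opp.
  move: (Cexp (Ci * PI * s)%C) e0 (Gam (s + 1)%C) g0 (Gam _) => a a0 c c0 g. field. by repeat split.
Qed.

Lemma meromorphic_isolated f z : meromorphic_on (fun _ => True) f -> isolated_sing f z.
Proof.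
  move=> H. case: (H z I) => [/locally_Cmod [d [d0 Hd]]|[/locally_Cmod [d [d0 Hd]] _]]; exists d; split => // w Hw; first by apply: Hd; lra.
  apply: Hd; first lra. move=> q. move: Hw. rewrite q Cmod_self. lra.
Qed.

Lemma isolated_minus f g z : isolated_sing f z -> isolated_sing g z -> isolated_sing (fun s => f s - g s)%C z.
Proof.
  move=> [d [d0 Hd]] [e [e0 He]]. exists (Rmin d e). split; first exact: Rmin_glb_lt. move=> w [Hw Hw2].
  have h1 := Rlt_le_trans _ _ _ Hw2 (Rmin_l _ _). have h2 := Rlt_le_trans _ _ _ Hw2 (Rmin_r _ _). apply: cdiff_minus; [exact: Hd|exact: He].
Qed.

Lemma barnes_series_rot n (theta : R) (omega : nat -> C) (y : R) (s : C) : (1 <= n)%nat -> periods n (rot theta omega) -> 0 <= y < 1 -> INR n < Re s ->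
  (barnes_series theta (map omega (indices n)) (Csum omega (indices n) * (1 - y)) s * Gam s = Cexp (- s * (Ci * theta)) * Mel (gen_exp n (rot theta omega) y) s)%C.
Proof.
  move=> Hn P Hy Hs. have -> : gen_exp n (rot theta omega) y = bk (map (rot theta omega) (indices n)) (Csum (rot theta omega) (indices n) * (1 - y))%C by apply: functional_extensionality => x; exact: gen_exp_bk.
  rewrite -barnes_series_Mel; [|exact: pos_list_periods|exact: Re_periods_sum_pos|by rewrite length_map length_seq].
  congr (barnes_series _ _ _ _ * _)%C.
  - rewrite map_map. apply: map_ext => k. exact: rot_inv.
  - rewrite Cmult_assoc -Csum_scal. congr (_ * _)%C. apply: Csum_ext => k _. exact: rot_inv.
Qed.

(** [barnes_zeta] is some continuation and [F] an explicit one; both equal the series for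
    [Re s > n], so the identity theorem makes them agree near any chosen point of the strip, here
    [-1/2], apart from the point itself. *)
Lemma barnes_zeta_strip n (theta : R) (omega : nat -> C) (y : R) : (2 <= n)%nat -> periods n (rot theta omega) -> 0 <= y < 1 ->
  let Z := barnes_zeta theta (map omega (indices n)) (Csum omega (indices n) * (1 - y))%C in
  meromorphic_on (fun _ => True) Z /\ punctured_zero (fun s => Z s - Cexp (- s * (Ci * theta)) * Bcont n (rot theta omega) y s)%C (RtoC (-1 / 2)).
Proof.
  move=> Hn P Hy Z. have [F [F1 [F2 F3]]] := continuation_exists n _ y theta Hn P Hy. have n0 := pos_INR n.
  have CF : barnes_continuation theta (map omega (indices n)) (Csum omega (indices n) * (1 - y))%C F.
  { split => // s. rewrite length_map length_seq => Hs. apply: (Cmult_reg_r _ _ (Gam s)); first by apply: Gam_neq0; lra.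
    rewrite F2 // barnes_series_rot //. lia. }
  have [Z1 Z2] : barnes_continuation theta (map omega (indices n)) (Csum omega (indices n) * (1 - y))%C Z by apply: epsilon_spec; exists F.
  split => //. have [d [d0 Hd]] : punctured_zero (fun s => Z s - F s)%C (RtoC (-1 / 2)).
  { apply: (identity_isolated _ (RtoC (INR n + 1))).
    - move=> t _. apply: isolated_minus; exact: meromorphic_isolated.
    - exists 1. split; first lra. move=> w [_ /Re_close Hw]. rewrite /= in Hw. rewrite Z2; last by rewrite length_map length_seq; lra.
      rewrite (proj2 CF); last by rewrite length_map length_seq; lra. ring. }
  exists (Rmin d (1 / 2)). split; first by apply: Rmin_glb_lt; lra. move=> w [Hw0 Hw].
  have h1 := Rlt_le_trans _ _ _ Hw (Rmin_l _ _). have h2 := Re_close _ _ _ (Rlt_le_trans _ _ _ Hw (Rmin_r _ _)). rewrite /= in h2.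
  rewrite -F3; last lra. apply: Hd. lra.
Qed.

Lemma region_seg y z0 z1 t : region y z0 -> region y z1 -> 0 <= t <= 1 -> region y (seg z0 z1 t).
Proof. case=> H0; first by left. case=> H1; first by left. move=> Ht. right. exact: half_plane_convex. Qed.

Lemma region_open y (s : C) : region y s -> exists r, 0 < r /\ forall w, Cmod (w - s)%C < r -> region y w.
Proof.
  case=> H; first by exists 1; split; [lra|move=> w _; left]. exists (- Re s). split; first lra. move=> w /Re_close Hw. right. lra.
Qed.

(** The region is convex, so the segment from [-1/2] to any of its points stays inside; along it the
    difference of the two sides has only isolated singularities, from the continuation and from the
    integers where [gamma_factor] degenerates. *)
Theorem barnes_zeta_expansion n (theta : R) (omega : nat -> C) (y : R) : (2 <= n)%nat -> periods n (rot theta omega) -> 0 <= y < 1 ->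
  meromorphic_eq (region y) (barnes_zeta theta (map omega (indices n)) (Csum omega (indices n) * (1 - y))%C) (expansion theta n omega y).
Proof.
  move=> Hn P Hy. have [Z1 Z2] := barnes_zeta_strip n theta omega y Hn P Hy.
  set Z := barnes_zeta _ _ _ in Z1 Z2 *. split; first by move=> z _; exact: Z1.
  move=> z Hz. have Rm : Re (RtoC (-1 / 2)) < 0 by rewrite /=; lra.
  have [d [d0 Hd]] : punctured_zero (fun s => Z s - expansion theta n omega y s)%C z.
  { apply: (identity_isolated _ (RtoC (-1 / 2))).
    - move=> t Ht. have Hr : region y (seg (RtoC (-1 / 2)) z t) by apply: region_seg => //; right.
      apply: isolated_minus; first exact: meromorphic_isolated. set u := seg _ _ _ in Hr *.
      have [r [r0 Hr2]] := region_open y u Hr. have [e [e0 He]] := gamma_factor_isolated u.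
      exists (Rmin r e). split; first exact: Rmin_glb_lt. move=> w [Hw0 Hw]. have w1 := Rlt_le_trans _ _ _ Hw (Rmin_l _ _). have w2 := Rlt_le_trans _ _ _ Hw (Rmin_r _ _).
      have [r' [r'0 Hr']] := region_open y w (Hr2 w w1).
      apply: (cdiff_ext_loc (fun s => - gamma_factor s * (Cexp (- s * (Ci * theta)) * res_sum n (rot theta omega) y s))%C _ w r' r'0).
      + move=> v Hv. rewrite expansion_rot //. exact: Hr'.
      + apply: cdiff_mult; first by apply: cdiff_opp; apply: He. apply: cdiff_mult; first by cdiff_tac. apply: res_sum_cdiff => //. exact: Hr2.
    - have [e [e0 He]] := Z2. exists (Rmin e (1 / 2)). split; first by apply: Rmin_glb_lt; lra. move=> w [Hw0 Hw].
      have w1 := Rlt_le_trans _ _ _ Hw (Rmin_l _ _). have w2 := Re_close _ _ _ (Rlt_le_trans _ _ _ Hw (Rmin_r _ _)). rewrite /= in w2.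
      rewrite -(He w); last lra. rewrite expansion_rot //; last by right; lra. rewrite gamma_factor_strip; last lra. rewrite /Bcont. ring. }
  apply/locally_Cmod. exists d. split => // w Hw N. apply: Cminus_eq_0. apply: Hd. split => //. exact: Cmod_minus_gt0.
Qed.

(** * Absolute and uniform convergence of the expansion *)

Lemma Csum_psum (g : nat -> C) M : Csum g (seq 1 M) = psum (fun i => g (S i)) M.
Proof. elim: M => [|M IH] //. rewrite seq_S Csum_app IH /= /Csum /=. ring. Qed.

Lemma Cmod_rotation (s : C) (theta : R) : Cmod (Cexp (- s * (Ci * theta))) = exp (Im s * theta).
Proof. rewrite Cmod_Cexp. congr exp. rewrite /= /Im /Re. ring. Qed.

Lemma Zstar_cvu_dom (K : C -> Prop) (f : Z -> C -> C) B S0 : dom_sum B S0 -> (forall s, K s -> zdom (fun m => f m s) B) -> Zstar_cvu K f.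
Proof.
  move=> HB HK eps He. have [N0 HN] := proj2 (proj2 HB) (eps / 2) ltac:(lra). exists N0 => M N HM HN' s Hs. have [H1 H2] := HK s Hs.
  have [_ b1] := CSeries_dom _ B S0 HB H1. have [_ b2] := CSeries_dom _ B S0 HB H2.
  rewrite /Zstar_partial /Zstar_sum !Csum_psum. set p1 := psum _ M. set p2 := psum _ N. set c1 := CSeries _. set c2 := CSeries (fun m => f (Z.of_nat (S m)) s).
  have -> : (p1 + p2 - (c1 + c2) = (p1 - c1) + (p2 - c2))%C by ring.
  apply: Rle_lt_trans (Cmod_triangle _ _) _. have := b1 M. have := b2 N. have := HN M HM. have := HN N HN'. rewrite -/p1 -/p2 -/c1 -/c2. lra.
Qed.

(** Compactness is applied to the open sets [|s| < j + 1], cut by [Re s < - 1 / (j + 1)] unless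
    [0 < y]; the largest index of a finite subcover gives the bounds. *)
Lemma compact_region_bounds (K : C -> Prop) y : compact_set K -> (forall s, K s -> region y s) ->
  exists R1 T, (0 < y \/ R1 < 0) /\ forall s, K s -> Re s <= R1 /\ Rabs (Re s) <= T /\ Rabs (Im s) <= T.
Proof.
  move=> HK HD.
  case: (HK nat (fun j s => Cmod s < INR j + 1 /\ (0 < y \/ Re s < - / (INR j + 1)))).
  - move=> j s [H1 H2]. apply/locally_Cmod. exists (Rmin (INR j + 1 - Cmod s) (match Rlt_dec 0 y with left _ => 1 | right _ => - / (INR j + 1) - Re s end)).
    split; first by apply: Rmin_glb_lt; [lra|case: Rlt_dec => q; [lra|case: H2; lra]].
    move=> w Hw. have w1 := Rlt_le_trans _ _ _ Hw (Rmin_l _ _). have w2 := Rlt_le_trans _ _ _ Hw (Rmin_r _ _). split.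
    + have := Cmod_triangle_rev_minus w s. lra.
    + move: w2. case: Rlt_dec => q w2; first by left. right. have := Re_close _ _ _ w2. lra.
  - move=> s Hs. have [N1 H1] := INR_unbounded (Cmod s).
    case: (HD s Hs) => H; first by exists N1; split; [lra|left].
    have [N2 H2] := INR_unbounded (/ (- Re s)). have p : 0 < / (- Re s) by apply: Rinv_0_lt_compat; lra.
    exists (N1 + N2)%nat. rewrite plus_INR. have p1 := pos_INR N1. have p2 := pos_INR N2. split; first lra. right.
    suff : / (INR N1 + INR N2 + 1) < - Re s by lra. rewrite -(Rinv_inv (- Re s)). apply: Rinv_lt_contravar; [apply: Rmult_lt_0_compat|]; lra.
  - move=> l Hl. set J := list_max l. exists (match Rlt_dec 0 y with left _ => INR J + 1 | right _ => - / (INR J + 1) end), (INR J + 1).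
    have pJ := pos_INR J. split.
    + case: Rlt_dec => q; first by left. right. have : 0 < / (INR J + 1) by apply: Rinv_0_lt_compat; lra. lra.
    + move=> s Hs. have [j [Hj [H1 H2]]] := Hl s Hs.
      have jJ : INR j <= INR J by apply: le_INR; have := proj1 (list_max_le l J) (le_n _); move=> /Forall_forall F; exact: F.
      have pj := pos_INR j. have r1 := Re_le_Cmod s. have r2 := Im_le_Cmod s. split; last lra.
      case: Rlt_dec => q; first by have := Rle_abs (Re s); lra. case: H2 => H2; first lra.
      have : / (INR J + 1) <= / (INR j + 1) by apply: Rinv_le_contravar; lra. lra.
Qed.

Lemma expansion_zdom n (theta : R) (omega : nat -> C) (y : R) k R1 T : (2 <= n)%nat -> periods n (rot theta omega) -> 0 <= y < 1 -> 0 < y \/ R1 < 0 -> In k (indices n) ->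
  exists B S0, dom_sum B S0 /\ forall s, Re s <= R1 -> Rabs (Re s) <= T -> Rabs (Im s) <= T -> zdom (fun m => expansion_term theta n omega y k m s) B.
Proof.
  move=> Hn P Hy Hc Hk. have [B [S0 [HB H]]] := res_term_dom n _ y k R1 T Hn P Hy Hc Hk.
  set M := exp (T * Rabs theta). exists (fun i => M * B i), (M * S0). split; first by apply: dom_sum_scal => //; left; exact: exp_pos.
  move=> s H1 H2 H3. apply: zdom_abs => m i Hm. rewrite (expansion_term_rot n) //; last by move=> q; move: Hm; rewrite q; lia.
  rewrite Cmod_mult Cmod_rotation. apply: Rmult_le_compat; [left; exact: exp_pos|exact: Cmod_ge_0| |exact: H].
  apply: exp_le. apply: Rle_trans (Rle_abs _) _. rewrite Rabs_mult. apply: Rmult_le_compat_r => //. exact: Rabs_pos.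
Qed.

Lemma expansion_zdom_at n (theta : R) (omega : nat -> C) (y : R) k (s : C) : (2 <= n)%nat -> periods n (rot theta omega) -> 0 <= y < 1 -> region y s -> In k (indices n) ->
  exists B S0, dom_sum B S0 /\ zdom (fun m => expansion_term theta n omega y k m s) B.
Proof.
  move=> Hn P Hy /region_margin [R1 [r [r0 [Hc Hr]]]] Hk. have [B [S0 [HB H]]] := expansion_zdom n theta omega y k R1 (Cmod s) Hn P Hy Hc Hk.
  exists B, S0. split => //. apply: H; [apply: Hr; rewrite Cmod_self; lra|exact: Re_le_Cmod|exact: Im_le_Cmod].
Qed.

Theorem expansion_convergence n (theta : R) (omega : nat -> C) (y : R) : (2 <= n)%nat -> periods n (rot theta omega) -> 0 <= y < 1 -> expansion_converges (region y) theta n omega y.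
Proof.
  move=> Hn P Hy k Hk. split.
  - move=> s Hs. have [B [S0 [HB [Z1 Z2]]]] := expansion_zdom_at n theta omega y k s Hn P Hy Hs Hk.
    split; [case: (dom_sum_le (fun m => Cmod (expansion_term theta n omega y k (- Z.of_nat (S m))%Z s)) B S0)|case: (dom_sum_le (fun m => Cmod (expansion_term theta n omega y k (Z.of_nat (S m)) s)) B S0)] => //.
    + move=> i. split; [exact: Cmod_ge_0|exact: Z1].
    + move=> S1. exact: dom_sum_ex_series.
    + move=> i. split; [exact: Cmod_ge_0|exact: Z2].
    + move=> S1. exact: dom_sum_ex_series.
  - move=> K HK HD. have [R1 [T [Hc Hb]]] := compact_region_bounds K y HK HD.
    have [B [S0 [HB H]]] := expansion_zdom n theta omega y k R1 T Hn P Hy Hc Hk.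
    apply: (Zstar_cvu_dom K _ B S0 HB) => s Hs. have [h1 [h2 h3]] := Hb s Hs. exact: H.
Qed.

(** * The hyperbolic sine form at y = 1/2 *)

Lemma Cpow_neq0 (z : C) k : z <> 0%C -> (z ^ k)%C <> 0%C.
Proof. move=> Hz. elim: k => [|k IH] /=; [exact: RtoC_neq0 R1_neq_R0|exact: Cmult_neq_0]. Qed.

Lemma Cexp_PI_nat k : Cexp (INR k * (Ci * PI))%C = ((- (1)) ^ k)%C.
Proof.
  elim: k => [|k IH]; first by rewrite Cmult_0_l Cexp_0. rewrite S_INR RtoC_plus.
  have -> : ((INR k + 1) * (Ci * PI) = Ci * PI + INR k * (Ci * PI))%C by ring. by rewrite Cexp_plus Cexp_PI IH.
Qed.

Lemma Cexp_PI_Z m : Cexp (IZR m * (Ci * PI))%C = ((- (1)) ^ Z.abs_nat m)%C.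
Proof.
  have sq : forall k, ((- (1)) ^ k * (- (1)) ^ k = RtoC 1)%C by elim=> [|k IH] /=; [ring|rewrite (_ : - (1) * (- (1)) ^ k * (- (1) * (- (1)) ^ k) = (- (1)) ^ k * (- (1)) ^ k)%C; [exact: IH|ring]].
  case: (Z_le_gt_dec 0 m) => H.
  - have {1}-> : m = Z.of_nat (Z.abs_nat m) by lia. by rewrite -INR_IZR_INZ Cexp_PI_nat.
  - have {1}-> : m = (- Z.of_nat (Z.abs_nat m))%Z by lia. rewrite opp_IZR -INR_IZR_INZ RtoC_opp.
    have -> : (- INR (Z.abs_nat m) * (Ci * PI) = - (INR (Z.abs_nat m) * (Ci * PI)))%C by ring. rewrite Cexp_opp Cexp_PI_nat.
    have s := sq (Z.abs_nat m). move: (_ ^ _)%C s => p s. have p0 : p <> 0%C by move=> q; move: s; rewrite q Cmult_0_l; exact: (not_eq_sym (RtoC_neq0 _ R1_neq_R0)).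
    apply: (Cmult_reg_r _ _ p p0). rewrite s. by field.
Qed.

Lemma gq_half_sinh (z : C) : (Cexp (2 * z * RtoC (1 / 2)) / (Cexp (2 * z) - 1) = / 2 * / Csinh z)%C.
Proof.
  have -> : (2 * z * RtoC (1 / 2) = z)%C by rewrite RtoC_div; [field|lra].
  have -> : (2 * z = z + z)%C by ring. rewrite Cexp_plus /Csinh Cexp_opp. have e0 := Cexp_neq0 z. move: (Cexp z) e0 => e e0.
  (* If [Cexp (2 z) = 1], both denominators vanish and both sides are 0 because [/ 0 = 0]. *)
  case: (classic ((e * e - 1)%C = 0%C)) => H.
  - have -> : ((e - / e) / 2 = 0)%C. { have -> : ((e - / e) / 2 = (e * e - 1) / (2 * e))%C by field. rewrite H /Cdiv. ring. }
    rewrite H /Cdiv Cinv_0. ring.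
  - have H2 : (e - / e)%C <> 0%C. { move=> q. apply: H. have -> : (e * e - 1 = e * (e - / e))%C by field. rewrite q. ring. }
    have -> : (e * e - 1 = e * (e - / e))%C by field. move: (e - / e)%C H2 => v v0. field. by split.
Qed.

Lemma Cprod_scal (c : C) (g : nat -> C) l : Cprod (fun j => c * g j)%C l = (c ^ length l * Cprod g l)%C.
Proof.
  elim: l => [|k l IH]; first by rewrite /Cprod /=; ring.
  change ((c * g k * Cprod (fun j => c * g j) l)%C = (c * c ^ length l * (g k * Cprod g l))%C). rewrite IH. ring.
Qed.

(** At [y = 1/2] each of the [n - 1] factors is [1 / (2 sinh)], whence the power of 2, and
    [Cexp (2 pi i m / 2)] is the sign [(-1)^m]. *)
Lemma sinh_term_expansion_term n (theta : R) (omega : nat -> C) k m (s : C) : In k (indices n) ->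
  sinh_term theta n omega k m s = (2 ^ (n - 1) * expansion_term theta n omega (1 / 2) k m s)%C.
Proof.
  move=> Hk. rewrite /sinh_term /expansion_term.
  rewrite (Cprod_ext (fun j => Cexp (2 * IZR m * PI * Ci * omega j / omega k * RtoC (1 / 2)) / (Cexp (2 * IZR m * PI * Ci * omega j / omega k) - 1))%C (fun j => / 2 * / Csinh (IZR m * PI * Ci * omega j / omega k))%C); last first.
  { move=> j _. rewrite -gq_half_sinh. have -> // : (2 * IZR m * PI * Ci * omega j / omega k = 2 * (IZR m * PI * Ci * omega j / omega k))%C by rewrite /Cdiv; ring. }
  rewrite Cprod_scal. have -> : length (indices_but n k) = (n - 1)%nat by have := length_indices_but n k Hk; lia.
  have -> : (2 * IZR m * PI * Ci * RtoC (1 / 2) = IZR m * (Ci * PI))%C by rewrite RtoC_div; [field|lra]. rewrite Cexp_PI_Z.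
  have e : (2 ^ (n - 1) * (/ 2) ^ (n - 1) = RtoC 1)%C.
  { elim: (n - 1)%nat => [|j IH] /=; first ring. have -> : (2 * 2 ^ j * (/ 2 * (/ 2) ^ j) = 2 ^ j * (/ 2) ^ j)%C by field. exact: IH. }
  have -> : RtoC (-1) = (- RtoC 1)%C by rewrite -RtoC_opp.
  move: (_ ^ Z.abs_nat m)%C (Cprod _ _) (residue_power _ _ _ _ _) => a b c.
  have -> : (2 ^ (n - 1) * (/ omega k * ((/ 2) ^ (n - 1) * b) * c * a) = (2 ^ (n - 1) * (/ 2) ^ (n - 1)) * (/ omega k * b * c * a))%C by ring. rewrite e. ring.
Qed.

Lemma sinh_expansion_half n (theta : R) (omega : nat -> C) (s : C) : (2 <= n)%nat -> periods n (rot theta omega) -> sinh_expansion theta n omega s = expansion theta n omega (1 / 2) s.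
Proof.
  move=> Hn P. rewrite /sinh_expansion /expansion. have reg : region (1 / 2) s by left; lra.
  rewrite (Csum_ext _ (fun k => 2 ^ (n - 1) * Zstar_sum (fun m => expansion_term theta n omega (1 / 2) k m s))%C); last first.
  { move=> k Hk. have [B [S0 [HB HZ]]] := expansion_zdom_at n theta omega (1 / 2) k s Hn P ltac:(lra) reg Hk.
    rewrite -(Zsum_scal _ _ B S0) //. apply: Zsum_ext => m _. exact: sinh_term_expansion_term. }
  rewrite Csum_scal. have q : (2 ^ (n - 1))%C <> 0%C by apply: Cpow_neq0; apply: RtoC_neq0; lra. field. exact: q.
Qed.

Theorem theorem2p1 :
  forall (n : nat) (theta : R) (omega : nat -> C),
    (2 <= n)%nat ->
    (forall k : nat, (1 <= k <= n)%nat -> half_plane theta (omega k)) ->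
    (forall j k : nat, (1 <= j <= n)%nat -> (1 <= k <= n)%nat -> j <> k ->
       Im (omega j / omega k)%C <> 0) ->
    (forall y : R, 0 <= y < 1 ->
       expansion_converges (region y) theta n omega y /\
       meromorphic_eq (region y)
         (barnes_zeta theta (map omega (indices n))
            (Csum omega (indices n) * (1 - y))%C)
         (expansion theta n omega y)) /\
    meromorphic_eq (fun _ => True)
      (barnes_zeta theta (map omega (indices n))
         (Csum omega (indices n) / 2)%C)
      (sinh_expansion theta n omega).
Proof.
  move=> n theta omega Hn H1 H2. have P := rot_periods n theta omega H1 H2. split.
  - move=> y Hy. split; [exact: expansion_convergence|exact: barnes_zeta_expansion].
  - have [M E] := barnes_zeta_expansion n theta omega (1 / 2) Hn P ltac:(lra).
    have Ea : (Csum omega (indices n) * (1 - RtoC (1 / 2)) = Csum omega (indices n) / 2)%C by rewrite RtoC_div; [field|lra].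
    rewrite Ea in M E. have reg : forall z, region (1 / 2) z by move=> z; left; lra.
    split; first by move=> z _; exact: M.
    move=> z _. have [d Hd] := E z (reg z). exists d => w Hw N. rewrite sinh_expansion_half //. exact: Hd.
Qed.
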